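(* Let $f$ be holomorphic and suppose $\dot z=f(z)$ has a center at $p$. Let $R_m^{+}(z,\overline z)$ and $R_m^-(z,\overline z)$ be complex polynomials of degree $m$ in $z,\overline z$, and consider, for $0<\epsilon\ll 1$, the piecewise system $$\dot z=f(z)+\epsilon R_m^+(z,\overline z)\ \text{ if } \operatorname{Im}(z)>0,\qquad \dot z=f(z)+\epsilon R_m^-(z,\overline z)\ \text{ if } \operatorname{Im}(z)<0 .$$ Let $\Sigma=\{z\in\mathbb C:\operatorname{Im}(z)=0\}$. Suppose that $\phi$ is the linearizing change of $\dot z=f(z)$ at $p$ and that $\phi(\Sigma)\subset\Sigma$. Then the first order Melnikov function of the system is $M_1(r)=M_1^+(r)-M_1^-(r)$, where $$M_1^\pm(r)=-\operatorname{Im}\left(\int_0^{\pm\pi}\overline{\phi'\big(\phi^{-1}(re^{\mathrm i\theta})\big)\,R_m^\pm\Big(\phi^{-1}(re^{\mathrm i\theta}),\overline{\phi^{-1}(re^{\mathrm i\theta})}\Big)}\;\mathrm i e^{\mathrm i\theta}\,d\theta\right).$$ In particular, each simple zero $r=r_0$ of $M_1$ provides, for $\epsilon$ sufficiently small, a hyperbolic limit cycle of the piecewise system that tends to $r=r_0$ when $\epsilon$ tends to $0$.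
   Context: Orbits on the discontinuity line $\Sigma$ are defined by the Filippov convention. Linearizing change: a conformal map $w=\phi(z)$ near $p$, with $\phi(p)=0$, transforming $\dot z=f(z)$ into $\dot w=-\mathrm i w$, i.e. $\phi'(z)f(z)=-\mathrm i\,\phi(z)$. One works on the largest open set $U\ni p$ where this conformal map is well defined; accordingly $\phi(\Sigma)\subset\Sigma$ refers to the points of $\Sigma$ in $U$, and $r>0$ ranges over values $r<r^*$ with $\{|w|<r^*\}\subset\phi(U)$. Here ''$r=r_0$'' denotes the circle $|w|=r_0$, that is, the periodic orbit $\phi^{-1}(\{|w|=r_0\})$ of $\dot z=f(z)$. First order Melnikov (averaged) function: after the change $w=\phi(z)$ and polar coordinates $w=re^{\mathrm i\theta}$, the piecewise system is written as $\frac{dr}{d\theta}=\epsilon F_1^+(\theta,r)+\mathcal O(\epsilon^2)$ for $0\le\theta\le\pi$ and $\frac{dr}{d\theta}=\epsilon F_1^-(\theta,r)+\mathcal O(\epsilon^2)$ for $\pi\le\theta\le2\pi$. The first order Melnikov function is $M_1(r)=\int_0^{\pi}F_1^+(\theta,r)\,d\theta-\int_0^{-\pi}F_1^-(\theta,r)\,d\theta$.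
   Formalization: It is additionally assumed that p lies on Σ and that φ'(p)>0, so φ preserves the orientation of Σ; otherwise the formula can fail, e.g. f=-iz, φ=-z, where it attaches R^+ to the wrong half plane. *)

(* Defs.v *)
(* Stdlib reals and Coquelicot; the plane is Coquelicot's C. *)
From Stdlib Require Import Reals.
From Coquelicot Require Import Coquelicot.
Open Scope R_scope.

Definition holomorphic_on (D : C -> Prop) (f : C -> C) : Prop :=
  forall z : C, D z -> ex_derive (K := C_AbsRing) (V := C_NormedModule) f z.

(* w = r e^(i theta) *)
Definition polar (r theta : R) : C := (r * cos theta, r * sin theta).

(* The zero p of f has a punctured neighbourhood that is a union of
   nonconstant periodic orbits of z' = f(z). *)
Definition has_center (D : C -> Prop) (f : C -> C) (p : C) : Prop :=
  f p = 0%C /\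
  exists V : C -> Prop,
    open V /\ V p /\ (forall z, V z -> D z) /\
    forall z0 : C, V z0 -> z0 <> p ->
      exists (x : R -> C) (T : R),
        0 < T /\ x 0 = z0 /\ (exists t, x t <> z0) /\
        forall t : R,
          V (x t) /\ x t <> p /\ x (t + T) = x t /\
          is_derive (K := R_AbsRing) (V := C_R_NormedModule) x t (f (x t)).

Definition conformal_on (U : C -> Prop) (phi : C -> C) : Prop :=
  holomorphic_on U phi /\
  (forall z, U z -> C_derive phi z <> 0%C) /\
  (forall z1 z2, U z1 -> U z2 -> phi z1 = phi z2 -> z1 = z2).

(* w = phi(z) turns z' = f(z) into w' = - i w on U. *)
Definition linearizing_change (D : C -> Prop) (f : C -> C) (p : C)
    (U : C -> Prop) (phi : C -> C) : Prop :=
  open U /\ U p /\ (forall z, U z -> D z) /\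
  conformal_on U phi /\ phi p = 0%C /\
  forall z, U z -> (C_derive phi z * f z = - Ci * phi z)%C.

(* Polynomial of total degree at most m in two variables, coefficients a j k. *)
Definition bipoly (m : nat) (a : nat -> nat -> C) (u v : C) : C :=
  sum_n (fun j => sum_n (fun k => (a j k * u ^ j * v ^ k)%C) (m - j)) m.

Definition perturbed (f : C -> C) (P : C -> C -> C) (eps : R) (z : C) : C :=
  (f z + RtoC eps * P z (Cconj z))%C.

(** ** Filippov solutions for the discontinuity line Im z = 0 *)

(* Velocities admitted at z when Xp is in force for Im z > 0 and Xm for
   Im z < 0; on the line, the segment joining the two one-sided values. *)
Definition filippov_set (Xp Xm : C -> C) (z v : C) : Prop :=
  (0 < Im z /\ v = Xp z) \/
  (Im z < 0 /\ v = Xm z) \/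
  (Im z = 0 /\ exists l : R, 0 <= l <= 1 /\
     v = (RtoC l * Xp z + RtoC (1 - l) * Xm z)%C).

(* Lebesgue-null *)
Definition null_set (A : R -> Prop) : Prop :=
  forall eta : R, 0 < eta ->
    exists a b : nat -> R,
      (forall k, a k <= b k) /\
      (forall t, A t -> exists k, a k < t < b k) /\
      (forall n, sum_n (fun k => b k - a k) n <= eta).

(* The intervals [a k, b k], k = 0, ..., n, are listed from left to right. *)
Definition absolutely_continuous (x : R -> C) (s t : R) : Prop :=
  forall eta : R, 0 < eta ->
    exists delta : R, 0 < delta /\
      forall (n : nat) (a b : nat -> R),
        (forall k, (k <= n)%nat -> s <= a k <= b k /\ b k <= t) ->
        (forall k, (k < n)%nat -> b k <= a (S k)) ->
        sum_n (fun k => b k - a k) n < delta ->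
        sum_n (fun k => Cmod (x (b k) - x (a k))%C) n < eta.

Definition filippov_solution (D : C -> Prop) (Xp Xm : C -> C) (s t : R)
    (x : R -> C) : Prop :=
  (forall u, s <= u <= t -> D (x u)) /\
  absolutely_continuous x s t /\
  null_set (fun u => s < u < t /\
    ~ exists v : C, filippov_set Xp Xm (x u) v /\
        is_derive (K := R_AbsRing) (V := C_R_NormedModule) x u v).

Definition periodic_orbit (D : C -> Prop) (Xp Xm : C -> C) (x : R -> C) : Prop :=
  (forall s t, s < t -> filippov_solution D Xp Xm s t x) /\
  (exists T, 0 < T /\ forall t, x (t + T) = x t) /\
  (exists t, x t <> x 0).

(* Isolated: some neighbourhood of the orbit contains no other periodic orbit. *)
Definition limit_cycle (D : C -> Prop) (Xp Xm : C -> C) (x : R -> C) : Prop :=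
  periodic_orbit D Xp Xm x /\
  exists eta : R, 0 < eta /\
    forall y : R -> C,
      periodic_orbit D Xp Xm y ->
      (forall t, exists s, Cmod (y t - x s)%C < eta) ->
      forall z : C, (exists t, y t = z) <-> (exists t, x t = z).

(** ** Hyperbolicity through the Poincare return map *)

(* C^1 injective arc sigma on (-b, b); Im (conj u * v) is the determinant of
   the plane vectors u and v, so every admitted velocity is transversal. *)
Definition transversal_section (D : C -> Prop) (Xp Xm : C -> C)
    (sigma : R -> C) (b : R) : Prop :=
  0 < b /\
  (forall s1 s2, Rabs s1 < b -> Rabs s2 < b -> sigma s1 = sigma s2 -> s1 = s2) /\
  exists dsigma : R -> C,
    forall s, Rabs s < b ->
      D (sigma s) /\
      is_derive (K := R_AbsRing) (V := C_R_NormedModule) sigma s (dsigma s) /\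
      continuous dsigma s /\
      forall v, filippov_set Xp Xm (sigma s) v ->
        Im (Cconj (dsigma s) * v)%C <> 0.

Definition first_return (D : C -> Prop) (Xp Xm : C -> C)
    (sigma : R -> C) (b s s' : R) : Prop :=
  exists (T : R) (x : R -> C),
    0 < T /\ filippov_solution D Xp Xm 0 T x /\
    x 0 = sigma s /\ x T = sigma s' /\
    forall t, 0 < t < T -> forall u, Rabs u < b -> x t <> sigma u.

(* On |s| < a, every solution from sigma s that comes back to the section does
   so first at sigma (P s), and such a solution exists. *)
Definition return_map (D : C -> Prop) (Xp Xm : C -> C)
    (sigma : R -> C) (a b : R) (P : R -> R) : Prop :=
  forall s, Rabs s < a ->
    Rabs (P s) < b /\
    forall s', Rabs s' < b -> (first_return D Xp Xm sigma b s s' <-> s' = P s).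

Definition hyperbolic_limit_cycle (D : C -> Prop) (Xp Xm : C -> C)
    (x : R -> C) : Prop :=
  limit_cycle D Xp Xm x /\
  exists (sigma : R -> C) (a b : R) (P : R -> R) (lambda : R),
    transversal_section D Xp Xm sigma b /\
    (exists t, x t = sigma 0) /\
    0 < a <= b /\ return_map D Xp Xm sigma a b P /\
    P 0 = 0 /\ is_derive P 0 lambda /\ Rabs lambda <> 1.

(** ** First order Melnikov function *)

(* If z' = v then w = phi(z) = r e^(i theta) satisfies
   w' e^(- i theta) = r' + i r theta'; this is dr/dtheta = r' / theta'. *)
Definition polar_slope (phi : C -> C) (z v : C) (r theta : R) : R :=
  let W := (C_derive phi z * v * Cconj (polar 1 theta))%C in
  r * Re W / Im W.

(* dr/dtheta = eps F(theta, r) + O(eps^2) for alpha < theta < beta, locally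
   uniformly in 0 < r < rs; psi is the inverse of phi on |w| < rs.  The endpoints,
   where the field is two-valued, are left out. *)
Definition first_order_coefficient (Xp Xm : R -> C -> C) (phi psi : C -> C)
    (rs alpha beta : R) (F : R -> R -> R) : Prop :=
  forall r1 r2, 0 < r1 -> r1 < r2 -> r2 < rs ->
    exists K eps0 : R, 0 < eps0 /\
      forall eps r theta v,
        0 < eps < eps0 -> r1 <= r <= r2 -> alpha < theta < beta ->
        filippov_set (Xp eps) (Xm eps) (psi (polar r theta)) v ->
        Rabs (polar_slope phi (psi (polar r theta)) v r theta - eps * F theta r)
          <= K * eps ^ 2.

(* The lower half turn pi <= theta <= 2 pi is parametrized by -pi <= theta <= 0. *)
Definition is_first_order_melnikov (Xp Xm : R -> C -> C) (phi psi : C -> C)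
    (rs : R) (M : R -> R) : Prop :=
  exists Fp Fm : R -> R -> R,
    first_order_coefficient Xp Xm phi psi rs 0 PI Fp /\
    first_order_coefficient Xp Xm phi psi rs (- PI) 0 Fm /\
    forall r, 0 < r < rs ->
      exists Jp Jm : R,
        is_RInt (fun theta => Fp theta r) 0 PI Jp /\
        is_RInt (fun theta => Fm theta r) 0 (- PI) Jm /\
        M r = Jp - Jm.

Definition melnikov_half (phi psi : C -> C) (P : C -> C -> C) (b r : R) : R :=
  - Im (RInt (V := C_R_CompleteNormedModule)
          (fun theta : R =>
             let z := psi (polar r theta) in
             (Cconj (C_derive phi z * P z (Cconj z)) * (Ci * polar 1 theta))%C)
          0 b).

Definition simple_zero (M : R -> R) (r0 : R) : Prop :=
  M r0 = 0 /\ exists d : R, is_derive M r0 d /\ d <> 0.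

(* Hausdorff convergence of the orbits x eps, as eps -> 0+, to the curve
   psi({|w| = r0}). *)
Definition tends_to_circle (psi : C -> C) (r0 : R) (x : R -> R -> C) : Prop :=
  forall eta : R, 0 < eta ->
    exists eps1 : R, 0 < eps1 /\
      forall eps, 0 < eps < eps1 ->
        (forall t, exists theta, Cmod (x eps t - psi (polar r0 theta))%C < eta) /\
        (forall theta, exists t, Cmod (x eps t - psi (polar r0 theta))%C < eta).

(* Main.v *)
(* In the coordinate w = phi(z) = r e^(i theta) the unperturbed flow is the rotation w' = - i w, so
   the perturbed field is z' = f + eps P with r' = eps A(r, theta), theta' = - (1 - eps b(r, theta)),
   and orbits are graphs of dr/dtheta = - eps A / (1 - eps b).  The symmetry of phi makes psi map the
   upper and lower half discs to the upper and lower half planes, so the two fields act on the half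
   turns, and both cross the real axis transversally for small eps.  Integrating over the two half
   turns gives a return map ret r = r - eps M1(r) + O(eps^2).  For two solutions u1, u2 of the scalar
   equation, ln (u2 - u1) is the integral of a difference quotient of the right-hand side, hence
   ret r2 - ret r1 = (r2 - r1) exp(eps L) with L close to - M1'(r0): near a simple zero r0 the map has
   exactly one fixed point, within O(eps) of r0, and its derivative there is not 1.

   Holomorphy is only complex differentiability, so regularity has to be earned: away from p,
   phi' = - i phi / f is continuous, hence psi is C^1, and the circle formula
   2 PI rho psi'(w) = int_0^(2 PI) psi(w + rho e^(i t)) e^(- i t) dt makes psi' C^1.

   Filippov solutions are merely absolutely continuous.  A function whose derivative is nonpositive
   almost everywhere along such a solution is nonincreasing; applied to Im y this gives immediate
   crossing of the real axis, and applied to Re (conj d (y - x)) with a fixed direction d it gives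
   uniqueness of solutions on each side. *)

Require Import Defs.
From Stdlib Require Import Reals Lra Lia Classical IndefiniteDescription ZArith.
From Coquelicot Require Import Coquelicot.
Open Scope R_scope.

(** * Complex plane and curves *)

(* The derivative of the return map at its fixed point differs from 1 only by a term of order [eps],
   so hyperbolicity cannot be read off the limit [eps -> 0]. Every estimate keeps the factor [eps]
   outside, and the exponent [L] of the slope is controlled to within a fixed fraction of [|M1' r0|]
   on a band of radii whose width does not depend on [eps]. The resulting slope formula serves
   monotonicity of the return map, existence and uniqueness of its fixed point, and hyperbolicity.
   The symmetry of [phi] sends real points to real points; this alone settles neither whether [psi]
   is real on real radii nor which half disc lies above the axis. Reality and orientation come from
   the derivative at [p], hold first for small radii, spread along the radius by connectedness, and
   then pass around each circle. Isolation of the cycle concerns all nearby periodic Filippov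
   orbits, whatever their number of turns; monotonicity of the return map excludes those that close
   only after several turns. Uniqueness of solutions runs forwards in time, and periodicity recovers
   the past. *)
Tactic Notation "below_min" hyp(H) "as" ident(H1) ident(H2) :=
  assert (H1 := Rlt_le_trans _ _ _ H (Rmin_l _ _));
  assert (H2 := Rlt_le_trans _ _ _ H (Rmin_r _ _)).

Notation cderiv g z l := (is_derive (K := C_AbsRing) (V := C_NormedModule) g z l).

Notation vderiv x t v := (is_derive (K := R_AbsRing) (V := C_R_NormedModule) x t v).

(** Stated with discs of [Cmod], whereas the balls of the uniform space on [C] are squares;
    [ccont_iff] passes between the two. *)
Definition ccont (g : C -> C) (z : C) : Prop :=
  forall e, 0 < e -> exists d, 0 < d /\
    forall y, Cmod (y - z) < d -> Cmod (g y - g z) < e.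

Lemma Cmod_minus_sym (x y : C) : Cmod (x - y) = Cmod (y - x).
Proof. rewrite <- Cmod_opp. f_equal. ring. Qed.

Lemma Cmod_minus_triangle (x y z : C) : Cmod (x - z) <= Cmod (x - y) + Cmod (y - z).
Proof.
  replace (x - z)%C with ((x - y) + (y - z))%C by ring. apply Cmod_triangle.
Qed.

Lemma Cmod_minus_self (z : C) : Cmod (z - z) = 0.
Proof. replace (z - z)%C with (RtoC 0) by ring. apply Cmod_0. Qed.

Lemma Cmod_triangle_rev (x y : C) : Cmod x - Cmod y <= Cmod (x - y).
Proof.
  assert (H := Cmod_triangle (x - y) y).
  replace (x - y + y)%C with x in H by ring. lra.
Qed.

Lemma im_le_Cmod (c : C) : Rabs (Im c) <= Cmod c.
Proof.
  eapply Rle_trans; [| apply Rmax_Cmod]. apply Rmax_r.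
Qed.

Lemma Cmod_le_re_im (c : C) : Cmod c <= Rabs (Re c) + Rabs (Im c).
Proof.
  destruct c as [x y]; simpl. unfold Cmod; simpl.
  apply Rsqr_incr_0_var.
  - rewrite Rsqr_sqrt; [| nra]. unfold Rsqr.
    assert (H1 := Rabs_pos x). assert (H2 := Rabs_pos y).
    assert (H3 : Rabs x * Rabs x = x * x) by (rewrite <- Rabs_mult; apply Rabs_pos_eq; nra).
    assert (H4 : Rabs y * Rabs y = y * y) by (rewrite <- Rabs_mult; apply Rabs_pos_eq; nra).
    nra.
  - assert (H1 := Rabs_pos x). assert (H2 := Rabs_pos y). lra.
Qed.

Lemma Cmod_re_im_bound (c : C) (K : R) :
  Rabs (Re c) <= K -> Rabs (Im c) <= K -> Cmod c <= 2 * K.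
Proof. intros H1 H2. assert (H := Cmod_le_re_im c). lra. Qed.

Lemma Re_plus (a b : C) : Re (a + b) = Re a + Re b. Proof. reflexivity. Qed.
Lemma Im_plus (a b : C) : Im (a + b) = Im a + Im b. Proof. reflexivity. Qed.
Lemma Re_minus (a b : C) : Re (a - b) = Re a - Re b. Proof. reflexivity. Qed.
Lemma Im_minus (a b : C) : Im (a - b) = Im a - Im b. Proof. reflexivity. Qed.
Lemma Re_mult (a b : C) : Re (a * b) = Re a * Re b - Im a * Im b. Proof. reflexivity. Qed.
Lemma Im_mult (a b : C) : Im (a * b) = Re a * Im b + Im a * Re b. Proof. reflexivity. Qed.

Lemma C_ext (a b : C) : Re a = Re b -> Im a = Im b -> a = b.
Proof. destruct a, b; simpl; intros; subst; reflexivity. Qed.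

Lemma cderiv_iff (g : C -> C) (z l : C) :
  cderiv g z l <->
  forall e, 0 < e -> exists d, 0 < d /\
    forall y, Cmod (y - z) < d -> Cmod (g y - g z - l * (y - z)) <= e * Cmod (y - z).
Proof.
  split.
  - intros [_ H] e He.
    destruct (H z (fun P HP => HP) (mkposreal e He)) as [d Hd].
    exists d; split; [apply cond_pos |].
    intros y Hy. specialize (Hd y Hy). simpl in Hd.
    unfold norm in Hd; simpl in Hd.
    replace (l * (y - z))%C with ((y - z) * l)%C by ring.
    exact Hd.
  - intros H. split.
    + apply is_linear_scal_l.
    + intros x Hx e.
      assert (x = z) as ->.
      { symmetry; apply (is_filter_lim_locally_unique (K := C_AbsRing) (V := AbsRing_NormedModule C_AbsRing)). exact Hx. }
      destruct (H e (cond_pos e)) as [d [Hd Hd']].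
      exists (mkposreal d Hd). intros y Hy. specialize (Hd' y Hy).
      unfold norm; simpl.
      replace (l * (y - z))%C with ((y - z) * l)%C in Hd' by ring.
      exact Hd'.
Qed.

Lemma cderiv_ccont (g : C -> C) (z l : C) : cderiv g z l -> ccont g z.
Proof.
  rewrite cderiv_iff. intros H e He.
  destruct (H 1 Rlt_0_1) as [d [Hd Hd']].
  assert (Hl := Cmod_ge_0 l).
  exists (Rmin d (e / (Cmod l + 2))); split.
  { apply Rmin_pos; [assumption | apply Rdiv_lt_0_compat; lra]. }
  intros y Hy.
  below_min Hy as Hy1 Hy2.
  specialize (Hd' y Hy1).
  assert (H1 := Cmod_triangle (g y - g z - l * (y - z)) (l * (y - z))).
  replace (g y - g z - l * (y - z) + l * (y - z))%C with (g y - g z)%C in H1 by ring.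
  rewrite Cmod_mult in H1.
  apply (Rmult_lt_compat_r (Cmod l + 2)) in Hy2; [| lra].
  unfold Rdiv in Hy2. rewrite Rmult_assoc, Rinv_l, Rmult_1_r in Hy2 by lra.
  assert (H2 := Cmod_ge_0 (y - z)). nra.
Qed.

Lemma ccont_ext_loc (g h : C -> C) (z : C) (d : R) :
  0 < d -> (forall y, Cmod (y - z) < d -> g y = h y) -> ccont g z -> ccont h z.
Proof.
  intros Hd He H e He0.
  destruct (H e He0) as [d' [Hd' H']].
  exists (Rmin d d'); split; [now apply Rmin_pos |].
  intros y Hy.
  below_min Hy as Hy1 Hy2.
  rewrite <- (He y Hy1), <- (He z). now apply H'.
  rewrite Cmod_minus_self. exact Hd.
Qed.

Lemma ccont_comp (f g : C -> C) (z : C) : ccont f z -> ccont g (f z) -> ccont (fun y => g (f y)) z.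
Proof.
  intros Hf Hg e He. destruct (Hg e He) as [d [Hd H]].
  destruct (Hf d Hd) as [d' [Hd' H']].
  exists d'; split; [assumption |]. intros y Hy. apply H, H', Hy.
Qed.

Lemma open_Cmod (U : C -> Prop) (z : C) :
  open U -> U z -> exists d, 0 < d /\ forall y, Cmod (y - z) < d -> U y.
Proof.
  intros HU Hz. destruct (HU z Hz) as [d Hd].
  exists d; split; [apply cond_pos |]. intros y Hy. apply Hd.
  apply C_NormedModule_mixin_compat1. exact Hy.
Qed.

Lemma ccont_iff (g : C -> C) (z : C) :
  ccont g z <-> continuous (T := C_UniformSpace) (U := C_UniformSpace) g z.
Proof.
  split.
  - intros H. apply filterlim_locally. intros e.
    destruct (H e (cond_pos e)) as [d [Hd Hd']].
    apply locally_C. exists (mkposreal d Hd). intros y Hy.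
    apply C_NormedModule_mixin_compat1. apply Hd'. exact Hy.
  - intros H e He.
    (* A square of half-side [e / 2] lies in the disc of radius [sqrt 2 * (e / 2)], which is below
       [e]. *)
    assert (He2 : 0 < e / 2) by lra.
    assert (Hf := proj1 (filterlim_locally _ _) H (mkposreal _ He2)).
    destruct Hf as [d Hd].
    exists d; split; [apply cond_pos |]. intros y Hy.
    assert (Hb : ball (M := C_UniformSpace) (g z) (e / 2) (g y)).
    { apply (Hd y). apply C_NormedModule_mixin_compat1. exact Hy. }
    assert (Hc := C_NormedModule_mixin_compat2 _ _ (mkposreal _ He2) Hb). simpl in Hc.
    change (minus (g y) (g z)) with (g y - g z)%C in Hc.
    assert (sqrt 2 < 2). { rewrite <- (sqrt_Rsqr 2) at 2 by lra. apply sqrt_lt_1; unfold Rsqr; lra. }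
    assert (0 <= sqrt 2) by apply sqrt_pos. nra.
Qed.

Lemma ccont_const (c z : C) : ccont (fun _ => c) z.
Proof. intros e He. exists 1; split; [lra |]. intros. rewrite Cmod_minus_self. exact He. Qed.

Lemma ccont_plus (f g : C -> C) (z : C) :
  ccont f z -> ccont g z -> ccont (fun y => f y + g y)%C z.
Proof.
  rewrite !ccont_iff. intros H1 H2. apply (continuous_plus (K := R_AbsRing) (V := C_R_NormedModule) f g z H1 H2).
Qed.

Lemma ccont_bounded (g : C -> C) (z : C) : ccont g z ->
  exists d, 0 < d /\ forall y, Cmod (y - z) < d -> Cmod (g y) <= Cmod (g z) + 1.
Proof.
  intros H. destruct (H 1 Rlt_0_1) as [d [Hd Hd']]. exists d; split; [assumption |].
  intros y Hy. specialize (Hd' y Hy).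
  assert (H1 := Cmod_triangle_rev (g y) (g z)). lra.
Qed.

Lemma ccont_mult (f g : C -> C) (z : C) :
  ccont f z -> ccont g z -> ccont (fun y => f y * g y)%C z.
Proof.
  intros Hf Hg e He.
  destruct (ccont_bounded f z Hf) as [d0 [Hd0 Hb]].
  assert (H0 := Cmod_ge_0 (f z)). assert (H1 := Cmod_ge_0 (g z)).
  set (K := Cmod (f z) + Cmod (g z) + 1).
  assert (HK : 0 < K) by (unfold K; lra).
  destruct (Hf (e / (2 * K))) as [d1 [Hd1 H1']]. { apply Rdiv_lt_0_compat; lra. }
  destruct (Hg (e / (2 * K))) as [d2 [Hd2 H2']]. { apply Rdiv_lt_0_compat; lra. }
  exists (Rmin d0 (Rmin d1 d2)); split.
  { apply Rmin_pos; [assumption | now apply Rmin_pos]. }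
  intros y Hy.
  below_min Hy as Hy0 Hy'.
  below_min Hy' as Hy1 Hy2.
  specialize (Hb y Hy0). specialize (H1' y Hy1). specialize (H2' y Hy2).
  replace (f y * g y - f z * g z)%C with (f y * (g y - g z) + (f y - f z) * g z)%C by ring.
  eapply Rle_lt_trans; [apply Cmod_triangle |]. rewrite !Cmod_mult.
  assert (E : e = e / (2 * K) * (2 * K)) by (field; lra).
  assert (P1 := Cmod_ge_0 (g y - g z)). assert (P2 := Cmod_ge_0 (f y - f z)).
  assert (P3 := Cmod_ge_0 (f y)).
  assert (Hq : 0 < e / (2 * K)) by (apply Rdiv_lt_0_compat; lra).
  set (q := e / (2 * K)) in *.
  assert (Cmod (f y) * Cmod (g y - g z) <= K * Cmod (g y - g z)).
  { apply Rmult_le_compat_r; unfold K; lra. }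
  assert (K * Cmod (g y - g z) < K * q) by (apply Rmult_lt_compat_l; lra).
  assert (Cmod (f y - f z) * Cmod (g z) <= q * K).
  { apply Rmult_le_compat; unfold K; lra. }
  nra.
Qed.

Lemma ccont_inv (g : C -> C) (z : C) :
  ccont g z -> g z <> 0%C -> ccont (fun y => / g y)%C z.
Proof.
  intros Hg Hz e He.
  assert (Hm : 0 < Cmod (g z)) by now apply Cmod_gt_0.
  set (m := Cmod (g z)) in *.
  destruct (Hg (m / 2)) as [d1 [Hd1 H1]]; [lra |].
  destruct (Hg (e * m * m / 2)) as [d2 [Hd2 H2]].
  { apply Rdiv_lt_0_compat; [| lra]. repeat apply Rmult_lt_0_compat; lra. }
  exists (Rmin d1 d2); split; [now apply Rmin_pos |].
  intros y Hy.
  below_min Hy as Hy1 Hy2.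
  specialize (H1 y Hy1). specialize (H2 y Hy2).
  assert (H3 := Cmod_triangle_rev (g z) (g y)).
  rewrite (Cmod_minus_sym (g z)) in H3. fold m in H3.
  assert (Hy3 : m / 2 < Cmod (g y)) by lra.
  assert (Hnz : g y <> 0%C) by (apply Cmod_gt_0; lra).
  replace (/ g y - / g z)%C with ((g z - g y) * / (g y * g z))%C by (field; split; assumption).
  rewrite Cmod_mult, Cmod_inv, Cmod_mult by (now apply Cmult_neq_0). fold m.
  rewrite Cmod_minus_sym.
  assert (Hq : 0 < Cmod (g y) * m) by (apply Rmult_lt_0_compat; lra).
  apply (Rmult_lt_reg_r (Cmod (g y) * m)); [assumption |].
  rewrite Rmult_assoc, Rinv_l, Rmult_1_r by lra.
  eapply Rlt_le_trans; [exact H2 |].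
  replace (e * m * m / 2) with (e * (m / 2 * m)) by field.
  apply Rmult_le_compat_l; [lra |]. apply Rmult_le_compat_r; lra.
Qed.

Lemma ccont_conj (z : C) : ccont Cconj z.
Proof.
  intros e He. exists e; split; [assumption |]. intros y Hy.
  replace (Cconj y - Cconj z)%C with (Cconj (y - z)).
  - now rewrite Cmod_conj.
  - apply C_ext; simpl; ring.
Qed.

Lemma vderiv_re_im (x : R -> C) (t : R) (v : C) :
  vderiv x t v <->
  is_derive (fun u => Re (x u)) t (Re v) /\ is_derive (fun u => Im (x u)) t (Im v).
Proof.
  split.
  - intros H. split.
    + apply (filterdiff_comp' x (fun z : C_R_NormedModule => fst z : R_NormedModule) t (fun y => scal y v) (fun z => fst z) H).
      apply filterdiff_linear. apply is_linear_fst.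
    + apply (filterdiff_comp' x (fun z : C_R_NormedModule => snd z : R_NormedModule) t (fun y => scal y v) (fun z => snd z) H).
      apply filterdiff_linear. apply is_linear_snd.
  - intros [H1 H2].
    assert (H := filterdiff_comp'_2 (fun u => Re (x u)) (fun u => Im (x u)) (fun a b => (a, b) : C_R_NormedModule) t _ _ (fun a b => (a,b)) H1 H2).
    apply filterdiff_ext with (f := fun u => (Re (x u), Im (x u)) : C_R_NormedModule).
    { intros u. now destruct (x u). }
    apply filterdiff_ext_lin with (l1 := fun y => (scal y (Re v), scal y (Im v)) : C_R_NormedModule).
    2: { intros y. destruct v. reflexivity. }
    apply H.
    apply filterdiff_ext with (f := fun z : prod_NormedModule R_AbsRing R_NormedModule R_NormedModule => z).
    { intros [a b]. reflexivity. }
    apply filterdiff_ext_lin with (l1 := fun z : prod_NormedModule R_AbsRing R_NormedModule R_NormedModule => z).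
    2: { intros [a b]. reflexivity. }
    apply filterdiff_id.
Qed.

Lemma vderiv_iff (x : R -> C) (t : R) (v : C) :
  vderiv x t v <->
  forall e, 0 < e -> exists d, 0 < d /\
    forall s, Rabs (s - t) < d -> Cmod (x s - x t - RtoC (s - t) * v) <= e * Rabs (s - t).
Proof.
  split.
  - intros [_ H] e He.
    destruct (H t (fun P HP => HP) (mkposreal e He)) as [d Hd].
    exists d; split; [apply cond_pos |].
    intros y Hy. specialize (Hd y Hy). simpl in Hd.
    rewrite <- Cmod_norm in Hd. 
    replace (RtoC (y - t) * v)%C with (scal (V := C_R_NormedModule) (y - t) v : C).
    exact Hd. apply (scal_R_Cmult (y - t) v).
  - intros H. split.
    + apply is_linear_scal_l.
    + intros x0 Hx e.
      assert (x0 = t) as ->.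
      { symmetry; apply (is_filter_lim_locally_unique (K := R_AbsRing) (V := R_NormedModule)). exact Hx. }
      destruct (H e (cond_pos e)) as [d [Hd Hd']].
      exists (mkposreal d Hd). intros y Hy. specialize (Hd' y Hy).
      rewrite <- Cmod_norm.
      replace (RtoC (y - t) * v)%C with (scal (V := C_R_NormedModule) (y - t) v : C) in Hd'.
      exact Hd'. apply (scal_R_Cmult (y - t) v).
Qed.

(** The chain rule across two scalar fields: a real derivative of a curve followed by a complex
    derivative of a map. *)
Lemma vderiv_comp (g : C -> C) (x : R -> C) (t : R) (l v : C) :
  vderiv x t v -> cderiv g (x t) l -> vderiv (fun s => g (x s)) t (l * v)%C.
Proof.
  rewrite !vderiv_iff, cderiv_iff. intros Hx Hg e He.
  assert (Hv := Cmod_ge_0 v). assert (Hl := Cmod_ge_0 l).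
  assert (He1 : 0 < e / (2 * (Cmod v + 1))) by (apply Rdiv_lt_0_compat; lra).
  assert (He2 : 0 < Rmin 1 (e / (2 * (Cmod l + 1)))).
  { apply Rmin_pos; [lra |]. apply Rdiv_lt_0_compat; lra. }
  destruct (Hg _ He1) as [d1 [Hd1 H1]].
  destruct (Hx _ He2) as [d2 [Hd2 H2]].
  exists (Rmin d2 (d1 / (Cmod v + 1))); split.
  { apply Rmin_pos; [assumption |]. apply Rdiv_lt_0_compat; lra. }
  intros s Hs.
  below_min Hs as Hs1 Hs2.
  specialize (H2 s Hs1).
  assert (Hd : Cmod (x s - x t) <= (Cmod v + 1) * Rabs (s - t)).
  { assert (T := Cmod_triangle (x s - x t - RtoC (s - t) * v) (RtoC (s - t) * v)).
    replace (x s - x t - RtoC (s - t) * v + RtoC (s - t) * v)%C with (x s - x t)%C in T by ring.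
    rewrite Cmod_mult, Cmod_R in T.
    assert (Hp := Rabs_pos (s - t)).
    assert (Rmin 1 (e / (2 * (Cmod l + 1))) <= 1) by apply Rmin_l. nra. }
  apply (Rmult_lt_compat_l (Cmod v + 1)) in Hs2; [| lra].
  replace ((Cmod v + 1) * (d1 / (Cmod v + 1))) with d1 in Hs2 by (field; lra).
  specialize (H1 (x s) (Rle_lt_trans _ _ _ Hd Hs2)).
  replace (g (x s) - g (x t) - RtoC (s - t) * (l * v))%C
    with ((g (x s) - g (x t) - l * (x s - x t)) + l * (x s - x t - RtoC (s - t) * v))%C by ring.
  eapply Rle_trans; [apply Cmod_triangle |]. rewrite Cmod_mult.
  assert (Hp := Rabs_pos (s - t)).
  assert (B1 : Cmod (g (x s) - g (x t) - l * (x s - x t)) <= e / 2 * Rabs (s - t)).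
  { eapply Rle_trans; [exact H1 |].
    replace (e / 2 * Rabs (s - t)) with (e / (2 * (Cmod v + 1)) * ((Cmod v + 1) * Rabs (s - t))) by (field; lra).
    apply Rmult_le_compat_l; lra. }
  assert (B2 : Cmod l * Cmod (x s - x t - RtoC (s - t) * v) <= e / 2 * Rabs (s - t)).
  { eapply Rle_trans. apply Rmult_le_compat_l; [assumption | exact H2].
    rewrite <- Rmult_assoc. apply Rmult_le_compat_r; [assumption |].
    eapply Rle_trans. apply Rmult_le_compat_l; [assumption | apply Rmin_r].
    apply Rle_trans with ((Cmod l + 1) * (e / (2 * (Cmod l + 1)))).
    - apply Rmult_le_compat_r; [| lra]. apply Rlt_le, Rdiv_lt_0_compat; lra.
    - right. field. lra. }
  lra.
Qed.

Lemma is_derive_re_mult (c : C) (x : R -> C) (t : R) (v : C) :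
  vderiv x t v -> is_derive (fun s => Re (c * x s)) t (Re (c * v)).
Proof.
  intros H. apply vderiv_re_im in H. destruct H as [H1 H2].
  apply (is_derive_minus (K := R_AbsRing) (V := R_NormedModule)
    (fun s => Re c * Re (x s)) (fun s => Im c * Im (x s)) t (Re c * Re v) (Im c * Im v)).
  - apply (is_derive_scal (fun s => Re (x s)) t (Re c) (Re v) H1).
  - apply (is_derive_scal (fun s => Im (x s)) t (Im c) (Im v) H2).
Qed.

Lemma vderiv_continuous_re_im (x : R -> C) (t : R) (v : C) :
  vderiv x t v -> continuous (fun s => Re (x s)) t /\ continuous (fun s => Im (x s)) t.
Proof.
  intros H. apply vderiv_re_im in H. destruct H as [H1 H2].
  split; apply (ex_derive_continuous (K := R_AbsRing) (V := R_NormedModule)); eexists; eassumption.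
Qed.

Lemma Re_conj_mult_self (d : C) : Re (Cconj d * d) = Cmod d * Cmod d.
Proof.
  transitivity (Re d ^ 2 + Im d ^ 2).
  - destruct d; simpl; ring.
  - rewrite <- Cmod2_alt. ring.
Qed.

(** The scalar mean value theorem is applied to the projection of the curve on the direction of its
    own chord [d], whose increment is [Cmod d] squared. *)
Lemma mean_value_curve (x v : R -> C) (a b K : R) :
  a <= b -> (forall t, a <= t <= b -> vderiv x t (v t) /\ Cmod (v t) <= K) ->
  Cmod (x b - x a) <= K * (b - a).
Proof.
  intros Hab H.
  set (d := (x b - x a)%C).
  destruct (MVT_gen (fun s => Re (Cconj d * x s)) a b (fun s => Re (Cconj d * v s))) as [c [Hc Hm]].
  - rewrite Rmin_left, Rmax_right by assumption. intros t Ht.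
    apply is_derive_re_mult. apply H. lra.
  - rewrite Rmin_left, Rmax_right by assumption. intros t Ht.
    apply continuity_pt_filterlim.
    apply (ex_derive_continuous (K := R_AbsRing) (V := R_NormedModule)).
    eexists. apply is_derive_re_mult. apply H. lra.
  - rewrite Rmin_left, Rmax_right in Hc by assumption.
    assert (E : Re (Cconj d * x b) - Re (Cconj d * x a) = Cmod d * Cmod d).
    { rewrite <- Re_conj_mult_self. unfold d. simpl. ring. }
    rewrite E in Hm.
    assert (B : Re (Cconj d * v c) <= Cmod d * K).
    { eapply Rle_trans; [apply Rle_abs |]. eapply Rle_trans; [apply re_le_Cmod |].
      rewrite Cmod_mult, Cmod_conj. apply Rmult_le_compat_l; [apply Cmod_ge_0 |]. apply H; lra. }
    assert (H0 := Cmod_ge_0 d).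
    assert (HK : 0 <= K) by (eapply Rle_trans; [apply Cmod_ge_0 | apply (H a); lra]).
    destruct (Req_dec (Cmod d) 0) as [Hz | Hz].
    + rewrite Hz. apply Rmult_le_pos; lra.
    + apply (Rmult_le_reg_l (Cmod d)); [lra |]. nra.
Qed.

Lemma vderiv_segment (z1 z2 : C) (t : R) : vderiv (fun s => z1 + RtoC s * (z2 - z1))%C t (z2 - z1)%C.
Proof.
  apply vderiv_iff. intros e He. exists 1; split; [lra |]. intros s _.
  replace (z1 + RtoC s * (z2 - z1) - (z1 + RtoC t * (z2 - z1)) - RtoC (s - t) * (z2 - z1))%C with (RtoC 0).
  - rewrite Cmod_0. apply Rmult_le_pos; [lra | apply Rabs_pos].
  - rewrite RtoC_minus. ring.
Qed.

Lemma vderiv_minus (x y : R -> C) (t : R) (v w : C) :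
  vderiv x t v -> vderiv y t w -> vderiv (fun s => x s - y s)%C t (v - w)%C.
Proof. exact (is_derive_minus (K := R_AbsRing) (V := C_R_NormedModule) x y t v w). Qed.

Lemma vderiv_scal_C (c : C) (x : R -> C) (t : R) (v : C) :
  vderiv x t v -> vderiv (fun s => c * x s)%C t (c * v)%C.
Proof.
  rewrite !vderiv_iff. intros H e He.
  assert (Hc := Cmod_ge_0 c).
  destruct (H (e / (Cmod c + 1))) as [d [Hd Hd']]; [apply Rdiv_lt_0_compat; lra |].
  exists d; split; [assumption |]. intros s Hs. specialize (Hd' s Hs).
  replace (c * x s - c * x t - RtoC (s - t) * (c * v))%C with (c * (x s - x t - RtoC (s - t) * v))%C by ring.
  rewrite Cmod_mult.
  assert (Hp := Rabs_pos (s - t)).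
  apply Rle_trans with ((Cmod c + 1) * (e / (Cmod c + 1) * Rabs (s - t))).
  - apply Rmult_le_compat; try lra. apply Cmod_ge_0.
  - right. field. lra.
Qed.

Lemma ball_convex (z0 z1 z2 : C) (r s : R) :
  Cmod (z1 - z0) < r -> Cmod (z2 - z0) < r -> 0 <= s <= 1 ->
  Cmod (z1 + RtoC s * (z2 - z1) - z0) < r.
Proof.
  intros H1 H2 Hs.
  replace (z1 + RtoC s * (z2 - z1) - z0)%C
    with (RtoC (1 - s) * (z1 - z0) + RtoC s * (z2 - z0))%C by (rewrite RtoC_minus; ring).
  eapply Rle_lt_trans; [apply Cmod_triangle |]. rewrite !Cmod_mult, !Cmod_R.
  rewrite !Rabs_pos_eq by lra.
  assert (P1 := Cmod_ge_0 (z1 - z0)). assert (P2 := Cmod_ge_0 (z2 - z0)).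
  destruct (Req_dec s 0) as [-> | Hs0]; [lra |]. nra.
Qed.

(** Subtracting the linear map [A] before following the segment makes [K] measure the oscillation of
    the derivative. Used with [A = 0] for Lipschitz bounds and with [A] a value of the derivative
    for strict differentiability. *)
Lemma mean_value_ball (g g1 : C -> C) (z0 A : C) (r K : R) :
  (forall z, Cmod (z - z0) < r -> cderiv g z (g1 z) /\ Cmod (g1 z - A) <= K) ->
  forall z1 z2, Cmod (z1 - z0) < r -> Cmod (z2 - z0) < r ->
    Cmod (g z2 - g z1 - A * (z2 - z1)) <= K * Cmod (z2 - z1).
Proof.
  intros H z1 z2 H1 H2.
  set (c := fun s : R => (z1 + RtoC s * (z2 - z1))%C).
  assert (E := mean_value_curve (fun s => g (c s) - A * c s)%C
    (fun s => g1 (c s) * (z2 - z1) - A * (z2 - z1))%C 0 1 (K * Cmod (z2 - z1))).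
  replace (g z2 - g z1 - A * (z2 - z1))%C with (g (c 1) - A * c 1 - (g (c 0) - A * c 0))%C.
  - eapply Rle_trans; [apply E; [lra |] | right; ring].
    intros s Hs. assert (Hb := ball_convex z0 z1 z2 r s H1 H2 Hs).
    destruct (H _ Hb) as [Hg Hk]. split.
    + apply vderiv_minus.
      * apply (vderiv_comp g c); [apply vderiv_segment | exact Hg].
      * apply (vderiv_scal_C A c). apply vderiv_segment.
    + replace (g1 (c s) * (z2 - z1) - A * (z2 - z1))%C with ((g1 (c s) - A) * (z2 - z1))%C by ring.
      rewrite Cmod_mult. apply Rmult_le_compat_r; [apply Cmod_ge_0 | exact Hk].
  - unfold c. replace (z1 + 1 * (z2 - z1))%C with z2 by ring.
    replace (z1 + 0 * (z2 - z1))%C with z1 by ring. ring.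
Qed.

(** Both arguments vary, not only one against the centre: uniqueness of solutions compares the field
    at two moving points. *)
Definition loclip (g : C -> C) (z : C) : Prop :=
  exists L d, 0 <= L /\ 0 < d /\ forall z1 z2, Cmod (z1 - z) < d -> Cmod (z2 - z) < d ->
    Cmod (g z2 - g z1) <= L * Cmod (z2 - z1).

Lemma loclip_C1 (g g1 : C -> C) (z0 : C) (r : R) :
  0 < r -> (forall z, Cmod (z - z0) < r -> cderiv g z (g1 z)) -> ccont g1 z0 -> loclip g z0.
Proof.
  intros Hr Hg Hc. destruct (ccont_bounded g1 z0 Hc) as [d [Hd Hb]].
  exists (Cmod (g1 z0) + 1), (Rmin d r). assert (H0 := Cmod_ge_0 (g1 z0)).
  split; [lra |]. split; [now apply Rmin_pos |].
  intros z1 z2 H1 H2.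
  replace (g z2 - g z1)%C with (g z2 - g z1 - 0 * (z2 - z1))%C by ring.
  apply (mean_value_ball g g1 z0 0 (Rmin d r)); try assumption.
  intros z Hz. split.
  - apply Hg. eapply Rlt_le_trans; [exact Hz | apply Rmin_r].
  - replace (g1 z - 0)%C with (g1 z) by ring. apply Hb. eapply Rlt_le_trans; [exact Hz | apply Rmin_l].
Qed.

(** The explicit rate is kept because the limits of the Newton and Picard iterations are shown to be
    fixed points by comparison with the iterates. *)
Lemma geometric_limit (u : nat -> R) (K : R) :
  (forall n, Rabs (u (S n) - u n) <= K * (1 / 2) ^ n) ->
  exists l, forall n, Rabs (l - u n) <= 2 * K * (1 / 2) ^ n.
Proof.
  intros H.
  assert (HK : 0 <= K).
  { specialize (H 0%nat). simpl in H. assert (P := Rabs_pos (u 1%nat - u 0%nat)). lra. }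
  assert (Hd : forall n k, Rabs (u (n + k)%nat - u n) <= 2 * K * (1 / 2) ^ n * (1 - (1 / 2) ^ k)).
  { intros n k. induction k as [| k IH].
    - rewrite Nat.add_0_r. replace (u n - u n) with 0 by ring. rewrite Rabs_R0. simpl. right; ring.
    - replace (n + S k)%nat with (S (n + k)) by lia.
      replace (u (S (n + k)) - u n) with ((u (S (n + k)) - u (n + k)%nat) + (u (n + k)%nat - u n)) by ring.
      eapply Rle_trans; [apply Rabs_triang |]. specialize (H (n + k)%nat).
      rewrite pow_add in H. simpl. nra. }
  assert (Hp : forall n, 0 < (1 / 2) ^ n) by (intros; apply pow_lt; lra).
  assert (Hc : ex_finite_lim_seq u).
  { apply ex_lim_seq_cauchy_corr. intros e.
    destruct (pow_lt_1_zero (1 / 2)) with (y := e / (4 * K + 1)) as [N HN].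
    - rewrite Rabs_pos_eq; lra.
    - apply Rdiv_lt_0_compat; [apply cond_pos | lra].
    - exists N. intros n m Hn Hm.
      specialize (HN N (le_n N)). rewrite Rabs_pos_eq in HN by (apply Rlt_le, Hp).
      assert (E : forall j, (N <= j)%nat -> Rabs (u j - u N) <= 2 * K * (1 / 2) ^ N).
      { intros j Hj. replace j with (N + (j - N))%nat by lia.
        eapply Rle_trans; [apply Hd |].
        assert (P1 := Hp N). assert (P2 := Hp (j - N)%nat).
        assert (0 <= 2 * K * (1 / 2) ^ N) by (apply Rmult_le_pos; lra). nra. }
      replace (u n - u m) with ((u n - u N) - (u m - u N)) by ring.
      eapply Rle_lt_trans; [apply Rabs_triang |]. rewrite Rabs_Ropp.
      assert (E1 := E n Hn). assert (E2 := E m Hm).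
      apply (Rmult_lt_compat_l (4 * K + 1)) in HN; [| lra].
      replace ((4 * K + 1) * (e / (4 * K + 1))) with (pos e) in HN by (field; lra).
      assert (P := Hp N). nra. }
  destruct Hc as [l Hl]. exists l. intros n.
  assert (Hl' : is_lim_seq (fun k => Rabs (u (k + n)%nat - u n)) (Rabs (l - u n))).
  { apply (is_lim_seq_abs _ (Finite (l - u n))).
    apply (is_lim_seq_minus' (fun k => u (k + n)%nat) (fun _ => u n)).
    - now apply is_lim_seq_incr_n.
    - apply is_lim_seq_const. }
  apply (is_lim_seq_le _ (fun _ => 2 * K * (1 / 2) ^ n) (Rabs (l - u n)) (2 * K * (1 / 2) ^ n)) in Hl'.
  - exact Hl'.
  - intros k. rewrite Nat.add_comm. eapply Rle_trans; [apply Hd |].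
    assert (P1 := Hp n). assert (P2 := Hp k).
    assert (0 <= 2 * K * (1 / 2) ^ n) by (apply Rmult_le_pos; lra). nra.
  - apply is_lim_seq_const.
Qed.

(* Newton iteration with the derivative frozen at [z0]. *)
Lemma local_surjectivity (g g1 : C -> C) (z0 : C) (r : R) :
  0 < r -> (forall z, Cmod (z - z0) < r -> cderiv g z (g1 z)) ->
  ccont g1 z0 -> g1 z0 <> 0%C ->
  forall d, 0 < d -> exists d', 0 < d' /\
    forall w, Cmod (w - g z0) < d' -> exists z, Cmod (z - z0) < d /\ g z = w.
Proof.
  intros Hr Hg Hc HA d Hd. set (A := g1 z0) in *.
  assert (Hm : 0 < Cmod A) by now apply Cmod_gt_0.
  destruct (Hc (Cmod A / 2)) as [d0 [Hd0 H0]]; [lra |].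
  set (q := Rmin d (Rmin d0 r)).
  assert (Hq : 0 < q) by (unfold q; apply Rmin_pos; [| apply Rmin_pos]; assumption).
  assert (Hq1 : q <= d) by apply Rmin_l.
  assert (Hq2 : q <= d0) by (eapply Rle_trans; [apply Rmin_r | apply Rmin_l]).
  assert (Hq3 : q <= r) by (eapply Rle_trans; [apply Rmin_r | apply Rmin_r]).
  assert (MV := mean_value_ball g g1 z0 A q (Cmod A / 2)).
  assert (MV' : forall z1 z2, Cmod (z1 - z0) < q -> Cmod (z2 - z0) < q ->
    Cmod (g z2 - g z1 - A * (z2 - z1)) <= Cmod A / 2 * Cmod (z2 - z1)).
  { apply MV. intros z Hz. split; [apply Hg; lra |]. apply Rlt_le, H0. lra. }
  (* The first Newton step is [(w - g z0) / A], hence shorter than [q / 4]; all iterates stay within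
     twice that step of [z0], so the iteration never leaves the ball of radius [q]. *)
  exists (Cmod A * q / 4). split. { apply Rdiv_lt_0_compat; [apply Rmult_lt_0_compat |]; lra. }
  intros w Hw.
  (* Solutions of [g z = w] are the fixed points of [T], which contracts by 1/2 because [g1] stays
     within [Cmod A / 2] of [A] on the ball of radius [q]. *)
  set (T := fun z => (z - (g z - w) / A)%C).
  assert (HT : forall z1 z2, Cmod (z1 - z0) < q -> Cmod (z2 - z0) < q ->
    Cmod (T z2 - T z1) <= 1 / 2 * Cmod (z2 - z1)).
  { intros z1 z2 H1 H2. unfold T.
    replace (z2 - (g z2 - w) / A - (z1 - (g z1 - w) / A))%C
      with (- ((g z2 - g z1 - A * (z2 - z1)) / A))%C by (field; exact HA).
    rewrite Cmod_opp, Cmod_div by exact HA.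
    apply (Rmult_le_reg_r (Cmod A)); [lra |].
    unfold Rdiv at 1. rewrite Rmult_assoc, Rinv_l, Rmult_1_r by lra.
    specialize (MV' z1 z2 H1 H2). lra. }
  set (zs := fun n => Nat.iter n T z0).
  set (c := Cmod (T z0 - z0)).
  assert (Hc0 : c < q / 4).
  { unfold c, T. replace (z0 - (g z0 - w) / A - z0)%C with ((w - g z0) / A)%C by (field; exact HA).
    rewrite Cmod_div by exact HA. apply (Rmult_lt_reg_r (Cmod A)); [lra |].
    unfold Rdiv at 1. rewrite Rmult_assoc, Rinv_l, Rmult_1_r by lra. lra. }
  assert (Hc1 : 0 <= c) by apply Cmod_ge_0.
  assert (Hp : forall n, 0 < (1 / 2) ^ n) by (intros; apply pow_lt; lra).
  assert (Hi : forall n, Cmod (zs n - z0) <= 2 * c * (1 - (1 / 2) ^ n) /\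
                         Cmod (zs (S n) - zs n) <= c * (1 / 2) ^ n).
  { induction n as [| n [IH1 IH2]].
    - split.
      + simpl. rewrite Cmod_minus_self. lra.
      + simpl. fold c. lra.
    - assert (IH1' : Cmod (zs (S n) - z0) <= 2 * c * (1 - (1 / 2) ^ S n)).
      { eapply Rle_trans; [apply (Cmod_minus_triangle _ (zs n)) |]. rewrite <- tech_pow_Rmult. lra. }
      assert (P := Hp n). assert (P' := Hp (S n)).
      split; [exact IH1' |].
      change (zs (S (S n))) with (T (zs (S n))). change (zs (S n)) with (T (zs n)) at 2.
      eapply Rle_trans; [apply HT; nra |]. rewrite <- tech_pow_Rmult. lra. }
  destruct (geometric_limit (fun n => Re (zs n)) c) as [a Ha].
  { intros n. eapply Rle_trans; [| apply (Hi n)]. rewrite <- Re_minus. apply re_le_Cmod. }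
  destruct (geometric_limit (fun n => Im (zs n)) c) as [b Hb].
  { intros n. eapply Rle_trans; [| apply (Hi n)]. rewrite <- Im_minus. apply im_le_Cmod. }
  set (z := (a, b) : C).
  assert (Hz : forall n, Cmod (z - zs n) <= 4 * c * (1 / 2) ^ n).
  { intros n. eapply Rle_trans; [apply Cmod_le_re_im |].
    specialize (Ha n). specialize (Hb n). rewrite Re_minus, Im_minus. simpl Re at 1. simpl Im at 1. lra. }
  assert (Hzb : Cmod (z - z0) < q).
  { eapply Rle_lt_trans; [apply (Cmod_minus_triangle _ (zs 2%nat)) |].
    assert (H1 := Hz 2%nat). destruct (Hi 2%nat) as [H2 _]. 
    change ((1 / 2) ^ 2) with (1 / 2 * (1 / 2 * 1)) in H1, H2. lra. }
  exists z. split; [lra |].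
  assert (HTz : Cmod (T z - z) <= 0).
  { apply le_epsilon. intros e He.
    destruct (pow_lt_1_zero (1 / 2)) with (y := e / (8 * c + 1)) as [N HN].
    { rewrite Rabs_pos_eq; lra. } { apply Rdiv_lt_0_compat; lra. }
    specialize (HN N (le_n N)). rewrite Rabs_pos_eq in HN by (apply Rlt_le, Hp).
    eapply Rle_trans; [apply (Cmod_minus_triangle _ (T (zs N))) |].
    eapply Rle_trans.
    { apply Rplus_le_compat. 
      - apply HT; [| exact Hzb]. destruct (Hi N) as [H2 _]. assert (P := Hp N). nra.
      - change (T (zs N)) with (zs (S N)). rewrite Cmod_minus_sym. apply Hz. }
    assert (H1 := Hz N). rewrite <- tech_pow_Rmult.
    apply (Rmult_lt_compat_l (8 * c + 1)) in HN; [| lra].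
    replace ((8 * c + 1) * (e / (8 * c + 1))) with e in HN by (field; lra).
    assert (P := Hp N). nra. }
  assert (HTz0 : (T z - z)%C = 0%C).
  { apply Cmod_eq_0. apply Rle_antisym; [exact HTz | apply Cmod_ge_0]. }
  unfold T in HTz0.
  replace (g z) with (w - (z - (g z - w) / A - z) * A)%C by (field; exact HA).
  rewrite HTz0. ring.
Qed.

(* Joint continuity in two real variables is [ccont] on the plane, and continuity of a
   curve is [ccont] after composition with the first projection. *)
Definition vcont (x : R -> C) : Prop := forall z : C, ccont (fun y : C => x (fst y)) z.

Lemma ccont_2d_re (G : C -> C) (u v : R) :
  ccont G (u, v) -> continuity_2d_pt (fun a b => Re (G (a, b))) u v.
Proof.
  intros H e. destruct (H e (cond_pos e)) as [d [Hd Hd']].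
  assert (Hd2 : 0 < d / 2) by lra.
  exists (mkposreal _ Hd2). intros a b Ha Hb. simpl in Ha, Hb.
  rewrite <- Re_minus. eapply Rle_lt_trans; [apply re_le_Cmod |]. apply Hd'.
  eapply Rle_lt_trans; [apply Cmod_le_re_im |]. rewrite Re_minus, Im_minus. simpl. lra.
Qed.

Lemma ccont_2d_im (G : C -> C) (u v : R) :
  ccont G (u, v) -> continuity_2d_pt (fun a b => Im (G (a, b))) u v.
Proof.
  intros H e. destruct (H e (cond_pos e)) as [d [Hd Hd']].
  assert (Hd2 : 0 < d / 2) by lra.
  exists (mkposreal _ Hd2). intros a b Ha Hb. simpl in Ha, Hb.
  rewrite <- Im_minus. eapply Rle_lt_trans; [apply im_le_Cmod |]. apply Hd'.
  eapply Rle_lt_trans; [apply Cmod_le_re_im |]. rewrite Re_minus, Im_minus. simpl. lra.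
Qed.

Lemma continuous_eps (f : R -> R) (t : R) :
  continuous f t <->
  forall e, 0 < e -> exists d, 0 < d /\ forall s, Rabs (s - t) < d -> Rabs (f s - f t) < e.
Proof.
  split.
  - intros H e He. destruct (proj1 (filterlim_locally _ _) H (mkposreal e He)) as [d Hd].
    exists d; split; [apply cond_pos |]. intros s Hs. apply (Hd s Hs).
  - intros H. apply filterlim_locally. intros e.
    destruct (H e (cond_pos e)) as [d [Hd Hd']]. exists (mkposreal d Hd). intros s Hs. apply (Hd' s Hs).
Qed.

Lemma ccont_curve (x : R -> C) (t s : R) :
  ccont (fun y : C => x (fst y)) (t, s) ->
  continuous (fun u => Re (x u)) t /\ continuous (fun u => Im (x u)) t.
Proof.
  intros H. split; apply continuous_eps; intros e He; destruct (H e He) as [d [Hd Hd']];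
    exists d; (split; [assumption |]); intros u Hu;
    (assert (Hc : Cmod ((u, s) - (t, s)) < d);
     [ eapply Rle_lt_trans; [apply Cmod_le_re_im |]; simpl;
       replace (s + - s) with 0 by ring; rewrite Rabs_R0, Rplus_0_r; exact Hu |]);
    specialize (Hd' (u, s) Hc); simpl in Hd'.
  - rewrite <- Re_minus. eapply Rle_lt_trans; [apply re_le_Cmod | exact Hd'].
  - rewrite <- Im_minus. eapply Rle_lt_trans; [apply im_le_Cmod | exact Hd'].
Qed.

Lemma vcont_re_im (x : R -> C) : vcont x ->
  forall t, continuous (fun u => Re (x u)) t /\ continuous (fun u => Im (x u)) t.
Proof. intros H t. apply (ccont_curve x t 0). apply H. Qed.

Lemma ccont_re_of (f : R -> R) (z : C) :
  continuous f (fst z) -> ccont (fun y : C => RtoC (f (fst y))) z.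
Proof.
  intros H e He. destruct (proj1 (continuous_eps f (fst z)) H e He) as [d [Hd Hd']].
  exists d; split; [assumption |]. intros y Hy.
  rewrite <- RtoC_minus, Cmod_R. apply Hd'.
  eapply Rle_lt_trans; [| exact Hy]. exact (re_le_Cmod (y - z)).
Qed.

Lemma ccont_im_of (f : R -> R) (z : C) :
  continuous f (snd z) -> ccont (fun y : C => RtoC (f (snd y))) z.
Proof.
  intros H e He. destruct (proj1 (continuous_eps f (snd z)) H e He) as [d [Hd Hd']].
  exists d; split; [assumption |]. intros y Hy.
  rewrite <- RtoC_minus, Cmod_R. apply Hd'.
  eapply Rle_lt_trans; [| exact Hy]. exact (im_le_Cmod (y - z)).
Qed.

Lemma polar_split (r t : R) : polar r t = (RtoC r * (RtoC (cos t) + Ci * RtoC (sin t)))%C.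
Proof. apply C_ext; simpl; ring. Qed.

Lemma ccont_polar (z : C) : ccont (fun y : C => polar (fst y) (snd y)) z.
Proof.
  apply (ccont_ext_loc (fun y : C => RtoC (fst y) * (RtoC (cos (snd y)) + Ci * RtoC (sin (snd y))))%C _ z 1).
  { lra. } { intros. symmetry. apply polar_split. }
  apply ccont_mult.
  - apply (ccont_re_of (fun u => u)). apply continuous_id.
  - apply ccont_plus.
    + apply ccont_im_of. apply continuity_pt_filterlim, continuity_cos.
    + apply ccont_mult; [apply ccont_const |]. apply ccont_im_of. apply continuity_pt_filterlim, continuity_sin.
Qed.

Lemma vcont_polar (r : R) : vcont (polar r).
Proof.
  intros z.
  assert (H : ccont (fun y : C => (r, fst y)) z).
  { intros e He. exists e; split; [assumption |]. intros y Hy.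
    eapply Rle_lt_trans; [| exact Hy].
    replace ((r, fst y) - (r, fst z))%C with (Ci * RtoC (fst y - fst z))%C.
    - rewrite Cmod_mult, Cmod_Ci, Rmult_1_l, Cmod_R. exact (re_le_Cmod (y - z)).
    - apply C_ext; simpl; ring. }
  exact (ccont_comp (fun y : C => (r, fst y)) (fun y => polar (fst y) (snd y)) z H (ccont_polar _)).
Qed.

Lemma polar_cis (r t : R) : polar r t = (RtoC r * polar 1 t)%C.
Proof. apply C_ext; simpl; ring. Qed.

Lemma Cmod_cis (t : R) : Cmod (polar 1 t) = 1.
Proof.
  unfold Cmod, polar. simpl. rewrite !Rmult_1_l, !Rmult_1_r.
  assert (H := sin2_cos2 t). unfold Rsqr in H.
  rewrite <- sqrt_1. f_equal. lra.
Qed.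

Lemma Cmod_polar (r t : R) : Cmod (polar r t) = Rabs r.
Proof. rewrite polar_cis, Cmod_mult, Cmod_R, Cmod_cis. ring. Qed.

Lemma cis_mult_conj (t : R) : (polar 1 t * Cconj (polar 1 t) = 1)%C.
Proof.
  assert (H := sin2_cos2 t). unfold Rsqr in H. apply C_ext; simpl; nra.
Qed.

Lemma vderiv_polar (r t : R) : vderiv (polar r) t (Ci * polar r t)%C.
Proof.
  apply vderiv_re_im. split; simpl.
  - auto_derive; [trivial | ring].
  - auto_derive; [trivial | ring].
Qed.

Lemma vderiv_cis_conj (t : R) : vderiv (fun s => Cconj (polar 1 s)) t (- Ci * Cconj (polar 1 t))%C.
Proof.
  apply vderiv_re_im. split; simpl.
  - auto_derive; [trivial | ring].
  - auto_derive; [trivial | ring].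
Qed.

Lemma vderiv_mult (x y : R -> C) (t : R) (v w : C) :
  vderiv x t v -> vderiv y t w -> vderiv (fun s => x s * y s)%C t (v * y t + x t * w)%C.
Proof.
  rewrite !vderiv_re_im. intros [H1 H2] [H3 H4].
  assert (D1 := is_derive_mult _ _ t _ _ H1 H3 Rmult_comm).
  assert (D2 := is_derive_mult _ _ t _ _ H2 H4 Rmult_comm).
  assert (D3 := is_derive_mult _ _ t _ _ H1 H4 Rmult_comm).
  assert (D4 := is_derive_mult _ _ t _ _ H2 H3 Rmult_comm).
  split.
  - evar_last. exact (is_derive_minus _ _ t _ _ D1 D2).
    unfold minus, plus, opp, mult; simpl; unfold Re, Im; ring.
  - evar_last. exact (is_derive_plus _ _ t _ _ D3 D4).
    unfold minus, plus, opp, mult; simpl; unfold Re, Im; ring.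
Qed.

(** * Integrals of plane curves *)

Definition CInt (x : R -> C) (a b : R) : C :=
  (RInt (fun t => Re (x t)) a b, RInt (fun t => Im (x t)) a b).

Lemma vcont_ex_RInt (x : R -> C) (a b : R) : vcont x ->
  ex_RInt (fun t => Re (x t)) a b /\ ex_RInt (fun t => Im (x t)) a b.
Proof.
  intros H. split; apply (ex_RInt_continuous (V := R_CompleteNormedModule)); intros t _;
    apply (vcont_re_im x H t).
Qed.

Lemma abs_RInt_le_cont (f : R -> R) (a b K : R) :
  a <= b -> (forall t, a <= t <= b -> continuous f t) ->
  (forall t, a <= t <= b -> Rabs (f t) <= K) -> Rabs (RInt f a b) <= K * (b - a).
Proof.
  intros Hab Hc Hb.
  replace (K * (b - a)) with ((b - a) * K) by ring.
  apply abs_RInt_le_const; try assumption.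
  apply (ex_RInt_continuous (V := R_CompleteNormedModule)).
  rewrite Rmin_left, Rmax_right by assumption. exact Hc.
Qed.

(** The factor 2 is the price of bounding the two components separately; it only affects
    constants. *)
Lemma CInt_bound (x : R -> C) (a b K : R) :
  a <= b -> vcont x -> (forall t, a <= t <= b -> Cmod (x t) <= K) ->
  Cmod (CInt x a b) <= 2 * (K * (b - a)).
Proof.
  intros Hab Hc Hb. apply Cmod_re_im_bound; simpl.
  - apply abs_RInt_le_cont; [assumption | intros; apply (proj1 (vcont_re_im x Hc _)) |].
    intros. eapply Rle_trans; [apply re_le_Cmod | auto].
  - apply abs_RInt_le_cont; [assumption | intros; apply (proj2 (vcont_re_im x Hc _)) |].
    intros. eapply Rle_trans; [apply im_le_Cmod | auto].
Qed.

Lemma CInt_scal (c : C) (x : R -> C) (a b : R) : vcont x ->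
  CInt (fun t => c * x t)%C a b = (c * CInt x a b)%C.
Proof.
  intros Hx. destruct (vcont_ex_RInt x a b Hx) as [H1 H2].
  apply C_ext; simpl.
  - etransitivity. apply (RInt_minus (V := R_CompleteNormedModule) (fun t => Re c * Re (x t)) (fun t => Im c * Im (x t)));
      apply (ex_RInt_scal (V := R_NormedModule)); assumption.
    rewrite !(RInt_scal (V := R_CompleteNormedModule)) by assumption. reflexivity.
  - etransitivity. apply (RInt_plus (V := R_CompleteNormedModule) (fun t => Re c * Im (x t)) (fun t => Im c * Re (x t)));
      apply (ex_RInt_scal (V := R_NormedModule)); assumption.
    rewrite !(RInt_scal (V := R_CompleteNormedModule)) by assumption. reflexivity.
Qed.

Lemma CInt_minus (x y : R -> C) (a b : R) : vcont x -> vcont y ->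
  CInt (fun t => x t - y t)%C a b = (CInt x a b - CInt y a b)%C.
Proof.
  intros Hx Hy. destruct (vcont_ex_RInt x a b Hx). destruct (vcont_ex_RInt y a b Hy).
  apply C_ext; simpl; apply (RInt_minus (V := R_CompleteNormedModule)); assumption.
Qed.

Lemma CInt_derive (x v : R -> C) (a b : R) :
  (forall t, vderiv x t (v t)) -> vcont v -> CInt v a b = (x b - x a)%C.
Proof.
  intros H Hc. apply C_ext.
  - apply (is_RInt_unique (V := R_CompleteNormedModule) (fun t => Re (v t))).
    apply (is_RInt_derive (V := R_CompleteNormedModule) (fun s => Re (x s)) (fun s => Re (v s))); intros t _.
    + apply (proj1 (vderiv_re_im x t (v t)) (H t)).
    + apply (proj1 (vcont_re_im v Hc _)).
  - apply (is_RInt_unique (V := R_CompleteNormedModule) (fun t => Im (v t))).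
    apply (is_RInt_derive (V := R_CompleteNormedModule) (fun s => Im (x s)) (fun s => Im (v s))); intros t _.
    + apply (proj1 (vderiv_re_im x t (v t)) (H t)).
    + apply (proj2 (vcont_re_im v Hc _)).
Qed.

Lemma CInt_const (c : C) (a b : R) : CInt (fun _ => c) a b = (RtoC (b - a) * c)%C.
Proof.
  apply C_ext; simpl; rewrite RInt_const; unfold scal; simpl; unfold mult; simpl; unfold Re, Im; ring.
Qed.

(** * Continuous complex differentiability implies continuity of the second derivative *)

Lemma cderiv_shift_polar (g : C -> C) (w l : C) (r t : R) :
  cderiv g (w + polar r t)%C l -> vderiv (fun s => g (w + polar s t)%C) r (l * polar 1 t)%C.
Proof.
  intros H. apply (vderiv_comp g (fun s => w + polar s t)%C); [| exact H].
  apply vderiv_re_im. split; simpl.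
  - auto_derive; [trivial | ring].
  - auto_derive; [trivial | ring].
Qed.

Lemma vderiv_shift (w : C) (x : R -> C) (t : R) (v : C) :
  vderiv x t v -> vderiv (fun s => w + x s)%C t v.
Proof.
  rewrite !vderiv_iff. intros H e He. destruct (H e He) as [d [Hd Hd']].
  exists d; split; [assumption |]. intros s Hs.
  replace (w + x s - (w + x t))%C with (x s - x t)%C by ring. now apply Hd'.
Qed.

Lemma ccont_shift_polar (w z : C) : ccont (fun y : C => w + polar (fst y) (snd y))%C z.
Proof. apply ccont_plus; [apply ccont_const | apply ccont_polar]. Qed.

Lemma vcont_shift_polar (w : C) (r : R) : vcont (fun t => w + polar r t)%C.
Proof. intros z. apply ccont_plus; [apply ccont_const | apply (vcont_polar r)]. Qed.

Lemma vcont_cis_conj : vcont (fun t => Cconj (polar 1 t)).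
Proof. intros z. apply (ccont_comp (fun y : C => polar 1 (fst y)) Cconj); [apply vcont_polar | apply ccont_conj]. Qed.

Lemma vcont_comp (g : C -> C) (x : R -> C) :
  vcont x -> (forall t, ccont g (x t)) -> vcont (fun t => g (x t)).
Proof. intros Hx Hg z. apply (ccont_comp (fun y : C => x (fst y)) g); [apply Hx | apply Hg]. Qed.

Lemma vcont_mult (x y : R -> C) : vcont x -> vcont y -> vcont (fun t => x t * y t)%C.
Proof. intros Hx Hy z. apply ccont_mult; [apply Hx | apply Hy]. Qed.

Lemma vcont_const (c : C) : vcont (fun _ => c).
Proof. intros z. apply ccont_const. Qed.

Lemma polar_2PI (r : R) : polar r (2 * PI) = polar r 0.
Proof. unfold polar. now rewrite cos_2PI, sin_2PI, cos_0, sin_0. Qed.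

(** Differentiation under the integral sign: the radial derivative of [g] carries a factor
    [e^(i t)], which the weight [e^(- i t)] cancels. *)
Lemma is_derive_circle_integral (g g1 : C -> C) (w : C) (r s : R) :
  Rabs s < r -> (forall z, Cmod (z - w) < r -> cderiv g z (g1 z) /\ ccont g1 z) ->
  vderiv (fun u => CInt (fun t => g (w + polar u t) * Cconj (polar 1 t))%C 0 (2 * PI)) s
    (CInt (fun t => g1 (w + polar s t)%C) 0 (2 * PI)).
Proof.
  intros Hs H.
  assert (Hr : 0 < r - Rabs s) by lra.
  assert (Hin : forall u t, Rabs (u - s) < r - Rabs s -> Cmod (w + polar u t - w) < r).
  { intros u t Hu. replace (w + polar u t - w)%C with (polar u t) by ring. rewrite Cmod_polar.
    assert (T := Rabs_triang (u - s) s). replace (u - s + s) with u in T by ring. lra. }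
  assert (Hself : Rabs (s - s) < r - Rabs s).
  { replace (s - s) with 0 by ring. now rewrite Rabs_R0. }
  assert (HD : forall u t, Rabs (u - s) < r - Rabs s ->
    vderiv (fun u => g (w + polar u t) * Cconj (polar 1 t))%C u (g1 (w + polar u t)%C)).
  { intros u t Hu.
    replace (g1 (w + polar u t)%C) with (Cconj (polar 1 t) * (g1 (w + polar u t)%C * polar 1 t))%C.
    - apply (is_derive_ext (K := R_AbsRing) (V := C_R_NormedModule) (fun u => Cconj (polar 1 t) * g (w + polar u t))%C).
      { intros; apply Cmult_comm. }
      apply vderiv_scal_C. apply cderiv_shift_polar. apply H. now apply Hin.
    - rewrite <- (Cmult_1_l (g1 (w + polar u t)%C)) at 2. rewrite <- (cis_mult_conj t). ring. }
  assert (Hvc : forall u, Rabs (u - s) < r - Rabs s -> vcont (fun t => g (w + polar u t) * Cconj (polar 1 t))%C).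
  { intros u Hu. apply vcont_mult; [| apply vcont_cis_conj].
    apply (vcont_comp g (fun t => w + polar u t)%C); [apply vcont_shift_polar |].
    intros t. eapply cderiv_ccont. apply H. now apply Hin. }
  assert (Hcc : forall t, ccont (fun y : C => g1 (w + polar (fst y) (snd y))%C) (s, t)).
  { intros t. apply (ccont_comp (fun y : C => (w + polar (fst y) (snd y))%C) g1); [apply ccont_shift_polar |].
    simpl. apply H. now apply Hin. }
  apply vderiv_re_im. split.
  - assert (D := is_derive_RInt_param (fun u t => Re (g (w + polar u t) * Cconj (polar 1 t))%C) 0 (2 * PI) s).
    evar_last.
    + apply D.
      * exists (mkposreal _ Hr). intros u Hu t _. eexists. apply (proj1 (proj1 (vderiv_re_im _ _ _) (HD u t Hu))).
      * intros t _.
        apply (continuity_2d_pt_ext_loc (fun u t => Re (g1 (w + polar u t)%C))).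
        { exists (mkposreal _ Hr). intros u v Hu Hv. symmetry. apply is_derive_unique.
          apply (proj1 (proj1 (vderiv_re_im _ _ _) (HD u v Hu))). }
        apply (ccont_2d_re (fun y : C => g1 (w + polar (fst y) (snd y))%C)). apply Hcc.
      * exists (mkposreal _ Hr). intros u Hu. apply (vcont_ex_RInt _ _ _ (Hvc u Hu)).
    + simpl. apply RInt_ext. intros t _. apply is_derive_unique.
      apply (proj1 (proj1 (vderiv_re_im _ _ _) (HD s t Hself))).
  - assert (D := is_derive_RInt_param (fun u t => Im (g (w + polar u t) * Cconj (polar 1 t))%C) 0 (2 * PI) s).
    evar_last.
    + apply D.
      * exists (mkposreal _ Hr). intros u Hu t _. eexists. apply (proj2 (proj1 (vderiv_re_im _ _ _) (HD u t Hu))).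
      * intros t _.
        apply (continuity_2d_pt_ext_loc (fun u t => Im (g1 (w + polar u t)%C))).
        { exists (mkposreal _ Hr). intros u v Hu Hv. symmetry. apply is_derive_unique.
          apply (proj2 (proj1 (vderiv_re_im _ _ _) (HD u v Hu))). }
        apply (ccont_2d_im (fun y : C => g1 (w + polar (fst y) (snd y))%C)). apply Hcc.
      * exists (mkposreal _ Hr). intros u Hu. apply (vcont_ex_RInt _ _ _ (Hvc u Hu)).
    + simpl. apply RInt_ext. intros t _. apply is_derive_unique.
      apply (proj2 (proj1 (vderiv_re_im _ _ _) (HD s t Hself))).
Qed.

(** The angular derivative of [g(w + s e^(i t)) e^(- i t)] is [i] times the difference of the two
    integrands, and its integral over a full period vanishes. *)
Lemma circle_integral_by_parts (g g1 : C -> C) (w : C) (r s : R) :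
  Rabs s < r -> (forall z, Cmod (z - w) < r -> cderiv g z (g1 z) /\ ccont g1 z) ->
  (RtoC s * CInt (fun t => g1 (w + polar s t)%C) 0 (2 * PI))%C =
  CInt (fun t => g (w + polar s t) * Cconj (polar 1 t))%C 0 (2 * PI).
Proof.
  intros Hs H.
  assert (Hin : forall t, Cmod (w + polar s t - w) < r).
  { intros t. replace (w + polar s t - w)%C with (polar s t) by ring. now rewrite Cmod_polar. }
  assert (Hg1 : vcont (fun t => g1 (w + polar s t)%C)).
  { apply (vcont_comp g1 (fun t => w + polar s t)%C); [apply vcont_shift_polar |]. intros t. apply H, Hin. }
  assert (Hg : vcont (fun t => g (w + polar s t)%C)).
  { apply (vcont_comp g (fun t => w + polar s t)%C); [apply vcont_shift_polar |].
    intros t. eapply cderiv_ccont. apply H, Hin. }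
  assert (Hgc : vcont (fun t => g (w + polar s t)%C * Cconj (polar 1 t))%C).
  { apply vcont_mult; [exact Hg | apply vcont_cis_conj]. }
  rewrite <- CInt_scal by exact Hg1.
  assert (E : CInt (fun t => Ci * (RtoC s * g1 (w + polar s t)) - Ci * (g (w + polar s t) * Cconj (polar 1 t)))%C 0 (2 * PI) = 0%C).
  { rewrite (CInt_derive (fun t => g (w + polar s t) * Cconj (polar 1 t))%C).
    - rewrite !polar_2PI. ring.
    - intros t.
      replace (Ci * (RtoC s * g1 (w + polar s t)) - Ci * (g (w + polar s t) * Cconj (polar 1 t)))%C
        with ((g1 (w + polar s t) * (Ci * polar s t)) * Cconj (polar 1 t)
              + g (w + polar s t) * (- Ci * Cconj (polar 1 t)))%C.
      + apply vderiv_mult; [| apply vderiv_cis_conj].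
        apply (vderiv_comp g (fun t => w + polar s t)%C); [| apply H, Hin].
        apply vderiv_shift, vderiv_polar.
      + rewrite (polar_cis s t) at 2.
        replace (g1 (w + polar s t) * (Ci * (s * polar 1 t)) * Cconj (polar 1 t))%C
          with (Ci * (s * g1 (w + polar s t)) * (polar 1 t * Cconj (polar 1 t)))%C by ring.
        rewrite cis_mult_conj. ring.
    - intros z. apply ccont_plus.
      + apply ccont_mult; [apply ccont_const |]. apply ccont_mult; [apply ccont_const | apply Hg1].
      + apply (ccont_ext_loc (fun y : C => - Ci * (g (w + polar s (fst y)) * Cconj (polar 1 (fst y))))%C _ z 1); [lra | intros; ring |].
        apply ccont_mult; [apply ccont_const | apply Hgc]. }
  rewrite CInt_minus, !(CInt_scal Ci) in E.
  - assert (E' : (CInt (fun t => s * g1 (w + polar s t))%C 0 (2 * PI)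
        - CInt (fun t => g (w + polar s t) * Cconj (polar 1 t))%C 0 (2 * PI))%C = 0%C).
    { match type of E with (_ * ?a - _ * ?b)%C = _ =>
        replace (a - b)%C with (- Ci * (Ci * a - Ci * b))%C by (apply C_ext; simpl; ring) end.
      rewrite E. ring. }
    match type of E' with (?a - ?b)%C = _ => replace a with (a - b + b)%C by ring end.
    rewrite E'. ring.
  - exact Hgc.
  - intros z. apply ccont_mult; [apply ccont_const | apply Hg1].
  - intros z. apply ccont_mult; [apply ccont_const |]. apply ccont_mult; [apply ccont_const | apply Hg1].
  - intros z. apply ccont_mult; [apply ccont_const | apply Hgc].
Qed.

(* With [N s] the right-hand side at radius [s], integration by parts gives [s N' = N],
   so [N s / s] is constant and equals its limit [2 PI g1 w]. *)
Lemma cauchy_derivative (g g1 : C -> C) (w : C) (r rho : R) :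
  0 < rho < r -> (forall z, Cmod (z - w) < r -> cderiv g z (g1 z) /\ ccont g1 z) ->
  (RtoC (2 * PI * rho) * g1 w)%C =
  CInt (fun t => g (w + polar rho t) * Cconj (polar 1 t))%C 0 (2 * PI).
Proof.
  intros Hrho H.
  set (N := fun s => CInt (fun t => g (w + polar s t) * Cconj (polar 1 t))%C 0 (2 * PI)).
  set (N1 := fun s => CInt (fun t => g1 (w + polar s t)%C) 0 (2 * PI)).
  assert (HN : forall s, 0 < s < r -> vderiv N s (N1 s)).
  { intros s Hs. apply (is_derive_circle_integral g g1 w r s); [rewrite Rabs_pos_eq; lra | exact H]. }
  assert (HN1 : forall s, 0 < s < r -> (RtoC s * N1 s)%C = N s).
  { intros s Hs. apply (circle_integral_by_parts g g1 w r s); [rewrite Rabs_pos_eq; lra | exact H]. }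
  assert (Hnz : forall s : R, 0 < s -> RtoC s <> 0%C).
  { intros s Hs E. apply RtoC_inj in E. lra. }
  assert (Hconst : forall s, 0 < s <= rho -> N1 s = N1 rho).
  { intros s Hs.
    assert (Hq : Cmod (RtoC (/ rho) * N rho - RtoC (/ s) * N s) <= 0 * (rho - s)).
    { apply (mean_value_curve (fun u => RtoC (/ u) * N u)%C (fun u => RtoC (- / (u * u)) * N u + RtoC (/ u) * N1 u)%C); [lra |].
      intros u Hu. split.
      - apply (vderiv_mult (fun u => RtoC (/ u)) N u (RtoC (- / (u * u))) (N1 u)); [| apply HN; lra].
        apply vderiv_re_im. simpl. split.
        + auto_derive; [lra | field; lra].
        + apply (is_derive_const (K := R_AbsRing) (V := R_NormedModule)).
      - rewrite <- HN1 by lra.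
        replace (RtoC (- / (u * u)) * (u * N1 u) + RtoC (/ u) * N1 u)%C with (RtoC 0).
        + rewrite Cmod_0. lra.
        + rewrite RtoC_opp, !RtoC_inv, RtoC_mult by nra. field. apply Hnz; lra. }
    rewrite Rmult_0_l in Hq.
    assert (E : (RtoC (/ rho) * N rho - RtoC (/ s) * N s)%C = 0%C).
    { apply Cmod_eq_0, Rle_antisym; [exact Hq | apply Cmod_ge_0]. }
    rewrite <- !HN1, !RtoC_inv in E by lra.
    replace (N1 s) with (N1 rho - (/ rho * (rho * N1 rho) - / s * (s * N1 s)))%C.
    - rewrite E. ring.
    - field. split; apply Hnz; lra. }
  change ((RtoC (2 * PI * rho) * g1 w)%C = N rho).
  rewrite <- HN1 by lra.
  replace (RtoC (2 * PI * rho) * g1 w)%C with (RtoC rho * (RtoC (2 * PI) * g1 w))%C by (rewrite (RtoC_mult (2 * PI)); ring).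
  f_equal.
  assert (Hpi := PI_RGT_0).
  assert (Hlim : Cmod (RtoC (2 * PI) * g1 w - N1 rho) <= 0).
  { apply le_epsilon. intros e He.
    assert (Hw : ccont g1 w).
    { apply (H w). rewrite Cmod_minus_self. lra. }
    destruct (Hw (e / (4 * PI))) as [d [Hd Hd']]; [apply Rdiv_lt_0_compat; lra |].
    set (s := Rmin rho (d / 2)).
    assert (Hs0 : 0 < s) by (apply Rmin_pos; lra).
    assert (Hs1 : s <= rho) by apply Rmin_l.
    assert (Hs2 : s <= d / 2) by apply Rmin_r.
    rewrite <- (Hconst s) by lra.
    replace (RtoC (2 * PI) * g1 w)%C with (CInt (fun _ => g1 w) 0 (2 * PI)).
    2: { rewrite CInt_const. now rewrite Rminus_0_r. }
    assert (Hin : forall t, Cmod (w + polar s t - w) = s).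
    { intros t. replace (w + polar s t - w)%C with (polar s t) by ring. rewrite Cmod_polar.
      apply Rabs_pos_eq; lra. }
    assert (Hv : vcont (fun t => g1 (w + polar s t)%C)).
    { apply (vcont_comp g1 (fun t => w + polar s t)%C); [apply vcont_shift_polar |].
      intros t. apply H. rewrite Hin. lra. }
    unfold N1. rewrite <- CInt_minus; [| apply vcont_const | exact Hv].
    rewrite Rplus_0_l.
    replace e with (2 * (e / (4 * PI) * (2 * PI - 0))) by (field; lra).
    apply CInt_bound; [lra | |].
    - intros z. apply (ccont_ext_loc (fun y : C => g1 w + (-1) * g1 (w + polar s (fst y)))%C _ z 1); [lra | intros; ring |].
      apply ccont_plus; [apply ccont_const |]. apply ccont_mult; [apply ccont_const | apply Hv].
    - intros t _. rewrite Cmod_minus_sym. apply Rlt_le, Hd'. rewrite Hin. lra. }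
  replace (RtoC (2 * PI) * g1 w)%C with ((RtoC (2 * PI) * g1 w - N1 rho) + N1 rho)%C by ring.
  assert (E : (RtoC (2 * PI) * g1 w - N1 rho)%C = 0%C).
  { apply Cmod_eq_0, Rle_antisym; [exact Hlim | apply Cmod_ge_0]. }
  rewrite E. ring.
Qed.

Lemma vcont_circle (g : C -> C) (w : C) (s r : R) :
  0 <= s < r -> (forall z, Cmod (z - w) < r -> ccont g z) ->
  vcont (fun t => g (w + polar s t) * Cconj (polar 1 t))%C.
Proof.
  intros Hs H. apply vcont_mult; [| apply vcont_cis_conj].
  apply (vcont_comp g (fun t => w + polar s t)%C); [apply vcont_shift_polar |].
  intros t. apply H. replace (w + polar s t - w)%C with (polar s t) by ring.
  rewrite Cmod_polar, Rabs_pos_eq; lra.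
Qed.

Lemma vcont_minus (x y : R -> C) : vcont x -> vcont y -> vcont (fun t => x t - y t)%C.
Proof.
  intros Hx Hy z. apply (ccont_ext_loc (fun u : C => x (fst u) + (-1) * y (fst u))%C _ z 1); [lra | intros; ring |].
  apply ccont_plus; [apply Hx |]. apply ccont_mult; [apply ccont_const | apply Hy].
Qed.

(** How the circle formula is used: a quantity that it represents inherits the bound of the
    integrand, divided by the radius. *)
Lemma CInt_div_bound (y : R -> C) (c : C) (rho K : R) :
  0 < rho -> vcont y -> (forall t, Cmod (y t) <= K) ->
  (RtoC (2 * PI * rho) * c)%C = CInt y 0 (2 * PI) -> Cmod c <= 2 * K / rho.
Proof.
  intros Hrho Hy Hb E. assert (Hpi := PI_RGT_0).
  assert (B := CInt_bound y 0 (2 * PI) K).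
  rewrite <- E, Cmod_mult, Cmod_R, Rabs_pos_eq in B.
  2: { apply Rmult_le_pos; lra. }
  assert (B' : 2 * PI * rho * Cmod c <= 2 * (K * (2 * PI - 0))) by (apply B; [lra | assumption | auto]).
  apply (Rmult_le_reg_l (2 * PI * rho)). { apply Rmult_lt_0_compat; lra. }
  eapply Rle_trans; [exact B' |]. right. field. lra.
Qed.

(** The circle formula expresses [g1] through [g], so [g1] inherits a Lipschitz bound from [g]. The
    same formula applied to [g1] defines [g2], and the Lipschitz bound of [g1] makes the first order
    remainder quadratic and [g2] Lipschitz. *)
Lemma derivative_C1 (g g1 : C -> C) (w0 : C) (r : R) :
  0 < r -> (forall z, Cmod (z - w0) < r -> cderiv g z (g1 z) /\ ccont g1 z) ->
  exists (r' : R) (g2 : C -> C), 0 < r' /\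
    forall z, Cmod (z - w0) < r' -> cderiv g1 z (g2 z) /\ ccont g2 z.
Proof.
  intros Hr H.
  assert (Hw0 : ccont g1 w0). { apply (H w0). now rewrite Cmod_minus_self. }
  destruct (ccont_bounded g1 w0 Hw0) as [d [Hd Hb]].
  set (M := Cmod (g1 w0) + 1) in *.
  assert (HM : 0 < M) by (unfold M; assert (T := Cmod_ge_0 (g1 w0)); lra).
  set (R := Rmin d r).
  assert (HR : 0 < R) by (apply Rmin_pos; assumption).
  assert (HRd : R <= d) by apply Rmin_l. assert (HRr : R <= r) by apply Rmin_r.
  assert (Hlip : forall z1 z2, Cmod (z1 - w0) < R -> Cmod (z2 - w0) < R ->
    Cmod (g z2 - g z1) <= M * Cmod (z2 - z1)).
  { intros z1 z2 H1 H2. replace (g z2 - g z1)%C with (g z2 - g z1 - 0 * (z2 - z1))%C by ring.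
    apply (mean_value_ball g g1 w0 0 R); try assumption.
    intros z Hz. split; [apply H; lra |].
    replace (g1 z - 0)%C with (g1 z) by ring. apply Hb; lra. }
  assert (Hin : forall w q s t, Cmod (w - w0) < q -> 0 <= s -> Cmod (w + polar s t - w0) < q + s).
  { intros w q s t Hw Hs. eapply Rle_lt_trans; [apply (Cmod_minus_triangle _ w) |].
    replace (w + polar s t - w)%C with (polar s t) by ring. rewrite Cmod_polar, Rabs_pos_eq; lra. }
  assert (Hsub : forall w q, Cmod (w - w0) < R - q -> forall z, Cmod (z - w) < q -> Cmod (z - w0) < R).
  { intros w q Hw z Hz. eapply Rle_lt_trans; [apply (Cmod_minus_triangle _ w) |]. lra. }
  assert (HC : forall w s, Cmod (w - w0) < R / 2 -> 0 < s < R / 2 ->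
    (RtoC (2 * PI * s) * g1 w)%C = CInt (fun t => g (w + polar s t) * Cconj (polar 1 t))%C 0 (2 * PI)).
  { intros w s Hw Hs. apply (cauchy_derivative g g1 w (R / 2) s Hs).
    intros z Hz. apply H. eapply Rlt_le_trans; [| exact HRr]. apply (Hsub w (R / 2)); lra. }
  assert (Hgc : forall w s, Cmod (w - w0) < R / 2 -> 0 < s < R / 2 ->
    vcont (fun t => g (w + polar s t) * Cconj (polar 1 t))%C).
  { intros w s Hw Hs. apply (vcont_circle g w s (R / 2)); [lra |].
    intros z Hz. eapply cderiv_ccont. apply H. eapply Rlt_le_trans; [| exact HRr]. apply (Hsub w (R / 2)); lra. }
  assert (Hg1c : forall w s, Cmod (w - w0) < R / 2 -> 0 < s < R / 2 ->
    vcont (fun t => g1 (w + polar s t) * Cconj (polar 1 t))%C).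
  { intros w s Hw Hs. apply (vcont_circle g1 w s (R / 2)); [lra |].
    intros z Hz. apply H. eapply Rlt_le_trans; [| exact HRr]. apply (Hsub w (R / 2)); lra. }
  set (L := 2 * M / (R / 4)).
  assert (HL : 0 < L) by (unfold L; apply Rdiv_lt_0_compat; lra).
  assert (Hlip1 : forall z1 z2, Cmod (z1 - w0) < R / 2 -> Cmod (z2 - w0) < R / 2 ->
    Cmod (g1 z2 - g1 z1) <= L * Cmod (z2 - z1)).
  { intros z1 z2 H1 H2.
    replace (L * Cmod (z2 - z1)) with (2 * (M * Cmod (z2 - z1)) / (R / 4)) by (unfold L; field; lra).
    apply (CInt_div_bound (fun t => g (z2 + polar (R / 4) t) * Cconj (polar 1 t) - g (z1 + polar (R / 4) t) * Cconj (polar 1 t))%C).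
    - lra.
    - apply (vcont_minus (fun t => g (z2 + polar (R / 4) t) * Cconj (polar 1 t))%C); apply Hgc; lra.
    - intros t.
      replace (g (z2 + polar (R / 4) t) * Cconj (polar 1 t) - g (z1 + polar (R / 4) t) * Cconj (polar 1 t))%C
        with ((g (z2 + polar (R / 4) t) - g (z1 + polar (R / 4) t)) * Cconj (polar 1 t))%C by ring.
      rewrite Cmod_mult, Cmod_conj, Cmod_cis, Rmult_1_r.
      replace (z2 - z1)%C with (z2 + polar (R / 4) t - (z1 + polar (R / 4) t))%C by ring.
      apply Hlip.
      + apply Rlt_trans with (R / 2 + R / 4); [apply Hin |]; lra.
      + apply Rlt_trans with (R / 2 + R / 4); [apply Hin |]; lra.
    - rewrite CInt_minus by (apply Hgc; lra). rewrite <- !HC by lra. ring. }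
  (* Circles of radius [R / 8] about points within [R / 4] of [w0] stay in the ball of radius
     [R / 2], where [g1] is Lipschitz. *)
  set (rho := R / 8).
  assert (Hpi := PI_RGT_0).
  assert (Hnz : RtoC (2 * PI * rho) <> 0%C).
  { intros E. apply RtoC_inj in E. assert (0 < 2 * PI * rho); [| lra].
    apply Rmult_lt_0_compat; unfold rho; lra. }
  set (g2 := fun w => (CInt (fun t => g1 (w + polar rho t) * Cconj (polar 1 t)) 0 (2 * PI) / RtoC (2 * PI * rho))%C).
  assert (Hg2 : forall w, (RtoC (2 * PI * rho) * g2 w)%C = CInt (fun t => g1 (w + polar rho t) * Cconj (polar 1 t))%C 0 (2 * PI)).
  { intros w. unfold g2. field. exact Hnz. }
  exists (R / 8), g2. split; [lra |]. intros w Hw. split.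
  - apply cderiv_iff. intros e He.
    exists (Rmin (R / 8) (e * rho / (4 * L))). split.
    { apply Rmin_pos; [lra |]. apply Rdiv_lt_0_compat; [apply Rmult_lt_0_compat; unfold rho |]; lra. }
    intros y Hy.
    below_min Hy as Hy1 Hy2.
    destruct (Req_dec (Cmod (y - w)) 0) as [Hz | Hz].
    { apply Cmod_eq_0 in Hz. rewrite Hz, Cmod_0.
      replace y with w. 2: { replace y with (y - w + w)%C by ring. rewrite Hz. ring. }
      replace (g1 w - g1 w - g2 w * 0)%C with (RtoC 0) by ring. rewrite Cmod_0. lra. }
    assert (Hk : 0 < Cmod (y - w)) by (assert (T := Cmod_ge_0 (y - w)); lra).
    assert (Hyw : Cmod (y - w0) < R / 4).
    { eapply Rle_lt_trans; [apply (Cmod_minus_triangle _ w) |]. lra. }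
    (* The remainder of [g1] is the circle integral of the remainder of [g]. On the ball of radius
       [2 * Cmod (y - w)] about a point of the circle, [g1] oscillates by at most [L] times that
       radius. *)
    apply Rle_trans with (2 * (L * (2 * Cmod (y - w)) * Cmod (y - w)) / rho).
    + apply (CInt_div_bound (fun t => g (y + polar rho t) * Cconj (polar 1 t) - g (w + polar rho t) * Cconj (polar 1 t)
        - (y - w) * (g1 (w + polar rho t) * Cconj (polar 1 t)))%C).
      * unfold rho; lra.
      * apply (vcont_minus (fun t => g (y + polar rho t) * Cconj (polar 1 t) - g (w + polar rho t) * Cconj (polar 1 t))%C).
        -- apply (vcont_minus (fun t => g (y + polar rho t) * Cconj (polar 1 t))%C); apply Hgc; unfold rho; lra.
        -- apply vcont_mult; [apply vcont_const | apply Hg1c; unfold rho; lra].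
      * intros t. set (x := (w + polar rho t)%C).
        assert (Hx : Cmod (x - w0) < R / 4).
        { replace (R / 4) with (R / 8 + R / 8) by field. apply Hin; unfold rho; lra. }
        replace (y + polar rho t)%C with (x + (y - w))%C by (unfold x; ring).
        replace (g (x + (y - w)) * Cconj (polar 1 t) - g x * Cconj (polar 1 t) - (y - w) * (g1 x * Cconj (polar 1 t)))%C
          with ((g (x + (y - w)) - g x - g1 x * ((x + (y - w)) - x)) * Cconj (polar 1 t))%C by ring.
        rewrite Cmod_mult, Cmod_conj, Cmod_cis, Rmult_1_r.
        replace (Cmod (y - w)) with (Cmod (x + (y - w) - x)) at 2 by (f_equal; ring).
        apply (mean_value_ball g g1 x (g1 x) (2 * Cmod (y - w))).
        -- intros z Hz'.
           assert (Hzw : Cmod (z - w0) < R / 2).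
           { eapply Rle_lt_trans; [apply (Cmod_minus_triangle _ x) |]. lra. }
           split; [apply H; lra |].
           eapply Rle_trans; [apply Hlip1; lra |]. apply Rmult_le_compat_l; lra.
        -- rewrite Cmod_minus_self. lra.
        -- replace (x + (y - w) - x)%C with (y - w)%C by ring. lra.
      * rewrite CInt_minus, CInt_minus, CInt_scal.
        -- rewrite <- Hg2, <- !HC by (unfold rho; lra). ring.
        -- apply Hg1c; unfold rho; lra.
        -- apply Hgc; unfold rho; lra.
        -- apply Hgc; unfold rho; lra.
        -- apply (vcont_minus (fun t => g (y + polar rho t) * Cconj (polar 1 t))%C); apply Hgc; unfold rho; lra.
        -- apply vcont_mult; [apply vcont_const | apply Hg1c; unfold rho; lra].
    + assert (Hr0 : 0 < rho) by (unfold rho; lra).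
      apply (Rmult_lt_compat_r (4 * L / rho)) in Hy2; [| apply Rdiv_lt_0_compat; lra].
      replace (e * rho / (4 * L) * (4 * L / rho)) with e in Hy2 by (field; lra).
      replace (2 * (L * (2 * Cmod (y - w)) * Cmod (y - w)) / rho) with ((Cmod (y - w) * (4 * L / rho)) * Cmod (y - w)) by (field; lra).
      apply Rmult_le_compat_r; lra.
  - intros e He.
    assert (Hr0 : 0 < rho) by (unfold rho; lra).
    exists (Rmin (R / 8) (e * rho / (2 * L))). split.
    { apply Rmin_pos; [lra |]. apply Rdiv_lt_0_compat; [apply Rmult_lt_0_compat |]; lra. }
    intros y Hy.
    below_min Hy as Hy1 Hy2.
    assert (Hyw : Cmod (y - w0) < R / 4).
    { eapply Rle_lt_trans; [apply (Cmod_minus_triangle _ w) |]. lra. }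
    apply Rle_lt_trans with (2 * (L * Cmod (y - w)) / rho).
    + apply (CInt_div_bound (fun t => g1 (y + polar rho t) * Cconj (polar 1 t) - g1 (w + polar rho t) * Cconj (polar 1 t))%C).
      * lra.
      * apply (vcont_minus (fun t => g1 (y + polar rho t) * Cconj (polar 1 t))%C); apply Hg1c; unfold rho; lra.
      * intros t.
        replace (g1 (y + polar rho t) * Cconj (polar 1 t) - g1 (w + polar rho t) * Cconj (polar 1 t))%C
          with ((g1 (y + polar rho t) - g1 (w + polar rho t)) * Cconj (polar 1 t))%C by ring.
        rewrite Cmod_mult, Cmod_conj, Cmod_cis, Rmult_1_r.
        replace (y - w)%C with (y + polar rho t - (w + polar rho t))%C by ring.
        apply Hlip1.
        -- apply Rlt_le_trans with (R / 8 + rho); [apply Hin; lra | unfold rho; lra].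
        -- apply Rlt_le_trans with (R / 4 + rho); [apply Hin; lra | unfold rho; lra].
      * rewrite CInt_minus by (apply Hg1c; unfold rho; lra). rewrite <- !Hg2. ring.
    + apply (Rmult_lt_compat_r (2 * L / rho)) in Hy2; [| apply Rdiv_lt_0_compat; lra].
      replace (e * rho / (2 * L) * (2 * L / rho)) with e in Hy2 by (field; lra).
      replace (2 * (L * Cmod (y - w)) / rho) with (Cmod (y - w) * (2 * L / rho)) by (field; lra).
      exact Hy2.
Qed.

Set Implicit Arguments.
Unset Strict Implicit.

(** * The linearizing change and its inverse *)

(** Connectedness of the interval, by the supremum of the points where [G] holds. One step leads
    from any point just left of [u] to any point just right of it, so it covers both the passage to
    the limit at [u] and the continuation beyond it. *)
Lemma real_induction (G : R -> Prop) (s t : R) :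
  s <= t ->
  (forall u, s <= u <= t -> exists d, 0 < d /\ forall a b,
    s <= a <= u -> u <= b <= t -> u - a < d -> b - u < d -> G a -> G b) ->
  G s -> G t.
Proof.
  intros Hst H Hs.
  set (E := fun u => s <= u <= t /\ G u).
  destruct (completeness E) as [c [Hub Hlub]].
  - exists t. intros u [Hu _]. lra.
  - exists s. split; [lra | assumption].
  - assert (Hsc : s <= c) by (apply Hub; split; [lra | assumption]).
    assert (Hct : c <= t) by (apply Hlub; intros u [Hu _]; lra).
    destruct (H c (conj Hsc Hct)) as [d [Hd Hstep]].
    assert (Ha : exists a, E a /\ c - d < a).
    { apply NNPP. intros Hn. assert (Hc' : c <= c - d); [| lra].
      apply Hlub. intros u Hu. apply Rnot_lt_le. intros Hlt. apply Hn. now exists u. }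
    destruct Ha as [a [[Ha HGa] Hca]].
    assert (Hac : a <= c) by (apply Hub; split; assumption).
    destruct (Rle_lt_dec t c) as [Htc | Htc].
    + apply (Hstep a t); try assumption; lra.
    + exfalso. set (b := Rmin t (c + d / 2)).
      assert (Hb1 : b <= t) by apply Rmin_l. assert (Hb2 : b <= c + d / 2) by apply Rmin_r.
      assert (Hb3 : c < b) by (apply Rmin_glb_lt; lra).
      assert (Hb : E b).
      { split; [lra |]. apply (Hstep a b); try assumption; lra. }
      assert (Hcontra := Hub b Hb). lra.
Qed.

(** [lc_sigma] constrains real points only; [lc_orient] decides which half disc [psi] sends to the
    upper half plane. *)
Record linearized_center (D U : C -> Prop) (f phi psi : C -> C) (p : C) (rs : R) : Prop := {
  lc_hol : holomorphic_on D f;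
  lc_lin : linearizing_change D f p U phi;
  lc_sigma : forall z, U z -> Im z = 0 -> Im (phi z) = 0;
  lc_p : Im p = 0;
  lc_orient : 0 < Re (C_derive phi p);
  lc_rs : 0 < rs;
  lc_psi : forall w, Cmod w < rs -> U (psi w) /\ phi (psi w) = w }.

Section Linearization.

Variables (D U : C -> Prop) (f phi psi : C -> C) (p : C) (rs : R).
Hypothesis S : linearized_center D U f phi psi p rs.

Notation dphi := (C_derive phi).
Notation dpsi := (C_derive psi).

Lemma U_ball (z : C) : U z -> exists d, 0 < d /\ forall y, Cmod (y - z) < d -> U y.
Proof. apply open_Cmod. apply (lc_lin S). Qed.

Lemma U_D (z : C) : U z -> D z.
Proof. apply (lc_lin S). Qed.

Lemma f_cderiv (z : C) : D z -> cderiv f z (C_derive f z).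
Proof. intros Hz. apply C_derive_correct; [exact z |]. now apply (lc_hol S). Qed.

Lemma phi_cderiv (z : C) : U z -> cderiv phi z (dphi z).
Proof. intros Hz. apply C_derive_correct; [exact z |]. now apply (lc_lin S). Qed.

Lemma phi_inj (z1 z2 : C) : U z1 -> U z2 -> phi z1 = phi z2 -> z1 = z2.
Proof. apply (lc_lin S). Qed.

Lemma dphi_neq_0 (z : C) : U z -> dphi z <> 0%C.
Proof. apply (lc_lin S). Qed.

Lemma U_p : U p. Proof. apply (lc_lin S). Qed.
Lemma phi_p : phi p = 0%C. Proof. apply (lc_lin S). Qed.

Lemma phi_eq (z : C) : U z -> (dphi z * f z = - Ci * phi z)%C.
Proof. apply (lc_lin S). Qed.

Lemma phi_neq_0 (z : C) : U z -> z <> p -> phi z <> 0%C.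
Proof. intros Hz Hp E. apply Hp. apply phi_inj; [assumption | apply U_p |]. now rewrite phi_p. Qed.

Lemma f_neq_0 (z : C) : U z -> z <> p -> f z <> 0%C.
Proof.
  intros Hz Hp E. apply (phi_neq_0 Hz Hp). assert (H := phi_eq Hz). rewrite E in H.
  replace (phi z) with (Ci * (- Ci * phi z))%C by (apply C_ext; simpl; unfold Re, Im; ring).
  rewrite <- H. ring.
Qed.

(* No continuity of [dphi] is assumed; away from [p] it comes from [dphi = - Ci phi / f]. *)
Lemma dphi_ccont (z : C) : U z -> z <> p -> ccont dphi z.
Proof.
  intros Hz Hp. destruct (U_ball Hz) as [d [Hd HU]].
  assert (Hzp : 0 < Cmod (z - p)).
  { apply Cmod_gt_0. intros E. apply Hp. replace z with (z - p + p)%C by ring. rewrite E. ring. }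
  apply (ccont_ext_loc (fun y => - Ci * phi y * / f y)%C _ z (Rmin d (Cmod (z - p)))).
  - now apply Rmin_pos.
  - intros y Hy. 
    assert (Hy1 := HU y (Rlt_le_trans _ _ _ Hy (Rmin_l _ _))).
    assert (Hy2 := Rlt_le_trans _ _ _ Hy (Rmin_r _ _)).
    assert (Hyp : y <> p). { intros ->. rewrite Cmod_minus_sym in Hy2. lra. }
    rewrite <- phi_eq by assumption. field. now apply f_neq_0.
  - apply ccont_mult.
    + apply ccont_mult; [apply ccont_const |]. eapply cderiv_ccont, phi_cderiv, Hz.
    + apply ccont_inv; [| now apply f_neq_0]. eapply cderiv_ccont, f_cderiv, U_D, Hz.
Qed.

Definition pdisc (w : C) : Prop := 0 < Cmod w < rs.

Lemma psi_U (w : C) : pdisc w -> U (psi w).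
Proof. intros [_ H]. now apply (lc_psi S). Qed.

Lemma phi_psi (w : C) : pdisc w -> phi (psi w) = w.
Proof. intros [_ H]. now apply (lc_psi S). Qed.

Lemma psi_phi (z : C) : U z -> Cmod (phi z) < rs -> psi (phi z) = z.
Proof. intros Hz Hr. destruct (lc_psi S Hr) as [H1 H2]. now apply phi_inj. Qed.

Lemma pdisc_neq_0 (w : C) : pdisc w -> w <> 0%C.
Proof. intros [H _]. now apply Cmod_gt_0. Qed.

Lemma psi_neq_p (w : C) : pdisc w -> psi w <> p.
Proof.
  intros H E. apply (pdisc_neq_0 H). rewrite <- (phi_psi H), E. apply phi_p.
Qed.

Lemma pdisc_open (w : C) : pdisc w -> exists d, 0 < d /\ forall y, Cmod (y - w) < d -> pdisc y.
Proof.
  intros [H1 H2]. exists (Rmin (Cmod w) (rs - Cmod w)). split; [apply Rmin_pos; lra |].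
  intros y Hy.
  below_min Hy as Hy1 Hy2.
  assert (T1 := Cmod_triangle_rev y w). assert (T2 := Cmod_triangle_rev w y).
  rewrite (Cmod_minus_sym w y) in T2. unfold pdisc. lra.
Qed.

Lemma pdisc_polar (r t : R) : 0 < r < rs -> pdisc (polar r t).
Proof. intros H. unfold pdisc. rewrite Cmod_polar, Rabs_pos_eq; lra. Qed.

(** Local surjectivity of [phi] at [psi w] gives a preimage of [y] close to [psi w], and injectivity
    of [phi] identifies it with [psi y]. *)
Lemma psi_ccont (w : C) : pdisc w -> ccont psi w.
Proof.
  intros Hw e He. assert (HU := psi_U Hw).
  destruct (U_ball HU) as [d [Hd HUd]].
  destruct (local_surjectivity phi dphi (psi w) d) with (d := Rmin e d) as [d' [Hd' Hs]]; try assumption.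
  - intros z Hz. apply phi_cderiv. now apply HUd.
  - apply dphi_ccont; [assumption | now apply psi_neq_p].
  - now apply dphi_neq_0.
  - now apply Rmin_pos.
  - rewrite phi_psi in Hs by assumption.
    destruct (pdisc_open Hw) as [d2 [Hd2 Hp2]].
    exists (Rmin d' d2); split; [now apply Rmin_pos |].
    intros y Hy.
    assert (Hy1 := Rlt_le_trans _ _ _ Hy (Rmin_l _ _)).
    assert (Hy2 := Hp2 y (Rlt_le_trans _ _ _ Hy (Rmin_r _ _))).
    destruct (Hs y Hy1) as [z [Hz1 Hz2]].
    replace (psi y) with z.
    + eapply Rlt_le_trans; [exact Hz1 | apply Rmin_l].
    + rewrite <- Hz2. symmetry. apply psi_phi.
      * apply HUd. eapply Rlt_le_trans; [exact Hz1 | apply Rmin_r].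
      * rewrite Hz2. apply Hy2.
Qed.

Lemma psi_cderiv_inv (w : C) : pdisc w -> cderiv psi w (/ dphi (psi w))%C.
Proof.
  intros Hw. assert (HU := psi_U Hw).
  set (A := dphi (psi w)).
  assert (HA : A <> 0%C) by now apply dphi_neq_0.
  assert (Hm : 0 < Cmod A) by now apply Cmod_gt_0.
  apply cderiv_iff. intros e He.
  (* The bound [Cmod A / 2] makes [phi] expand distances from [psi w] by at least that factor, so an
     error relative to [k] becomes an error relative to [y - w]; the second bound makes the result
     at most [e]. *)
  set (e' := Rmin (Cmod A / 2) (e * Cmod A * Cmod A / 2)).
  assert (He' : 0 < e').
  { apply Rmin_pos; [lra |]. apply Rdiv_lt_0_compat; [| lra]. repeat apply Rmult_lt_0_compat; lra. }
  assert (He1 : e' <= Cmod A / 2) by apply Rmin_l.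
  assert (He2 : e' <= e * Cmod A * Cmod A / 2) by apply Rmin_r.
  destruct (proj1 (cderiv_iff _ _ _) (phi_cderiv HU) e' He') as [d [Hd Hphi]].
  destruct (psi_ccont Hw Hd) as [d1 [Hd1 Hc]].
  destruct (pdisc_open Hw) as [d2 [Hd2 Hp2]].
  exists (Rmin d1 d2); split; [now apply Rmin_pos |].
  intros y Hy.
  assert (Hy1 := Hc y (Rlt_le_trans _ _ _ Hy (Rmin_l _ _))).
  assert (Hy2 := Hp2 y (Rlt_le_trans _ _ _ Hy (Rmin_r _ _))).
  specialize (Hphi _ Hy1). rewrite !phi_psi in Hphi by assumption.
  set (k := (psi y - psi w)%C) in *. fold A in Hphi.
  assert (B : Cmod k <= 2 / Cmod A * Cmod (y - w)).
  { assert (T := Cmod_triangle_rev (A * k) (y - w)). rewrite Cmod_mult in T.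
    rewrite (Cmod_minus_sym (A * k)) in T.
    assert (Hk := Cmod_ge_0 k).
    assert (Cmod A / 2 * Cmod k <= Cmod (y - w)) by nra.
    apply (Rmult_le_reg_l (Cmod A / 2)); [lra |].
    replace (Cmod A / 2 * (2 / Cmod A * Cmod (y - w))) with (Cmod (y - w)) by (field; lra). assumption. }
  replace (k - / A * (y - w))%C with (- / A * (y - w - A * k))%C by (field; exact HA).
  rewrite Cmod_mult, Cmod_opp, Cmod_inv by exact HA.
  apply (Rmult_le_reg_l (Cmod A)); [lra |].
  rewrite <- Rmult_assoc, Rinv_r, Rmult_1_l by lra.
  eapply Rle_trans; [exact Hphi |].
  assert (Hk := Cmod_ge_0 k).
  apply Rle_trans with (e * Cmod A * Cmod A / 2 * (2 / Cmod A * Cmod (y - w))).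
  - apply Rmult_le_compat; lra.
  - right. field. lra.
Qed.

Lemma dpsi_eq (w : C) : pdisc w -> dpsi w = (/ dphi (psi w))%C.
Proof. intros Hw. apply is_C_derive_unique. now apply psi_cderiv_inv. Qed.

Lemma psi_cderiv (w : C) : pdisc w -> cderiv psi w (dpsi w).
Proof. intros Hw. rewrite dpsi_eq by assumption. now apply psi_cderiv_inv. Qed.

Lemma dpsi_neq_0 (w : C) : pdisc w -> dpsi w <> 0%C.
Proof.
  intros Hw E. rewrite dpsi_eq in E by assumption.
  assert (HA := dphi_neq_0 (psi_U Hw)).
  apply C1_nz. rewrite <- (Cinv_r (dphi (psi w))) by exact HA. rewrite E. ring.
Qed.

Lemma dphi_dpsi (w : C) : pdisc w -> dphi (psi w) = (/ dpsi w)%C.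
Proof.
  intros Hw. rewrite dpsi_eq by assumption. field. apply dphi_neq_0, psi_U, Hw.
Qed.

Lemma dpsi_ccont (w : C) : pdisc w -> ccont dpsi w.
Proof.
  intros Hw. destruct (pdisc_open Hw) as [d [Hd Hp]].
  apply (ccont_ext_loc (fun y => / dphi (psi y))%C _ w d Hd).
  { intros y Hy. symmetry. now apply dpsi_eq, Hp. }
  apply ccont_inv.
  - apply (ccont_comp psi dphi); [now apply psi_ccont |].
    apply dphi_ccont; [now apply psi_U | now apply psi_neq_p].
  - now apply dphi_neq_0, psi_U.
Qed.

Lemma d2psi (w : C) : pdisc w -> cderiv dpsi w (C_derive dpsi w) /\ ccont (C_derive dpsi) w.
Proof.
  intros Hw. destruct (pdisc_open Hw) as [d [Hd Hp]].
  destruct (derivative_C1 psi dpsi w d Hd) as [r' [g2 [Hr' Hg2]]].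
  { intros z Hz. split; [apply psi_cderiv | apply dpsi_ccont]; now apply Hp. }
  assert (Hww : Cmod (w - w) < r') by now rewrite Cmod_minus_self.
  split.
  - assert (E := proj1 (Hg2 w Hww)). now rewrite (is_C_derive_unique _ _ _ E).
  - apply (ccont_ext_loc g2 _ w r' Hr'); [| now apply Hg2].
    intros y Hy. symmetry. apply is_C_derive_unique. now apply Hg2.
Qed.

Lemma f_psi (w : C) : pdisc w -> f (psi w) = (dpsi w * (- Ci * w))%C.
Proof.
  intros Hw. assert (E := phi_eq (psi_U Hw)). rewrite phi_psi, dphi_dpsi in E by assumption.
  rewrite <- E. field. now apply dpsi_neq_0.
Qed.

End Linearization.

(** * Reality of [psi] on the real axis and the position of the two half discs *)

Lemma vcont_im_continuity (x : R -> C) : vcont x -> Ranalysis1.continuity (fun t => Im (x t)).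
Proof. intros H t. apply continuity_pt_filterlim. apply (vcont_re_im x H t). Qed.

Lemma derive_pos_increase (k : R -> R) (t l : R) :
  is_derive k t l -> 0 < l ->
  exists d, 0 < d /\ forall s, t - d < s < t + d -> (t < s -> k t < k s) /\ (s < t -> k s < k t).
Proof.
  intros H Hl.
  assert (H' := proj1 (is_derive_Reals k t l) H).
  destruct (H' (l / 2)) as [d Hd]; [lra |].
  exists d; split; [apply cond_pos |]. intros s Hs.
  assert (E : s <> t -> 0 < (k s - k t) / (s - t)).
  { intros Hn. specialize (Hd (s - t)). replace (t + (s - t)) with s in Hd by ring.
    assert (Rabs ((k s - k t) / (s - t) - l) < l / 2).
    { apply Hd; [lra |]. apply Rabs_def1; lra. }
    apply Rabs_def2 in H0. lra. }
  split; intros Hst.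
  - assert (E' := E ltac:(lra)). 
    assert (0 < (k s - k t) / (s - t) * (s - t)) by (apply Rmult_lt_0_compat; lra).
    replace ((k s - k t) / (s - t) * (s - t)) with (k s - k t) in H0 by (field; lra). lra.
  - assert (E' := E ltac:(lra)). 
    assert (0 < (k s - k t) / (s - t) * (t - s)) by (apply Rmult_lt_0_compat; lra).
    replace ((k s - k t) / (s - t) * (t - s)) with (k t - k s) in H0 by (field; lra). lra.
Qed.

Lemma im_mult_rot_opp (c : C) (r : R) : Im c = 0 -> Im (c * (- Ci * RtoC r)) = - (Re c * r).
Proof. destruct c as [x y]. simpl. intros ->. ring. Qed.

Lemma im_mult_rot (c : C) (r : R) : Im c = 0 -> Im (c * (Ci * RtoC r)) = Re c * r.
Proof. destruct c as [x y]. simpl. intros ->. ring. Qed.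

Section Real_axis.

Variables (D U : C -> Prop) (f phi psi : C -> C) (p : C) (rs : R).
Hypothesis S : linearized_center D U f phi psi p rs.

Notation dphi := (C_derive phi).
Notation dpsi := (C_derive psi).

Lemma pdisc_R (r : R) : 0 < r < rs -> pdisc rs (RtoC r).
Proof. intros H. unfold pdisc. rewrite Cmod_R, Rabs_pos_eq; lra. Qed.

Lemma vderiv_RtoC (t : R) : vderiv RtoC t (RtoC 1).
Proof.
  apply vderiv_re_im. split; simpl.
  - apply (is_derive_id (K := R_AbsRing)).
  - apply (is_derive_const (K := R_AbsRing) (V := R_NormedModule)).
Qed.

Lemma vderiv_psi_R (r : R) : 0 < r < rs -> vderiv (fun s => psi (RtoC s)) r (dpsi (RtoC r)).
Proof.
  intros Hr. replace (dpsi (RtoC r)) with (dpsi (RtoC r) * 1)%C by ring.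
  apply (vderiv_comp psi RtoC); [apply vderiv_RtoC |]. apply (psi_cderiv S). now apply pdisc_R.
Qed.

(** The radii with this property are shown to form a nonempty, open and closed subset of [(0, rs)].
    The derivative is part of the property because its reality is what makes the set open. *)
Definition real_pos (r : R) : Prop :=
  Im (psi (RtoC r)) = 0 /\ Im (dpsi (RtoC r)) = 0 /\ 0 < Re (dpsi (RtoC r)).

(** Along the real axis to the right of [p], [phi] is real and grows at least like [Re a / 2] times
    the distance, since its derivative [a] at [p] has positive real part. By the intermediate value
    theorem every small radius is attained at a real point, which injectivity identifies with
    [psi r]. *)
Lemma psi_R_small : exists c, 0 < c < rs /\ exists K, 0 < K /\ forall r, 0 < r < c ->
  Im (psi (RtoC r)) = 0 /\ Re p < Re (psi (RtoC r)) <= Re p + K * r.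
Proof.
  assert (Ha := lc_orient S). set (a := dphi p) in *.
  destruct (proj1 (cderiv_iff _ _ _) (phi_cderiv S (U_p S)) (Re a / 2)) as [d1 [Hd1 H1]]; [lra |].
  fold a in H1.
  destruct (U_ball S (U_p S)) as [d2 [Hd2 H2]].
  set (d := Rmin d1 d2 / 2).
  assert (Hd : 0 < d) by (unfold d; assert (0 < Rmin d1 d2) by (apply Rmin_pos; assumption); lra).
  assert (Hdd1 : d < d1) by (unfold d; assert (Rmin d1 d2 <= d1) by apply Rmin_l; unfold d in Hd; lra).
  assert (Hdd2 : d < d2) by (unfold d; assert (Rmin d1 d2 <= d2) by apply Rmin_r; unfold d in Hd; lra).
  assert (HxC : forall x, Cmod (p + RtoC x - p) = Rabs x).
  { intros x. replace (p + RtoC x - p)%C with (RtoC x) by ring. apply Cmod_R. }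
  assert (HU : forall x, Rabs x <= d -> U (p + RtoC x)%C).
  { intros x Hx. apply H2. rewrite HxC. lra. }
  set (F := fun x => Re (phi (p + RtoC x)%C)).
  assert (HF : forall x, 0 <= x <= d -> Re a / 2 * x <= F x).
  { intros x Hx. specialize (H1 (p + RtoC x)%C). rewrite HxC in H1. rewrite Rabs_pos_eq in H1 by lra.
    specialize (H1 ltac:(lra)). rewrite (phi_p S) in H1.
    replace (p + RtoC x - p)%C with (RtoC x) in H1 by ring.
    assert (E := Rle_trans _ _ _ (re_le_Cmod _) H1).
    apply Rabs_le_between in E. unfold F.
    replace (Re (phi (p + x)%C - 0 - a * x)) with (Re (phi (p + x)%C) - Re a * x) in E.
    - lra.
    - rewrite !Re_minus, Re_mult. simpl. ring. }
  assert (Hreal : forall x, Rabs x <= d -> phi (p + RtoC x)%C = RtoC (F x)).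
  { intros x Hx. apply C_ext; [reflexivity |]. simpl. apply (lc_sigma S); [now apply HU |].
    simpl. change (snd p) with (Im p). rewrite (lc_p S). ring. }
  assert (HF0 : F 0 = 0).
  { unfold F. replace (p + RtoC 0)%C with p by ring. now rewrite (phi_p S). }
  (* clamp, so as to apply the global intermediate value theorem *)
  set (cl := fun x => Rmax 0 (Rmin x d)).
  assert (Hcl : forall x, 0 <= cl x <= d).
  { intros x. unfold cl. split; [apply Rmax_l |]. apply Rmax_lub; [lra | apply Rmin_r]. }
  assert (Hclid : forall x, 0 <= x <= d -> cl x = x).
  { intros x Hx. unfold cl. rewrite Rmin_left by lra. apply Rmax_right; lra. }
  assert (Hclc : forall x y, Rabs (cl x - cl y) <= Rabs (x - y)).
  { intros x y. unfold cl, Rmax, Rmin. repeat destruct Rle_dec; unfold Rabs; repeat destruct Rcase_abs; lra. }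
  assert (HFc : Ranalysis1.continuity (fun x => F (cl x))).
  { intros x. apply continuity_pt_filterlim. apply (proj2 (continuous_eps (fun x => F (cl x)) x)). intros e He.
    assert (Hc : ccont phi (p + RtoC (cl x))%C).
    { eapply cderiv_ccont. apply (phi_cderiv S). apply HU. rewrite Rabs_pos_eq; apply Hcl. }
    destruct (Hc e He) as [d' [Hd' Hc']]. exists d'; split; [assumption |].
    intros y Hy. unfold F. rewrite <- Re_minus. eapply Rle_lt_trans; [apply re_le_Cmod |].
    apply Hc'. replace (p + RtoC (cl y) - (p + RtoC (cl x)))%C with (RtoC (cl y - cl x)) by (rewrite RtoC_minus; ring).
    rewrite Cmod_R. eapply Rle_lt_trans; [apply Hclc | exact Hy]. }
  exists (Rmin (F d) (rs / 2)).
  assert (Hrs := lc_rs S).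
  assert (HFd : 0 < F d).
  { eapply Rlt_le_trans; [| apply HF; lra]. apply Rmult_lt_0_compat; lra. }
  split. { split; [apply Rmin_pos; lra |]. assert (Rmin (F d) (rs / 2) <= rs / 2) by apply Rmin_r. lra. }
  exists (2 / Re a). split; [apply Rdiv_lt_0_compat; lra |].
  intros r Hr.
  assert (Hr1 : r < F d) by (eapply Rlt_le_trans; [apply Hr | apply Rmin_l]).
  assert (Hr2 : r < rs / 2) by (eapply Rlt_le_trans; [apply Hr | apply Rmin_r]).
  destruct (IVT_gen (fun x => F (cl x)) 0 d r HFc) as [x [Hx Hxr]].
  { rewrite !Hclid, HF0 by lra. rewrite Rmin_left, Rmax_right by lra. lra. }
  rewrite Rmin_left, Rmax_right in Hx by lra. rewrite Hclid in Hxr by lra.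
  assert (Hxa : Rabs x <= d) by (rewrite Rabs_pos_eq; lra).
  assert (Hpsi : psi (RtoC r) = (p + RtoC x)%C).
  { rewrite <- Hxr, <- Hreal by assumption. apply (psi_phi S); [now apply HU |].
    rewrite Hreal by assumption. rewrite Hxr, Cmod_R, Rabs_pos_eq; lra. }
  rewrite Hpsi, Im_plus, Re_plus, (lc_p S). change (Im (RtoC x)) with 0. change (Re (RtoC x)) with x. split; [ring |].
  assert (Hx0 : 0 < x).
  { destruct (Req_dec x 0) as [-> | Hn]; [| lra]. rewrite HF0 in Hxr. lra. }
  split; [lra |].
  assert (B := HF x ltac:(lra)). rewrite Hxr in B.
  apply Rplus_le_compat_l. apply (Rmult_le_reg_l (Re a / 2)); [lra |].
  replace (Re a / 2 * (2 / Re a * r)) with r by (field; lra). lra.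
Qed.

Lemma dpsi_im_of_real (r : R) (d : R) :
  0 < r < rs -> 0 < d -> (forall s, Rabs (s - r) < d -> Im (psi (RtoC s)) = 0) ->
  Im (dpsi (RtoC r)) = 0.
Proof.
  intros Hr Hd H.
  assert (E := proj2 (proj1 (vderiv_re_im _ _ _) (vderiv_psi_R Hr))).
  assert (E' : is_derive (fun s => Im (psi (RtoC s))) r 0).
  { apply (is_derive_ext_loc (fun _ => 0)).
    - exists (mkposreal d Hd). intros s Hs. symmetry. now apply H.
    - apply (is_derive_const (K := R_AbsRing) (V := R_NormedModule)). }
  rewrite <- (is_derive_unique _ _ _ E). now apply is_derive_unique.
Qed.

(** Near 0 the values of [psi] are controlled, its derivative is not. A radius [r0] so small that
    [K * r0] is at most half the gap at [r1] gives a smaller real part, and a mean value point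
    between the two has positive derivative. *)
Lemma real_pos_start : exists r, 0 < r < rs /\ real_pos r.
Proof.
  destruct psi_R_small as [c [Hc [K [HK H]]]].
  set (r1 := c / 2). assert (Hr1 := H r1 ltac:(unfold r1; lra)).
  set (g := Re (psi (RtoC r1)) - Re p).
  assert (Hg : 0 < g) by (unfold g; lra).
  set (r0 := Rmin (r1 / 2) (g / (2 * K))).
  assert (Hr0 : 0 < r0) by (apply Rmin_pos; [unfold r1; lra | apply Rdiv_lt_0_compat; lra]).
  assert (Hr0' : r0 <= r1 / 2) by apply Rmin_l.
  assert (Hr0'' : r0 <= g / (2 * K)) by apply Rmin_r.
  assert (Hlt : Re (psi (RtoC r0)) < Re (psi (RtoC r1))).
  { assert (B := H r0 ltac:(unfold r1 in *; lra)).
    apply (Rmult_le_compat_l K) in Hr0''; [| lra].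
    replace (K * (g / (2 * K))) with (g / 2) in Hr0'' by (field; lra). unfold g in *. lra. }
  destruct (MVT_gen (fun s => Re (psi (RtoC s))) r0 r1 (fun s => Re (dpsi (RtoC s)))) as [x [Hx HM]].
  - rewrite Rmin_left, Rmax_right by (unfold r1 in *; lra). intros x Hx.
    apply (proj1 (proj1 (vderiv_re_im _ _ _) (vderiv_psi_R (r := x) ltac:(unfold r1 in *; lra)))).
  - rewrite Rmin_left, Rmax_right by (unfold r1 in *; lra). intros x Hx.
    apply continuity_pt_filterlim, (ex_derive_continuous (K := R_AbsRing) (V := R_NormedModule)).
    eexists. apply (proj1 (proj1 (vderiv_re_im _ _ _) (vderiv_psi_R (r := x) ltac:(unfold r1 in *; lra)))).
  - rewrite Rmin_left, Rmax_right in Hx by (unfold r1 in *; lra).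
    exists x. split; [unfold r1 in *; lra |]. split; [apply H; unfold r1 in *; lra |]. split.
    + apply (dpsi_im_of_real (r := x) (d := Rmin x (c - x))); [unfold r1 in *; lra | apply Rmin_pos; unfold r1 in *; lra |].
      intros s Hs. apply H.
      below_min Hs as Hs1 Hs2.
      apply Rabs_def2 in Hs1. apply Rabs_def2 in Hs2. lra.
    + apply Rnot_le_lt. intros Hn. unfold r1 in *. nra.
Qed.

(* Comparing [phi] at [z = psi r] and at the real point [Re z]: both values are real, while
   [phi] is close to a real homothety. *)
Lemma real_pos_nearby (r : R) : 0 < r < rs -> real_pos r ->
  exists d, 0 < d /\ forall s, Rabs (s - r) < d -> real_pos s.
Proof.
  intros Hr [H1 [H2 H3]].
  assert (Hw := pdisc_R Hr).
  set (z0 := psi (RtoC r)) in *. set (A := dphi z0).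
  assert (HUz := psi_U S Hw). fold z0 in HUz.
  assert (HA : A = (/ dpsi (RtoC r))%C) by apply (dphi_dpsi S Hw).
  assert (HA0 : A <> 0%C) by apply (dphi_neq_0 S HUz).
  assert (Hm : 0 < Cmod A) by now apply Cmod_gt_0.
  assert (HAim : Im A = 0).
  { rewrite HA. destruct (dpsi (RtoC r)) as [x y]. simpl in H2, H3 |- *. subst y. field. nra. }
  assert (Hc : ccont dphi z0) by (apply (dphi_ccont S HUz), (psi_neq_p S Hw)).
  destruct (Hc (Cmod A / 2)) as [d1 [Hd1 Hc1]]; [lra |]. fold A in Hc1.
  destruct (U_ball S HUz) as [d2 [Hd2 HU2]].
  set (q := Rmin d1 d2).
  assert (Hq : 0 < q) by now apply Rmin_pos.
  assert (Hq1 : q <= d1) by apply Rmin_l. assert (Hq2 : q <= d2) by apply Rmin_r.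
  assert (MV := mean_value_ball phi dphi z0 A q (Cmod A / 2)).
  assert (MV' : forall z1 z2, Cmod (z1 - z0) < q -> Cmod (z2 - z0) < q ->
    Cmod (phi z2 - phi z1 - A * (z2 - z1)) <= Cmod A / 2 * Cmod (z2 - z1)).
  { apply MV. intros z Hz. split; [apply (phi_cderiv S), HU2; lra | apply Rlt_le, Hc1; lra]. }
  assert (Hreal : exists d, 0 < d /\ forall s, Rabs (s - r) < d -> Im (psi (RtoC s)) = 0 /\ 0 < Re (dpsi (RtoC s))).
  { destruct (psi_ccont S Hw Hq) as [d3 [Hd3 Hpsi]]. fold z0 in Hpsi.
    destruct (dpsi_ccont S Hw H3) as [d5 [Hd5 Hdp]].
    exists (Rmin d3 (Rmin d5 (Rmin r (rs - r)))).
    split; [repeat apply Rmin_pos; lra |]. intros s Hs.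
    below_min Hs as Hs1 Hs'.
    below_min Hs' as Hs5 Hs2.
    below_min Hs2 as Hs3 Hs4.
    apply Rabs_def2 in Hs3. apply Rabs_def2 in Hs4.
    assert (Hsr : Cmod (RtoC s - RtoC r) = Rabs (s - r)) by now rewrite <- RtoC_minus, Cmod_R.
    assert (Hsw : pdisc rs (RtoC s)) by (apply pdisc_R; lra).
    specialize (Hpsi (RtoC s) ltac:(rewrite Hsr; exact Hs1)).
    specialize (Hdp (RtoC s) ltac:(rewrite Hsr; exact Hs5)).
    split.
    - set (z := psi (RtoC s)) in *.
      set (x := RtoC (Re z)).
      assert (Hx : Cmod (x - z0) < q).
      { replace (x - z0)%C with (RtoC (Re (z - z0))).
        - rewrite Cmod_R. eapply Rle_lt_trans; [apply re_le_Cmod | exact Hpsi].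
        - apply C_ext; [reflexivity |]. rewrite Im_minus, H1. unfold x. simpl. ring. }
      specialize (MV' x z Hx Hpsi).
      assert (Hphx : Im (phi x) = 0).
      { apply (lc_sigma S); [apply HU2; lra | reflexivity]. }
      assert (Hphz : phi z = RtoC s) by apply (phi_psi S Hsw).
      assert (Hzx : (z - x)%C = (Ci * RtoC (Im z))%C) by (apply C_ext; unfold x; simpl; unfold Re, Im; ring).
      rewrite Hzx, Hphz in MV'.
      assert (E := Rle_trans _ _ _ (im_le_Cmod _) MV').
      replace (Im (s - phi x - A * (Ci * Im z))) with (- (Re A * Im z)) in E.
      2: { rewrite !Im_minus, Hphx, !Im_mult, !Re_mult, HAim. simpl. ring. }
      rewrite Rabs_Ropp, Rabs_mult, Cmod_mult, Cmod_Ci, Cmod_R, Rmult_1_l in E.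
      assert (HRA : Rabs (Re A) = Cmod A).
      { replace A with (RtoC (Re A)) at 2 by (apply C_ext; [reflexivity | now rewrite HAim]).
        now rewrite Cmod_R. }
      rewrite HRA in E. assert (P := Rabs_pos (Im z)).
      (* Since [A] is real, the imaginary part of the remainder has absolute value exactly
         [Cmod A * Rabs (Im z)], and this is bounded by half of itself. *)
      apply NNPP. intros Hn. apply Rabs_no_R0 in Hn. nra.
    - assert (E := Rle_lt_trans _ _ _ (re_le_Cmod _) Hdp). rewrite Re_minus in E.
      apply Rabs_def2 in E. lra. }
  destruct Hreal as [d [Hd Hreal]].
  exists (Rmin (d / 2) (Rmin r (rs - r))). split; [repeat apply Rmin_pos; lra |]. intros s Hs.
  below_min Hs as Hs1 Hs2.
  below_min Hs2 as Hs3 Hs4.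
  apply Rabs_def2 in Hs3. apply Rabs_def2 in Hs4.
  destruct (Hreal s ltac:(lra)) as [E1 E2]. split; [exact E1 |]. split; [| exact E2].
  apply (dpsi_im_of_real (r := s) (d := d / 2)); [lra | lra |].
  intros u Hu. apply Hreal. replace (u - r) with ((u - s) + (s - r)) by ring.
  eapply Rle_lt_trans; [apply Rabs_triang |]. lra.
Qed.

(** Continuity preserves reality and gives a nonnegative derivative; the value 0 is excluded because
    [dpsi] never vanishes. *)
Lemma real_pos_closed (r : R) : 0 < r < rs ->
  (forall d, 0 < d -> exists s, Rabs (s - r) < d /\ real_pos s) -> real_pos r.
Proof.
  intros Hr H. assert (Hw := pdisc_R Hr).
  assert (Happ : forall e, 0 < e -> Rabs (Im (psi (RtoC r))) < e /\ Rabs (Im (dpsi (RtoC r))) < e /\ - e < Re (dpsi (RtoC r))).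
  { intros e He. destruct (psi_ccont S Hw He) as [d1 [Hd1 H1]]. destruct (dpsi_ccont S Hw He) as [d2 [Hd2 H2]].
    destruct (H (Rmin d1 d2)) as [s [Hs [S1 [S2 S3]]]]; [now apply Rmin_pos |].
    below_min Hs as Hs1 Hs2.
    assert (Hsr : Cmod (RtoC s - RtoC r) = Rabs (s - r)) by now rewrite <- RtoC_minus, Cmod_R.
    specialize (H1 (RtoC s) ltac:(lra)). specialize (H2 (RtoC s) ltac:(lra)).
    assert (E1 := Rle_lt_trans _ _ _ (im_le_Cmod _) H1).
    assert (E2 := Rle_lt_trans _ _ _ (im_le_Cmod _) H2).
    assert (E3 := Rle_lt_trans _ _ _ (re_le_Cmod _) H2).
    rewrite Im_minus in E1, E2. rewrite Re_minus in E3. rewrite S1, Rminus_0_l, Rabs_Ropp in E1.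
    rewrite S2, Rminus_0_l, Rabs_Ropp in E2. apply Rabs_def2 in E3. repeat split; lra. }
  assert (Hz : forall x, (forall e, 0 < e -> Rabs x < e) -> x = 0).
  { intros x Hx. apply NNPP. intros Hn. apply Rabs_pos_lt in Hn. specialize (Hx _ Hn). lra. }
  assert (E1 : Im (psi (RtoC r)) = 0) by (apply Hz; intros; now apply Happ).
  assert (E2 : Im (dpsi (RtoC r)) = 0) by (apply Hz; intros; now apply Happ).
  split; [exact E1 |]. split; [exact E2 |].
  apply Rnot_le_lt. intros Hle.
  assert (E3 : Re (dpsi (RtoC r)) = 0).
  { apply Rle_antisym; [exact Hle |]. apply le_epsilon. intros e He. destruct (Happ e He) as [_ [_ T]]. lra. }
  apply (dpsi_neq_0 S Hw). apply C_ext; simpl; assumption.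
Qed.

Lemma real_pos_local (r : R) : 0 < r < rs ->
  exists d, 0 < d /\ forall a b, Rabs (a - r) < d -> Rabs (b - r) < d -> real_pos a -> real_pos b.
Proof.
  intros Hr. destruct (classic (real_pos r)) as [Hg | Hg].
  - destruct (real_pos_nearby Hr Hg) as [d [Hd H]]. exists d. split; [assumption |]. intros; now apply H.
  - assert (Hn : ~ forall d, 0 < d -> exists s, Rabs (s - r) < d /\ real_pos s).
    { intros Hn. apply Hg. now apply real_pos_closed. }
    apply not_all_ex_not in Hn. destruct Hn as [d Hn]. apply imply_to_and in Hn. destruct Hn as [Hd Hn].
    exists d. split; [assumption |]. intros a b Ha _ Hga. exfalso. apply Hn. now exists a.
Qed.

Lemma psi_real_pos (r : R) : 0 < r < rs -> real_pos r.
Proof.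
  intros Hr. destruct real_pos_start as [x [Hx Hg]].
  destruct (Rle_lt_dec x r) as [Hxr | Hxr].
  - apply (@real_induction real_pos x r Hxr); [| exact Hg].
    intros u Hu. destruct (@real_pos_local u) as [d [Hd H]]; [lra |].
    exists d. split; [assumption |]. intros a b Ha Hb Hda Hdb. apply H; apply Rabs_def1; lra.
  (* Real induction moves to the right only, so radii below the starting one are reached after the
     reflection [s -> - s]. *)
  - replace r with (- - r) by ring.
    apply (@real_induction (fun s => real_pos (- s)) (- x) (- r)); [lra | | now rewrite Ropp_involutive].
    intros u Hu. destruct (@real_pos_local (- u)) as [d [Hd H]]; [lra |].
    exists d. split; [assumption |]. intros a b Ha Hb Hda Hdb. apply H; apply Rabs_def1; lra.
Qed.

Lemma polar_0 (r : R) : polar r 0 = RtoC r.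
Proof. unfold polar. rewrite cos_0, sin_0. apply C_ext; simpl; ring. Qed.

Lemma polar_PI (r : R) : polar r PI = RtoC (- r).
Proof. unfold polar. rewrite cos_PI, sin_PI. apply C_ext; simpl; ring. Qed.

Lemma polar_opp_PI (r : R) : polar r (- PI) = RtoC (- r).
Proof. unfold polar. rewrite cos_neg, sin_neg, cos_PI, sin_PI. apply C_ext; simpl; ring. Qed.

Lemma vcont_psi_polar (r : R) : 0 < r < rs -> vcont (fun t => psi (polar r t)).
Proof.
  intros Hr. apply (vcont_comp psi (polar r)); [apply vcont_polar |].
  intros t. apply (psi_ccont S), pdisc_polar, Hr.
Qed.

Lemma vderiv_psi_polar (r t : R) : 0 < r < rs ->
  vderiv (fun s => psi (polar r s)) t (dpsi (polar r t) * (Ci * polar r t))%C.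
Proof.
  intros Hr. apply (vderiv_comp psi (polar r)); [apply vderiv_polar |]. apply (psi_cderiv S), pdisc_polar, Hr.
Qed.

(** Contrapositive of [lc_sigma] at [psi w]: a real point of [U] would have a real image. *)
Lemma im_psi_polar_neq_0 (r t : R) : 0 < r < rs -> sin t <> 0 -> Im (psi (polar r t)) <> 0.
Proof.
  intros Hr Hs E. assert (Hw := @pdisc_polar rs r t Hr).
  assert (E' := lc_sigma S (psi_U S Hw) E). rewrite (phi_psi S Hw) in E'. simpl in E'.
  apply Rmult_integral in E'. destruct E'; lra.
Qed.

Lemma im_psi_polar_0 (r : R) : 0 < r < rs -> Im (psi (polar r 0)) = 0.
Proof. intros Hr. rewrite polar_0. apply (psi_real_pos Hr). Qed.

Lemma im_psi_polar_derive_0 (r : R) : 0 < r < rs ->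
  exists l, 0 < l /\ is_derive (fun t => Im (psi (polar r t))) 0 l.
Proof.
  intros Hr. destruct (psi_real_pos Hr) as [_ [H2 H3]].
  exists (r * Re (dpsi (RtoC r))). split; [apply Rmult_lt_0_compat; lra |].
  assert (E := proj2 (proj1 (vderiv_re_im _ _ _) (vderiv_psi_polar 0 Hr))).
  rewrite polar_0 in E.
  rewrite im_mult_rot, Rmult_comm in E by exact H2. exact E.
Qed.

(** The imaginary part increases through 0 at angle 0 and has no zero on the open half turn, so it
    keeps the sign that it takes just after 0. *)
Lemma im_psi_upper (r t : R) : 0 < r < rs -> 0 < t < PI -> 0 < Im (psi (polar r t)).
Proof.
  intros Hr Ht. apply Rnot_le_lt. intros Hle.
  destruct (im_psi_polar_derive_0 Hr) as [l [Hl Hd]].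
  destruct (derive_pos_increase Hd Hl) as [d [Hd0 Hinc]].
  set (s := Rmin (d / 2) (t / 2)).
  assert (Hs0 : 0 < s) by (apply Rmin_pos; lra).
  assert (Hs1 : s <= d / 2) by apply Rmin_l. assert (Hs2 : s <= t / 2) by apply Rmin_r.
  assert (Hpos := proj1 (Hinc s ltac:(lra)) Hs0). rewrite im_psi_polar_0 in Hpos by assumption.
  destruct (IVT_gen (fun u => Im (psi (polar r u))) s t 0 (vcont_im_continuity (vcont_psi_polar Hr))) as [x [Hx Hx0]].
  { split; [eapply Rle_trans; [apply Rmin_r | exact Hle] | eapply Rle_trans; [| apply Rmax_l]; lra]. }
  rewrite Rmin_left, Rmax_right in Hx by lra.
  apply (@im_psi_polar_neq_0 r x Hr); [| exact Hx0].
  apply Rgt_not_eq, sin_gt_0; lra.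
Qed.

Lemma im_psi_lower (r t : R) : 0 < r < rs -> - PI < t < 0 -> Im (psi (polar r t)) < 0.
Proof.
  intros Hr Ht. apply Rnot_le_lt. intros Hle.
  destruct (im_psi_polar_derive_0 Hr) as [l [Hl Hd]].
  destruct (derive_pos_increase Hd Hl) as [d [Hd0 Hinc]].
  set (s := Rmax (- (d / 2)) (t / 2)).
  assert (Hs0 : s < 0) by (apply Rmax_lub_lt; lra).
  assert (Hs1 : - (d / 2) <= s) by apply Rmax_l. assert (Hs2 : t / 2 <= s) by apply Rmax_r.
  assert (Hneg := proj2 (Hinc s ltac:(lra)) Hs0). rewrite im_psi_polar_0 in Hneg by assumption.
  destruct (IVT_gen (fun u => Im (psi (polar r u))) t s 0 (vcont_im_continuity (vcont_psi_polar Hr))) as [x [Hx Hx0]].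
  { split; [eapply Rle_trans; [apply Rmin_r |]; lra | eapply Rle_trans; [| apply Rmax_l]; lra]. }
  rewrite Rmin_left, Rmax_right in Hx by lra.
  apply (@im_psi_polar_neq_0 r x Hr); [| exact Hx0].
  apply Rlt_not_eq. apply sin_lt_0_var; lra.
Qed.

(** The value on the negative axis is a limit of positive numbers along the upper half circle and of
    negative numbers along the lower one. *)
Lemma im_psi_PI (r : R) : 0 < r < rs -> Im (psi (RtoC (- r))) = 0.
Proof.
  intros Hr. assert (Hpi := PI_RGT_0).
  assert (Hc1 := proj2 (vcont_re_im _ (vcont_psi_polar Hr) PI)). simpl in Hc1.
  assert (Hc2 := proj2 (vcont_re_im _ (vcont_psi_polar Hr) (- PI))). simpl in Hc2.
  set (k := Im (psi (RtoC (- r)))).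
  apply NNPP. intros Hn.
  destruct (Rle_lt_dec 0 k) as [Hk | Hk].
  - destruct (proj1 (continuous_eps _ _) Hc2 k ltac:(lra)) as [d [Hd H]].
    set (s := Rmin (d / 2) (PI / 2)).
    assert (Hs0 : 0 < s) by (apply Rmin_pos; lra).
    assert (Hs1 : s <= d / 2) by apply Rmin_l. assert (Hs2 : s <= PI / 2) by apply Rmin_r.
    specialize (H (- PI + s) ltac:(apply Rabs_def1; lra)).
    rewrite polar_opp_PI in H. fold k in H. apply Rabs_def2 in H.
    assert (B := @im_psi_lower r (- PI + s) Hr ltac:(lra)). lra.
  - destruct (proj1 (continuous_eps _ _) Hc1 (- k) ltac:(lra)) as [d [Hd H]].
    set (s := Rmin (d / 2) (PI / 2)).
    assert (Hs0 : 0 < s) by (apply Rmin_pos; lra).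
    assert (Hs1 : s <= d / 2) by apply Rmin_l. assert (Hs2 : s <= PI / 2) by apply Rmin_r.
    specialize (H (PI - s) ltac:(apply Rabs_def1; lra)).
    rewrite polar_PI in H. fold k in H. apply Rabs_def2 in H.
    assert (B := @im_psi_upper r (PI - s) Hr ltac:(lra)). lra.
Qed.

Lemma pdisc_R_neg (r : R) : 0 < r < rs -> pdisc rs (RtoC (- r)).
Proof. intros H. unfold pdisc. rewrite Cmod_R, Rabs_Ropp, Rabs_pos_eq; lra. Qed.

(** Reality follows by differentiating [im_psi_PI] along the axis. A negative derivative would make
    the imaginary part increase through 0 at angle [PI], hence be negative just before, against
    [im_psi_upper]. *)
Lemma dpsi_neg_axis (r : R) : 0 < r < rs -> Im (dpsi (RtoC (- r))) = 0 /\ 0 < Re (dpsi (RtoC (- r))).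
Proof.
  intros Hr. assert (Hpi := PI_RGT_0).
  assert (E2 : Im (dpsi (RtoC (- r))) = 0).
  { assert (E : vderiv (fun s => psi (RtoC (- s))) r (dpsi (RtoC (- r)) * RtoC (- 1))%C).
    { apply (vderiv_comp psi (fun s => RtoC (- s))).
      - apply vderiv_re_im. simpl. split; [auto_derive; [trivial | ring] |].
        apply (is_derive_const (K := R_AbsRing) (V := R_NormedModule)).
      - apply (psi_cderiv S). now apply pdisc_R_neg. }
    assert (E1 := proj2 (proj1 (vderiv_re_im _ _ _) E)).
    assert (E' : is_derive (fun s => Im (psi (RtoC (- s)))) r 0).
    { apply (is_derive_ext_loc (fun _ => 0)).
      - assert (Hd : 0 < Rmin r (rs - r)) by (apply Rmin_pos; lra).
        exists (mkposreal _ Hd). intros s Hs. symmetry. apply im_psi_PI.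
        change (Rabs (s - r) < Rmin r (rs - r)) in Hs.
        below_min Hs as Hs1 Hs2.
        apply Rabs_def2 in Hs1. apply Rabs_def2 in Hs2. lra.
      - apply (is_derive_const (K := R_AbsRing) (V := R_NormedModule)). }
    assert (E3 : Im (dpsi (RtoC (- r)) * RtoC (- 1))%C = 0).
    { rewrite <- (is_derive_unique _ _ _ E1). now apply is_derive_unique. }
    rewrite Im_mult in E3. change (Re (RtoC (-1))) with (-1) in E3. change (Im (RtoC (-1))) with 0 in E3. lra. }
  split; [exact E2 |].
  apply Rnot_le_lt. intros Hle.
  assert (Hlt : Re (dpsi (RtoC (- r))) < 0).
  { destruct (Req_dec (Re (dpsi (RtoC (- r)))) 0) as [E | E]; [| lra].
    exfalso. apply (dpsi_neq_0 S (pdisc_R_neg Hr)). apply C_ext; simpl; assumption. }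
  assert (E := proj2 (proj1 (vderiv_re_im _ _ _) (vderiv_psi_polar PI Hr))).
  rewrite polar_PI in E.
  assert (Hl : 0 < Im (dpsi (RtoC (- r)) * (Ci * RtoC (- r)))).
  { rewrite im_mult_rot by exact E2. nra. }
  destruct (derive_pos_increase E Hl) as [d [Hd Hinc]].
  set (s := Rmin (d / 2) (PI / 2)).
  assert (Hs0 : 0 < s) by (apply Rmin_pos; lra).
  assert (Hs1 : s <= d / 2) by apply Rmin_l. assert (Hs2 : s <= PI / 2) by apply Rmin_r.
  assert (B := proj2 (Hinc (PI - s) ltac:(lra)) ltac:(lra)).
  rewrite polar_PI, im_psi_PI in B by assumption.
  assert (B' := @im_psi_upper r (PI - s) Hr ltac:(lra)). lra.
Qed.

Lemma im_f_pos_axis (r : R) : 0 < r < rs -> Im (f (psi (RtoC r))) < 0.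
Proof.
  intros Hr. rewrite (f_psi S (pdisc_R Hr)). destruct (psi_real_pos Hr) as [_ [E1 E2]].
  rewrite im_mult_rot_opp by exact E1. nra.
Qed.

Lemma im_f_neg_axis (r : R) : 0 < r < rs -> 0 < Im (f (psi (RtoC (- r)))).
Proof.
  intros Hr. rewrite (f_psi S (pdisc_R_neg Hr)). destruct (dpsi_neg_axis Hr) as [E1 E2].
  rewrite im_mult_rot_opp by exact E1. nra.
Qed.

End Real_axis.

(** * The perturbation in polar coordinates *)

(** An induction principle for polynomials, instantiated twice: with functions of class C^1 in the
    radius and with locally Lipschitz functions. *)
Lemma bipoly_closed (X : Type) (N : (X -> C) -> Prop) (u v : X -> C) (m : nat) (a : nat -> nat -> C) :
  (forall g h, (forall x, g x = h x) -> N g -> N h) ->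
  (forall c, N (fun _ => c)) ->
  (forall g h, N g -> N h -> N (fun x => g x + h x)%C) ->
  (forall g h, N g -> N h -> N (fun x => g x * h x)%C) ->
  N u -> N v -> N (fun x => bipoly m a (u x) (v x)).
Proof.
  intros Hext Hc Hp Hm Hu Hv.
  assert (Hpow : forall g, N g -> forall n, N (fun x => g x ^ n)%C).
  { intros g Hg n. induction n as [| n IH]; [exact (Hc 1%C) |]. now apply (Hm g (fun x => g x ^ n)%C). }
  assert (Hsum : forall (t : nat -> X -> C) n, (forall j, N (t j)) -> N (fun x => sum_n (fun j => t j x) n : C)).
  { intros t n Ht. induction n as [| n IH].
    - apply (Hext (t 0%nat)); [| apply Ht]. intros x. now rewrite sum_O.
    - apply (Hext (fun x => sum_n (fun j => t j x) n + t (S n) x)%C).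
      + intros x. rewrite sum_Sn. reflexivity.
      + now apply Hp. }
  apply (Hsum (fun j x => sum_n (fun k => a j k * u x ^ j * v x ^ k)%C (m - j))). intros j.
  apply (Hsum (fun k x => a j k * u x ^ j * v x ^ k)%C). intros k.
  apply Hm; [| now apply Hpow]. apply Hm; [apply Hc | now apply Hpow].
Qed.

Lemma vderiv_const (c : C) (t : R) : vderiv (fun _ => c) t (RtoC 0).
Proof. exact (is_derive_const (K := R_AbsRing) (V := C_R_NormedModule) c t). Qed.

Lemma vderiv_plus (x y : R -> C) (t : R) (v w : C) :
  vderiv x t v -> vderiv y t w -> vderiv (fun s => x s + y s)%C t (v + w)%C.
Proof. exact (@is_derive_plus R_AbsRing C_R_NormedModule x y t v w). Qed.

Lemma vderiv_conj (x : R -> C) (t : R) (v : C) :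
  vderiv x t v -> vderiv (fun s => Cconj (x s)) t (Cconj v).
Proof.
  rewrite !vderiv_re_im. intros [H1 H2]. split; [exact H1 |].
  exact (is_derive_opp (K := R_AbsRing) (V := R_NormedModule) _ _ _ H2).
Qed.

Lemma vderiv_ext (x y : R -> C) (t : R) (v : C) :
  (forall s, x s = y s) -> vderiv x t v -> vderiv y t v.
Proof. exact (@is_derive_ext R_AbsRing C_R_NormedModule x y t v). Qed.

Lemma cderiv_inv (z : C) : z <> 0%C -> cderiv Cinv z (- / (z * z))%C.
Proof.
  intros Hz. apply cderiv_iff. intros e He.
  assert (Hm : 0 < Cmod z) by now apply Cmod_gt_0. set (m := Cmod z) in *.
  exists (Rmin (m / 2) (e * m * m * m / 2)). split.
  { apply Rmin_pos; [lra |]. apply Rdiv_lt_0_compat; [| lra]. repeat apply Rmult_lt_0_compat; lra. }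
  intros y Hy.
  below_min Hy as Hy1 Hy2.
  assert (T := Cmod_triangle_rev z y). rewrite (Cmod_minus_sym z y) in T. fold m in T.
  assert (Hy3 : m / 2 < Cmod y) by lra.
  assert (Hyz : y <> 0%C) by (apply Cmod_gt_0; lra).
  replace (/ y - / z - - / (z * z) * (y - z))%C with ((y - z) * (y - z) * / (z * z * y))%C.
  2: { field. split; assumption. }
  rewrite !Cmod_mult, Cmod_inv, !Cmod_mult by (repeat apply Cmult_neq_0; assumption). fold m.
  assert (Hq : 0 < m * m * Cmod y) by (repeat apply Rmult_lt_0_compat; lra).
  apply (Rmult_le_reg_r (m * m * Cmod y)); [exact Hq |].
  rewrite Rmult_assoc, Rinv_l, Rmult_1_r by lra.
  assert (P := Cmod_ge_0 (y - z)).
  apply Rle_trans with (e * m * m * m / 2 * Cmod (y - z)); [apply Rmult_le_compat_r; lra |].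
  replace (e * Cmod (y - z) * (m * m * Cmod y)) with (e * m * m * Cmod y * Cmod (y - z)) by ring.
  apply Rmult_le_compat_r; [assumption |].
  replace (e * m * m * m / 2) with (e * m * m * (m / 2)) by field.
  apply Rmult_le_compat_l; [| lra]. repeat apply Rmult_le_pos; lra.
Qed.

Lemma Cconj_mult (z w : C) : Cconj (z * w) = (Cconj z * Cconj w)%C.
Proof. apply C_ext; simpl; ring. Qed.

Lemma Cconj_involutive (z : C) : Cconj (Cconj z) = z.
Proof. apply C_ext; simpl; unfold Re, Im; ring. Qed.

Notation ccont2 G r t := (ccont (fun y : C => G (fst y) (snd y)) (r, t)).

(** Differentiability is in the radius alone, with joint continuity of value and derivative: what
    the scalar equation in the angle requires. For the rotated perturbation this radial derivative
    involves the second derivative of [psi]. *)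
Definition radial_C1_with (rs : R) (G G1 : R -> R -> C) : Prop :=
  forall r t, 0 < r < rs ->
    vderiv (fun s => G s t) r (G1 r t) /\ ccont2 G r t /\ ccont2 G1 r t.

Definition radial_C1 (rs : R) (G : R -> R -> C) : Prop := exists G1, radial_C1_with rs G G1.

Section Radial.

Variable rs : R.

Lemma radial_ext (G H : R -> R -> C) :
  (forall r t, G r t = H r t) -> radial_C1 rs G -> radial_C1 rs H.
Proof.
  intros E [G1 HG]. exists G1. intros r t Hr. destruct (HG r t Hr) as [H1 [H2 H3]].
  split; [| split; [| exact H3]].
  - apply (vderiv_ext (x := fun s => G s t)); [auto | exact H1].
  - apply (ccont_ext_loc (fun y : C => G (fst y) (snd y)) _ _ 1); [lra | auto | exact H2].
Qed.

Lemma radial_const (c : C) : radial_C1 rs (fun _ _ => c).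
Proof.
  exists (fun _ _ => RtoC 0). intros r t _. split; [apply vderiv_const |]. split; apply ccont_const.
Qed.

Lemma radial_plus (G H : R -> R -> C) :
  radial_C1 rs G -> radial_C1 rs H -> radial_C1 rs (fun r t => G r t + H r t)%C.
Proof.
  intros [G1 HG] [H1 HH]. exists (fun r t => G1 r t + H1 r t)%C. intros r t Hr.
  destruct (HG r t Hr) as [A1 [A2 A3]]. destruct (HH r t Hr) as [B1 [B2 B3]].
  split; [| split].
  - now apply (vderiv_plus (x := fun s => G s t) (y := fun s => H s t)).
  - now apply ccont_plus.
  - now apply ccont_plus.
Qed.

Lemma radial_mult (G H : R -> R -> C) :
  radial_C1 rs G -> radial_C1 rs H -> radial_C1 rs (fun r t => G r t * H r t)%C.
Proof.
  intros [G1 HG] [H1 HH]. exists (fun r t => G1 r t * H r t + G r t * H1 r t)%C. intros r t Hr.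
  destruct (HG r t Hr) as [A1 [A2 A3]]. destruct (HH r t Hr) as [B1 [B2 B3]].
  split; [| split].
  - now apply (vderiv_mult (fun s => G s t) (fun s => H s t)).
  - now apply ccont_mult.
  - apply ccont_plus; now apply ccont_mult.
Qed.

Lemma radial_conj (G : R -> R -> C) : radial_C1 rs G -> radial_C1 rs (fun r t => Cconj (G r t)).
Proof.
  intros [G1 HG]. exists (fun r t => Cconj (G1 r t)). intros r t Hr.
  destruct (HG r t Hr) as [A1 [A2 A3]]. split; [| split].
  - now apply (vderiv_conj (x := fun s => G s t)).
  - apply (ccont_comp (fun y : C => G (fst y) (snd y)) Cconj); [exact A2 | apply ccont_conj].
  - apply (ccont_comp (fun y : C => G1 (fst y) (snd y)) Cconj); [exact A3 | apply ccont_conj].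
Qed.

Lemma radial_inv (G : R -> R -> C) :
  (forall r t, 0 < r < rs -> G r t <> 0%C) -> radial_C1 rs G -> radial_C1 rs (fun r t => / G r t)%C.
Proof.
  intros Hnz [G1 HG]. exists (fun r t => - / (G r t * G r t) * G1 r t)%C. intros r t Hr.
  destruct (HG r t Hr) as [A1 [A2 A3]]. split; [| split].
  - apply (vderiv_comp Cinv (fun s => G s t)); [exact A1 |]. now apply cderiv_inv, Hnz.
  - apply ccont_inv; [exact A2 | now apply Hnz].
  - apply ccont_mult; [| exact A3].
    apply (ccont_ext_loc (fun y : C => (- (1)) * / (G (fst y) (snd y) * G (fst y) (snd y)))%C _ _ 1); [lra | intros; ring |].
    apply ccont_mult; [apply ccont_const |]. apply ccont_inv; [now apply ccont_mult |].
    simpl. apply Cmult_neq_0; now apply Hnz.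
Qed.

Lemma ccont_cis (z : C) : ccont (fun y : C => polar 1 (snd y)) z.
Proof.
  apply (ccont_ext_loc (fun y : C => RtoC (cos (snd y)) + Ci * RtoC (sin (snd y)))%C _ _ 1); [lra | |].
  - intros y _. apply C_ext; simpl; ring.
  - apply ccont_plus.
    + apply ccont_im_of. apply continuity_pt_filterlim, continuity_cos.
    + apply ccont_mult; [apply ccont_const |]. apply ccont_im_of. apply continuity_pt_filterlim, continuity_sin.
Qed.

Lemma radial_cis : radial_C1 rs (fun _ t => polar 1 t).
Proof.
  exists (fun _ _ => RtoC 0). intros r t _. split; [apply vderiv_const |].
  split; [apply ccont_cis | apply ccont_const].
Qed.

Lemma radial_radius : radial_C1 rs (fun r _ => RtoC r).
Proof.
  exists (fun _ _ => RtoC 1). intros r t _. split; [apply vderiv_RtoC |].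
  split; [apply (ccont_re_of (fun u => u)), continuous_id | apply ccont_const].
Qed.

Lemma radial_comp_polar (g g1 : C -> C) :
  (forall w, pdisc rs w -> cderiv g w (g1 w) /\ ccont g1 w) -> radial_C1 rs (fun r t => g (polar r t)).
Proof.
  intros Hg. exists (fun r t => g1 (polar r t) * polar 1 t)%C. intros r t Hr.
  assert (Hw := pdisc_polar t Hr). destruct (Hg _ Hw) as [H1 H2].
  split; [| split].
  - apply (vderiv_ext (x := fun s => g (0 + polar s t)%C)); [intros s; f_equal; ring |].
    apply (cderiv_shift_polar g 0). now replace (0 + polar r t)%C with (polar r t) by ring.
  - apply (ccont_comp (fun y : C => polar (fst y) (snd y)) g); [apply ccont_polar |].
    eapply cderiv_ccont. exact H1.
  - apply ccont_mult; [| apply ccont_cis].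
    apply (ccont_comp (fun y : C => polar (fst y) (snd y)) g1); [apply ccont_polar | exact H2].
Qed.

End Radial.

(** One gauge plays two roles: [e z] is the size of a neighbourhood of [z] and its inverse bounds
    [F] there. Compactness bounds the gauge below by some [m], so [/ m] is a global bound. *)
Lemma rect_bounded (F : R -> R -> C) (a b c d : R) :
  (forall r t, a <= r <= b -> c <= t <= d -> ccont2 F r t) ->
  exists K, 0 < K /\ forall r t, a <= r <= b -> c <= t <= d -> Cmod (F r t) <= K.
Proof.
  intros H.
  assert (Hex : forall z : C, exists e : posreal,
    a <= fst z <= b -> c <= snd z <= d ->
    forall r t, Rabs (r - fst z) < e -> Rabs (t - snd z) < e -> Cmod (F r t) <= / e).
  { intros [r0 t0]. simpl.
    destruct (classic (a <= r0 <= b /\ c <= t0 <= d)) as [[Hr Ht] | Hn].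
    2: { exists (mkposreal 1 Rlt_0_1). tauto. }
    destruct (ccont_bounded _ _ (H r0 t0 Hr Ht)) as [e [He Hb]]. simpl in Hb.
    assert (Hk := Cmod_ge_0 (F r0 t0)).
    assert (He' : 0 < Rmin (e / 2) (/ (Cmod (F r0 t0) + 1))).
    { apply Rmin_pos; [lra |]. apply Rinv_0_lt_compat. lra. }
    exists (mkposreal _ He'). intros _ _ r t H1 H2. simpl in *.
    assert (H1' := Rlt_le_trans _ _ _ H1 (Rmin_l _ _)).
    assert (H2' := Rlt_le_trans _ _ _ H2 (Rmin_l _ _)).
    eapply Rle_trans; [apply (Hb (r, t)) |].
    - eapply Rle_lt_trans; [apply Cmod_le_re_im |]. simpl.
      replace (r + - r0) with (r - r0) by ring. replace (t + - t0) with (t - t0) by ring. lra.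
    - apply Rle_trans with (/ / (Cmod (F r0 t0) + 1)); [rewrite Rinv_inv; lra |].
      apply Rinv_le_contravar; [exact He' | apply Rmin_r]. }
  apply functional_choice in Hex. destruct Hex as [e He].
  destruct (compactness_value_2d a b c d (fun r t => e (r, t))) as [m Hm].
  exists (/ m). split; [apply Rinv_0_lt_compat, cond_pos |].
  intros r t Hr Ht. apply Rnot_lt_le. intros Hlt. apply (Hm r t Hr Ht).
  intros [u [v [Hu [Hv [H1 [H2 H3]]]]]].
  assert (B := He (u, v) Hu Hv r t H1 H2).
  assert (/ e (u, v) <= / m) by (apply Rinv_le_contravar; [apply cond_pos | exact H3]). lra.
Qed.

Lemma rect_uniform (F : R -> R -> C) (a b c d : R) :
  (forall r t, a <= r <= b -> c <= t <= d -> ccont2 F r t) ->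
  forall e, 0 < e -> exists dl, 0 < dl /\
    forall r r' t, a <= r <= b -> a <= r' <= b -> c <= t <= d -> Rabs (r' - r) < dl ->
      Cmod (F r' t - F r t) < e.
Proof.
  intros H e He.
  assert (He2 : 0 < e / 2) by lra.
  destruct (uniform_continuity_2d (fun r t => Re (F r t)) a b c d) with (eps := mkposreal _ He2) as [d1 H1].
  { intros x y Hx Hy. apply (ccont_2d_re (fun y : C => F (fst y) (snd y))). now apply H. }
  destruct (uniform_continuity_2d (fun r t => Im (F r t)) a b c d) with (eps := mkposreal _ He2) as [d2 H2].
  { intros x y Hx Hy. apply (ccont_2d_im (fun y : C => F (fst y) (snd y))). now apply H. }
  exists (Rmin d1 d2). split; [apply Rmin_pos; apply cond_pos |].
  intros r r' t Hr Hr' Ht Hd.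
  below_min Hd as Hd1 Hd2.
  assert (H0 : forall x : posreal, Rabs (t - t) < x).
  { intros x. replace (t - t) with 0 by ring. rewrite Rabs_R0. apply cond_pos. }
  specialize (H1 r t r' t Hr Ht Hr' Ht Hd1 (H0 _)). specialize (H2 r t r' t Hr Ht Hr' Ht Hd2 (H0 _)).
  simpl in H1, H2. eapply Rle_lt_trans; [apply Cmod_le_re_im |]. rewrite Re_minus, Im_minus. lra.
Qed.

(* In the coordinate [w = phi z] the perturbed field is [- i w + eps G(w)]; this is
   [G(w) e^(- i t)] at [w = r e^(i t)], whose real and imaginary parts drive [r'] and [r t']. *)
Definition rotated_perturbation (psi : C -> C) (P : C -> C -> C) (r t : R) : C :=
  (P (psi (polar r t)) (Cconj (psi (polar r t))) / C_derive psi (polar r t) * Cconj (polar 1 t))%C.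

Section Perturbation.

Variables (D U : C -> Prop) (f phi psi : C -> C) (p : C) (rs : R).
Hypothesis S : linearized_center D U f phi psi p rs.

Lemma radial_psi : radial_C1 rs (fun r t => psi (polar r t)).
Proof.
  apply (radial_comp_polar (g1 := C_derive psi)). intros w Hw.
  split; [now apply (psi_cderiv S) | now apply (dpsi_ccont S)].
Qed.

Lemma radial_dpsi : radial_C1 rs (fun r t => C_derive psi (polar r t)).
Proof. apply (radial_comp_polar (g1 := C_derive (C_derive psi))). exact (d2psi S). Qed.

Lemma radial_perturbation (m : nat) (a : nat -> nat -> C) :
  radial_C1 rs (rotated_perturbation psi (bipoly m a)).
Proof.
  apply radial_mult; [| apply radial_conj, radial_cis].
  apply radial_mult.
  - apply (radial_ext (G := fun r t => bipoly m a (psi (polar r t)) (Cconj (psi (polar r t))))); [reflexivity |].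
    apply (bipoly_closed (N := fun g : C -> C => radial_C1 rs (fun r t => g (r, t)))
      (u := fun y : C => psi (polar (fst y) (snd y))) (v := fun y : C => Cconj (psi (polar (fst y) (snd y))))).
    + intros g h E. apply radial_ext. auto.
    + intros c. apply radial_const.
    + intros g h. apply radial_plus.
    + intros g h. apply radial_mult.
    + apply radial_psi.
    + apply radial_conj, radial_psi.
  - apply radial_inv; [| apply radial_dpsi].
    intros r t Hr. now apply (dpsi_neq_0 S), pdisc_polar.
Qed.

Lemma polar_slope_perturbed (P : C -> C -> C) (eps r t : R) : 0 < r < rs ->
  polar_slope phi (psi (polar r t)) (perturbed f P eps (psi (polar r t))) r t =
  r * (eps * Re (rotated_perturbation psi P r t)) / (- r + eps * Im (rotated_perturbation psi P r t)).
Proof.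
  intros Hr. assert (Hw := pdisc_polar t Hr).
  unfold polar_slope, perturbed.
  rewrite (f_psi S Hw), (dphi_dpsi S Hw).
  replace (/ C_derive psi (polar r t) * (C_derive psi (polar r t) * (- Ci * polar r t)
      + eps * P (psi (polar r t)) (Cconj (psi (polar r t)))) * Cconj (polar 1 t))%C
    with (- Ci * RtoC r + RtoC eps * rotated_perturbation psi P r t)%C.
  - rewrite Re_plus, Im_plus, !Re_mult, !Im_mult. 
    generalize (rotated_perturbation psi P r t). intros [x y]. simpl. f_equal; [ring | f_equal; ring].
  - unfold rotated_perturbation.
    assert (Hnz := dpsi_neq_0 S Hw).
    set (dd := C_derive psi (polar r t)) in *.
    set (Pz := P (psi (polar r t)) (Cconj (psi (polar r t)))).
    transitivity (- Ci * r * (polar 1 t * Cconj (polar 1 t)) + eps * (Pz / dd * Cconj (polar 1 t)))%C.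
    + rewrite cis_mult_conj. ring.
    + rewrite (polar_cis r t). field. exact Hnz.
Qed.

Lemma melnikov_half_eq (m : nat) (a : nat -> nat -> C) (b r : R) : 0 < r < rs ->
  melnikov_half phi psi (bipoly m a) b r =
  - RInt (fun t => Re (rotated_perturbation psi (bipoly m a) r t)) 0 b.
Proof.
  intros Hr. unfold melnikov_half. f_equal.
  set (W := rotated_perturbation psi (bipoly m a)).
  destruct (radial_perturbation m a) as [W1 HW]. fold W in HW.
  assert (HWc : vcont (W r)).
  { intros [z1 z2].
    assert (H1 : ccont (fun y : C => (r, fst y)) (z1, z2)).
    { intros e He. exists e; split; [assumption |]. intros y Hy.
      eapply Rle_lt_trans; [| exact Hy].
      replace ((r, fst y) - (r, fst (z1, z2)))%C with (Ci * RtoC (fst y - z1))%C.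
      - rewrite Cmod_mult, Cmod_Ci, Rmult_1_l, Cmod_R. exact (re_le_Cmod (y - (z1, z2))).
      - apply C_ext; simpl; ring. }
    apply (ccont_comp (fun y : C => (r, fst y)) (fun y : C => W (fst y) (snd y)) _ H1).
    apply (HW r z1 Hr). }
  (* The factor [e^(i t)] moved under the conjugation becomes [e^(- i t)], so the integrand is
     [Ci * Cconj W], whose imaginary part is [Re W]. *)
  assert (Hint : forall t, (let z := psi (polar r t) in
      Cconj (C_derive phi z * bipoly m a z (Cconj z)) * (Ci * polar 1 t))%C = (Ci * Cconj (W r t))%C).
  { intros t. cbv zeta. unfold W, rotated_perturbation.
    assert (Hw := pdisc_polar t Hr). rewrite (dphi_dpsi S Hw).
    unfold Cdiv. rewrite !Cconj_mult, Cconj_involutive. ring. }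
  rewrite (RInt_ext (V := C_R_CompleteNormedModule) _ (fun t => (Ci * Cconj (W r t))%C)).
  2: { intros t _. apply Hint. }
  assert (E : is_RInt (V := C_R_NormedModule) (fun t => (Ci * Cconj (W r t))%C) 0 b
    (RInt (fun t => Im (W r t)) 0 b, RInt (fun t => Re (W r t)) 0 b)).
  { destruct (vcont_ex_RInt _ 0 b HWc) as [E1 E2].
    apply (is_RInt_fct_extend_pair (U := R_NormedModule) (V := R_NormedModule)).
    - apply (is_RInt_ext (V := R_NormedModule) (fun t => Im (W r t))).
      + intros t _. simpl. unfold Re, Im. ring.
      + now apply (RInt_correct (V := R_CompleteNormedModule)).
    - apply (is_RInt_ext (V := R_NormedModule) (fun t => Re (W r t))).
      + intros t _. simpl. unfold Re, Im. ring.
      + now apply (RInt_correct (V := R_CompleteNormedModule)). }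
  rewrite (is_RInt_unique (V := C_R_CompleteNormedModule) _ _ _ _ E). reflexivity.
Qed.

End Perturbation.

(** * The first order coefficient and the Melnikov function *)

Lemma filippov_set_upper (Xp Xm : C -> C) (z v : C) :
  0 < Im z -> filippov_set Xp Xm z v -> v = Xp z.
Proof. intros Hz [[_ H] | [[H _] | [H _]]]; [exact H | lra | lra]. Qed.

Lemma filippov_set_lower (Xp Xm : C -> C) (z v : C) :
  Im z < 0 -> filippov_set Xp Xm z v -> v = Xm z.
Proof. intros Hz [[H _] | [[_ H] | [H _]]]; [lra | exact H | lra]. Qed.

Lemma filippov_set_nonempty (Xp Xm : C -> C) (z : C) : exists v, filippov_set Xp Xm z v.
Proof.
  destruct (Rtotal_order (Im z) 0) as [H | [H | H]].
  - exists (Xm z). right; left. split; [exact H | reflexivity].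
  - exists (RtoC 1 * Xp z + RtoC (1 - 1) * Xm z)%C. right; right. split; [exact H |].
    exists 1. split; [lra | reflexivity].
  - exists (Xp z). left. split; [exact H | reflexivity].
Qed.

Section First_order.

Variables (D U : C -> Prop) (f phi psi : C -> C) (p : C) (rs : R).
Hypothesis S : linearized_center D U f phi psi p rs.

Lemma perturbation_bounded (m : nat) (a : nat -> nat -> C) (r1 r2 c d : R) : 0 < r1 -> r2 < rs ->
  exists K, 0 < K /\ forall r t, r1 <= r <= r2 -> c <= t <= d ->
    Cmod (rotated_perturbation psi (bipoly m a) r t) <= K.
Proof.
  intros H1 H2. apply rect_bounded. intros r t Hr _.
  destruct (radial_perturbation S m a) as [W1 HW]. apply HW. lra.
Qed.

Lemma first_order_coefficient_perturbed (Xp Xm : R -> C -> C) (m : nat) (a : nat -> nat -> C) (alpha beta : R) :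
  (forall eps r t v, 0 < r < rs -> alpha < t < beta ->
     filippov_set (Xp eps) (Xm eps) (psi (polar r t)) v ->
     v = perturbed f (bipoly m a) eps (psi (polar r t))) ->
  first_order_coefficient Xp Xm phi psi rs alpha beta
    (fun t r => - Re (rotated_perturbation psi (bipoly m a) r t)).
Proof.
  intros HX r1 r2 Hr1 Hr12 Hr2.
  destruct (@perturbation_bounded m a r1 r2 alpha beta Hr1 Hr2) as [K [HK HB]].
  (* The error is exactly [x * y * eps ^ 2 / (- r + eps * y)], and this range of [eps] keeps the
     denominator at least [r1 / 2] in absolute value. *)
  exists (2 * (K * K) / r1), (r1 / (2 * K)).
  split; [apply Rdiv_lt_0_compat; lra |].
  intros eps r t v He Hr Ht Hv.
  rewrite (HX eps r t v) by (auto; lra).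
  rewrite (polar_slope_perturbed S) by lra.
  specialize (HB r t Hr ltac:(lra)).
  assert (HA := Rle_trans _ _ _ (re_le_Cmod _) HB). assert (HI := Rle_trans _ _ _ (im_le_Cmod _) HB).
  set (x := Re (rotated_perturbation psi (bipoly m a) r t)) in *.
  set (y := Im (rotated_perturbation psi (bipoly m a) r t)) in *.
  assert (HeK : eps * K < r1 / 2).
  { destruct He as [_ He]. apply (Rmult_lt_compat_r K) in He; [| lra].
    replace (r1 / (2 * K) * K) with (r1 / 2) in He by (field; lra). exact He. }
  assert (Hey : Rabs (eps * y) < r1 / 2).
  { rewrite Rabs_mult, Rabs_pos_eq by lra. eapply Rle_lt_trans; [| exact HeK]. apply Rmult_le_compat_l; lra. }
  apply Rabs_def2 in Hey.
  assert (Hd : - r + eps * y < - (r1 / 2)) by lra.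
  replace (r * (eps * x) / (- r + eps * y) - eps * - x) with ((x * y) * eps ^ 2 * / (- r + eps * y)) by (field; lra).
  rewrite Rabs_mult, Rabs_mult, Rabs_mult.
  rewrite (Rabs_pos_eq (eps ^ 2)) by (apply pow2_ge_0).
  assert (Hi : Rabs (/ (- r + eps * y)) <= 2 / r1).
  { rewrite Rabs_inv, Rabs_left by lra. replace (2 / r1) with (/ (r1 / 2)) by (field; lra).
    apply Rinv_le_contravar; lra. }
  assert (Hxy : Rabs x * Rabs y <= K * K) by (apply Rmult_le_compat; try apply Rabs_pos; assumption).
  replace (2 * (K * K) / r1 * eps ^ 2) with (K * K * eps ^ 2 * (2 / r1)) by (field; lra).
  apply Rmult_le_compat; try assumption.
  - apply Rmult_le_pos; [| apply pow2_ge_0]. apply Rmult_le_pos; apply Rabs_pos.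
  - apply Rabs_pos.
  - apply Rmult_le_compat_r; [apply pow2_ge_0 | exact Hxy].
Qed.

Lemma first_order_coefficient_unique (Xp Xm : R -> C -> C) (alpha beta : R) (F G : R -> R -> R) :
  first_order_coefficient Xp Xm phi psi rs alpha beta F ->
  first_order_coefficient Xp Xm phi psi rs alpha beta G ->
  forall r t, 0 < r < rs -> alpha < t < beta -> F t r = G t r.
Proof.
  intros HF HG r t Hr Ht.
  destruct (HF (r / 2) ((r + rs) / 2)) as [K1 [e1 [He1 H1]]]; try lra.
  destruct (HG (r / 2) ((r + rs) / 2)) as [K2 [e2 [He2 H2]]]; try lra.
  assert (HK : forall eps, 0 < eps < Rmin e1 e2 -> Rabs (F t r - G t r) <= (K1 + K2) * eps).
  { intros eps He.
    assert (Hm1 : Rmin e1 e2 <= e1) by apply Rmin_l. assert (Hm2 : Rmin e1 e2 <= e2) by apply Rmin_r.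
    destruct (filippov_set_nonempty (Xp eps) (Xm eps) (psi (polar r t))) as [v Hv].
    specialize (H1 eps r t v ltac:(lra) ltac:(lra) Ht Hv).
    specialize (H2 eps r t v ltac:(lra) ltac:(lra) Ht Hv).
    set (s := polar_slope phi (psi (polar r t)) v r t) in *.
    apply (Rmult_le_reg_l eps); [lra |].
    rewrite <- (Rabs_pos_eq eps) at 1 by lra. rewrite <- Rabs_mult.
    replace (eps * (F t r - G t r)) with ((s - eps * G t r) - (s - eps * F t r)) by ring.
    eapply Rle_trans; [apply Rabs_triang |]. rewrite Rabs_Ropp.
    replace (eps * ((K1 + K2) * eps)) with (K2 * eps ^ 2 + K1 * eps ^ 2) by ring. lra. }
  apply Rminus_diag_uniq. apply NNPP. intros Hn. apply Rabs_pos_lt in Hn.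
  set (g := Rabs (F t r - G t r)) in *.
  set (K := Rmax 1 (K1 + K2)).
  assert (HK1 : 1 <= K) by apply Rmax_l. assert (HK2 : K1 + K2 <= K) by apply Rmax_r.
  set (eps := Rmin (Rmin e1 e2 / 2) (g / (2 * K))).
  assert (Hm : 0 < Rmin e1 e2) by now apply Rmin_pos.
  assert (He0 : 0 < eps) by (apply Rmin_pos; [lra | apply Rdiv_lt_0_compat; lra]).
  assert (Hea : eps <= Rmin e1 e2 / 2) by apply Rmin_l.
  assert (Heb : eps <= g / (2 * K)) by apply Rmin_r.
  specialize (HK eps ltac:(lra)).
  apply (Rmult_le_compat_r (2 * K)) in Heb; [| lra].
  replace (g / (2 * K) * (2 * K)) with g in Heb by (field; lra). nra.
Qed.

Lemma ex_RInt_perturbation (m : nat) (a : nat -> nat -> C) (r b c : R) : 0 < r < rs ->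
  ex_RInt (fun t => Re (rotated_perturbation psi (bipoly m a) r t)) b c.
Proof.
  intros Hr. apply (ex_RInt_continuous (V := R_CompleteNormedModule)). intros t _.
  destruct (radial_perturbation S m a) as [W1 HW]. destruct (HW r t Hr) as [_ [Hc _]].
  apply continuous_eps. intros e He. destruct (Hc e He) as [d [Hd Hd']].
  exists d. split; [assumption |]. intros s Hs. rewrite <- Re_minus.
  eapply Rle_lt_trans; [apply re_le_Cmod |]. apply (Hd' (r, s)).
  eapply Rle_lt_trans; [apply Cmod_le_re_im |]. simpl.
  replace (r + - r) with 0 by ring. rewrite Rabs_R0, Rplus_0_l. exact Hs.
Qed.

(** The coefficients are determined on the open half turns only, which is enough to determine the
    integrals. *)
Lemma first_order_melnikov_iff (m : nat) (ap am : nat -> nat -> C) (M : R -> R) :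
  is_first_order_melnikov (perturbed f (bipoly m ap)) (perturbed f (bipoly m am)) phi psi rs M <->
  (forall r, 0 < r < rs -> M r =
    melnikov_half phi psi (bipoly m ap) PI r - melnikov_half phi psi (bipoly m am) (- PI) r).
Proof.
  assert (Hpi := PI_RGT_0).
  assert (Hup : first_order_coefficient (perturbed f (bipoly m ap)) (perturbed f (bipoly m am)) phi psi rs 0 PI
      (fun t r => - Re (rotated_perturbation psi (bipoly m ap) r t))).
  { apply first_order_coefficient_perturbed. intros eps r t v Hr Ht.
    apply filippov_set_upper. now apply (im_psi_upper S). }
  assert (Hlo : first_order_coefficient (perturbed f (bipoly m ap)) (perturbed f (bipoly m am)) phi psi rs (- PI) 0
      (fun t r => - Re (rotated_perturbation psi (bipoly m am) r t))).
  { apply first_order_coefficient_perturbed. intros eps r t v Hr Ht.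
    apply filippov_set_lower. now apply (im_psi_lower S). }
  assert (Hint : forall a b r, 0 < r < rs -> is_RInt (V := R_NormedModule)
     (fun t => - Re (rotated_perturbation psi (bipoly m a) r t)) 0 b (melnikov_half phi psi (bipoly m a) b r)).
  { intros a b r Hr. rewrite (melnikov_half_eq S) by assumption.
    apply (is_RInt_opp (V := R_NormedModule)). apply (RInt_correct (V := R_CompleteNormedModule)).
    now apply ex_RInt_perturbation. }
  split.
  - intros [Fp [Fm [H1 [H2 H3]]]] r Hr. destruct (H3 r Hr) as [Jp [Jm [I1 [I2 E]]]].
    rewrite E. f_equal.
    + rewrite <- (is_RInt_unique (V := R_CompleteNormedModule) _ _ _ _ I1).
      apply (is_RInt_unique (V := R_CompleteNormedModule)).
      eapply (is_RInt_ext (V := R_NormedModule)); [| apply (Hint ap PI r Hr)].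
      rewrite Rmin_left, Rmax_right by lra. intros t Ht. simpl.
      symmetry. exact (first_order_coefficient_unique H1 Hup Hr Ht).
    + rewrite <- (is_RInt_unique (V := R_CompleteNormedModule) _ _ _ _ I2).
      apply (is_RInt_unique (V := R_CompleteNormedModule)).
      eapply (is_RInt_ext (V := R_NormedModule)); [| apply (Hint am (- PI) r Hr)].
      rewrite Rmin_right, Rmax_left by lra. intros t Ht. simpl.
      symmetry. exact (first_order_coefficient_unique H2 Hlo Hr Ht).
  - intros E. 
    exists (fun t r => - Re (rotated_perturbation psi (bipoly m ap) r t)),
      (fun t r => - Re (rotated_perturbation psi (bipoly m am) r t)).
    split; [exact Hup |]. split; [exact Hlo |]. intros r Hr.
    exists (melnikov_half phi psi (bipoly m ap) PI r), (melnikov_half phi psi (bipoly m am) (- PI) r).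
    split; [now apply Hint |]. split; [now apply Hint | now apply E].
Qed.

End First_order.

(** * Filippov solutions *)

Lemma sum_n_S (u : nat -> R) (n : nat) : sum_n u (S n) = sum_n u n + u (S n).
Proof. rewrite sum_Sn. reflexivity. Qed.

Lemma sum_n_0 (u : nat -> R) : sum_n u 0 = u 0%nat.
Proof. apply sum_O. Qed.

Lemma sum_n_nonneg (u : nat -> R) (n : nat) : (forall k, (k <= n)%nat -> 0 <= u k) -> 0 <= sum_n u n.
Proof.
  induction n as [| n IH]; intros H.
  - rewrite sum_n_0. now apply H.
  - rewrite sum_n_S. assert (0 <= sum_n u n) by (apply IH; intros; apply H; lia).
    assert (0 <= u (S n)) by now apply H. lra.
Qed.

Lemma sum_n_le_compat (u v : nat -> R) (n : nat) :
  (forall k, (k <= n)%nat -> u k <= v k) -> sum_n u n <= sum_n v n.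
Proof.
  induction n as [| n IH]; intros H.
  - rewrite !sum_n_0. now apply H.
  - rewrite !sum_n_S. assert (sum_n u n <= sum_n v n) by (apply IH; intros; apply H; lia).
    assert (u (S n) <= v (S n)) by now apply H. lra.
Qed.

Section Cover_length.

Variables a b : nat -> R.
Hypothesis Hab : forall k, a k <= b k.

(** Length of the part of [[a k, b k]] to the left of [t]. The sum [cover_length] counts overlaps
    with multiplicity, and its increment over an interval contained in one of the first cover
    intervals is at least the length of that interval. *)
Definition clipped_length (k : nat) (t : R) : R := Rmax 0 (Rmin (t - a k) (b k - a k)).
Definition cover_length (N : nat) (t : R) : R := sum_n (fun k => clipped_length k t) N.

Lemma clipped_length_incr (k : nat) (u v : R) : u <= v -> clipped_length k u <= clipped_length k v.
Proof.
  intros H. unfold clipped_length. apply Rle_max_compat_l. apply Rle_min_compat_r. lra.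
Qed.

Lemma clipped_length_range (k : nat) (t : R) : 0 <= clipped_length k t <= b k - a k.
Proof.
  unfold clipped_length. specialize (Hab k). split; [apply Rmax_l |].
  apply Rmax_lub; [lra | apply Rmin_r].
Qed.

Lemma clipped_length_inside (k : nat) (u v : R) : a k <= u -> u <= v -> v <= b k ->
  clipped_length k v - clipped_length k u = v - u.
Proof.
  intros. unfold clipped_length. rewrite !Rmin_left by lra. rewrite !Rmax_right by lra. ring.
Qed.

Lemma cover_length_diff_S (N : nat) (u v : R) : u <= v ->
  cover_length N v - cover_length N u <= cover_length (S N) v - cover_length (S N) u.
Proof.
  intros H. unfold cover_length. rewrite !sum_n_S. assert (B := clipped_length_incr (S N) H). lra.
Qed.

Lemma cover_length_diff_le (N N' : nat) (u v : R) : u <= v -> (N <= N')%nat ->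
  cover_length N v - cover_length N u <= cover_length N' v - cover_length N' u.
Proof.
  intros H HN. induction HN as [| N' HN IH]; [lra |].
  eapply Rle_trans; [exact IH |]. now apply cover_length_diff_S.
Qed.

Lemma cover_length_incr (N : nat) (u v : R) : u <= v -> cover_length N u <= cover_length N v.
Proof. intros H. apply sum_n_le_compat. intros. now apply clipped_length_incr. Qed.

Lemma cover_length_inside (N k : nat) (u v : R) : (k <= N)%nat -> a k <= u -> u <= v -> v <= b k ->
  v - u <= cover_length N v - cover_length N u.
Proof.
  intros HN H1 H2 H3. eapply Rle_trans; [| apply (cover_length_diff_le H2 HN)].
  rewrite <- (clipped_length_inside H1 H2 H3). destruct k as [| k].
  - unfold cover_length. rewrite !sum_n_0. lra.
  - unfold cover_length. rewrite !sum_n_S. assert (B := cover_length_incr k H2). unfold cover_length in B. lra.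
Qed.

Lemma cover_length_total (N : nat) (s t : R) :
  cover_length N t - cover_length N s <= sum_n (fun k => b k - a k) N.
Proof.
  assert (H1 : cover_length N t <= sum_n (fun k => b k - a k) N).
  { apply sum_n_le_compat. intros. apply clipped_length_range. }
  assert (H2 : 0 <= cover_length N s).
  { apply sum_n_nonneg. intros. apply clipped_length_range. }
  lra.
Qed.

(** [cover_length N] is nondecreasing, so its increments over ordered intervals telescope to at most
    its total increase, which the length of the cover bounds. *)
Lemma disjoint_length_le (N n : nat) (al be : nat -> R) (s t : R) :
  (forall k, (k <= n)%nat -> s <= al k <= be k /\ be k <= t) ->
  (forall k, (k < n)%nat -> be k <= al (S k)) ->
  (forall k, (k <= n)%nat -> be k - al k <= cover_length N (be k) - cover_length N (al k)) ->
  sum_n (fun k => be k - al k) n <= sum_n (fun k => b k - a k) N.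
Proof.
  intros H1 H2 H3. eapply Rle_trans; [| apply (cover_length_total N s t)].
  assert (E : sum_n (fun k => be k - al k) n <= cover_length N (be n) - cover_length N s).
  { induction n as [| n IH].
    - rewrite sum_n_0. assert (B := H3 0%nat (le_n _)).
      assert (B' := cover_length_incr N (proj1 (proj1 (H1 0%nat (le_n _))))). lra.
    - rewrite sum_n_S.
      assert (IH' : sum_n (fun k => be k - al k) n <= cover_length N (be n) - cover_length N s).
      { apply IH; intros; [apply H1 | apply H2 | apply H3]; lia. }
      assert (B := H3 (S n) (le_n _)).
      assert (B' := cover_length_incr N (H2 n (le_n _))). lra. }
  assert (B := cover_length_incr N (proj2 (H1 n (le_n _)))). lra.
Qed.

End Cover_length.

(* Gordon's argument: advance along [s, t] by short intervals around each point, using the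
   local bound off [E] and, on [E], absolute continuity on intervals of small total length. *)
Lemma ac_nonincreasing (y : R -> C) (V : R -> R) (E : R -> Prop) (s t K : R) :
  s <= t -> absolutely_continuous y s t -> 0 <= K ->
  (forall a b, s <= a -> a <= b -> b <= t -> V b - V a <= K * (Cmod (y b - y a) + (b - a))) ->
  null_set E ->
  (forall u, s <= u <= t -> ~ E u -> forall eta, 0 < eta -> exists d, 0 < d /\
     forall a b, s <= a <= u -> u <= b <= t -> u - a < d -> b - u < d -> V b - V a <= eta * (b - a)) ->
  V t <= V s.
Proof.
  intros Hst Hac HK Hdom HE Hloc.
  assert (Heta : forall eta, 0 < eta -> V t - V s <= eta * (t - s + 2 * K)).
  { intros eta He. destruct (Hac eta He) as [dl [Hdl Hac']].
    destruct (HE (Rmin eta (dl / 2))) as [ca [cb [Hc1 [Hc2 Hc3]]]]; [apply Rmin_pos; lra |].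
    set (L := cover_length ca cb).
    (* State of the induction at [c]: an ordered list of intervals, each charged to the first cover
       intervals up to [N]. The growth of [V] up to [c] is paid by the slope [eta] and by the
       variation of [y] over the list. *)
    set (good := fun c (n N : nat) (al be : nat -> R) =>
      (forall k, (k <= n)%nat -> s <= al k <= be k /\ be k <= c) /\
      (forall k, (k < n)%nat -> be k <= al (S k)) /\
      (forall k, (k <= n)%nat -> be k - al k <= L N (be k) - L N (al k)) /\
      V c - V s <= eta * (c - s) + K * sum_n (fun k => Cmod (y (be k) - y (al k)) + (be k - al k)) n).
    set (G := fun c => exists n N al be, good c n N al be).
    assert (HGt : G t).
    { apply (@real_induction G s t Hst).
      - intros u Hu. destruct (classic (E u)) as [HEu | HEu].
        + destruct (Hc2 u HEu) as [k Hk].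
          exists (Rmin (u - ca k) (cb k - u)). split; [apply Rmin_pos; lra |].
          intros a b Ha Hb Hda Hdb [n [N [al [be [G1 [G2 [G3 G4]]]]]]].
          assert (Hda' := Rlt_le_trans _ _ _ Hda (Rmin_l _ _)).
          assert (Hdb' := Rlt_le_trans _ _ _ Hdb (Rmin_r _ _)).
          (* Crossing a point of [E] appends [[a, b]] to the list, charged to the cover interval of
             index [k] that contains it. *)
          set (al' := fun j => if Nat.leb j n then al j else a).
          set (be' := fun j => if Nat.leb j n then be j else b).
          assert (Hold : forall j, (j <= n)%nat -> al' j = al j /\ be' j = be j).
          { intros j Hj. unfold al', be'. apply Nat.leb_le in Hj. rewrite Hj. auto. }
          assert (Hnew : al' (S n) = a /\ be' (S n) = b).
          { unfold al', be'. assert (Hj : Nat.leb (S n) n = false) by (apply Nat.leb_gt; lia). rewrite Hj. auto. }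
          destruct Hnew as [Hn1 Hn2].
          exists (S n), (Nat.max N k), al', be'. repeat split.
          * destruct (Nat.eq_dec k0 (S n)) as [-> | Hne]; [rewrite Hn1; lra |].
            destruct (Hold k0 ltac:(lia)) as [-> _]. apply G1; lia.
          * destruct (Nat.eq_dec k0 (S n)) as [-> | Hne]; [rewrite Hn1, Hn2; lra |].
            destruct (Hold k0 ltac:(lia)) as [-> ->]. apply G1; lia.
          * destruct (Nat.eq_dec k0 (S n)) as [-> | Hne]; [rewrite Hn2; lra |].
            destruct (Hold k0 ltac:(lia)) as [_ ->]. assert (T := G1 k0 ltac:(lia)). lra.
          * intros j Hj. destruct (Nat.eq_dec j n) as [-> | Hne].
            -- rewrite Hn1. destruct (Hold n (le_n _)) as [_ ->]. apply G1; lia.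
            -- destruct (Hold j ltac:(lia)) as [_ ->]. destruct (Hold (S j) ltac:(lia)) as [-> _]. apply G2; lia.
          * intros j Hj. destruct (Nat.eq_dec j (S n)) as [-> | Hne].
            -- rewrite Hn1, Hn2. unfold L. apply (@cover_length_inside ca cb) with (k := k); try lra. lia.
            -- destruct (Hold j ltac:(lia)) as [-> ->].
               eapply Rle_trans; [apply G3; lia |]. unfold L. apply cover_length_diff_le; [| lia].
               apply G1; lia.
          * rewrite sum_n_S, Hn1, Hn2.
            rewrite (sum_n_ext_loc _ (fun k => Cmod (y (be k) - y (al k)) + (be k - al k))).
            2: { intros j Hj. destruct (Hold j Hj) as [-> ->]. reflexivity. }
            assert (T := Hdom a b ltac:(lra) ltac:(lra) ltac:(lra)).
            assert (0 <= eta * (b - a)) by (apply Rmult_le_pos; lra). lra.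
        + destruct (Hloc u Hu HEu eta He) as [d [Hd Hd']]. exists d. split; [assumption |].
          intros a b Ha Hb Hda Hdb [n [N [al [be [G1 [G2 [G3 G4]]]]]]].
          exists n, N, al, be. repeat split; try assumption.
          * apply G1; assumption.
          * apply G1; assumption.
          * assert (T := G1 k H). lra.
          * assert (T := Hd' a b Ha Hb Hda Hdb). lra.
      (* The list carries indices [0] to [n], so it is never empty; it starts with the degenerate
         interval at [s]. *)
      - exists 0%nat, 0%nat, (fun _ => s), (fun _ => s). repeat split; intros; try lra; try lia.
        rewrite sum_n_0, Cmod_minus_self. lra. }
    destruct HGt as [n [N [al [be [G1 [G2 [G3 G4]]]]]]].
    assert (Hlen : sum_n (fun k => be k - al k) n <= Rmin eta (dl / 2)).
    { eapply Rle_trans; [apply (@disjoint_length_le ca cb Hc1 N n al be s t); assumption | apply Hc3]. }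
    assert (Hlen1 : sum_n (fun k => be k - al k) n <= eta) by (eapply Rle_trans; [exact Hlen | apply Rmin_l]).
    assert (Hlen2 : sum_n (fun k => be k - al k) n <= dl / 2) by (eapply Rle_trans; [exact Hlen | apply Rmin_r]).
    assert (Hvar := Hac' n al be G1 G2 ltac:(lra)).
    rewrite (sum_n_plus (G := R_AbelianMonoid) (fun k => Cmod (y (be k) - y (al k))) (fun k => be k - al k)) in G4.
    change (plus ?x ?y) with (x + y) in G4.
    assert (K * (sum_n (fun k => Cmod (y (be k) - y (al k))) n + sum_n (fun k => be k - al k) n) <= K * (2 * eta)).
    { apply Rmult_le_compat_l; [assumption |]. lra. }
    unfold plus in G4; simpl in G4. lra. }
  apply Rnot_lt_le. intros Hlt.
  set (c := t - s + 2 * K + 1).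
  assert (Hc : 0 < c) by (unfold c; lra).
  assert (T := Heta ((V t - V s) / (2 * c)) ltac:(apply Rdiv_lt_0_compat; lra)).
  assert (T2 : (V t - V s) / (2 * c) * (t - s + 2 * K) <= (V t - V s) / (2 * c) * c).
  { apply Rmult_le_compat_l; [apply Rlt_le, Rdiv_lt_0_compat; lra | unfold c; lra]. }
  replace ((V t - V s) / (2 * c) * c) with ((V t - V s) / 2) in T2 by (field; lra). lra.
Qed.

Lemma null_set_add_point (E : R -> Prop) (c : R) : null_set E -> null_set (fun u => E u \/ u = c).
Proof.
  intros H eta He. destruct (H (eta / 2)) as [a [b [H1 [H2 H3]]]]; [lra |].
  exists (fun k => match k with 0%nat => c - eta / 4 | S j => a j end),
         (fun k => match k with 0%nat => c + eta / 4 | S j => b j end).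
  split; [| split].
  - intros [| k]; [lra | apply H1].
  - intros t [Ht | ->].
    + destruct (H2 t Ht) as [k Hk]. exists (S k). exact Hk.
    + exists 0%nat. lra.
  - intros n. destruct n as [| n].
    + rewrite sum_n_0. lra.
    + assert (T : sum_n (fun k => match k with 0%nat => c + eta / 4 | S j => b j end - match k with 0%nat => c - eta / 4 | S j => a j end) (S n)
        = eta / 2 + sum_n (fun k => b k - a k) n).
      { induction n as [| n IH].
        - rewrite sum_n_S, !sum_n_0. lra.
        - rewrite sum_n_S, IH, (sum_n_S (fun k => b k - a k)). lra. }
      rewrite T. specialize (H3 n). lra.
Qed.

Lemma null_set_subset (E F : R -> Prop) : (forall u, E u -> F u) -> null_set F -> null_set E.
Proof.
  intros Hs H eta He. destruct (H eta He) as [a [b [H1 [H2 H3]]]].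
  exists a, b. split; [assumption |]. split; [| assumption]. intros t Ht. now apply H2, Hs.
Qed.

Lemma null_set_countable (c : nat -> R) (E : R -> Prop) : (forall u, E u -> exists k, u = c k) -> null_set E.
Proof.
  intros H eta He.
  assert (Hp : forall k, 0 < (1 / 2) ^ k) by (intros; apply pow_lt; lra).
  (* Intervals of length [eta / 2 * (1 / 2) ^ k] have total length below [eta]. *)
  exists (fun k => c k - eta / 4 * (1 / 2) ^ k), (fun k => c k + eta / 4 * (1 / 2) ^ k).
  assert (Hq : forall k, 0 < eta / 4 * (1 / 2) ^ k) by (intros k; apply Rmult_lt_0_compat; [lra | apply Hp]).
  split; [intros k; specialize (Hq k); lra |]. split.
  - intros t Ht. destruct (H t Ht) as [k ->]. exists k. specialize (Hq k). lra.
  - intros n.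
    assert (T : sum_n (fun k => c k + eta / 4 * (1 / 2) ^ k - (c k - eta / 4 * (1 / 2) ^ k)) n
        = eta * (1 - 1 / 2 * (1 / 2) ^ n)).
    { induction n as [| n IH].
      - rewrite sum_n_0. simpl. lra.
      - rewrite sum_n_S, IH. simpl. lra. }
    rewrite T. specialize (Hp n). nra.
Qed.

(** For intervals that contain [u], differentiability at the single point [u] bounds the increment:
    the errors on the two sides of [u] add up. *)
Lemma derive_nonpos_straddle (V : R -> R) (u l : R) : is_derive V u l -> l <= 0 ->
  forall eta, 0 < eta -> exists d, 0 < d /\
    forall a b, a <= u <= b -> u - a < d -> b - u < d -> V b - V a <= eta * (b - a).
Proof.
  intros H Hl eta He.
  destruct H as [_ H]. destruct (H u (fun P HP => HP) (mkposreal eta He)) as [d Hd].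
  exists d. split; [apply cond_pos |]. intros a b Hab Ha Hb.
  assert (Ba : ball (M := AbsRing_UniformSpace R_AbsRing) u d a).
  { change (Rabs (a - u) < d). rewrite Rabs_left1; lra. }
  assert (Bb : ball (M := AbsRing_UniformSpace R_AbsRing) u d b).
  { change (Rabs (b - u) < d). rewrite Rabs_pos_eq; lra. }
  assert (Ea := Hd a Ba). assert (Eb := Hd b Bb).
  unfold norm, minus, plus, opp, scal in Ea, Eb; simpl in Ea, Eb. unfold abs, mult in Ea, Eb; simpl in Ea, Eb.
  rewrite (Rabs_left1 (a + - u)) in Ea by lra. rewrite (Rabs_pos_eq (b + - u)) in Eb by lra.
  apply Rabs_le_between in Ea. apply Rabs_le_between in Eb. nra.
Qed.

(** * Monotonicity, crossing and uniqueness along Filippov solutions *)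

Section Filippov.

Variables (D : C -> Prop) (Xp Xm : C -> C).

Lemma filippov_sub (s t s' t' : R) (y : R -> C) : s <= s' -> t' <= t ->
  filippov_solution D Xp Xm s t y -> filippov_solution D Xp Xm s' t' y.
Proof.
  intros Hs Ht [H1 [H2 H3]]. split; [intros; apply H1; lra |]. split.
  - intros eta He. destruct (H2 eta He) as [d [Hd H]]. exists d. split; [assumption |].
    intros n a b Ha Hb. apply H; [| assumption]. intros k Hk. specialize (Ha k Hk). lra.
  - eapply null_set_subset; [| exact H3]. intros u [Hu Hn]. split; [lra | exact Hn].
Qed.

Lemma filippov_continuous (s t : R) (y : R -> C) : filippov_solution D Xp Xm s t y ->
  forall u, s <= u <= t -> forall e, 0 < e -> exists d, 0 < d /\
    forall u', s <= u' <= t -> Rabs (u' - u) < d -> Cmod (y u' - y u) < e.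
Proof.
  intros [_ [H _]] u Hu e He. destruct (H e He) as [d [Hd Hac]]. exists d. split; [assumption |].
  intros u' Hu' Hd'.
  destruct (Rle_lt_dec u u') as [Hle | Hlt].
  - specialize (Hac 0%nat (fun _ => u) (fun _ => u')). rewrite !sum_n_0 in Hac.
    apply Hac; intros; try lia; try lra. apply Rabs_def2 in Hd'. lra.
  - specialize (Hac 0%nat (fun _ => u') (fun _ => u)). rewrite !sum_n_0 in Hac.
    rewrite Cmod_minus_sym. apply Hac; intros; try lia; try lra. apply Rabs_def2 in Hd'. lra.
Qed.

(** The increment bound transfers the absolute continuity of [y] to [V]; without it, a nonpositive
    derivative almost everywhere would not control the growth of [V]. *)
Lemma filippov_nonincreasing (s t K : R) (y : R -> C) (V : R -> R) :
  s <= t -> filippov_solution D Xp Xm s t y -> 0 <= K ->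
  (forall a b, s <= a -> a <= b -> b <= t -> V b - V a <= K * (Cmod (y b - y a) + (b - a))) ->
  (forall u v, s < u < t -> filippov_set Xp Xm (y u) v -> vderiv y u v ->
     exists l, l <= 0 /\ is_derive V u l) ->
  V t <= V s.
Proof.
  intros Hst [_ [Hac Hnull]] HK Hdom Hder.
  (* The endpoints join the exceptional set because the null set in [filippov_solution] concerns
     interior times. *)
  apply (@ac_nonincreasing y V
    (fun u => ((s < u < t /\ ~ exists v, filippov_set Xp Xm (y u) v /\ vderiv y u v) \/ u = s) \/ u = t) s t K); try assumption.
  - apply null_set_add_point, null_set_add_point. exact Hnull.
  - intros u Hu HE eta He.
    assert (Hu' : s < u < t).
    { apply not_or_and in HE. destruct HE as [HE Ht]. apply not_or_and in HE. destruct HE as [HE Hs].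
      split; apply Rnot_le_lt; intros Hle; [apply Hs | apply Ht]; lra. }
    assert (Hv : exists v, filippov_set Xp Xm (y u) v /\ vderiv y u v).
    { apply NNPP. intros Hn. apply HE. left; left. split; assumption. }
    destruct Hv as [v [Hv1 Hv2]]. destruct (Hder u v Hu' Hv1 Hv2) as [l [Hl HV]].
    destruct (derive_nonpos_straddle HV Hl He) as [d [Hd Hd']]. exists d. split; [assumption |].
    intros a b Ha Hb. apply Hd'. lra.
Qed.

(** The chord argument of [mean_value_curve] with an absolutely continuous [y]: the component of
    [y - x] along the total displacement [d], minus [M * Cmod d] times the time, is
    nonincreasing. *)
Lemma filippov_mean_value (s t M Kx : R) (y x xd : R -> C) :
  s <= t -> filippov_solution D Xp Xm s t y -> 0 <= Kx ->
  (forall a b, s <= a -> a <= b -> b <= t -> Cmod (x b - x a) <= Kx * (b - a)) ->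
  (forall u, s < u < t -> vderiv x u (xd u)) ->
  (forall u v, s < u < t -> filippov_set Xp Xm (y u) v -> Cmod (v - xd u) <= M) ->
  0 <= M ->
  Cmod ((y t - x t) - (y s - x s)) <= M * (t - s).
Proof.
  intros Hst Hy HK Hx Hxd Hv HM.
  set (d := ((y t - x t) - (y s - x s))%C).
  set (V := fun u => Re (Cconj d * (y u - x u)) - M * Cmod d * u).
  assert (Hd0 := Cmod_ge_0 d).
  assert (HV : V t <= V s).
  { apply (@filippov_nonincreasing s t (Cmod d * (1 + Kx)) y V Hst Hy).
    - apply Rmult_le_pos; lra.
    - intros a b Ha Hab Hb. unfold V.
      replace (Re (Cconj d * (y b - x b)) - M * Cmod d * b - (Re (Cconj d * (y a - x a)) - M * Cmod d * a))
        with (Re (Cconj d * ((y b - y a) - (x b - x a))) - M * Cmod d * (b - a)) by (simpl; ring).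
      assert (B : Re (Cconj d * (y b - y a - (x b - x a))) <= Cmod d * (Cmod (y b - y a) + Kx * (b - a))).
      { eapply Rle_trans; [apply Rle_abs |]. eapply Rle_trans; [apply re_le_Cmod |].
        rewrite Cmod_mult, Cmod_conj. apply Rmult_le_compat_l; [assumption |].
        eapply Rle_trans; [apply Cmod_triangle |]. rewrite Cmod_opp.
        specialize (Hx a b Ha Hab Hb). lra. }
      assert (0 <= M * Cmod d * (b - a)) by (repeat apply Rmult_le_pos; lra).
      assert (P := Cmod_ge_0 (y b - y a)).
      assert (Cmod d * (Cmod (y b - y a) + Kx * (b - a)) <= Cmod d * (1 + Kx) * (Cmod (y b - y a) + (b - a))).
      { rewrite Rmult_assoc. apply Rmult_le_compat_l; [assumption |]. nra. }
      lra.
    - intros u v Hu Hfv Hyv.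
      exists (Re (Cconj d * (v - xd u)) - M * Cmod d). split.
      + assert (B : Re (Cconj d * (v - xd u)) <= Cmod d * M); [| lra].
        eapply Rle_trans; [apply Rle_abs |]. eapply Rle_trans; [apply re_le_Cmod |].
        rewrite Cmod_mult, Cmod_conj. apply Rmult_le_compat_l; [assumption |]. now apply Hv.
      + apply (is_derive_minus (K := R_AbsRing) (V := R_NormedModule)).
        * apply is_derive_re_mult. apply vderiv_minus; [assumption | now apply Hxd].
        * auto_derive; [trivial | ring]. }
  assert (E : Re (Cconj d * (y t - x t)) - Re (Cconj d * (y s - x s)) = Cmod d * Cmod d).
  { rewrite <- Re_conj_mult_self. unfold d. simpl. ring. }
  unfold V in HV.
  destruct (Req_dec (Cmod d) 0) as [Hz | Hz].
  - rewrite Hz. apply Rmult_le_pos; lra.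
  - apply (Rmult_le_reg_l (Cmod d)); [lra |]. nra.
Qed.

End Filippov.

Lemma filippov_set_im_le (Xp Xm : C -> C) (z v : C) (c : R) :
  Im (Xp z) <= c -> Im (Xm z) <= c -> filippov_set Xp Xm z v -> Im v <= c.
Proof.
  intros H1 H2 [[_ ->] | [[_ ->] | [_ [l [Hl ->]]]]]; try assumption.
  rewrite Im_plus, !Im_mult. change (Re (RtoC l)) with l. change (Im (RtoC l)) with 0.
  change (Re (RtoC (1 - l))) with (1 - l). change (Im (RtoC (1 - l))) with 0. nra.
Qed.

Lemma filippov_set_im_ge (Xp Xm : C -> C) (z v : C) (c : R) :
  c <= Im (Xp z) -> c <= Im (Xm z) -> filippov_set Xp Xm z v -> c <= Im v.
Proof.
  intros H1 H2 [[_ ->] | [[_ ->] | [_ [l [Hl ->]]]]]; try assumption.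
  rewrite Im_plus, !Im_mult. change (Re (RtoC l)) with l. change (Im (RtoC l)) with 0.
  change (Re (RtoC (1 - l))) with (1 - l). change (Im (RtoC (1 - l))) with 0. nra.
Qed.

Lemma ccont_im_lt (g : C -> C) (z : C) (c : R) : ccont g z -> Im (g z) < c ->
  exists d, 0 < d /\ forall y, Cmod (y - z) < d -> Im (g y) < c.
Proof.
  intros H Hc. destruct (H (c - Im (g z))) as [d [Hd Hd']]; [lra |].
  exists d. split; [assumption |]. intros y Hy. specialize (Hd' y Hy).
  assert (E := Rle_lt_trans _ _ _ (im_le_Cmod _) Hd'). rewrite Im_minus in E.
  apply Rabs_def2 in E. lra.
Qed.

Lemma ccont_im_gt (g : C -> C) (z : C) (c : R) : ccont g z -> c < Im (g z) ->
  exists d, 0 < d /\ forall y, Cmod (y - z) < d -> c < Im (g y).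
Proof.
  intros H Hc. destruct (H (Im (g z) - c)) as [d [Hd Hd']]; [lra |].
  exists d. split; [assumption |]. intros y Hy. specialize (Hd' y Hy).
  assert (E := Rle_lt_trans _ _ _ (im_le_Cmod _) Hd'). rewrite Im_minus in E.
  apply Rabs_def2 in E. lra.
Qed.

Section Uniqueness.

Variables (D : C -> Prop) (Xp Xm : C -> C).

(** Near the crossing point both fields have imaginary part below some [c < 0], hence so has every
    convex combination. Whatever velocity is selected on the line, [Im (y u) - c * u] is
    nonincreasing, which excludes sliding. *)
Lemma filippov_crosses_down (s t : R) (y : R -> C) :
  s < t -> filippov_solution D Xp Xm s t y -> Im (y s) <= 0 ->
  ccont Xp (y s) -> ccont Xm (y s) -> Im (Xp (y s)) < 0 -> Im (Xm (y s)) < 0 ->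
  exists d, 0 < d /\ forall u, s < u <= t -> u < s + d -> Im (y u) < 0.
Proof.
  intros Hst Hy Hs HXp HXm Hp Hm.
  set (c := Rmax (Im (Xp (y s))) (Im (Xm (y s))) / 2).
  assert (Hmax : Rmax (Im (Xp (y s))) (Im (Xm (y s))) < 0) by (apply Rmax_lub_lt; lra).
  assert (Hc : c < 0) by (unfold c; lra).
  destruct (ccont_im_lt (c := c) HXp) as [d1 [Hd1 H1]].
  { assert (T := Rmax_l (Im (Xp (y s))) (Im (Xm (y s)))). unfold c in *. lra. }
  destruct (ccont_im_lt (c := c) HXm) as [d2 [Hd2 H2]].
  { assert (T := Rmax_r (Im (Xp (y s))) (Im (Xm (y s)))). unfold c in *. lra. }
  destruct (filippov_continuous Hy (u := s) ltac:(lra) (e := Rmin d1 d2)) as [d [Hd Hcont]]; [now apply Rmin_pos |].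
  exists d. split; [assumption |]. intros u Hu Hud.
  assert (HV : Im (y u) - c * u <= Im (y s) - c * s).
  { apply (@filippov_nonincreasing D Xp Xm s u (1 - c) y (fun w => Im (y w) - c * w)).
    - lra.
    - apply (filippov_sub (s := s) (t := t)); [lra | lra | exact Hy].
    - lra.
    - intros a b Ha Hab Hb.
      assert (T := Rle_trans _ _ _ (Rle_abs _) (im_le_Cmod (y b - y a))). rewrite Im_minus in T.
      assert (P := Cmod_ge_0 (y b - y a)). nra.
    - intros w v Hw Hv Hyv. exists (Im v - c). split.
      + assert (Im v <= c); [| lra].
        assert (Hwd : Cmod (y w - y s) < Rmin d1 d2) by (apply Hcont; [lra | apply Rabs_def1; lra]).
        apply (filippov_set_im_le (Xp := Xp) (Xm := Xm) (z := y w)); [| | exact Hv]; apply Rlt_le.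
        * apply H1. eapply Rlt_le_trans; [exact Hwd | apply Rmin_l].
        * apply H2. eapply Rlt_le_trans; [exact Hwd | apply Rmin_r].
      + apply (is_derive_minus (K := R_AbsRing) (V := R_NormedModule)).
        * apply (proj1 (vderiv_re_im _ _ _) Hyv).
        * auto_derive; [trivial | ring]. }
  nra.
Qed.

Lemma filippov_crosses_up (s t : R) (y : R -> C) :
  s < t -> filippov_solution D Xp Xm s t y -> 0 <= Im (y s) ->
  ccont Xp (y s) -> ccont Xm (y s) -> 0 < Im (Xp (y s)) -> 0 < Im (Xm (y s)) ->
  exists d, 0 < d /\ forall u, s < u <= t -> u < s + d -> 0 < Im (y u).
Proof.
  intros Hst Hy Hs HXp HXm Hp Hm.
  set (c := Rmin (Im (Xp (y s))) (Im (Xm (y s))) / 2).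
  assert (Hmin : 0 < Rmin (Im (Xp (y s))) (Im (Xm (y s)))) by (apply Rmin_glb_lt; lra).
  assert (Hc : 0 < c) by (unfold c; lra).
  destruct (ccont_im_gt (c := c) HXp) as [d1 [Hd1 H1]].
  { assert (T := Rmin_l (Im (Xp (y s))) (Im (Xm (y s)))). unfold c in *. lra. }
  destruct (ccont_im_gt (c := c) HXm) as [d2 [Hd2 H2]].
  { assert (T := Rmin_r (Im (Xp (y s))) (Im (Xm (y s)))). unfold c in *. lra. }
  destruct (filippov_continuous Hy (u := s) ltac:(lra) (e := Rmin d1 d2)) as [d [Hd Hcont]]; [now apply Rmin_pos |].
  exists d. split; [assumption |]. intros u Hu Hud.
  assert (HV : c * u - Im (y u) <= c * s - Im (y s)).
  { apply (@filippov_nonincreasing D Xp Xm s u (1 + c) y (fun w => c * w - Im (y w))).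
    - lra.
    - apply (filippov_sub (s := s) (t := t)); [lra | lra | exact Hy].
    - lra.
    - intros a b Ha Hab Hb.
      assert (T := Rle_trans _ _ _ (Rle_abs _) (im_le_Cmod (y a - y b))).
      rewrite Cmod_minus_sym, Im_minus in T.
      assert (P := Cmod_ge_0 (y b - y a)). nra.
    - intros w v Hw Hv Hyv. exists (c - Im v). split.
      + assert (c <= Im v); [| lra].
        assert (Hwd : Cmod (y w - y s) < Rmin d1 d2) by (apply Hcont; [lra | apply Rabs_def1; lra]).
        apply (filippov_set_im_ge (Xp := Xp) (Xm := Xm) (z := y w)); [| | exact Hv]; apply Rlt_le.
        * apply H1. eapply Rlt_le_trans; [exact Hwd | apply Rmin_l].
        * apply H2. eapply Rlt_le_trans; [exact Hwd | apply Rmin_r].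
      + apply (is_derive_minus (K := R_AbsRing) (V := R_NormedModule)).
        * auto_derive; [trivial | ring].
        * apply (proj1 (vderiv_re_im _ _ _) Hyv). }
  nra.
Qed.

Lemma vderiv_continuous (x : R -> C) (t : R) (v : C) : vderiv x t v ->
  forall e, 0 < e -> exists d, 0 < d /\ forall s, Rabs (s - t) < d -> Cmod (x s - x t) < e.
Proof.
  intros H e He. destruct (vderiv_continuous_re_im _ _ _ H) as [H1 H2].
  destruct (proj1 (continuous_eps _ _) H1 (e / 2) ltac:(lra)) as [d1 [Hd1 E1]].
  destruct (proj1 (continuous_eps _ _) H2 (e / 2) ltac:(lra)) as [d2 [Hd2 E2]].
  exists (Rmin d1 d2). split; [now apply Rmin_pos |]. intros s Hs.
  specialize (E1 s (Rlt_le_trans _ _ _ Hs (Rmin_l _ _))).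
  specialize (E2 s (Rlt_le_trans _ _ _ Hs (Rmin_r _ _))).
  eapply Rle_lt_trans; [apply Cmod_le_re_im |]. rewrite Re_minus, Im_minus. lra.
Qed.

(** A bound on [y - x] over a time at most [d], with [L * d <= 1 / 2], is halved by each use of the
    mean value estimate, so the difference vanishes. *)
Lemma filippov_unique_local (X : C -> C) (x y : R -> C) (s t : R) :
  s < t -> filippov_solution D Xp Xm s t y -> y s = x s ->
  (forall u, s <= u <= t -> vderiv x u (X (x u))) -> loclip X (x s) ->
  (exists d, 0 < d /\ forall u v, s < u < t -> u < s + d -> filippov_set Xp Xm (y u) v -> v = X (y u)) ->
  exists d, 0 < d /\ forall u, s <= u <= t -> u < s + d -> y u = x u.
Proof.
  intros Hst Hy Hs Hx [L [r [HL [Hr HXL]]]] [d0 [Hd0 Hside]].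
  destruct (filippov_continuous Hy (u := s) ltac:(lra) Hr) as [d1 [Hd1 Hyc]].
  destruct (vderiv_continuous (Hx s ltac:(lra)) Hr) as [d2 [Hd2 Hxc]].
  (* [/ (2 * L + 1)] gives the contraction factor 1/2 even when [L = 0]; the other bounds keep [y]
     on its side and both curves in the Lipschitz ball. *)
  set (d := Rmin (Rmin d0 (/ (2 * L + 1))) (Rmin d1 d2)).
  assert (Hinv : 0 < / (2 * L + 1)) by (apply Rinv_0_lt_compat; lra).
  assert (Hd : 0 < d) by (repeat apply Rmin_pos; assumption).
  assert (Hda : d <= d0) by (eapply Rle_trans; [apply Rmin_l | apply Rmin_l]).
  assert (Hdb : d <= / (2 * L + 1)) by (eapply Rle_trans; [apply Rmin_l | apply Rmin_r]).
  assert (Hdc : d <= d1) by (eapply Rle_trans; [apply Rmin_r | apply Rmin_l]).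
  assert (Hdd : d <= d2) by (eapply Rle_trans; [apply Rmin_r | apply Rmin_r]).
  assert (HLd : L * d <= 1 / 2).
  { apply Rle_trans with (L * / (2 * L + 1)); [apply Rmult_le_compat_l; lra |].
    apply (Rmult_le_reg_r (2 * L + 1)); [lra |]. rewrite Rmult_assoc, Rinv_l by lra. lra. }
  exists d. split; [assumption |].
  assert (Hyr : forall u, s <= u <= t -> u < s + d -> Cmod (y u - x s) < r).
  { intros u Hu Hud. rewrite <- Hs. apply Hyc; [lra | apply Rabs_def1; lra]. }
  assert (Hxr : forall u, s <= u <= t -> u < s + d -> Cmod (x u - x s) < r).
  { intros u Hu Hud. apply Hxc. apply Rabs_def1; lra. }
  set (KX := Cmod (X (x s)) + L * r).
  assert (HKX : 0 <= KX).
  { unfold KX. assert (T := Cmod_ge_0 (X (x s))). assert (0 <= L * r) by (apply Rmult_le_pos; lra). lra. }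
  assert (HX0 : Cmod (x s - x s) < r) by now rewrite Cmod_minus_self.
  assert (Hxlip : forall u a b, u < s + d -> u <= t -> s <= a -> a <= b -> b <= u -> Cmod (x b - x a) <= KX * (b - a)).
  { intros u a b Hud Hut Ha Hab Hb. apply (mean_value_curve x (fun w => X (x w))); [assumption |].
    intros w Hw. split; [apply Hx; lra |].
    assert (T := HXL (x s) (x w) HX0 (Hxr w ltac:(lra) ltac:(lra))).
    assert (T2 := Cmod_triangle_rev (X (x w)) (X (x s))).
    assert (T3 := Hxr w ltac:(lra) ltac:(lra)).
    assert (L * Cmod (x w - x s) <= L * r) by (apply Rmult_le_compat_l; lra).
    unfold KX. lra. }
  assert (Hit : forall n u, s <= u <= t -> u < s + d -> Cmod (y u - x u) <= 2 * r * (1 / 2) ^ n).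
  { induction n as [| n IH]; intros u Hu Hud.
    - simpl. eapply Rle_trans; [apply (Cmod_minus_triangle _ (x s)) |].
      rewrite (Cmod_minus_sym (x s)). assert (T1 := Hyr u Hu Hud). assert (T2 := Hxr u Hu Hud). lra.
    - assert (Hp : 0 < (1 / 2) ^ n) by (apply pow_lt; lra).
      assert (T : Cmod (y u - x u - (y s - x s)) <= L * (2 * r * (1 / 2) ^ n) * (u - s)).
      { apply (@filippov_mean_value D Xp Xm s u (L * (2 * r * (1 / 2) ^ n)) KX y x (fun w => X (x w))).
        - lra.
        - apply (filippov_sub (s := s) (t := t)); [lra | lra | exact Hy].
        - exact HKX.
        - intros a b Ha Hab Hb. apply (Hxlip u); lra.
        - intros w Hw. apply Hx. lra.
        - intros w v Hw Hv. rewrite (Hside w v) by (try lra; assumption).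
          eapply Rle_trans; [apply HXL; [apply Hxr | apply Hyr]; lra |].
          apply Rmult_le_compat_l; [assumption |]. apply IH; lra.
        - apply Rmult_le_pos; [assumption |]. apply Rmult_le_pos; lra. }
      rewrite Hs in T. replace (y u - x u - (x s - x s))%C with (y u - x u)%C in T by ring.
      eapply Rle_trans; [exact T |]. rewrite <- tech_pow_Rmult.
      assert (0 <= 2 * r * (1 / 2) ^ n) by (apply Rmult_le_pos; lra).
      assert (L * (u - s) <= 1 / 2).
      { eapply Rle_trans; [| exact HLd]. apply Rmult_le_compat_l; lra. }
      nra. }
  intros u Hu Hud.
  assert (Hz : Cmod (y u - x u) = 0).
  { apply Rle_antisym; [| apply Cmod_ge_0]. apply le_epsilon. intros e He.
    destruct (pow_lt_1_zero (1 / 2)) with (y := e / (2 * r)) as [N HN].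
    { rewrite Rabs_pos_eq; lra. } { apply Rdiv_lt_0_compat; lra. }
    specialize (HN N (le_n N)). rewrite Rabs_pos_eq in HN by (apply pow_le; lra).
    specialize (Hit N u Hu Hud).
    apply (Rmult_lt_compat_l (2 * r)) in HN; [| lra].
    replace (2 * r * (e / (2 * r))) with e in HN by (field; lra). lra. }
  apply Cmod_eq_0 in Hz. replace (y u) with (y u - x u + x u)%C by ring. rewrite Hz. ring.
Qed.

(** The side condition is asked only at times where [y] already agrees with [x], and only for the
    near future. It can thus be checked on the known curve [x], also where that curve leaves the
    discontinuity line. *)
Lemma filippov_unique (X : C -> C) (x y : R -> C) (t : R) :
  0 <= t -> filippov_solution D Xp Xm 0 t y -> y 0 = x 0 ->
  (forall u, 0 <= u <= t -> vderiv x u (X (x u))) ->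
  (forall u, 0 <= u <= t -> loclip X (x u)) ->
  (forall s, 0 <= s < t -> y s = x s ->
    exists d, 0 < d /\ forall u v, s < u < t -> u < s + d -> filippov_set Xp Xm (y u) v -> v = X (y u)) ->
  forall u, 0 <= u <= t -> y u = x u.
Proof.
  intros Ht Hy H0 Hx HX Hside.
  set (G := fun c => forall u, 0 <= u <= c -> y u = x u).
  assert (HG : G t); [| exact HG].
  apply (@real_induction G 0 t Ht).
  - intros u Hu.
    destruct (classic (forall w, 0 <= w < u -> y w = x w)) as [Heq | Hneq].
    + assert (Hyx : y u = x u).
      { destruct (Req_dec u 0) as [-> | Hu0]; [exact H0 |].
        apply NNPP. intros Hn.
        assert (Hpos : 0 < Cmod (y u - x u)).
        { apply Cmod_gt_0. intros E. apply Hn. replace (y u) with (y u - x u + x u)%C by ring. rewrite E. ring. }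
        set (e := Cmod (y u - x u) / 2).
        destruct (filippov_continuous Hy Hu (e := e)) as [d1 [Hd1 H1]]; [unfold e; lra |].
        destruct (vderiv_continuous (Hx u Hu) (e := e)) as [d2 [Hd2 H2]]; [unfold e; lra |].
        set (d := Rmin (Rmin d1 d2 / 2) u).
        assert (Hm : 0 < Rmin d1 d2) by now apply Rmin_pos.
        assert (Hm1 : Rmin d1 d2 <= d1) by apply Rmin_l. assert (Hm2 : Rmin d1 d2 <= d2) by apply Rmin_r.
        assert (Hd0 : 0 < d) by (apply Rmin_pos; lra).
        assert (Hda : d <= Rmin d1 d2 / 2) by apply Rmin_l. assert (Hdb : d <= u) by apply Rmin_r.
        specialize (H1 (u - d) ltac:(lra) ltac:(apply Rabs_def1; lra)).
        specialize (H2 (u - d) ltac:(apply Rabs_def1; lra)).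
        rewrite Heq in H1 by lra.
        assert (T := Cmod_minus_triangle (y u) (x (u - d)) (x u)).
        rewrite (Cmod_minus_sym (y u) (x (u - d))) in T. unfold e in *. lra. }
      destruct (Rle_lt_or_eq_dec u t) as [Hut | ->]; [lra | |].
      * destruct (@filippov_unique_local X (fun w => x w) y u t Hut) as [d [Hd Hd']].
        -- apply (filippov_sub (s := 0) (t := t)); [lra | lra | exact Hy].
        -- exact Hyx.
        -- intros w Hw. apply Hx. lra.
        -- apply HX. lra.
        -- apply Hside; [lra | exact Hyx].
        -- exists d. split; [assumption |]. intros a b Ha Hb Hda Hdb HGa w Hw.
           destruct (Rlt_le_dec w u); [apply Heq; lra | apply Hd'; lra].
      * exists 1. split; [lra |]. intros a b Ha Hb _ _ _ w Hw.
        destruct (Rlt_le_dec w t); [apply Heq; lra |]. now replace w with t by lra.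
    (* A disagreement at [w < u] makes [G a] false for all [a] close to [u], so the step holds
       vacuously. *)
    + apply not_all_ex_not in Hneq. destruct Hneq as [w Hw]. apply imply_to_and in Hw. destruct Hw as [Hw Hn].
      exists (u - w). split; [lra |]. intros a b Ha Hb Hda Hdb HGa. exfalso. apply Hn, HGa. lra.
  - intros u Hu. now replace u with 0 by lra.
Qed.

End Uniqueness.

Lemma lipschitz_absolutely_continuous (x : R -> C) (s t K : R) : 0 <= K ->
  (forall a b, s <= a -> a <= b -> b <= t -> Cmod (x b - x a) <= K * (b - a)) ->
  absolutely_continuous x s t.
Proof.
  intros HK H eta He. exists (eta / (K + 1)). split; [apply Rdiv_lt_0_compat; lra |].
  intros n a b Hab Hord Hsum.
  apply Rle_lt_trans with ((K + 1) * sum_n (fun k => b k - a k) n).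
  - rewrite <- (sum_n_mult_l (K := R_Ring) (K + 1)). apply sum_n_le_compat. intros k Hk.
    unfold mult; simpl. specialize (Hab k Hk).
    eapply Rle_trans; [apply H; lra |]. apply Rmult_le_compat_r; lra.
  - apply (Rmult_lt_compat_l (K + 1)) in Hsum; [| lra].
    replace ((K + 1) * (eta / (K + 1))) with eta in Hsum by (field; lra). exact Hsum.
Qed.

Lemma null_set_shift (E : R -> Prop) (c : R) : null_set E -> null_set (fun u => E (u + c)).
Proof.
  intros H eta He. destruct (H eta He) as [a [b [H1 [H2 H3]]]].
  exists (fun k => a k - c), (fun k => b k - c). split; [intros k; specialize (H1 k); lra |]. split.
  - intros t Ht. destruct (H2 _ Ht) as [k Hk]. exists k. lra.
  - intros n. rewrite (sum_n_ext _ (fun k => b k - a k)); [apply H3 |]. intros k.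
    assert (E0 : b k - c - (a k - c) = b k - a k) by ring. exact E0.
Qed.

Lemma vderiv_time_shift (x : R -> C) (t c : R) (v : C) :
  vderiv x (t + c) v <-> vderiv (fun u => x (u + c)) t v.
Proof.
  rewrite !vderiv_iff. split; intros H e He; destruct (H e He) as [d [Hd Hd']];
    exists d; (split; [assumption |]); intros s Hs.
  - specialize (Hd' (s + c)). replace (s + c - (t + c)) with (s - t) in Hd' by ring. now apply Hd'.
  - specialize (Hd' (s - c)). replace (s - c - t) with (s - (t + c)) in Hd' by ring.
    replace (s - c + c) with s in Hd' by ring. now apply Hd'.
Qed.

Lemma filippov_shift (D : C -> Prop) (Xp Xm : C -> C) (s t c : R) (y : R -> C) :
  filippov_solution D Xp Xm (s + c) (t + c) y -> filippov_solution D Xp Xm s t (fun u => y (u + c)).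
Proof.
  intros [H1 [H2 H3]]. split; [intros; apply H1; lra |]. split.
  - intros eta He. destruct (H2 eta He) as [d [Hd H]]. exists d. split; [assumption |].
    intros n a b Ha Hb Hs. apply (H n (fun k => a k + c) (fun k => b k + c)).
    + intros k Hk. specialize (Ha k Hk). lra.
    + intros k Hk. specialize (Hb k Hk). lra.
    + rewrite (sum_n_ext _ (fun k => b k - a k)); [exact Hs |]. intros k.
      assert (E0 : b k + c - (a k + c) = b k - a k) by ring. exact E0.
  - eapply null_set_subset; [| apply (null_set_shift c H3)]. simpl.
    intros u [Hu Hn]. split; [lra |]. intros [v [Hv1 Hv2]]. apply Hn. exists v. split; [exact Hv1 |].
    now apply vderiv_time_shift.
Qed.

(** * The radial equation *)

(** Extends a function from an interval or rectangle to the whole line or plane without increasing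
    its oscillation, so that global statements apply. *)
Definition clamp (a b x : R) : R := Rmax a (Rmin x b).

Lemma clamp_range (a b x : R) : a <= b -> a <= clamp a b x <= b.
Proof. intros H. unfold clamp. split; [apply Rmax_l |]. apply Rmax_lub; [lra | apply Rmin_r]. Qed.

Lemma clamp_id (a b x : R) : a <= x <= b -> clamp a b x = x.
Proof. intros H. unfold clamp. rewrite Rmin_left by lra. apply Rmax_right; lra. Qed.

Lemma clamp_lipschitz (a b x y : R) : Rabs (clamp a b x - clamp a b y) <= Rabs (x - y).
Proof. unfold clamp, Rmax, Rmin. repeat destruct Rle_dec; unfold Rabs; repeat destruct Rcase_abs; lra. Qed.

Lemma continuity_2d_clamp (F : R -> R -> R) (a b c d r t : R) :
  continuity_2d_pt F (clamp a b r) (clamp c d t) ->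
  continuity_2d_pt (fun r t => F (clamp a b r) (clamp c d t)) r t.
Proof.
  intros H e. destruct (H e) as [dl Hd]. exists dl. intros u v Hu Hv. apply Hd.
  - eapply Rle_lt_trans; [apply clamp_lipschitz | exact Hu].
  - eapply Rle_lt_trans; [apply clamp_lipschitz | exact Hv].
Qed.

Lemma continuous_along (F : R -> R -> R) (u : R -> R) (t : R) :
  continuity_2d_pt F (u t) t -> continuous u t -> continuous (fun s => F (u s) s) t.
Proof.
  intros HF Hu. apply continuous_eps. intros e He. destruct (HF (mkposreal e He)) as [d Hd].
  destruct (proj1 (continuous_eps _ _) Hu d (cond_pos d)) as [d' [Hd' Hu']].
  exists (Rmin d d'). split; [apply Rmin_pos; [apply cond_pos | assumption] |]. intros s Hs.
  apply Hd.
  - apply Hu'. eapply Rlt_le_trans; [exact Hs | apply Rmin_r].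
  - eapply Rlt_le_trans; [exact Hs | apply Rmin_l].
Qed.

Lemma ex_RInt_cont (f : R -> R) (a b : R) : (forall t, continuous f t) -> ex_RInt f a b.
Proof. intros H. apply (ex_RInt_continuous (V := R_CompleteNormedModule)). auto. Qed.

Lemma abs_RInt_le_mult (f : R -> R) (a b K : R) : (forall t, continuous f t) ->
  (forall t, Rmin a b <= t <= Rmax a b -> Rabs (f t) <= K) -> Rabs (RInt f a b) <= K * Rabs (b - a).
Proof.
  intros Hc Hb. destruct (Rle_lt_dec a b) as [Hab | Hab].
  - rewrite Rmin_left, Rmax_right in Hb by lra. rewrite (Rabs_pos_eq (b - a)) by lra.
    now apply abs_RInt_le_cont.
  - rewrite Rmin_right, Rmax_left in Hb by lra. rewrite (Rabs_left (b - a)) by lra.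
    rewrite <- (opp_RInt_swap (V := R_CompleteNormedModule)) by now apply ex_RInt_cont.
    change (Rabs (- RInt f b a) <= K * - (b - a)). rewrite Rabs_Ropp.
    replace (- (b - a)) with (a - b) by ring. apply abs_RInt_le_cont; auto; lra.
Qed.

Lemma is_derive_RInt_cont (f : R -> R) (a t : R) : (forall t, continuous f t) ->
  is_derive (fun t => RInt f a t) t (f t).
Proof.
  intros H. apply (is_derive_RInt (V := R_NormedModule) f (fun t => RInt f a t) a t).
  - exists (mkposreal 1 Rlt_0_1). intros y _. apply (RInt_correct (V := R_CompleteNormedModule)). now apply ex_RInt_cont.
  - apply H.
Qed.

Lemma is_derive_continuous (f : R -> R) (t l : R) : is_derive f t l -> continuous f t.
Proof. intros H. apply (ex_derive_continuous (K := R_AbsRing) (V := R_NormedModule)). now exists l. Qed.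

Lemma abs_interval (T x y t : R) : Rabs x <= T -> Rabs y <= T -> Rmin x y <= t <= Rmax x y -> Rabs t <= T.
Proof.
  intros Hx Hy Ht. apply Rabs_le_between in Hx. apply Rabs_le_between in Hy. apply Rabs_le_between.
  unfold Rmin, Rmax in Ht. destruct Rle_dec; lra.
Qed.

Lemma small_is_zero (x K : R) : (forall n : nat, Rabs x <= K * (1 / 2) ^ n) -> x = 0.
Proof.
  intros H. assert (HK : 0 <= K).
  { specialize (H 0%nat). simpl in H. assert (P := Rabs_pos x). lra. }
  apply NNPP. intros Hn. apply Rabs_pos_lt in Hn.
  destruct (pow_lt_1_zero (1 / 2)) with (y := Rabs x / (K + 1)) as [N HN].
  { rewrite Rabs_pos_eq; lra. } { apply Rdiv_lt_0_compat; lra. }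
  specialize (HN N (le_n N)). rewrite (Rabs_pos_eq ((1 / 2) ^ N)) in HN by (apply pow_le; lra).
  specialize (H N). apply (Rmult_lt_compat_l (K + 1)) in HN; [| lra].
  replace ((K + 1) * (Rabs x / (K + 1))) with (Rabs x) in HN by (field; lra).
  assert (0 < (1 / 2) ^ N) by (apply pow_lt; lra). nra.
Qed.

Lemma mean_value_bound (f g : R -> R) (a b K : R) :
  (forall t, Rmin a b <= t <= Rmax a b -> is_derive f t (g t) /\ Rabs (g t) <= K) ->
  Rabs (f b - f a) <= K * Rabs (b - a).
Proof.
  intros H. destruct (MVT_gen f a b g) as [c [Hc E]].
  - intros t Ht. apply H. lra.
  - intros t Ht. apply continuity_pt_filterlim. eapply is_derive_continuous. now apply H.
  - rewrite E, Rabs_mult. apply Rmult_le_compat_r; [apply Rabs_pos |]. now apply H.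
Qed.

(** Both [t] and [t0] lie in [[- T, T]], so one integration multiplies a bound on a difference by at
    most [2 * T * L], that is, by at most 1/2. *)
Lemma picard (F : R -> R -> R) (L M T rho t0 : R) :
  0 <= L -> 0 < T -> 2 * T * L <= 1 / 2 -> Rabs t0 <= T ->
  (forall r t, continuity_2d_pt F r t) ->
  (forall r r' t, Rabs (F r' t - F r t) <= L * Rabs (r' - r)) ->
  (forall r t, Rabs (F r t) <= M) ->
  exists u : R -> R, (forall t, continuous u t) /\ u t0 = rho /\
    forall t, Rabs t <= T -> is_derive u t (F (u t) t).
Proof.
  intros HL HT HLT Ht0 Hc Hlip HM.
  assert (HM0 : 0 <= M) by (eapply Rle_trans; [apply Rabs_pos | apply (HM 0 0)]).
  set (I := fun (g : R -> R) t => rho + RInt (fun s => F (g s) s) t0 t).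
  assert (Hic : forall g, (forall t, continuous g t) -> forall t, continuous (fun s => F (g s) s) t).
  { intros g Hg t. apply continuous_along; [apply Hc | apply Hg]. }
  assert (HI : forall g, (forall t, continuous g t) -> forall t, is_derive (I g) t (F (g t) t)).
  { intros g Hg t. unfold I.
    replace (F (g t) t) with (0 + F (g t) t) by ring.
    apply (is_derive_plus (K := R_AbsRing) (V := R_NormedModule)).
    - apply (is_derive_const (K := R_AbsRing) (V := R_NormedModule)).
    - apply (is_derive_RInt_cont (f := fun s => F (g s) s)). now apply Hic. }
  assert (HId : forall g g' e, (forall t, continuous g t) -> (forall t, continuous g' t) ->
    (forall t, Rabs t <= T -> Rabs (g' t - g t) <= e) ->
    forall t, Rabs t <= T -> Rabs (I g' t - I g t) <= e / 2).
  { intros g g' e Hg Hg' He t Ht.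
    assert (He0 : 0 <= e) by (eapply Rle_trans; [apply Rabs_pos | apply (He t Ht)]).
    replace (I g' t - I g t) with (RInt (fun s => F (g' s) s - F (g s) s) t0 t).
    2: { unfold I. 
         assert (E : RInt (fun s => F (g' s) s - F (g s) s) t0 t = RInt (fun s => F (g' s) s) t0 t - RInt (fun s => F (g s) s) t0 t).
         { apply (RInt_minus (V := R_CompleteNormedModule)); apply ex_RInt_cont; now apply Hic. }
         assert (E2 : forall x y z : R, x = y - z -> x = rho + y - (rho + z)) by (intros; lra).
         apply E2, E. }
    eapply Rle_trans.
    - apply (abs_RInt_le_mult (K := L * e)).
      + intros s. apply (continuous_minus (V := R_NormedModule) (fun s => F (g' s) s) (fun s => F (g s) s)); now apply Hic.
      + intros s Hs. eapply Rle_trans; [apply Hlip |]. apply Rmult_le_compat_l; [assumption |].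
        apply He. apply (abs_interval Ht0 Ht Hs).
    - assert (Rabs (t - t0) <= 2 * T).
      { eapply Rle_trans; [apply Rabs_triang |]. rewrite Rabs_Ropp. lra. }
      assert (L * e * Rabs (t - t0) <= L * e * (2 * T)).
      { apply Rmult_le_compat_l; [now apply Rmult_le_pos | assumption]. }
      nra. }
  set (us := fix us n := match n with 0%nat => fun _ : R => rho | S n => I (us n) end).
  assert (Husc : forall n t, continuous (us n) t).
  { induction n as [| n IH]; intros t; [apply continuous_const |].
    eapply is_derive_continuous. now apply (HI (us n)). }
  (* Bound on the first iteration step: slope at most [M], over a distance at most [2 * T]. *)
  set (K := M * (2 * T)).
  assert (Hdiff : forall n t, Rabs t <= T -> Rabs (us (S n) t - us n t) <= K * (1 / 2) ^ n).
  { induction n as [| n IH]; intros t Ht.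
    - change (Rabs (I (fun _ => rho) t - rho) <= K * 1). unfold I.
      assert (E3 : forall x : R, rho + x - rho = x) by (intros; ring). rewrite E3.
      eapply Rle_trans; [apply (abs_RInt_le_mult (K := M)) |].
      + intros s. apply (Hic (fun _ => rho)). intros; apply continuous_const.
      + intros; apply HM.
      + unfold K. rewrite Rmult_1_r. apply Rmult_le_compat_l; [assumption |].
        eapply Rle_trans; [apply Rabs_triang |]. rewrite Rabs_Ropp. lra.
    - rewrite <- tech_pow_Rmult. replace (K * (1 / 2 * (1 / 2) ^ n)) with (K * (1 / 2) ^ n / 2) by field.
      apply (HId (us n) (us (S n))); auto. }
  (* The iterates converge on [[- T, T]]; the clamp makes the limit a continuous function on the
     whole line. *)
  set (ct := clamp (- T) T).
  assert (Hct : forall t, Rabs (ct t) <= T).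
  { intros t. apply Rabs_le_between. apply clamp_range. lra. }
  assert (Hex : forall t, exists l, forall n, Rabs (l - us n (ct t)) <= 2 * K * (1 / 2) ^ n).
  { intros t. apply geometric_limit. intros n. apply Hdiff, Hct. }
  apply functional_choice in Hex. destruct Hex as [ul Hul].
  assert (Hulc : forall t, continuous ul t).
  { intros t. apply continuous_eps. intros e He.
    assert (HK : 0 <= K) by (apply Rmult_le_pos; lra).
    destruct (pow_lt_1_zero (1 / 2)) with (y := e / (8 * (K + 1))) as [N HN].
    { rewrite Rabs_pos_eq; lra. } { apply Rdiv_lt_0_compat; lra. }
    specialize (HN N (le_n N)). rewrite (Rabs_pos_eq ((1 / 2) ^ N)) in HN by (apply pow_le; lra).
    apply (Rmult_lt_compat_l (8 * (K + 1))) in HN; [| lra].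
    replace (8 * (K + 1) * (e / (8 * (K + 1)))) with e in HN by (field; lra).
    assert (Hp : 0 < (1 / 2) ^ N) by (apply pow_lt; lra).
    destruct (proj1 (continuous_eps _ _) (Husc N (ct t)) (e / 4) ltac:(lra)) as [d [Hd Hd']].
    exists d. split; [assumption |]. intros s Hs.
    assert (E1 := Hul s N). assert (E2 := Hul t N).
    assert (E3 : Rabs (us N (ct s) - us N (ct t)) < e / 4).
    { apply Hd'. eapply Rle_lt_trans; [apply clamp_lipschitz | exact Hs]. }
    replace (ul s - ul t) with ((ul s - us N (ct s)) + (us N (ct s) - us N (ct t)) - (ul t - us N (ct t))) by ring.
    eapply Rle_lt_trans; [apply Rabs_triang |]. rewrite Rabs_Ropp.
    eapply Rle_lt_trans; [apply Rplus_le_compat_r, Rabs_triang |]. nra. }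
  assert (Hfix : forall t, Rabs t <= T -> I ul t = ul t).
  { intros t Ht. apply Rminus_diag_uniq. apply (small_is_zero (K := 2 * K)). intros n.
    assert (Hctt : forall s, Rabs s <= T -> ct s = s).
    { intros s Hs. apply clamp_id. now apply Rabs_le_between. }
    assert (E1 := Hul t (S n)). rewrite Hctt in E1 by assumption.
    assert (E2 : Rabs (I ul t - I (us n) t) <= 2 * K * (1 / 2) ^ n / 2).
    { apply (HId (us n) ul); auto. intros s Hs. rewrite <- (Hctt s Hs) at 2. apply Hul. }
    change (I (us n) t) with (us (S n) t) in E2.
    replace (I ul t - ul t) with ((I ul t - us (S n) t) - (ul t - us (S n) t)) by ring.
    eapply Rle_trans; [apply Rabs_triang |]. rewrite Rabs_Ropp.
    rewrite <- tech_pow_Rmult in E1. lra. }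
  (* The integral of the limit is taken instead of the limit itself: they agree on [[- T, T]], and
     the integral has two-sided derivatives at the endpoints too. *)
  exists (I ul). split; [| split].
  - intros t. eapply is_derive_continuous. now apply HI.
  - unfold I. assert (E : RInt (fun s => F (ul s) s) t0 t0 = 0) by apply (RInt_point (V := R_CompleteNormedModule)).
    apply (eq_trans (f_equal (Rplus rho) E)). ring.
  - intros t Ht. rewrite (Hfix t Ht). now apply HI.
Qed.

(** The lower bound [c] on the derivative makes [g] onto the line and its inverse Lipschitz. Its use
    is to turn time as a function of the angle into the angle as a function of time. *)
Lemma increasing_inverse (g q : R -> R) (c : R) : 0 < c ->
  (forall t, is_derive g t (q t) /\ c <= q t) ->
  exists k : R -> R, (forall y, g (k y) = y) /\ (forall t, k (g t) = t) /\
    forall y, is_derive k y (/ q (k y)).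
Proof.
  intros Hc H.
  assert (Hmv : forall s t, s <= t -> c * (t - s) <= g t - g s).
  { intros s t Hst. destruct (MVT_gen g s t q) as [x [Hx E]].
    - intros; apply H.
    - intros x _. apply continuity_pt_filterlim. eapply is_derive_continuous. apply H.
    - rewrite E. apply Rmult_le_compat_r; [lra | apply H]. }
  assert (Hcont : Ranalysis1.continuity g).
  { intros x. apply continuity_pt_filterlim. eapply is_derive_continuous. apply H. }
  assert (Hsurj : forall y, exists t, g t = y).
  { intros y. set (w := Rabs (y - g 0) / c).
    assert (Hw : 0 <= w) by (apply Rmult_le_pos; [apply Rabs_pos | apply Rlt_le, Rinv_0_lt_compat; lra]).
    assert (Hcw : c * w = Rabs (y - g 0)) by (unfold w; field; lra).
    assert (B1 := Hmv 0 w Hw). assert (B2 := Hmv (- w) 0 ltac:(lra)).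
    assert (P1 := Rle_abs (y - g 0)). assert (P2 := Rle_abs (- (y - g 0))). rewrite Rabs_Ropp in P2.
    destruct (IVT_gen g (- w) w y Hcont) as [x [_ Hx]].
    - split.
      + eapply Rle_trans; [apply Rmin_l |]. lra.
      + eapply Rle_trans; [| apply Rmax_r]. lra.
    - now exists x. }
  apply functional_choice in Hsurj. destruct Hsurj as [k Hk].
  assert (Habs : forall s t, c * Rabs (t - s) <= Rabs (g t - g s)).
  { intros s t. destruct (Rle_lt_dec s t) as [Hst | Hst].
    - assert (B := Hmv s t Hst). assert (0 <= c * (t - s)) by (apply Rmult_le_pos; lra).
      rewrite !Rabs_pos_eq; lra.
    - assert (B := Hmv t s ltac:(lra)). assert (0 <= c * (s - t)) by (apply Rmult_le_pos; lra).
      rewrite !Rabs_left1; lra. }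
  exists k. split; [exact Hk |]. split.
  - intros t. assert (B := Habs t (k (g t))). rewrite Hk in B.
    replace (g t - g t) with 0 in B by ring. rewrite Rabs_R0 in B.
    apply NNPP. intros Hn. assert (0 < Rabs (k (g t) - t)) by (apply Rabs_pos_lt; lra). nra.
  - intros y. set (t := k y).
    assert (Hq : c <= q t) by apply H.
    apply is_derive_Reals. intros e He.
    destruct (proj1 (is_derive_Reals g t (q t)) (proj1 (H t)) (e * c * c)) as [d Hd].
    { repeat apply Rmult_lt_0_compat; lra. }
    assert (Hdc : 0 < d * c) by (apply Rmult_lt_0_compat; [apply cond_pos | lra]).
    exists (mkposreal _ Hdc). intros hh Hh Hhd. simpl in Hhd.
    set (th := k (y + hh) - t).
    assert (Hg1 : g (t + th) = y + hh) by (unfold th; replace (t + (k (y + hh) - t)) with (k (y + hh)) by ring; apply Hk).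
    assert (Hg0 : g t = y) by apply Hk.
    assert (B := Habs t (t + th)). rewrite Hg1, Hg0 in B.
    replace (t + th - t) with th in B by ring. replace (y + hh - y) with hh in B by ring.
    assert (Hth : th <> 0).
    { intros E. rewrite E, Rplus_0_r, Hg0 in Hg1. lra. }
    assert (Hthd : Rabs th < d).
    { apply (Rmult_lt_reg_l c); [lra |]. rewrite (Rmult_comm c d). lra. }
    specialize (Hd th Hth Hthd). rewrite Hg1, Hg0 in Hd. replace (y + hh - y) with hh in Hd by ring.
    change (Rabs (th / hh - / q t) < e).
    replace (th / hh - / q t) with (- ((hh / th - q t) * (th / hh) * / q t)) by (field; lra).
    rewrite Rabs_Ropp, !Rabs_mult.
    assert (H1 : Rabs (th / hh) <= / c).
    { unfold Rdiv. rewrite Rabs_mult, Rabs_inv. assert (0 < Rabs hh) by now apply Rabs_pos_lt.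
      apply (Rmult_le_reg_r (Rabs hh)); [assumption |]. rewrite Rmult_assoc, Rinv_l, Rmult_1_r by lra.
      apply (Rmult_le_reg_l c); [lra |]. rewrite <- Rmult_assoc, Rinv_r, Rmult_1_l by lra. exact B. }
    assert (H2 : Rabs (/ q t) <= / c).
    { rewrite Rabs_inv, Rabs_pos_eq by lra. apply Rinv_le_contravar; lra. }
    assert (Hic : 0 < / c) by now apply Rinv_0_lt_compat.
    apply Rle_lt_trans with (Rabs (hh / th - q t) * (/ c * / c)).
    + rewrite Rmult_assoc. apply Rmult_le_compat_l; [apply Rabs_pos |].
      apply Rmult_le_compat; try apply Rabs_pos; assumption.
    + apply Rlt_le_trans with (e * c * c * (/ c * / c)).
      * apply Rmult_lt_compat_r; [nra | exact Hd].
      * right. field. lra.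
Qed.

(* [dr/dt] along [r' = eps A], [t' = - (1 - eps b)], divided by [eps]. *)
Definition slope (A b : R -> R -> R) (eps r t : R) : R := - A r t / (1 - eps * b r t).

Definition slope_r (A A1 b b1 : R -> R -> R) (eps r t : R) : R :=
  - A1 r t / (1 - eps * b r t) - eps * (A r t * b1 r t) / ((1 - eps * b r t) * (1 - eps * b r t)).

(* The bound 4 on angles only serves to cover [[- PI, PI]]. *)
Record band_data (A A1 b b1 : R -> R -> R) (r0 h K : R) : Prop := {
  bd_h : 0 < h;
  bd_K : 0 < K;
  bd_A : forall r t, r0 - 2 * h <= r <= r0 + 2 * h -> Rabs t <= 4 ->
    is_derive (fun s => A s t) r (A1 r t) /\ is_derive (fun s => b s t) r (b1 r t);
  bd_c : forall r t, r0 - 2 * h <= r <= r0 + 2 * h -> Rabs t <= 4 ->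
    continuity_2d_pt A r t /\ continuity_2d_pt b r t /\ continuity_2d_pt A1 r t /\ continuity_2d_pt b1 r t;
  bd_b : forall r t, r0 - 2 * h <= r <= r0 + 2 * h -> Rabs t <= 4 ->
    Rabs (A r t) <= K /\ Rabs (b r t) <= K /\ Rabs (A1 r t) <= K /\ Rabs (b1 r t) <= K }.

(** The first bound gives [32 * K * eps <= 1 / 4]: the radial Lipschitz constant [4 * K] of the
    slope, times the angle span 8, contracts by 1/4. The second keeps the drift [16 * K * eps]
    within [h]. *)
Definition band_eps (h K : R) : R := Rmin (/ (128 * K)) (h / (16 * K)).

(** The drift [16 * K * eps] is the slope bound [2 * K] times the angle span 8 of [[-4, 4]]. *)
Definition is_flow (A b : R -> R -> R) (r0 h K eps t0 rho : R) (u : R -> R) : Prop :=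
  (forall t, continuous u t) /\ u t0 = rho /\
  forall t, Rabs t <= 4 -> r0 - 2 * h <= u t <= r0 + 2 * h /\
    is_derive u t (eps * slope A b eps (u t) t) /\ Rabs (u t - rho) <= 16 * K * eps.

Section Flow.

Variables (A A1 b b1 : R -> R -> R) (r0 h K : R).
Hypothesis B : band_data A A1 b b1 r0 h K.

Notation inb r := (r0 - 2 * h <= r <= r0 + 2 * h).

Variable eps : R.
Hypothesis Heps : 0 < eps < band_eps h K.

Lemma eps_K : eps * K <= 1 / 128.
Proof.
  destruct Heps as [H1 H2]. assert (HK := bd_K B).
  assert (H3 := Rlt_le_trans _ _ _ H2 (Rmin_l _ _)).
  apply (Rmult_lt_compat_r K) in H3; [| assumption].
  replace (/ (128 * K) * K) with (1 / 128) in H3 by (field; lra). lra.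
Qed.

Lemma eps_h : 16 * K * eps <= h.
Proof.
  destruct Heps as [H1 H2]. assert (HK := bd_K B).
  assert (H3 := Rlt_le_trans _ _ _ H2 (Rmin_r _ _)).
  apply (Rmult_lt_compat_r (16 * K)) in H3; [| lra].
  replace (h / (16 * K) * (16 * K)) with h in H3 by (field; lra). lra.
Qed.

Lemma denominator_bounds (r t : R) : inb r -> Rabs t <= 4 -> 1 / 2 <= 1 - eps * b r t <= 3 / 2.
Proof.
  intros Hr Ht. destruct (bd_b B Hr Ht) as [_ [Hb _]]. assert (H := eps_K).
  apply Rabs_le_between in Hb. assert (HK := bd_K B). nra.
Qed.

Lemma inv_denominator_abs (r t : R) : inb r -> Rabs t <= 4 -> Rabs (/ (1 - eps * b r t)) <= 2.
Proof.
  intros Hr Ht. assert (H := denominator_bounds Hr Ht).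
  rewrite Rabs_inv, Rabs_pos_eq by lra. replace 2 with (/ (1 / 2)) by field.
  apply Rinv_le_contravar; lra.
Qed.

Lemma slope_abs (r t : R) : inb r -> Rabs t <= 4 -> Rabs (slope A b eps r t) <= 2 * K.
Proof.
  intros Hr Ht. destruct (bd_b B Hr Ht) as [HA _]. assert (H := inv_denominator_abs Hr Ht).
  unfold slope, Rdiv. rewrite Rabs_mult, Rabs_Ropp, (Rmult_comm 2).
  apply Rmult_le_compat; try apply Rabs_pos; assumption.
Qed.

Lemma slope_near (r t : R) : inb r -> Rabs t <= 4 ->
  Rabs (slope A b eps r t + A r t) <= 2 * K * K * eps.
Proof.
  intros Hr Ht. destruct (bd_b B Hr Ht) as [HA [Hb _]]. assert (H := inv_denominator_abs Hr Ht).
  assert (H' := denominator_bounds Hr Ht).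
  unfold slope.
  replace (- A r t / (1 - eps * b r t) + A r t) with (- (A r t * (eps * b r t) * / (1 - eps * b r t))) by (field; lra).
  rewrite Rabs_Ropp, !Rabs_mult, (Rabs_pos_eq eps) by lra.
  replace (2 * K * K * eps) with (K * (eps * K) * 2) by ring.
  assert (P1 := Rabs_pos (A r t)). assert (P2 := Rabs_pos (b r t)). assert (HK := bd_K B).
  apply Rmult_le_compat; [| apply Rabs_pos | | exact H].
  - apply Rmult_le_pos; [assumption |]. apply Rmult_le_pos; lra.
  - apply Rmult_le_compat; try lra. apply Rmult_le_pos; lra. apply Rmult_le_compat_l; lra.
Qed.

Lemma slope_derive (r t : R) : inb r -> Rabs t <= 4 ->
  is_derive (fun s => slope A b eps s t) r (slope_r A A1 b b1 eps r t).
Proof.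
  intros Hr Ht. destruct (bd_A B Hr Ht) as [HA Hb]. assert (H := denominator_bounds Hr Ht).
  unfold slope, slope_r.
  assert (EA : ex_derive (fun s => A s t) r) by (eexists; exact HA).
  assert (Eb : ex_derive (fun s => b s t) r) by (eexists; exact Hb).
  auto_derive.
  - repeat split; try assumption. lra.
  - assert (DA : Derive (fun s : R => A s t) r = A1 r t) by exact (is_derive_unique _ _ _ HA).
    assert (Db : Derive (fun s : R => b s t) r = b1 r t) by exact (is_derive_unique _ _ _ Hb).
    rewrite DA, Db. field. lra.
Qed.

Lemma slope_r_second_term (r t : R) : inb r -> Rabs t <= 4 ->
  Rabs (eps * (A r t * b1 r t) / ((1 - eps * b r t) * (1 - eps * b r t))) <= 4 * K * K * eps.
Proof.
  intros Hr Ht. destruct (bd_b B Hr Ht) as [HA [_ [_ Hb1]]]. assert (H := inv_denominator_abs Hr Ht).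
  assert (H' := denominator_bounds Hr Ht).
  replace (eps * (A r t * b1 r t) / ((1 - eps * b r t) * (1 - eps * b r t)))
    with (eps * (A r t * b1 r t) * (/ (1 - eps * b r t) * / (1 - eps * b r t))) by (field; lra).
  rewrite !Rabs_mult, (Rabs_pos_eq eps) by lra.
  replace (4 * K * K * eps) with (eps * (K * K) * (2 * 2)) by ring.
  assert (P1 := Rabs_pos (A r t)). assert (P2 := Rabs_pos (b1 r t)). assert (HK := bd_K B).
  assert (P3 := Rabs_pos (/ (1 - eps * b r t))).
  apply Rmult_le_compat.
  - repeat apply Rmult_le_pos; lra.
  - apply Rmult_le_pos; lra.
  - apply Rmult_le_compat_l; [lra |]. apply Rmult_le_compat; lra.
  - apply Rmult_le_compat; lra.
Qed.

Lemma slope_r_near (r t : R) : inb r -> Rabs t <= 4 ->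
  Rabs (slope_r A A1 b b1 eps r t + A1 r t) <= 6 * K * K * eps.
Proof.
  intros Hr Ht. destruct (bd_b B Hr Ht) as [_ [Hb [HA1 _]]]. assert (H := inv_denominator_abs Hr Ht).
  assert (H' := denominator_bounds Hr Ht). assert (H2 := slope_r_second_term Hr Ht).
  assert (P1 := Rabs_pos (A1 r t)). assert (P2 := Rabs_pos (b r t)). assert (HK := bd_K B).
  unfold slope_r.
  set (X := eps * (A r t * b1 r t) / ((1 - eps * b r t) * (1 - eps * b r t))) in *.
  replace (- A1 r t / (1 - eps * b r t) - X + A1 r t)
    with (- (A1 r t * (eps * b r t) * / (1 - eps * b r t)) - X) by (field; lra).
  eapply Rle_trans; [apply Rabs_triang |]. rewrite !Rabs_Ropp.
  assert (E : Rabs (A1 r t * (eps * b r t) * / (1 - eps * b r t)) <= 2 * K * K * eps); [| lra].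
  rewrite !Rabs_mult, (Rabs_pos_eq eps) by lra.
  replace (2 * K * K * eps) with (K * (eps * K) * 2) by ring.
  apply Rmult_le_compat; [| apply Rabs_pos | | exact H].
  - apply Rmult_le_pos; [assumption |]. apply Rmult_le_pos; lra.
  - apply Rmult_le_compat; try lra. apply Rmult_le_pos; lra. apply Rmult_le_compat_l; lra.
Qed.

Lemma slope_r_abs (r t : R) : inb r -> Rabs t <= 4 -> Rabs (slope_r A A1 b b1 eps r t) <= 4 * K.
Proof.
  intros Hr Ht. assert (H1 := slope_r_near Hr Ht). destruct (bd_b B Hr Ht) as [_ [_ [HA1 _]]].
  assert (HK := bd_K B). assert (HeK := eps_K).
  replace (slope_r A A1 b b1 eps r t) with ((slope_r A A1 b b1 eps r t + A1 r t) - A1 r t) by ring.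
  eapply Rle_trans; [apply Rabs_triang |]. rewrite Rabs_Ropp. nra.
Qed.

Lemma continuity_2d_denominator (r t : R) : inb r -> Rabs t <= 4 ->
  continuity_2d_pt (fun r t => 1 - eps * b r t) r t.
Proof.
  intros Hr Ht. apply continuity_2d_pt_minus; [apply continuity_2d_pt_const |].
  apply continuity_2d_pt_mult; [apply continuity_2d_pt_const | apply (bd_c B Hr Ht)].
Qed.

Lemma slope_continuity (r t : R) : inb r -> Rabs t <= 4 -> continuity_2d_pt (slope A b eps) r t.
Proof.
  intros Hr Ht. assert (H := denominator_bounds Hr Ht). unfold slope, Rdiv.
  apply (continuity_2d_pt_mult (fun r t => - A r t) (fun r t => / (1 - eps * b r t))).
  - apply continuity_2d_pt_opp. apply (bd_c B Hr Ht).
  - apply continuity_2d_pt_inv; [now apply continuity_2d_denominator | lra].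
Qed.

Lemma slope_r_continuity (r t : R) : inb r -> Rabs t <= 4 -> continuity_2d_pt (slope_r A A1 b b1 eps) r t.
Proof.
  intros Hr Ht. assert (H := denominator_bounds Hr Ht). unfold slope_r, Rdiv.
  destruct (bd_c B Hr Ht) as [HA [Hb [HA1 Hb1]]].
  apply (continuity_2d_pt_minus (fun r t => - A1 r t * / (1 - eps * b r t))
    (fun r t => eps * (A r t * b1 r t) * / ((1 - eps * b r t) * (1 - eps * b r t)))).
  - apply (continuity_2d_pt_mult (fun r t => - A1 r t) (fun r t => / (1 - eps * b r t))).
    + now apply continuity_2d_pt_opp.
    + apply continuity_2d_pt_inv; [now apply continuity_2d_denominator | lra].
  - apply (continuity_2d_pt_mult (fun r t => eps * (A r t * b1 r t)) (fun r t => / ((1 - eps * b r t) * (1 - eps * b r t)))).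
    + apply (continuity_2d_pt_mult (fun _ _ => eps)); [apply continuity_2d_pt_const |].
      now apply continuity_2d_pt_mult.
    + apply continuity_2d_pt_inv; [| nra].
      apply (continuity_2d_pt_mult (fun r t => 1 - eps * b r t) (fun r t => 1 - eps * b r t)); now apply continuity_2d_denominator.
Qed.

Lemma inb_between (r r' x : R) : inb r -> inb r' -> Rmin r r' <= x <= Rmax r r' -> inb x.
Proof. unfold Rmin, Rmax. destruct Rle_dec; intros; lra. Qed.

Lemma slope_lipschitz (r r' t : R) : inb r -> inb r' -> Rabs t <= 4 ->
  Rabs (slope A b eps r' t - slope A b eps r t) <= 4 * K * Rabs (r' - r).
Proof.
  intros Hr Hr' Ht.
  apply (mean_value_bound (f := fun s => slope A b eps s t) (g := fun s => slope_r A A1 b b1 eps s t)).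
  intros s Hs. assert (Hs' := inb_between Hr Hr' Hs).
  split; [now apply slope_derive | now apply slope_r_abs].
Qed.

Lemma A_lipschitz (r r' t : R) : inb r -> inb r' -> Rabs t <= 4 ->
  Rabs (A r' t - A r t) <= K * Rabs (r' - r).
Proof.
  intros Hr Hr' Ht.
  apply (mean_value_bound (f := fun s => A s t) (g := fun s => A1 s t)).
  intros s Hs. assert (Hs' := inb_between Hr Hr' Hs).
  split; [apply (bd_A B Hs' Ht) | apply (bd_b B Hs' Ht)].
Qed.

Lemma abs_diff_8 (s t : R) : Rabs s <= 4 -> Rabs t <= 4 -> Rabs (t - s) <= 8.
Proof. intros Hs Ht. eapply Rle_trans; [apply Rabs_triang |]. rewrite Rabs_Ropp. lra. Qed.

(** The slope is clamped to the band to make it global. The solution drifts by at most [h] from a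
    radius within [h] of [r0], so it stays where the clamp is the identity. *)
Lemma flow_exists (t0 rho : R) : Rabs t0 <= 4 -> Rabs (rho - r0) <= h ->
  exists u, is_flow A b r0 h K eps t0 rho u.
Proof.
  intros Ht0 Hrho. assert (Hh := bd_h B). assert (HK := bd_K B). assert (HeK := eps_K). assert (Heh := eps_h).
  set (cr := clamp (r0 - 2 * h) (r0 + 2 * h)). set (ct := clamp (-4) 4).
  assert (Hcr : forall r, inb (cr r)) by (intros; apply clamp_range; lra).
  assert (Hct : forall t, Rabs (ct t) <= 4) by (intros; apply Rabs_le_between, clamp_range; lra).
  set (F := fun r t => eps * slope A b eps (cr r) (ct t)).
  destruct (@picard F (eps * (4 * K)) (eps * (2 * K)) 4 rho t0) as [u [Hu1 [Hu2 Hu3]]].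
  - apply Rmult_le_pos; lra.
  - lra.
  - nra.
  - exact Ht0.
  - intros r t. unfold F. apply continuity_2d_pt_mult; [apply continuity_2d_pt_const |].
    apply (continuity_2d_clamp (F := slope A b eps)). apply slope_continuity; [apply Hcr | apply Hct].
  - intros r r' t. unfold F. rewrite <- Rmult_minus_distr_l, Rabs_mult, Rabs_pos_eq, Rmult_assoc by lra.
    apply Rmult_le_compat_l; [lra |]. eapply Rle_trans; [apply slope_lipschitz; [apply Hcr | apply Hcr | apply Hct] |].
    apply Rmult_le_compat_l; [lra | apply clamp_lipschitz].
  - intros r t. unfold F. rewrite Rabs_mult, Rabs_pos_eq by lra. apply Rmult_le_compat_l; [lra |]. now apply slope_abs.
  - assert (Hdist : forall t, Rabs t <= 4 -> Rabs (u t - rho) <= 16 * K * eps).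
    { intros t Ht. rewrite <- Hu2.
      eapply Rle_trans; [apply (mean_value_bound (f := u) (g := fun s => F (u s) s) (K := eps * (2 * K))) |].
      - intros s Hs. assert (Hs4 := abs_interval Ht0 Ht Hs). split; [now apply Hu3 |].
        unfold F. rewrite Rabs_mult, Rabs_pos_eq by lra. apply Rmult_le_compat_l; [lra |]. now apply slope_abs.
      - assert (T := abs_diff_8 Ht0 Ht).
        replace (16 * K * eps) with (eps * (2 * K) * 8) by ring.
        apply Rmult_le_compat_l; [| exact T]. apply Rmult_le_pos; lra. }
    exists u. split; [exact Hu1 |]. split; [exact Hu2 |]. intros t Ht.
    specialize (Hdist t Ht).
    assert (Hin : inb (u t)).
    { assert (T := Rle_trans _ _ _ Hdist Heh). apply Rabs_le_between in T. apply Rabs_le_between in Hrho. lra. }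
    split; [exact Hin |]. split; [| exact Hdist].
    assert (E := Hu3 t Ht). unfold F, cr, ct in E. rewrite !clamp_id in E; [exact E | now apply Rabs_le_between | exact Hin].
Qed.

(** Iteration in place of an exponential estimate: a bound [m] on [u2 - u1] improves to
    [Rabs (rho2 - rho1) + m / 4]. Starting from the band width [4 * h], the bounds decrease to at
    most [2 * Rabs (rho2 - rho1)]. *)
Lemma flow_difference (t0 rho1 rho2 : R) (u1 u2 : R -> R) : Rabs t0 <= 4 ->
  is_flow A b r0 h K eps t0 rho1 u1 -> is_flow A b r0 h K eps t0 rho2 u2 ->
  forall t, Rabs t <= 4 -> Rabs ((u2 t - u1 t) - (rho2 - rho1)) <= Rabs (rho2 - rho1) / 2.
Proof.
  intros Ht0 [_ [I1 F1]] [_ [I2 F2]].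
  assert (Hh := bd_h B). assert (HK := bd_K B). assert (HeK := eps_K).
  assert (Hmv : forall m, (forall t, Rabs t <= 4 -> Rabs (u2 t - u1 t) <= m) ->
    forall t, Rabs t <= 4 -> Rabs ((u2 t - u1 t) - (rho2 - rho1)) <= m / 4).
  { intros m Hm t Ht.
    assert (Hm0 : 0 <= m) by (eapply Rle_trans; [apply Rabs_pos | apply (Hm t Ht)]).
    rewrite <- I1, <- I2.
    eapply Rle_trans; [apply (mean_value_bound (f := fun s => u2 s - u1 s)
      (g := fun s => eps * slope A b eps (u2 s) s - eps * slope A b eps (u1 s) s) (K := eps * (4 * K * m))) |].
    - intros s Hs. assert (Hs4 := abs_interval Ht0 Ht Hs).
      destruct (F1 s Hs4) as [B1 [D1 _]]. destruct (F2 s Hs4) as [B2 [D2 _]]. split.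
      + now apply (is_derive_minus (K := R_AbsRing) (V := R_NormedModule)).
      + rewrite <- Rmult_minus_distr_l, Rabs_mult, Rabs_pos_eq by lra. apply Rmult_le_compat_l; [lra |].
        eapply Rle_trans; [now apply slope_lipschitz |]. apply Rmult_le_compat_l; [lra |]. now apply Hm.
    - assert (T := abs_diff_8 Ht0 Ht).
      assert (0 <= eps * (4 * K * m)) by (repeat apply Rmult_le_pos; lra).
      apply Rle_trans with (eps * (4 * K * m) * 8); [now apply Rmult_le_compat_l |].
      replace (eps * (4 * K * m) * 8) with (32 * (eps * K) * m) by ring. nra. }
  assert (P := Rabs_pos (rho2 - rho1)).
  assert (Hit : forall n t, Rabs t <= 4 -> Rabs (u2 t - u1 t) <= 2 * Rabs (rho2 - rho1) + 4 * h * (1 / 2) ^ n).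
  { induction n as [| n IH]; intros t Ht.
    - simpl. destruct (F1 t Ht) as [B1 _]. destruct (F2 t Ht) as [B2 _].
      apply Rabs_le. lra.
    - assert (T := Hmv _ IH t Ht).
      replace (u2 t - u1 t) with ((u2 t - u1 t - (rho2 - rho1)) + (rho2 - rho1)) by ring.
      eapply Rle_trans; [apply Rabs_triang |]. rewrite <- tech_pow_Rmult.
      assert (0 < (1 / 2) ^ n) by (apply pow_lt; lra). nra. }
  intros t Ht. replace (Rabs (rho2 - rho1) / 2) with (2 * Rabs (rho2 - rho1) / 4) by field.
  apply Hmv; [| exact Ht]. intros s Hs. apply le_epsilon. intros e He.
  destruct (pow_lt_1_zero (1 / 2)) with (y := e / (4 * h)) as [N HN].
  { rewrite Rabs_pos_eq; lra. } { apply Rdiv_lt_0_compat; lra. }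
  specialize (HN N (le_n N)). rewrite (Rabs_pos_eq ((1 / 2) ^ N)) in HN by (apply pow_le; lra).
  apply (Rmult_lt_compat_l (4 * h)) in HN; [| lra].
  replace (4 * h * (e / (4 * h))) with e in HN by (field; lra).
  assert (T := Hit N s Hs). lra.
Qed.

(* [(ln (u2 - u1))' / eps] is a difference quotient of [slope], i.e. a value of [slope_r]. *)
Lemma flow_log_difference (t0 rho1 rho2 kap : R) (u1 u2 G g : R -> R) : Rabs t0 <= 4 -> rho1 <> rho2 ->
  is_flow A b r0 h K eps t0 rho1 u1 -> is_flow A b r0 h K eps t0 rho2 u2 ->
  (forall t, Rabs t <= 4 -> is_derive G t (g t)) ->
  (forall t r, Rabs t <= 4 -> Rmin (u1 t) (u2 t) <= r <= Rmax (u1 t) (u2 t) ->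
     Rabs (slope_r A A1 b b1 eps r t - g t) <= kap) ->
  forall t, Rabs t <= 4 -> exists La,
    u2 t - u1 t = (rho2 - rho1) * exp (eps * La) /\ Rabs (La - (G t - G t0)) <= 8 * kap.
Proof.
  intros Ht0 Hne H1 H2 HG Hk t Ht.
  assert (Hd := flow_difference Ht0 H1 H2).
  destruct H1 as [_ [I1 F1]]. destruct H2 as [_ [I2 F2]].
  set (q := fun s => (u2 s - u1 s) / (rho2 - rho1)).
  (* [flow_difference] keeps the quotient [q] within 1/2 of 1, so its logarithm makes sense along
     the whole flow. *)
  assert (Hq : forall s, Rabs s <= 4 -> 1 / 2 <= q s).
  { intros s Hs. specialize (Hd s Hs).
    assert (E : Rabs (q s - 1) <= 1 / 2).
    { unfold q. replace ((u2 s - u1 s) / (rho2 - rho1) - 1) with ((u2 s - u1 s - (rho2 - rho1)) * / (rho2 - rho1)) by (field; lra).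
      rewrite Rabs_mult, Rabs_inv. assert (P : 0 < Rabs (rho2 - rho1)) by (apply Rabs_pos_lt; lra).
      apply (Rmult_le_reg_r (Rabs (rho2 - rho1))); [assumption |].
      rewrite Rmult_assoc, Rinv_l by lra. lra. }
    apply Rabs_le_between in E. lra. }
  assert (Hqt := Hq t Ht).
  exists (ln (q t) / eps). split.
  - replace (eps * (ln (q t) / eps)) with (ln (q t)) by (field; lra).
    rewrite exp_ln by lra. unfold q. field. lra.
  - assert (Hq0 : q t0 = 1) by (unfold q; rewrite I1, I2; field; lra).
    assert (E : Rabs ((ln (q t) - eps * G t) - (ln (q t0) - eps * G t0)) <= eps * kap * Rabs (t - t0)).
    { apply (mean_value_bound (f := fun s => ln (q s) - eps * G s)
        (g := fun s => eps * ((slope A b eps (u2 s) s - slope A b eps (u1 s) s) / (u2 s - u1 s) - g s))).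
      intros s Hs. assert (Hs4 := abs_interval Ht0 Ht Hs). assert (Hqs := Hq s Hs4).
      destruct (F1 s Hs4) as [B1 [D1 _]]. destruct (F2 s Hs4) as [B2 [D2 _]].
      assert (Hne' : u2 s - u1 s <> 0).
      { intros E. unfold q in Hqs. rewrite E in Hqs. unfold Rdiv in Hqs. rewrite Rmult_0_l in Hqs. lra. }
      split.
      - unfold q. specialize (HG s Hs4).
        assert (X1 : ex_derive u1 s) by (eexists; exact D1). assert (X2 : ex_derive u2 s) by (eexists; exact D2).
        assert (X3 : ex_derive G s) by (eexists; exact HG).
        auto_derive.
        + repeat split; try assumption. fold (q s). unfold q in Hqs. unfold Rdiv in Hqs. unfold Rminus in *. lra.
        + assert (E1 : Derive (fun x : R => u1 x) s = eps * slope A b eps (u1 s) s) by exact (is_derive_unique _ _ _ D1).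
          assert (E2 : Derive (fun x : R => u2 x) s = eps * slope A b eps (u2 s) s) by exact (is_derive_unique _ _ _ D2).
          assert (E3 : Derive (fun x : R => G x) s = g s) by exact (is_derive_unique _ _ _ HG).
          rewrite E1, E2, E3.
          field. split; lra.
      - destruct (MVT_gen (fun r => slope A b eps r s) (u1 s) (u2 s) (fun r => slope_r A A1 b b1 eps r s)) as [c [Hc EM]].
        + intros x Hx. apply slope_derive; [| exact Hs4]. apply (inb_between B1 B2). lra.
        + intros x Hx. apply continuity_pt_filterlim. refine (is_derive_continuous (slope_derive _ Hs4)).
          now apply (inb_between B1 B2).
        + rewrite EM. replace (slope_r A A1 b b1 eps c s * (u2 s - u1 s) / (u2 s - u1 s)) with (slope_r A A1 b b1 eps c s) by (field; exact Hne').
          rewrite Rabs_mult, Rabs_pos_eq by lra. apply Rmult_le_compat_l; [lra |]. now apply Hk. }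
    rewrite Hq0, ln_1 in E.
    assert (Hk0 : 0 <= kap).
    { eapply Rle_trans; [apply Rabs_pos | apply (Hk t (u1 t) Ht)]. split; [apply Rmin_l | apply Rmax_l]. }
    replace (ln (q t) / eps - (G t - G t0)) with ((ln (q t) - eps * G t - (0 - eps * G t0)) * / eps) by (field; lra).
    rewrite Rabs_mult, Rabs_inv, (Rabs_pos_eq eps) by lra.
    apply (Rmult_le_reg_r eps); [lra |]. rewrite Rmult_assoc, Rinv_l, Rmult_1_r by lra.
    eapply Rle_trans; [exact E |].
    assert (T := abs_diff_8 Ht0 Ht).
    replace (8 * kap * eps) with (eps * kap * 8) by ring. apply Rmult_le_compat_l; [| exact T].
    apply Rmult_le_pos; lra.
Qed.

End Flow.

(** * Dependence of the flow on the initial radius *)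

Lemma primitive_exists (g : R -> R) (T : R) : 0 < T ->
  (forall t, Rabs t <= T -> continuous g t) ->
  exists G, (forall t, Rabs t <= T -> is_derive G t (g t)) /\
    forall s t, Rabs s <= T -> Rabs t <= T -> RInt g s t = G t - G s.
Proof.
  intros HT Hg.
  set (ct := clamp (- T) T).
  assert (Hct : forall t, Rabs (ct t) <= T) by (intros; apply Rabs_le_between, clamp_range; lra).
  assert (Hid : forall t, Rabs t <= T -> ct t = t) by (intros; apply clamp_id, Rabs_le_between; assumption).
  assert (Hc : forall t, continuous (fun s => g (ct s)) t).
  { intros t. apply continuous_eps. intros e He.
    destruct (proj1 (continuous_eps _ _) (Hg (ct t) (Hct t)) e He) as [d [Hd Hd']].
    exists d. split; [assumption |]. intros s Hs. apply Hd'.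
    eapply Rle_lt_trans; [apply clamp_lipschitz | exact Hs]. }
  exists (fun t => RInt (fun s => g (ct s)) 0 t).
  assert (HG : forall t, Rabs t <= T -> is_derive (fun t => RInt (fun s => g (ct s)) 0 t) t (g t)).
  { intros t Ht. rewrite <- (Hid t Ht) at 2. now apply (is_derive_RInt_cont (f := fun s => g (ct s))). }
  split; [exact HG |]. intros s t Hs Ht.
  apply (is_RInt_unique (V := R_CompleteNormedModule)).
  apply (is_RInt_derive (V := R_CompleteNormedModule)); intros x Hx; assert (Hx' := abs_interval Hs Ht Hx); auto.
Qed.

Section Flow_family.

Variables (A A1 b b1 : R -> R -> R) (r0 h K kap : R).
Hypothesis B : band_data A A1 b b1 r0 h K.
Hypothesis Hosc : forall r t, r0 - 2 * h <= r <= r0 + 2 * h -> Rabs t <= 4 ->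
  Rabs (A1 r t - A1 r0 t) <= kap.

(** The second bound puts [slope_r] within [kap] of [- A1]. With the oscillation of [A1] over the
    band this gives [2 * kap] at frozen radius, and [16 * kap] after integration over the angle span
    8. *)
Definition family_eps : R := Rmin (band_eps h K) (kap / (6 * K * K)).

Variable eps : R.
Hypothesis Heps : 0 < eps < family_eps.

Lemma family_eps_band : 0 < eps < band_eps h K.
Proof. split; [apply Heps |]. eapply Rlt_le_trans; [apply Heps | apply Rmin_l]. Qed.

Lemma family_eps_kap : 6 * K * K * eps <= kap.
Proof.
  assert (HK := bd_K B).
  assert (H := Rlt_le_trans _ _ _ (proj2 Heps) (Rmin_r _ _)).
  assert (H6 : 0 < 6 * K * K) by (repeat apply Rmult_lt_0_compat; lra).
  apply (Rmult_lt_compat_l (6 * K * K)) in H; [| exact H6].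
  replace (6 * K * K * (kap / (6 * K * K))) with kap in H by (field; lra). lra.
Qed.

Lemma inb_center : r0 - 2 * h <= r0 <= r0 + 2 * h.
Proof. assert (Hh := bd_h B). lra. Qed.

Lemma A_center_continuous (t : R) : Rabs t <= 4 ->
  continuous (fun s => A r0 s) t /\ continuous (fun s => A1 r0 s) t.
Proof.
  intros Ht. destruct (bd_c B inb_center Ht) as [HA [_ [HA1 _]]].
  split; [apply (continuous_along (F := A) (u := fun _ => r0)) | apply (continuous_along (F := A1) (u := fun _ => r0))];
    try assumption; apply continuous_const.
Qed.

Lemma slope_r_kap (r t : R) : r0 - 2 * h <= r <= r0 + 2 * h -> Rabs t <= 4 ->
  Rabs (slope_r A A1 b b1 eps r t + A1 r0 t) <= 2 * kap.
Proof.
  intros Hr Ht. assert (H1 := slope_r_near B family_eps_band Hr Ht). assert (H2 := Hosc Hr Ht).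
  assert (H3 := family_eps_kap).
  replace (slope_r A A1 b b1 eps r t + A1 r0 t) with ((slope_r A A1 b b1 eps r t + A1 r t) - (A1 r t - A1 r0 t)) by ring.
  eapply Rle_trans; [apply Rabs_triang |]. rewrite Rabs_Ropp. lra.
Qed.

Lemma flow_slope (t0 rho1 rho2 : R) (u1 u2 : R -> R) : Rabs t0 <= 4 -> rho1 <> rho2 ->
  is_flow A b r0 h K eps t0 rho1 u1 -> is_flow A b r0 h K eps t0 rho2 u2 ->
  forall t, Rabs t <= 4 -> exists La,
    u2 t - u1 t = (rho2 - rho1) * exp (eps * La) /\
    Rabs (La + RInt (fun s => A1 r0 s) t0 t) <= 16 * kap.
Proof.
  intros Ht0 Hne H1 H2 t Ht.
  destruct (@primitive_exists (fun s => A1 r0 s) 4) as [G [HG HG']]; [lra | intros; now apply A_center_continuous |].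
  destruct (@flow_log_difference A A1 b b1 r0 h K B eps family_eps_band t0 rho1 rho2 (2 * kap) u1 u2
    (fun s => - G s) (fun s => - A1 r0 s) Ht0 Hne H1 H2) with (t := t) as [La [E1 E2]]; try assumption.
  - intros s Hs. apply (is_derive_opp (K := R_AbsRing) (V := R_NormedModule)). now apply HG.
  - intros s r Hs Hr. replace (slope_r A A1 b b1 eps r s - - A1 r0 s) with (slope_r A A1 b b1 eps r s + A1 r0 s) by ring.
    apply slope_r_kap; [| exact Hs].
    apply (inb_between (r := u1 s) (r' := u2 s)); [apply H1 | apply H2 |]; assumption.
  - exists La. split; [exact E1 |]. rewrite HG' by assumption.
    replace (La + (G t - G t0)) with (La - (- G t - - G t0)) by ring. lra.
Qed.

(** First order averaging at frozen radius [r0]. The 18 adds 2 from [slope_near] to 16 from the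
    drift multiplied by the Lipschitz constant [K] of [A]; the 8 is the angle span. *)
Lemma flow_average (t0 rho : R) (u : R -> R) : Rabs t0 <= 4 ->
  is_flow A b r0 h K eps t0 rho u -> forall t, Rabs t <= 4 ->
  Rabs (u t - rho + eps * RInt (fun s => A r0 s) t0 t) <= 8 * eps * (18 * K * K * eps + K * Rabs (rho - r0)).
Proof.
  intros Ht0 [_ [I0 F]] t Ht. assert (HK := bd_K B). assert (He := family_eps_band).
  destruct (@primitive_exists (fun s => A r0 s) 4) as [G [HG HG']]; [lra | intros; now apply A_center_continuous |].
  rewrite HG' by assumption. rewrite <- I0 at 1.
  replace (u t - u t0 + eps * (G t - G t0)) with ((u t + eps * G t) - (u t0 + eps * G t0)) by ring.
  assert (P := Rabs_pos (rho - r0)).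
  eapply Rle_trans.
  - apply (mean_value_bound (f := fun s => u s + eps * G s) (g := fun s => eps * slope A b eps (u s) s + eps * A r0 s)
      (K := eps * (18 * K * K * eps + K * Rabs (rho - r0)))).
    intros s Hs. assert (Hs4 := abs_interval Ht0 Ht Hs). destruct (F s Hs4) as [B1 [D1 R1]]. split.
    + apply (is_derive_plus (K := R_AbsRing) (V := R_NormedModule)); [exact D1 |].
      apply (is_derive_scal G s eps). now apply HG.
    + rewrite <- Rmult_plus_distr_l, Rabs_mult, Rabs_pos_eq by lra. apply Rmult_le_compat_l; [lra |].
      assert (N1 := slope_near B He B1 Hs4).
      assert (N2 := A_lipschitz B inb_center B1 Hs4).
      replace (slope A b eps (u s) s + A r0 s) with ((slope A b eps (u s) s + A (u s) s) - (A (u s) s - A r0 s)) by ring.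
      eapply Rle_trans; [apply Rabs_triang |]. rewrite Rabs_Ropp.
      assert (N3 : Rabs (u s - r0) <= 16 * K * eps + Rabs (rho - r0)).
      { replace (u s - r0) with ((u s - rho) + (rho - r0)) by ring.
        eapply Rle_trans; [apply Rabs_triang |]. lra. }
      assert (K * Rabs (u s - r0) <= K * (16 * K * eps + Rabs (rho - r0))) by (apply Rmult_le_compat_l; lra).
      lra.
  - assert (T := abs_diff_8 Ht0 Ht).
    replace (8 * eps * (18 * K * K * eps + K * Rabs (rho - r0))) with (eps * (18 * K * K * eps + K * Rabs (rho - r0)) * 8) by ring.
    apply Rmult_le_compat_l; [| exact T]. apply Rmult_le_pos; [lra |].
    apply Rplus_le_le_0_compat; repeat apply Rmult_le_pos; lra.
Qed.

(** In the logarithmic difference formula, the comparison function is now [slope_r] along the orbit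
    itself. As the second orbit approaches, the exponent tends to its integral and the difference
    quotient to the exponential. *)
Lemma flow_derive (t0 : R) (Phi : R -> R -> R) : Rabs t0 <= 4 ->
  (forall rho, Rabs (rho - r0) <= h -> is_flow A b r0 h K eps t0 rho (Phi rho)) ->
  forall rho t, Rabs (rho - r0) < h -> Rabs t <= 4 -> exists La,
    is_derive (fun x => Phi x t) rho (exp (eps * La)) /\
    Rabs (La + RInt (fun s => A1 r0 s) t0 t) <= 16 * kap.
Proof.
  intros Ht0 HPhi rho t Hrho Ht. assert (He := family_eps_band). assert (HK := bd_K B).
  assert (Hu := HPhi rho ltac:(lra)). set (u := Phi rho) in *.
  assert (Hgc : forall s, Rabs s <= 4 -> continuous (fun s => slope_r A A1 b b1 eps (u s) s) s).
  { intros s Hs. apply (continuous_along (F := slope_r A A1 b b1 eps) (u := u)); [| apply Hu].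
    apply (slope_r_continuity B He); [now apply Hu | exact Hs]. }
  destruct (@primitive_exists (fun s => slope_r A A1 b b1 eps (u s) s) 4) as [G [HG HG']]; [lra | exact Hgc |].
  destruct (@primitive_exists (fun s => A1 r0 s) 4) as [G1 [HG1 HG1']]; [lra | intros; now apply A_center_continuous |].
  exists (G t - G t0). split.
  - apply is_derive_Reals. intros e Hepos.
    assert (Hexp : continuous exp (eps * (G t - G t0))).
    { apply continuity_pt_filterlim. apply derivable_continuous_pt, derivable_pt_exp. }
    destruct (proj1 (continuous_eps _ _) Hexp e Hepos) as [eta [Heta Hexp']].
    (* The exponents then differ by at most [eps * (8 * k) = eta / 2]. *)
    set (k := eta / (16 * eps)).
    assert (Hk : 0 < k) by (apply Rdiv_lt_0_compat; lra).
    destruct (uniform_continuity_2d (slope_r A A1 b b1 eps) (r0 - 2 * h) (r0 + 2 * h) (-4) 4) with (eps := mkposreal k Hk) as [d1 Hd1].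
    { intros x y Hx Hy. apply (slope_r_continuity B He Hx). apply Rabs_le_between; lra. }
    assert (Hdl : 0 < Rmin (d1 / 2) (h - Rabs (rho - r0))).
    { apply Rmin_pos; [assert (T := cond_pos d1) |]; lra. }
    exists (mkposreal _ Hdl). intros hh Hhh Hhd. simpl in Hhd.
    below_min Hhd as Hhd1 Hhd2.
    assert (Hrho2 : Rabs (rho + hh - r0) <= h).
    { replace (rho + hh - r0) with ((rho - r0) + hh) by ring. eapply Rle_trans; [apply Rabs_triang |]. lra. }
    assert (Hu2 := HPhi _ Hrho2).
    assert (Hdiff := flow_difference B He Ht0 Hu Hu2).
    destruct (@flow_log_difference A A1 b b1 r0 h K B eps He t0 rho (rho + hh) k u (Phi (rho + hh))
      G (fun s => slope_r A A1 b b1 eps (u s) s) Ht0) with (t := t) as [La [E1 E2]]; try assumption.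
    + lra.
    + intros s r Hs Hr. apply Rlt_le.
      assert (Hs' : -4 <= s <= 4) by now apply Rabs_le_between.
      assert (B1 : r0 - 2 * h <= u s <= r0 + 2 * h) by now apply Hu.
      assert (B2 : r0 - 2 * h <= Phi (rho + hh) s <= r0 + 2 * h) by now apply Hu2.
      apply (Hd1 (u s) s r s); try assumption.
      * apply (inb_between B1 B2 Hr).
      * specialize (Hdiff s Hs). replace (rho + hh - rho) with hh in Hdiff by ring.
        assert (Rabs (Phi (rho + hh) s - u s) <= 3 / 2 * Rabs hh).
        { replace (Phi (rho + hh) s - u s) with ((Phi (rho + hh) s - u s - hh) + hh) by ring.
          eapply Rle_trans; [apply Rabs_triang |]. lra. }
        rewrite Rmin_comm, Rmax_comm in Hr. apply Rabs_le_between_min_max in Hr. assert (T := cond_pos d1). lra.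
      * replace (s - s) with 0 by ring. rewrite Rabs_R0. apply cond_pos.
    + fold u. change (Phi (rho + hh) t - Phi rho t) with (Phi (rho + hh) t - u t).
      rewrite E1. replace ((rho + hh - rho) * exp (eps * La) / hh) with (exp (eps * La)) by (field; exact Hhh).
      apply Hexp'. rewrite <- Rmult_minus_distr_l, Rabs_mult, Rabs_pos_eq by lra.
      apply Rle_lt_trans with (eps * (8 * k)); [apply Rmult_le_compat_l; lra |].
      unfold k. replace (eps * (8 * (eta / (16 * eps)))) with (eta / 2) by (field; lra). lra.
  - rewrite HG1' by assumption.
    replace (G t - G t0 + (G1 t - G1 t0)) with ((G t + G1 t) - (G t0 + G1 t0)) by ring.
    eapply Rle_trans.
    + apply (mean_value_bound (f := fun s => G s + G1 s) (g := fun s => slope_r A A1 b b1 eps (u s) s + A1 r0 s) (K := 2 * kap)).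
      intros s Hs. assert (Hs4 := abs_interval Ht0 Ht Hs). split.
      * apply (is_derive_plus (K := R_AbsRing) (V := R_NormedModule)); [now apply HG | now apply HG1].
      * apply slope_r_kap; [now apply Hu | exact Hs4].
    + assert (T := abs_diff_8 Ht0 Ht). replace (16 * kap) with (2 * kap * 8) by ring.
      assert (Hkap : 0 <= kap) by (eapply Rle_trans; [apply Rabs_pos | exact (Hosc inb_center Ht)]).
      apply Rmult_le_compat_l; lra.
Qed.

(* Time along an orbit, from [t' = - (1 - eps b)]. *)
Lemma flow_angle (t0 rho : R) (u : R -> R) : is_flow A b r0 h K eps t0 rho u ->
  Rabs t0 <= 4 -> exists th : R -> R, th 0 = t0 /\
    (forall s, Rabs (th s) <= 4 -> is_derive th s (- (1 - eps * b (u (th s)) (th s)))) /\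
    (forall s s', s < s' -> th s' < th s) /\
    (forall y, exists s, th s = y) /\
    (forall s s', Rabs (th s' - th s) <= 2 * Rabs (s' - s)).
Proof.
  intros Hu Ht0. assert (He := family_eps_band).
  set (ct := clamp (-4) 4).
  assert (Hct : forall t, Rabs (ct t) <= 4) by (intros; apply Rabs_le_between, clamp_range; lra).
  set (q := fun t => / (1 - eps * b (u (ct t)) (ct t))).
  assert (Hden : forall t, 1 / 2 <= 1 - eps * b (u (ct t)) (ct t) <= 3 / 2).
  { intros t. apply (denominator_bounds B He); [now apply Hu | apply Hct]. }
  assert (Hqc : forall t, continuous q t).
  { intros t. unfold q.
    apply (continuous_comp (fun t => 1 - eps * b (u (ct t)) (ct t)) Rinv).
    - apply (continuous_minus (V := R_NormedModule) (fun _ => 1)); [apply continuous_const |].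
      apply (continuous_scal_r (K := R_AbsRing) (V := R_NormedModule) eps (fun t => b (u (ct t)) (ct t))).
      assert (Hb : continuous (fun s => b (u s) s) (ct t)).
      { apply (continuous_along (F := b) (u := u)); [| apply Hu]. apply (bd_c B); [now apply Hu | apply Hct]. }
      apply continuous_eps. intros e Hepos.
      destruct (proj1 (continuous_eps _ _) Hb e Hepos) as [d [Hd Hd']].
      exists d. split; [assumption |]. intros s Hs. apply (Hd' (ct s)).
      eapply Rle_lt_trans; [apply clamp_lipschitz | exact Hs].
    - apply continuity_pt_filterlim. apply continuity_pt_inv; [apply continuity_pt_id |]. specialize (Hden t). lra. }
  set (g := fun t => RInt q t0 t).
  destruct (@increasing_inverse g q (1 / 2)) as [k [Hk1 [Hk2 Hk3]]].
  - lra.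
  - intros t. split; [now apply is_derive_RInt_cont |].
    unfold q. specialize (Hden t). replace (1 / 2) with (/ 2) by field. apply Rinv_le_contravar; lra.
  - assert (Hg0 : g t0 = 0) by apply (RInt_point (V := R_CompleteNormedModule)).
    assert (Hqi : forall y, / q (k y) = 1 - eps * b (u (ct (k y))) (ct (k y))) by (intros; unfold q; apply Rinv_inv).
    assert (Hmono : forall y y', y < y' -> k y < k y').
    { intros y y' Hy. destruct (MVT_gen k y y' (fun y => / q (k y))) as [c [_ E]].
      - intros; apply Hk3.
      - intros x _. apply continuity_pt_filterlim. exact (is_derive_continuous (Hk3 x)).
      - rewrite Hqi in E. specialize (Hden (k c)). 
        assert (0 < (1 - eps * b (u (ct (k c))) (ct (k c))) * (y' - y)) by (apply Rmult_lt_0_compat; lra). lra. }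
    assert (Hder : forall s, is_derive (fun s => k (- s)) s (- (1 - eps * b (u (ct (k (- s)))) (ct (k (- s)))))).
    { intros s. rewrite <- Hqi.
      evar_last.
      - apply (is_derive_comp k (fun s => - s)); [apply Hk3 |]. apply (is_derive_opp (K := R_AbsRing) (V := R_NormedModule)), (is_derive_id (K := R_AbsRing)).
      - unfold scal, opp, one; simpl. unfold mult; simpl. ring. }
    (* [g] is the time as a function of the angle up to sign: the orbit turns clockwise, so its
       angle is the inverse of [g] run backwards. The clamp inside [q] makes it exist for all
       times. *)
    exists (fun s => k (- s)). split; [| split; [| split; [| split]]].
    + rewrite Ropp_0, <- Hg0. apply Hk2.
    + intros s Hs. assert (E := Hder s). unfold ct in E. rewrite clamp_id in E; [exact E |]. now apply Rabs_le_between.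
    + intros s s' Hs. apply Hmono. lra.
    + intros y. exists (- g y). rewrite Ropp_involutive. apply Hk2.
    + intros s s'. apply (mean_value_bound (f := fun s => k (- s)) (g := fun s => - (1 - eps * b (u (ct (k (- s)))) (ct (k (- s)))))).
      intros x _. split; [apply Hder |]. rewrite Rabs_Ropp. specialize (Hden (k (- x))). apply Rabs_le. lra.
Qed.

End Flow_family.

(** * Orbits in each half turn *)

Lemma ccont2_continuity_re (G : R -> R -> C) (r t : R) : ccont2 G r t -> continuity_2d_pt (fun r t => Re (G r t)) r t.
Proof. exact (ccont_2d_re (fun y : C => G (fst y) (snd y)) r t). Qed.

Lemma ccont2_continuity_im (G : R -> R -> C) (r t : R) : ccont2 G r t -> continuity_2d_pt (fun r t => Im (G r t)) r t.
Proof. exact (ccont_2d_im (fun y : C => G (fst y) (snd y)) r t). Qed.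

Lemma vderiv_polar_curve (a th : R -> R) (t a' th' : R) :
  is_derive a t a' -> is_derive th t th' ->
  vderiv (fun s => polar (a s) (th s)) t ((RtoC a' + Ci * RtoC (a t * th')) * polar 1 (th t))%C.
Proof.
  intros Ha Hth.
  assert (Xa : ex_derive a t) by (eexists; exact Ha). assert (Xt : ex_derive th t) by (eexists; exact Hth).
  assert (E1 : Derive (fun x : R => a x) t = a') by exact (is_derive_unique _ _ _ Ha).
  assert (E2 : Derive (fun x : R => th x) t = th') by exact (is_derive_unique _ _ _ Hth).
  apply vderiv_re_im. split; simpl.
  - auto_derive; [now split |]. rewrite E1, E2. ring.
  - auto_derive; [now split |]. rewrite E1, E2. ring.
Qed.

Section Perturbation_band.

Variables (D U : C -> Prop) (f phi psi : C -> C) (p : C) (rs : R).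
Hypothesis S : linearized_center D U f phi psi p rs.

Definition radial_rate (m : nat) (a : nat -> nat -> C) (r t : R) : R :=
  Re (rotated_perturbation psi (bipoly m a) r t).

Definition angular_rate (m : nat) (a : nat -> nat -> C) (r t : R) : R :=
  Im (rotated_perturbation psi (bipoly m a) r t * / RtoC r).

(** The derivatives come before the band because its width is later chosen from the oscillation of
    [A1]. The constant may be enlarged freely, so that one value serves both fields. *)
Lemma perturbation_band (m : nat) (a : nat -> nat -> C) :
  exists A1 b1 : R -> R -> R,
    (forall r t, 0 < r < rs -> is_derive (fun s => radial_rate m a s t) r (A1 r t) /\
       continuity_2d_pt (radial_rate m a) r t /\ continuity_2d_pt A1 r t) /\
    (forall r0 h, 0 < h -> 0 < r0 - 2 * h -> r0 + 2 * h < rs -> exists K, 0 < K /\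
       forall K', K <= K' -> band_data (radial_rate m a) A1 (angular_rate m a) b1 r0 h K') /\
    (forall r0 kap, 0 < r0 < rs -> 0 < kap -> exists h, 0 < h /\ 0 < r0 - 2 * h /\ r0 + 2 * h < rs /\
       forall r t, r0 - 2 * h <= r <= r0 + 2 * h -> Rabs t <= 4 -> Rabs (A1 r t - A1 r0 t) <= kap).
Proof.
  destruct (radial_perturbation S m a) as [W1 HW].
  assert (HV : radial_C1 rs (fun r t => rotated_perturbation psi (bipoly m a) r t * / RtoC r)%C).
  { apply radial_mult; [now exists W1 |]. apply radial_inv; [| apply radial_radius].
    intros r _ Hr E. apply RtoC_inj in E. lra. }
  destruct HV as [V1 HV].
  exists (fun r t => Re (W1 r t)), (fun r t => Im (V1 r t)). split; [| split].
  - intros r t Hr. destruct (HW r t Hr) as [H1 [H2 H3]]. split; [| split].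
    + exact (proj1 (proj1 (vderiv_re_im _ _ _) H1)).
    + exact (ccont2_continuity_re H2).
    + exact (ccont2_continuity_re H3).
  - intros r0 h Hh Hh1 Hh2.
    assert (Hsub : forall r, r0 - 2 * h <= r <= r0 + 2 * h -> 0 < r < rs) by (intros; lra).
    destruct (@rect_bounded (rotated_perturbation psi (bipoly m a)) (r0 - 2 * h) (r0 + 2 * h) (-4) 4) as [K1 [P1 B1]].
    { intros r t Hr _. apply HW. auto. }
    destruct (@rect_bounded W1 (r0 - 2 * h) (r0 + 2 * h) (-4) 4) as [K2 [P2 B2]].
    { intros r t Hr _. apply HW. auto. }
    destruct (@rect_bounded (fun r t => rotated_perturbation psi (bipoly m a) r t * / RtoC r)%C (r0 - 2 * h) (r0 + 2 * h) (-4) 4) as [K3 [P3 B3]].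
    { intros r t Hr _. apply HV. auto. }
    destruct (@rect_bounded V1 (r0 - 2 * h) (r0 + 2 * h) (-4) 4) as [K4 [P4 B4]].
    { intros r t Hr _. apply HV. auto. }
    exists (K1 + K2 + K3 + K4). split; [lra |]. intros K HK. constructor; try lra.
    + intros r t Hr Ht. destruct (HW r t (Hsub r Hr)) as [H1 _]. destruct (HV r t (Hsub r Hr)) as [H2 _].
      split; [exact (proj1 (proj1 (vderiv_re_im _ _ _) H1)) | exact (proj2 (proj1 (vderiv_re_im _ _ _) H2))].
    + intros r t Hr Ht. destruct (HW r t (Hsub r Hr)) as [_ [H1 H2]]. destruct (HV r t (Hsub r Hr)) as [_ [H3 H4]].
      repeat split.
      * exact (ccont2_continuity_re H1).
      * exact (ccont2_continuity_im H3).
      * exact (ccont2_continuity_re H2).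
      * exact (ccont2_continuity_im H4).
    + intros r t Hr Ht. apply Rabs_le_between in Ht.
      specialize (B1 r t Hr Ht). specialize (B2 r t Hr Ht). specialize (B3 r t Hr Ht). specialize (B4 r t Hr Ht).
      repeat split.
      * eapply Rle_trans; [apply re_le_Cmod |]. lra.
      * eapply Rle_trans; [apply im_le_Cmod |]. lra.
      * eapply Rle_trans; [apply re_le_Cmod |]. lra.
      * eapply Rle_trans; [apply im_le_Cmod |]. lra.
  - intros r0 kap Hr0 Hkap.
    set (h0 := Rmin r0 (rs - r0) / 4).
    assert (Hm : 0 < Rmin r0 (rs - r0)) by (apply Rmin_pos; lra).
    assert (Hm1 : Rmin r0 (rs - r0) <= r0) by apply Rmin_l. assert (Hm2 : Rmin r0 (rs - r0) <= rs - r0) by apply Rmin_r.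
    destruct (@rect_uniform W1 (r0 - 2 * h0) (r0 + 2 * h0) (-4) 4) with (e := kap) as [d [Hd HU]]; [| exact Hkap |].
    { intros r t Hr _. apply HW. unfold h0 in Hr. lra. }
    set (h := Rmin h0 (d / 4)).
    assert (Hh : 0 < h) by (apply Rmin_pos; unfold h0; lra).
    assert (Hh1 : h <= h0) by apply Rmin_l. assert (Hh2 : h <= d / 4) by apply Rmin_r.
    exists h. unfold h0 in Hh1. repeat split; try lra.
    intros r t Hr Ht. apply Rabs_le_between in Ht. rewrite <- Re_minus.
    eapply Rle_trans; [apply re_le_Cmod |]. apply Rlt_le. apply HU.
    + unfold h0; lra.
    + unfold h0; lra.
    + exact Ht.
    + apply Rabs_def1; lra.
Qed.

(** Restores time: [u] solves the equation with the angle as variable, and composing it with the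
    angular motion [th] gives back a solution in the plane. *)
Lemma perturbed_orbit_derive (m : nat) (a : nat -> nat -> C) (eps : R) (u th : R -> R) (s : R) :
  0 < u (th s) < rs -> 1 / 2 <= 1 - eps * angular_rate m a (u (th s)) (th s) ->
  is_derive u (th s) (eps * slope (radial_rate m a) (angular_rate m a) eps (u (th s)) (th s)) ->
  is_derive th s (- (1 - eps * angular_rate m a (u (th s)) (th s))) ->
  vderiv (fun s => psi (polar (u (th s)) (th s))) s
    (perturbed f (bipoly m a) eps (psi (polar (u (th s)) (th s)))).
Proof.
  intros Hr Hden Hu Hth.
  set (r := u (th s)) in *. set (t := th s) in *.
  assert (Hw := pdisc_polar t Hr).
  set (W := rotated_perturbation psi (bipoly m a) r t).
  assert (Hnz := dpsi_neq_0 S Hw).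
  assert (Hrz : RtoC r <> 0%C). { intros E. apply RtoC_inj in E. lra. }
  assert (Hut : is_derive (fun s => u (th s)) s (eps * Re W)).
  { evar_last; [apply (is_derive_comp u th s); [exact Hu | exact Hth] |].
    unfold scal; simpl. unfold mult; simpl. unfold slope.
    change (radial_rate m a r t) with (Re W).
    assert (E : forall x y e : R, y <> 0 -> - y * (e * (- x / y)) = e * x) by (intros; field; assumption).
    apply E. lra. }
  assert (Hb : r * angular_rate m a r t = Im W).
  { unfold angular_rate. fold W. rewrite <- RtoC_inv by lra. rewrite Im_mult.
    change (Im (RtoC (/ r))) with 0. change (Re (RtoC (/ r))) with (/ r). field. lra. }
  assert (Hpc := vderiv_polar_curve Hut Hth).
  assert (Hx := vderiv_comp psi (fun s => polar (u (th s)) (th s)) s _ _ Hpc (psi_cderiv S Hw)).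
  assert (Hang : u (th s) * - (1 - eps * angular_rate m a r t) = - r + eps * Im W).
  { change (u (th s)) with r. rewrite <- Hb. ring. }
  cbv beta in Hx. rewrite Hang in Hx.
  evar_last; [exact Hx |].
  change ((C_derive psi (polar r t) * ((RtoC (eps * Re W) + Ci * RtoC (- r + eps * Im W)) * polar 1 t))%C =
    perturbed f (bipoly m a) eps (psi (polar r t))).
  unfold perturbed. rewrite (f_psi S Hw).
  set (Pz := bipoly m a (psi (polar r t)) (Cconj (psi (polar r t)))).
  assert (HP : Pz = (C_derive psi (polar r t) * (W * polar 1 t))%C).
  { unfold W, rotated_perturbation. fold Pz.
    transitivity (Pz * (polar 1 t * Cconj (polar 1 t)))%C; [rewrite cis_mult_conj; ring |]. field. exact Hnz. }
  rewrite HP.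
  assert (HWs : W = (RtoC (Re W) + Ci * RtoC (Im W))%C) by (apply C_ext; simpl; unfold Re, Im; ring).
  set (dd := C_derive psi (polar r t)).
  transitivity (dd * (- Ci * (RtoC r * polar 1 t)) + eps * (dd * ((RtoC (Re W) + Ci * RtoC (Im W)) * polar 1 t)))%C.
  - rewrite RtoC_plus, RtoC_opp, !RtoC_mult. ring.
  - rewrite <- HWs, <- (polar_cis r t). reflexivity.
Qed.

Lemma radial_integral_derive (m : nat) (a : nat -> nat -> C) (A1 : R -> R -> R) (c d r : R) :
  (forall r t, 0 < r < rs -> is_derive (fun s => radial_rate m a s t) r (A1 r t) /\
     continuity_2d_pt (radial_rate m a) r t /\ continuity_2d_pt A1 r t) ->
  0 < r < rs ->
  is_derive (fun s => RInt (fun t => radial_rate m a s t) c d) r (RInt (fun t => A1 r t) c d).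
Proof.
  intros H Hr.
  assert (Hd : 0 < Rmin r (rs - r)) by (apply Rmin_pos; lra).
  assert (Hin : forall s, Rabs (s - r) < Rmin r (rs - r) -> 0 < s < rs).
  { intros s Hs. below_min Hs as H1 H2.
    apply Rabs_def2 in H1. apply Rabs_def2 in H2. lra. }
  evar_last.
  - apply (is_derive_RInt_param (fun s t => radial_rate m a s t) c d r).
    + exists (mkposreal _ Hd). intros s Hs t _. eexists. apply (H s t (Hin s Hs)).
    + intros t _. apply (continuity_2d_pt_ext_loc A1).
      * exists (mkposreal _ Hd). intros s v Hs _. symmetry. apply is_derive_unique. apply (H s v (Hin s Hs)).
      * apply H. exact Hr.
    + exists (mkposreal _ Hd). intros s Hs. apply (@ex_RInt_perturbation D U f phi psi p rs S m a s). exact (Hin s Hs).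
  - simpl. apply RInt_ext. intros t _. apply is_derive_unique. apply (H r t Hr).
Qed.

End Perturbation_band.

(** * Local Lipschitz regularity of the perturbed fields *)

Lemma loclip_ext (g h : C -> C) (z : C) (d : R) :
  0 < d -> (forall y, Cmod (y - z) < d -> g y = h y) -> loclip g z -> loclip h z.
Proof.
  intros Hd He [L [d' [HL [Hd' H]]]]. exists L, (Rmin d d'). split; [assumption |]. split; [now apply Rmin_pos |].
  intros z1 z2 H1 H2.
  rewrite <- !He by (eapply Rlt_le_trans; [eassumption | apply Rmin_l]).
  apply H; (eapply Rlt_le_trans; [eassumption | apply Rmin_r]).
Qed.

Lemma loclip_ccont (g : C -> C) (z : C) : loclip g z -> ccont g z.
Proof.
  intros [L [d [HL [Hd H]]]] e He. exists (Rmin d (e / (L + 1))). split.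
  { apply Rmin_pos; [assumption | apply Rdiv_lt_0_compat; lra]. }
  intros y Hy. below_min Hy as Hy1 Hy2.
  assert (T := H z y ltac:(rewrite Cmod_minus_self; lra) Hy1).
  apply (Rmult_lt_compat_l (L + 1)) in Hy2; [| lra].
  replace ((L + 1) * (e / (L + 1))) with e in Hy2 by (field; lra).
  assert (P := Cmod_ge_0 (y - z)). nra.
Qed.

Lemma loclip_const (c z : C) : loclip (fun _ => c) z.
Proof.
  exists 0, 1. split; [lra |]. split; [lra |]. intros. rewrite Cmod_minus_self. lra.
Qed.

Lemma loclip_id (z : C) : loclip (fun y => y) z.
Proof. exists 1, 1. split; [lra |]. split; [lra |]. intros. lra. Qed.

Lemma loclip_conj (z : C) : loclip Cconj z.
Proof.
  exists 1, 1. split; [lra |]. split; [lra |]. intros z1 z2 _ _.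
  replace (Cconj z2 - Cconj z1)%C with (Cconj (z2 - z1)) by (apply C_ext; simpl; ring).
  rewrite Cmod_conj. lra.
Qed.

Lemma loclip_plus (g h : C -> C) (z : C) : loclip g z -> loclip h z -> loclip (fun y => g y + h y)%C z.
Proof.
  intros [L1 [d1 [HL1 [Hd1 H1]]]] [L2 [d2 [HL2 [Hd2 H2]]]].
  exists (L1 + L2), (Rmin d1 d2). split; [lra |]. split; [now apply Rmin_pos |].
  intros z1 z2 Hz1 Hz2.
  replace (g z2 + h z2 - (g z1 + h z1))%C with ((g z2 - g z1) + (h z2 - h z1))%C by ring.
  eapply Rle_trans; [apply Cmod_triangle |]. rewrite Rmult_plus_distr_r. apply Rplus_le_compat.
  - apply H1; (eapply Rlt_le_trans; [eassumption | apply Rmin_l]).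
  - apply H2; (eapply Rlt_le_trans; [eassumption | apply Rmin_r]).
Qed.

Lemma loclip_mult (g h : C -> C) (z : C) : loclip g z -> loclip h z -> loclip (fun y => g y * h y)%C z.
Proof.
  intros Hg Hh. destruct (ccont_bounded g z (loclip_ccont Hg)) as [d3 [Hd3 B3]].
  destruct (ccont_bounded h z (loclip_ccont Hh)) as [d4 [Hd4 B4]].
  destruct Hg as [L1 [d1 [HL1 [Hd1 H1]]]]. destruct Hh as [L2 [d2 [HL2 [Hd2 H2]]]].
  set (Kg := Cmod (g z) + 1) in *. set (Kh := Cmod (h z) + 1) in *.
  assert (PKg : 0 <= Kg) by (unfold Kg; assert (T := Cmod_ge_0 (g z)); lra).
  assert (PKh : 0 <= Kh) by (unfold Kh; assert (T := Cmod_ge_0 (h z)); lra).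
  exists (Kg * L2 + L1 * Kh), (Rmin (Rmin d1 d2) (Rmin d3 d4)).
  split. { assert (0 <= Kg * L2) by now apply Rmult_le_pos. assert (0 <= L1 * Kh) by now apply Rmult_le_pos. lra. }
  split; [repeat apply Rmin_pos; assumption |].
  assert (Hsub : forall y, Cmod (y - z) < Rmin (Rmin d1 d2) (Rmin d3 d4) ->
    Cmod (y - z) < d1 /\ Cmod (y - z) < d2 /\ Cmod (y - z) < d3 /\ Cmod (y - z) < d4).
  { intros y Hy. below_min Hy as Ha Hb.
    split; [exact (Rlt_le_trans _ _ _ Ha (Rmin_l _ _)) |]. split; [exact (Rlt_le_trans _ _ _ Ha (Rmin_r _ _)) |].
    split; [exact (Rlt_le_trans _ _ _ Hb (Rmin_l _ _)) | exact (Rlt_le_trans _ _ _ Hb (Rmin_r _ _))]. }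
  intros z1 z2 Hz1 Hz2. destruct (Hsub z1 Hz1) as [a1 [a2 [a3 a4]]]. destruct (Hsub z2 Hz2) as [b1 [b2 [b3 b4]]].
  replace (g z2 * h z2 - g z1 * h z1)%C with (g z2 * (h z2 - h z1) + (g z2 - g z1) * h z1)%C by ring.
  eapply Rle_trans; [apply Cmod_triangle |]. rewrite !Cmod_mult, Rmult_plus_distr_r. apply Rplus_le_compat.
  - rewrite Rmult_assoc. apply Rmult_le_compat; try apply Cmod_ge_0; [now apply B3 | now apply H2].
  - replace (L1 * Kh * Cmod (z2 - z1)) with (L1 * Cmod (z2 - z1) * Kh) by ring.
    apply Rmult_le_compat; try apply Cmod_ge_0; [now apply H1 | now apply B4].
Qed.

Lemma loclip_comp (g h : C -> C) (z : C) : loclip g z -> loclip h (g z) -> loclip (fun y => h (g y)) z.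
Proof.
  intros Hg [L2 [d2 [HL2 [Hd2 H2]]]]. destruct (loclip_ccont Hg Hd2) as [d3 [Hd3 Hc]].
  destruct Hg as [L1 [d1 [HL1 [Hd1 H1]]]].
  exists (L2 * L1), (Rmin d1 d3). split; [now apply Rmult_le_pos |]. split; [now apply Rmin_pos |].
  intros z1 z2 Hz1 Hz2.
  eapply Rle_trans; [apply H2; apply Hc; (eapply Rlt_le_trans; [eassumption | apply Rmin_r]) |].
  rewrite Rmult_assoc. apply Rmult_le_compat_l; [assumption |].
  apply H1; (eapply Rlt_le_trans; [eassumption | apply Rmin_l]).
Qed.

Section Field_regularity.

Variables (D U : C -> Prop) (f phi psi : C -> C) (p : C) (rs : R).
Hypothesis S : linearized_center D U f phi psi p rs.

Lemma phi_loclip (w : C) : pdisc rs w -> loclip phi (psi w).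
Proof.
  intros Hw. destruct (U_ball S (psi_U S Hw)) as [d [Hd HU]].
  apply (loclip_C1 phi (C_derive phi) (psi w) d Hd).
  - intros z Hz. apply (phi_cderiv S). now apply HU.
  - apply (dphi_ccont S); [apply (psi_U S Hw) | apply (psi_neq_p S Hw)].
Qed.

(** Complex differentiability of [f] alone gives no Lipschitz bound, so [f z] is rewritten as
    [psi'(phi z) * (- i phi z)], whose factors have continuous derivatives. *)
Lemma field_loclip (m : nat) (a : nat -> nat -> C) (eps : R) (w : C) : pdisc rs w ->
  loclip (perturbed f (bipoly m a) eps) (psi w).
Proof.
  intros Hw. unfold perturbed.
  apply (loclip_plus (g := f) (h := fun z => (RtoC eps * bipoly m a z (Cconj z))%C)).
  - destruct (U_ball S (psi_U S Hw)) as [d [Hd HU]].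
    destruct (pdisc_open Hw) as [d1 [Hd1 Hp]].
    assert (Hphi := phi_loclip Hw).
    destruct (loclip_ccont Hphi Hd1) as [d2 [Hd2 Hc]]. rewrite (phi_psi S Hw) in Hc.
    apply (loclip_ext (g := fun z => (C_derive psi (phi z) * (- Ci * phi z))%C) (d := Rmin d d2)); [now apply Rmin_pos | |].
    + intros z Hz. below_min Hz as Hz1 Hz2.
      assert (Hpz : pdisc rs (phi z)) by now apply Hp, Hc.
      rewrite <- (f_psi S Hpz). f_equal. apply (psi_phi S); [now apply HU | apply Hpz].
    + apply loclip_mult.
      * apply (loclip_comp (g := phi) (h := C_derive psi)); [exact Hphi |]. rewrite (phi_psi S Hw).
        apply (loclip_C1 (C_derive psi) (C_derive (C_derive psi)) w d1 Hd1).
        -- intros z Hz. apply (d2psi S). now apply Hp.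
        -- apply (d2psi S Hw).
      * apply loclip_mult; [apply loclip_const | exact Hphi].
  - apply loclip_mult; [apply loclip_const |].
    apply (bipoly_closed (N := fun g : C -> C => loclip g (psi w)) (u := fun z => z) (v := Cconj)).
    + intros g h E. apply (loclip_ext (d := 1)); [lra | auto].
    + intros c. apply loclip_const.
    + intros g h. apply loclip_plus.
    + intros g h. apply loclip_mult.
    + apply loclip_id.
    + apply loclip_conj.
Qed.

Lemma field_ccont (m : nat) (a : nat -> nat -> C) (eps : R) (w : C) : pdisc rs w ->
  ccont (perturbed f (bipoly m a) eps) (psi w).
Proof. intros Hw. now apply loclip_ccont, field_loclip. Qed.

Lemma field_bounded (m : nat) (a : nat -> nat -> C) (eps r1 r2 : R) : 0 < r1 -> r2 < rs ->
  exists Kx, 0 < Kx /\ forall r t, r1 <= r <= r2 -> Rabs t <= 4 ->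
    Cmod (perturbed f (bipoly m a) eps (psi (polar r t))) <= Kx.
Proof.
  intros H1 H2.
  destruct (@rect_bounded (fun r t => perturbed f (bipoly m a) eps (psi (polar r t))) r1 r2 (-4) 4) as [Kx [HK Hb]].
  - intros r t Hr _. assert (Hw : pdisc rs (polar r t)) by (apply pdisc_polar; lra).
    apply (ccont_comp (fun y : C => psi (polar (fst y) (snd y))) (perturbed f (bipoly m a) eps)).
    + apply (ccont_comp (fun y : C => polar (fst y) (snd y)) psi); [apply ccont_polar | now apply (psi_ccont S)].
    + now apply field_ccont.
  - exists Kx. split; [exact HK |]. intros r t Hr Ht. apply Hb; [exact Hr | now apply Rabs_le_between].
Qed.

(** The inequality between [t0 - t1] and [2 * tau] bounds the duration of a half turn below by
    [PI / 2]; surjectivity of [th] later finds the time at which a given angle is passed. *)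
Lemma half_orbit (m : nat) (a : nat -> nat -> C) (A1 b1 : R -> R -> R) (r0 h K kap eps t0 t1 rho : R) (u : R -> R) :
  band_data (radial_rate psi m a) A1 (angular_rate psi m a) b1 r0 h K ->
  0 < r0 - 2 * h -> r0 + 2 * h < rs -> 0 < eps < family_eps h K kap ->
  is_flow (radial_rate psi m a) (angular_rate psi m a) r0 h K eps t0 rho u ->
  Rabs t0 <= 4 -> Rabs t1 <= 4 -> t1 <= t0 ->
  exists (th : R -> R) (tau : R), 0 <= tau /\ th 0 = t0 /\ th tau = t1 /\ t0 - t1 <= 2 * tau /\
    (forall s s', s < s' -> th s' < th s) /\
    (forall y, exists s, th s = y) /\
    (forall s, 0 <= s <= tau -> t1 <= th s <= t0) /\
    forall s, 0 <= s <= tau ->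
      vderiv (fun s => psi (polar (u (th s)) (th s))) s
        (perturbed f (bipoly m a) eps (psi (polar (u (th s)) (th s)))).
Proof.
  intros Bd Hr1 Hr2 He Hu Ht0 Ht1 Ht.
  destruct (flow_angle Bd He Hu Ht0) as [th [E0 [Hd [Hmono [Hsurj Hlip]]]]].
  destruct (Hsurj t1) as [tau Etau].
  assert (Htau : 0 <= tau).
  { apply Rnot_lt_le. intros Hn. assert (T := Hmono tau 0 Hn). lra. }
  assert (Hmono' : forall s s', s <= s' -> th s' <= th s).
  { intros s s' [Hs | ->]; [apply Rlt_le; now apply Hmono | lra]. }
  assert (Hrange : forall s, 0 <= s <= tau -> t1 <= th s <= t0).
  { intros s Hs. rewrite <- Etau, <- E0. split; apply Hmono'; lra. }
  exists th, tau. repeat (split; [assumption |]). split; [| split; [| split; [| split]]]; try assumption.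
  - assert (T := Hlip 0 tau). rewrite E0, Etau in T. rewrite (Rabs_pos_eq (tau - 0)) in T by lra.
    assert (T2 := Rle_abs (- (t1 - t0))). rewrite Rabs_Ropp in T2. lra.
  - intros s Hs. assert (Hs4 : Rabs (th s) <= 4).
    { specialize (Hrange s Hs). apply Rabs_le_between in Ht0. apply Rabs_le_between in Ht1. apply Rabs_le. lra. }
    destruct Hu as [_ [_ Hu]]. destruct (Hu (th s) Hs4) as [Hin [Hder _]].
    apply (@perturbed_orbit_derive D U f phi psi p rs S); try assumption.
    + lra.
    + apply (denominator_bounds Bd (family_eps_band He) Hin Hs4).
    + now apply Hd.
Qed.

End Field_regularity.

Lemma vderiv_ext_loc (x y : R -> C) (t : R) (v : C) (d : R) : 0 < d ->
  (forall s, Rabs (s - t) < d -> x s = y s) -> vderiv x t v -> vderiv y t v.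
Proof.
  intros Hd E. apply (is_derive_ext_loc (K := R_AbsRing) (V := C_R_NormedModule)).
  exists (mkposreal d Hd). intros s Hs. now apply E.
Qed.

(** * One full turn around the center *)

Lemma abs_PI_4 : Rabs PI <= 4.
Proof. rewrite Rabs_pos_eq; [exact PI_4 | assert (P := PI_RGT_0); lra]. Qed.

Lemma abs_opp_PI_4 : Rabs (- PI) <= 4.
Proof. rewrite Rabs_Ropp. exact abs_PI_4. Qed.

Lemma abs_0_4 : Rabs 0 <= 4.
Proof. rewrite Rabs_R0. lra. Qed.

Section Turn.

Variables (D U : C -> Prop) (f phi psi : C -> C) (p : C) (rs : R).
Hypothesis S : linearized_center D U f phi psi p rs.
Variables (m : nat) (ap am : nat -> nat -> C) (A1p b1p A1m b1m : R -> R -> R) (r0 h K kap eps : R).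
Hypothesis Bp : band_data (radial_rate psi m ap) A1p (angular_rate psi m ap) b1p r0 h K.
Hypothesis Bm : band_data (radial_rate psi m am) A1m (angular_rate psi m am) b1m r0 h K.
Hypothesis Hr1 : 0 < r0 - 2 * h.
Hypothesis Hr2 : r0 + 2 * h < rs.
Hypothesis Heps : 0 < eps < family_eps h K kap.
Hypothesis Hdrift : 32 * K * eps <= h / 2.

Notation Xp := (perturbed f (bipoly m ap) eps).
Notation Xm := (perturbed f (bipoly m am) eps).
Notation inb r := (r0 - 2 * h <= r <= r0 + 2 * h).

Hypothesis Htr : forall r, inb r ->
  (Im (Xp (psi (RtoC r))) < 0 /\ Im (Xm (psi (RtoC r))) < 0) /\
  (0 < Im (Xp (psi (RtoC (- r)))) /\ 0 < Im (Xm (psi (RtoC (- r))))).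

Lemma inb_rs (r : R) : inb r -> 0 < r < rs.
Proof. intros H. lra. Qed.

Lemma filippov_near (x y : R -> C) (s T : R) : filippov_solution D Xp Xm 0 T y -> 0 <= s < T ->
  forall e, 0 < e -> exists d, 0 < d /\ forall w, s < w < T -> w < s + d -> Cmod (y w - y s) < e.
Proof.
  intros Hy Hs e He. destruct (filippov_continuous Hy (u := s) ltac:(lra) He) as [d [Hd H]].
  exists d. split; [assumption |]. intros w Hw Hwd. apply H; [lra | apply Rabs_def1; lra].
Qed.

(** On the positive axis both fields point down, so any Filippov solution enters the lower half
    plane at once; at angles in the open half turn, continuity keeps it there for a while. Only the
    final time may sit on the negative axis. *)
Lemma lower_unique (x y : R -> C) (r t : R -> R) (T : R) : 0 <= T ->
  (forall s, 0 <= s <= T -> x s = psi (polar (r s) (t s)) /\ inb (r s) /\ - PI <= t s <= 0) ->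
  (forall s, 0 <= s < T -> - PI < t s) ->
  (forall s, 0 <= s <= T -> vderiv x s (Xm (x s))) ->
  filippov_solution D Xp Xm 0 T y -> y 0 = x 0 -> forall s, 0 <= s <= T -> y s = x s.
Proof.
  intros HT Hx Ht Hder Hy H0.
  apply (@filippov_unique D Xp Xm Xm x y T HT Hy H0 Hder).
  - intros s Hs. destruct (Hx s Hs) as [E [Hin _]]. rewrite E. apply (field_loclip S). now apply pdisc_polar, inb_rs.
  - intros s Hs Eyx. destruct (Hx s ltac:(lra)) as [E [Hin Hts]].
    assert (Hneg : exists d, 0 < d /\ forall w, s < w < T -> w < s + d -> Im (y w) < 0).
    { assert (HyT : filippov_solution D Xp Xm s T y) by (apply (filippov_sub (s := 0) (t := T)); [lra | lra | exact Hy]).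
      assert (Hw := pdisc_polar (t s) (inb_rs Hin)).
      destruct (Rle_lt_or_eq_dec (t s) 0 ltac:(lra)) as [Hlt | Heq].
      - assert (Hneg := im_psi_lower S (inb_rs Hin) (conj (Ht s Hs) Hlt)). rewrite <- E, <- Eyx in Hneg.
        destruct (filippov_near x Hy Hs (e := - Im (y s)) ltac:(lra)) as [d [Hd H]].
        exists d. split; [assumption |]. intros w Hw1 Hw2. specialize (H w Hw1 Hw2).
        assert (T1 := Rle_lt_trans _ _ _ (im_le_Cmod _) H). rewrite Im_minus in T1. apply Rabs_def2 in T1. lra.
      - destruct (Htr Hin) as [[H1 H2] _].
        assert (Ey : y s = psi (RtoC (r s))) by (rewrite Eyx, E, Heq, polar_0; reflexivity).
        assert (Hwr := pdisc_R (inb_rs Hin)).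
        destruct (@filippov_crosses_down D Xp Xm s T y) as [d [Hd H]]; try lra; try assumption.
        + rewrite Ey. rewrite (proj1 (psi_real_pos S (inb_rs Hin))). lra.
        + rewrite Ey. now apply (field_ccont S).
        + rewrite Ey. now apply (field_ccont S).
        + now rewrite Ey.
        + now rewrite Ey.
        + exists d. split; [assumption |]. intros w Hw1 Hw2. apply H; lra. }
    destruct Hneg as [d [Hd H]]. exists d. split; [assumption |]. intros w v Hw1 Hw2 Hv.
    apply (filippov_set_lower (Xp := Xp) (Xm := Xm)); [now apply H | exact Hv].
Qed.

Lemma upper_unique (x y : R -> C) (r t : R -> R) (T : R) : 0 <= T ->
  (forall s, 0 <= s <= T -> x s = psi (polar (r s) (t s)) /\ inb (r s) /\ 0 <= t s <= PI) ->
  (forall s, 0 <= s < T -> 0 < t s) ->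
  (forall s, 0 <= s <= T -> vderiv x s (Xp (x s))) ->
  filippov_solution D Xp Xm 0 T y -> y 0 = x 0 -> forall s, 0 <= s <= T -> y s = x s.
Proof.
  intros HT Hx Ht Hder Hy H0.
  apply (@filippov_unique D Xp Xm Xp x y T HT Hy H0 Hder).
  - intros s Hs. destruct (Hx s Hs) as [E [Hin _]]. rewrite E. apply (field_loclip S). now apply pdisc_polar, inb_rs.
  - intros s Hs Eyx. destruct (Hx s ltac:(lra)) as [E [Hin Hts]].
    assert (Hpos : exists d, 0 < d /\ forall w, s < w < T -> w < s + d -> 0 < Im (y w)).
    { assert (HyT : filippov_solution D Xp Xm s T y) by (apply (filippov_sub (s := 0) (t := T)); [lra | lra | exact Hy]).
      destruct (Rle_lt_or_eq_dec (t s) PI ltac:(lra)) as [Hlt | Heq].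
      - assert (Hpos := im_psi_upper S (inb_rs Hin) (conj (Ht s Hs) Hlt)). rewrite <- E, <- Eyx in Hpos.
        destruct (filippov_near x Hy Hs (e := Im (y s)) ltac:(lra)) as [d [Hd H]].
        exists d. split; [assumption |]. intros w Hw1 Hw2. specialize (H w Hw1 Hw2).
        assert (T1 := Rle_lt_trans _ _ _ (im_le_Cmod _) H). rewrite Im_minus in T1. apply Rabs_def2 in T1. lra.
      - destruct (Htr Hin) as [_ [H1 H2]].
        assert (Ey : y s = psi (RtoC (- r s))) by (rewrite Eyx, E, Heq, polar_PI; reflexivity).
        assert (Hwr := pdisc_R_neg (inb_rs Hin)).
        destruct (@filippov_crosses_up D Xp Xm s T y) as [d [Hd H]]; try lra; try assumption.
        + rewrite Ey. rewrite (im_psi_PI S (inb_rs Hin)). lra.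
        + rewrite Ey. now apply (field_ccont S).
        + rewrite Ey. now apply (field_ccont S).
        + now rewrite Ey.
        + now rewrite Ey.
        + exists d. split; [assumption |]. intros w Hw1 Hw2. apply H; lra. }
    destruct Hpos as [d [Hd H]]. exists d. split; [assumption |]. intros w v Hw1 Hw2 Hv.
    apply (filippov_set_upper (Xp := Xp) (Xm := Xm)); [now apply H | exact Hv].
Qed.

Lemma flow_inb (a : nat -> nat -> C) (t0 rho : R) (u : R -> R) :
  is_flow (radial_rate psi m a) (angular_rate psi m a) r0 h K eps t0 rho u ->
  forall t, Rabs t <= 4 -> inb (u t) /\ Rabs (u t - rho) <= 16 * K * eps.
Proof. intros [_ [_ H]] t Ht. destruct (H t Ht) as [H1 [_ H2]]. now split. Qed.

(** Needed for isolation: an arbitrary orbit near the cycle must first be brought to the positive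
    axis before the return map applies to it. *)
Lemma reaches_axis_upper (t0 rho : R) (y : R -> C) : 0 <= t0 <= PI -> Rabs (rho - r0) <= h ->
  (forall s t, s < t -> filippov_solution D Xp Xm s t y) -> y 0 = psi (polar rho t0) ->
  exists tau r, 0 <= tau /\ inb r /\ y tau = psi (RtoC r).
Proof.
  intros Ht0 Hrho Hy H0. assert (HP4 := PI_4).
  assert (Ht4 : Rabs t0 <= 4) by (apply Rabs_le; lra).
  destruct (flow_exists Bp (family_eps_band Heps) Ht4 Hrho) as [u Hu].
  destruct (half_orbit S Bp Hr1 Hr2 Heps Hu Ht4 abs_0_4 (proj1 Ht0)) as [th [tau [H1 [H2 [H3 [H4 [H5 [_ [H6 H7]]]]]]]]].
  exists tau, (u 0). split; [exact H1 |]. split; [apply (flow_inb Hu abs_0_4) |].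
  rewrite <- polar_0, <- H3.
  apply (@upper_unique (fun s => psi (polar (u (th s)) (th s))) y (fun s => u (th s)) th tau H1); try lra.
  - intros s Hs. specialize (H6 s Hs). split; [reflexivity |]. split; [| lra].
    apply (flow_inb Hu). apply Rabs_le; lra.
  - intros s Hs. rewrite <- H3. apply H5. lra.
  - exact H7.
  - apply (filippov_sub (s := 0) (t := tau + 1)); [lra | lra | apply Hy; lra].
  - rewrite H0, H2. destruct Hu as [_ [E _]]. now rewrite E.
Qed.

Lemma reaches_axis_lower (t0 rho : R) (y : R -> C) : - PI <= t0 <= 0 -> Rabs (rho - r0) <= h / 2 ->
  (forall s t, s < t -> filippov_solution D Xp Xm s t y) -> y 0 = psi (polar rho t0) ->
  exists tau r, 0 <= tau /\ inb r /\ y tau = psi (RtoC r).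
Proof.
  intros Ht0 Hrho Hy H0. assert (HP4 := PI_4). assert (Hh := bd_h Bm).
  assert (HK := bd_K Bm).
  assert (Ht4 : Rabs t0 <= 4) by (apply Rabs_le; lra).
  destruct (flow_exists Bm (family_eps_band Heps) Ht4 (rho := rho) ltac:(lra)) as [u Hu].
  destruct (half_orbit S Bm Hr1 Hr2 Heps Hu Ht4 abs_opp_PI_4 (proj1 Ht0)) as [th [tau [H1 [H2 [H3 [H4 [H5 [_ [H6 H7]]]]]]]]].
  (* The angles [- PI] and [PI] give the same point of the negative axis, from which the upper half
     turn continues. The drift of the lower half turn is at most [h / 4], which explains the bound
     [h / 2] on the start. *)
  assert (Ey : y tau = psi (polar (u (- PI)) PI)).
  { rewrite polar_PI, <- polar_opp_PI. rewrite <- H3.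
    apply (@lower_unique (fun s => psi (polar (u (th s)) (th s))) y (fun s => u (th s)) th tau H1); try lra.
    - intros s Hs. specialize (H6 s Hs). split; [reflexivity |]. split; [| lra].
      apply (flow_inb Hu). apply Rabs_le; lra.
    - intros s Hs. rewrite <- H3. apply H5. lra.
    - exact H7.
    - apply (filippov_sub (s := 0) (t := tau + 1)); [lra | lra | apply Hy; lra].
    - rewrite H0, H2. destruct Hu as [_ [E _]]. now rewrite E. }
  destruct (@reaches_axis_upper PI (u (- PI)) (fun s => y (s + tau))) as [tau' [r [Q1 [Q2 Q3]]]].
  - assert (P := PI_RGT_0). lra.
  - destruct (flow_inb Hu abs_opp_PI_4) as [_ T].
    assert (He := proj1 Heps).
    replace (u (- PI) - r0) with ((u (- PI) - rho) + (rho - r0)) by ring.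
    eapply Rle_trans; [apply Rabs_triang |].
    assert (0 <= K * eps) by (apply Rmult_le_pos; lra). lra.
  - intros s t Hst. apply filippov_shift. apply Hy. lra.
  - rewrite Rplus_0_l. exact Ey.
  - exists (tau' + tau), r. split; [lra |]. now split.
Qed.

Variables (Phm Php : R -> R -> R).
Hypothesis HPhm : forall rho, Rabs (rho - r0) <= h ->
  is_flow (radial_rate psi m am) (angular_rate psi m am) r0 h K eps 0 rho (Phm rho).
Hypothesis HPhp : forall rho, Rabs (rho - r0) <= h ->
  is_flow (radial_rate psi m ap) (angular_rate psi m ap) r0 h K eps PI rho (Php rho).

(** Orbits turn clockwise: from the positive axis the lower half turn comes first, angle 0 to
    [- PI], then the upper one, angle [PI] to 0. *)
Definition return_radius (rho : R) : R := Php (Phm rho (- PI)) 0.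

(** [T1] is the crossing of the negative axis. [tn_off] makes [T] the first return to the positive
    axis, and [tn_uniq] carries all of this over to every Filippov solution from the same point. *)
Record turn (rho T1 T : R) (x : R -> C) : Prop := {
  tn_T1 : 0 < T1 < T;
  tn_T : PI <= T;
  tn_0 : x 0 = psi (RtoC rho);
  tn_end : x T = psi (RtoC (return_radius rho));
  tn_lip : exists L, 0 <= L /\ forall a b, 0 <= a -> a <= b -> b <= T -> Cmod (x b - x a) <= L * (b - a);
  tn_der : forall s, 0 < s < T -> s <> T1 -> exists v, filippov_set Xp Xm (x s) v /\ vderiv x s v;
  tn_ann : forall s, 0 <= s <= T -> exists r t, x s = psi (polar r t) /\ inb r /\ Rabs (r - rho) <= 32 * K * eps;
  tn_onto : forall t, - PI <= t <= PI -> exists s r, 0 <= s <= T /\ inb r /\ Rabs (r - rho) <= 32 * K * eps /\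
    x s = psi (polar r t);
  tn_off : forall s r, 0 < s < T -> 0 < r < rs -> x s <> psi (RtoC r);
  tn_uniq : forall T' y, 0 <= T' <= T -> filippov_solution D Xp Xm 0 T' y -> y 0 = psi (RtoC rho) ->
    forall s, 0 <= s <= T' -> y s = x s }.

Lemma half_radius (rho : R) : Rabs (rho - r0) <= h / 2 -> Rabs (Phm rho (- PI) - r0) <= h.
Proof.
  intros Hrho. assert (Hh := bd_h Bm). assert (HK := bd_K Bm). assert (He := proj1 Heps).
  destruct (flow_inb (HPhm (rho := rho) ltac:(lra)) abs_opp_PI_4) as [_ T].
  replace (Phm rho (- PI) - r0) with ((Phm rho (- PI) - rho) + (rho - r0)) by ring.
  eapply Rle_trans; [apply Rabs_triang |].
  assert (0 <= K * eps) by (apply Rmult_le_pos; lra). lra.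
Qed.

Lemma lipschitz_join (x : R -> C) (L a c b : R) :
  (forall s t, a <= s -> s <= t -> t <= c -> Cmod (x t - x s) <= L * (t - s)) ->
  (forall s t, c <= s -> s <= t -> t <= b -> Cmod (x t - x s) <= L * (t - s)) ->
  forall s t, a <= s -> s <= t -> t <= b -> Cmod (x t - x s) <= L * (t - s).
Proof.
  intros H1 H2 s t Hs Hst Ht.
  destruct (Rle_lt_dec t c) as [Htc | Htc]; [apply H1; lra |].
  destruct (Rle_lt_dec c s) as [Hcs | Hcs]; [apply H2; lra |].
  eapply Rle_trans; [apply (Cmod_minus_triangle _ (x c)) |].
  assert (T1 := H1 s c ltac:(lra) ltac:(lra) ltac:(lra)).
  assert (T2 := H2 c t ltac:(lra) ltac:(lra) ltac:(lra)). lra.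
Qed.

Lemma turn_exists (rho : R) : Rabs (rho - r0) <= h / 2 -> exists T1 T x, turn rho T1 T x.
Proof.
  intros Hrho. assert (HP := PI_RGT_0). assert (HP4 := PI_4).
  assert (Hh := bd_h Bm). assert (HK := bd_K Bm). assert (He := proj1 Heps).
  assert (HKe : 0 <= K * eps) by (apply Rmult_le_pos; lra).
  assert (Hum := HPhm (rho := rho) ltac:(lra)). set (um := Phm rho) in *.
  assert (Hrho' := half_radius Hrho). fold um in Hrho'. set (rho' := um (- PI)) in *.
  assert (Hup := HPhp Hrho'). set (up := Php rho') in *.
  assert (Hret : return_radius rho = up 0) by reflexivity.
  destruct (half_orbit S Bm Hr1 Hr2 Heps Hum abs_0_4 abs_opp_PI_4 ltac:(lra))
    as [thm [T1 [M1 [M2 [M3 [M4 [M5 [M5' [M6 M7]]]]]]]]].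
  destruct (half_orbit S Bp Hr1 Hr2 Heps Hup abs_PI_4 abs_0_4 ltac:(lra))
    as [thp [T2 [P1 [P2 [P3 [P4 [P5 [P5' [P6 P7]]]]]]]]].
  set (xm := fun s => psi (polar (um (thm s)) (thm s))) in *.
  set (xp := fun s => psi (polar (up (thp s)) (thp s))) in *.
  assert (HT1 : PI / 2 <= T1) by lra. assert (HT2 : PI / 2 <= T2) by lra.
  set (x := fun s => if Rle_dec s T1 then xm s else xp (s - T1)).
  assert (Hjoin : xm T1 = xp 0).
  { unfold xm, xp. rewrite M3, P2, polar_opp_PI, polar_PI. destruct Hup as [_ [E _]]. now rewrite E. }
  assert (Hxm : forall s, s <= T1 -> x s = xm s).
  { intros s Hs. unfold x. destruct (Rle_dec s T1); [reflexivity | lra]. }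
  assert (Hxp : forall s, T1 <= s -> x s = xp (s - T1)).
  { intros s Hs. unfold x. destruct (Rle_dec s T1); [| reflexivity].
    replace s with T1 by lra. rewrite Rminus_diag. exact Hjoin. }
  assert (Mdom : forall s, 0 <= s <= T1 -> Rabs (thm s) <= 4) by (intros s Hs; specialize (M6 s Hs); apply Rabs_le; lra).
  assert (Pdom : forall s, 0 <= s <= T2 -> Rabs (thp s) <= 4) by (intros s Hs; specialize (P6 s Hs); apply Rabs_le; lra).
  assert (Mband : forall s, 0 <= s <= T1 -> inb (um (thm s)) /\ Rabs (um (thm s) - rho) <= 16 * K * eps).
  { intros s Hs. apply (flow_inb Hum). now apply Mdom. }
  assert (Pband : forall s, 0 <= s <= T2 -> inb (up (thp s)) /\ Rabs (up (thp s) - rho) <= 32 * K * eps).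
  { intros s Hs. destruct (flow_inb Hup (Pdom s Hs)) as [Q1 Q2]. split; [exact Q1 |].
    destruct (flow_inb Hum abs_opp_PI_4) as [_ Q3]. fold rho' in Q3.
    replace (up (thp s) - rho) with ((up (thp s) - rho') + (rho' - rho)) by ring.
    eapply Rle_trans; [apply Rabs_triang |]. lra. }
  destruct (@field_bounded D U f phi psi p rs S m am eps (r0 - 2 * h) (r0 + 2 * h) Hr1 Hr2) as [Lm [HLm Bxm]].
  destruct (@field_bounded D U f phi psi p rs S m ap eps (r0 - 2 * h) (r0 + 2 * h) Hr1 Hr2) as [Lp [HLp Bxp]].
  exists T1, (T1 + T2), x. constructor.
  - lra.
  - lra.
  - rewrite Hxm by lra. unfold xm. rewrite M2, polar_0. destruct Hum as [_ [E _]]. now rewrite E.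
  - rewrite Hxp by lra. replace (T1 + T2 - T1) with T2 by ring. unfold xp. now rewrite P3, polar_0, Hret.
  - exists (Lm + Lp). split; [lra |]. apply (@lipschitz_join x (Lm + Lp) 0 T1 (T1 + T2)).
    + intros s t Hs Hst Ht. rewrite !Hxm by lra.
      apply (mean_value_curve xm (fun w => Xm (xm w))); [assumption |]. intros w Hw.
      split; [apply M7; lra |]. eapply Rle_trans; [apply Bxm; [apply Mband; lra | apply Mdom; lra] | lra].
    + intros s t Hs Hst Ht. rewrite !Hxp by lra.
      replace (t - s) with ((t - T1) - (s - T1)) by ring.
      apply (mean_value_curve xp (fun w => Xp (xp w))); [lra |]. intros w Hw.
      split; [apply P7; lra |]. eapply Rle_trans; [apply Bxp; [apply Pband; lra | apply Pdom; lra] | lra].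
  - intros s Hs Hne. destruct (Rle_lt_dec s T1) as [Hs1 | Hs1].
    + exists (Xm (xm s)). split.
      * rewrite Hxm by lra. right; left. split; [| reflexivity].
        apply (im_psi_lower S); [apply inb_rs, Mband; lra |].
        rewrite <- M3 at 1. rewrite <- M2. split; apply M5; lra.
      * apply (vderiv_ext_loc (x := xm) (d := T1 - s)); [lra | | apply M7; lra].
        intros w Hw. apply Rabs_def2 in Hw. rewrite Hxm by lra. reflexivity.
    + exists (Xp (xp (s - T1))). split.
      * rewrite Hxp by lra. left. split; [| reflexivity].
        apply (im_psi_upper S); [apply inb_rs, Pband; lra |].
        rewrite <- P2. rewrite <- P3 at 1. split; apply P5; lra.
      * apply (vderiv_ext_loc (x := fun w => xp (w + - T1)) (d := s - T1)); [lra | |].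
        -- intros w Hw. apply Rabs_def2 in Hw. rewrite Hxp by lra. reflexivity.
        -- apply (vderiv_time_shift xp s (- T1)). apply P7. lra.
  - intros s Hs. destruct (Rle_lt_dec s T1) as [Hs1 | Hs1].
    + exists (um (thm s)), (thm s). rewrite Hxm by lra. split; [reflexivity |].
      destruct (Mband s ltac:(lra)) as [Q1 Q2]. split; [exact Q1 | lra].
    + exists (up (thp (s - T1))), (thp (s - T1)). rewrite Hxp by lra. split; [reflexivity |]. apply Pband. lra.
  - intros t Ht. destruct (Rle_lt_dec t 0) as [Ht0 | Ht0].
    + destruct (M5' t) as [s Es].
      assert (Hs : 0 <= s <= T1).
      { split; apply Rnot_lt_le; intros Hn.
        - assert (Q := M5 s 0 Hn). lra.
        - assert (Q := M5 T1 s Hn). lra. }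
      exists s, (um (thm s)). split; [lra |]. destruct (Mband s Hs) as [Q1 Q2]. split; [exact Q1 |]. split; [lra |].
      rewrite Hxm by lra. unfold xm. now rewrite Es.
    + destruct (P5' t) as [s Es].
      assert (Hs : 0 <= s <= T2).
      { split; apply Rnot_lt_le; intros Hn.
        - assert (Q := P5 s 0 Hn). lra.
        - assert (Q := P5 T2 s Hn). lra. }
      exists (s + T1), (up (thp s)). split; [lra |]. destruct (Pband s Hs) as [Q1 Q2]. split; [exact Q1 |]. split; [lra |].
      rewrite Hxp by lra. replace (s + T1 - T1) with s by ring. unfold xp. now rewrite Es.
  - intros s r Hs Hr E. assert (Hreal := proj1 (psi_real_pos S Hr)). rewrite <- E in Hreal.
    destruct (Rtotal_order s T1) as [Hs1 | [-> | Hs1]].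
    + rewrite Hxm in Hreal by lra.
      assert (Im (xm s) < 0); [| lra].
      apply (im_psi_lower S); [apply inb_rs, Mband; lra |].
      rewrite <- M3 at 1. rewrite <- M2. split; apply M5; lra.
    (* At [T1] the orbit is on the negative axis: applying [phi] would equate the numbers [- rho']
       and [r], of opposite signs. *)
    + rewrite Hxm in E by lra. unfold xm in E. rewrite M3, polar_opp_PI in E. fold rho' in E.
      assert (Hr' : 0 < rho' < rs) by (apply inb_rs, (flow_inb Hum abs_opp_PI_4)).
      assert (E' := f_equal phi E). rewrite (phi_psi S (pdisc_R_neg Hr')), (phi_psi S (pdisc_R Hr)) in E'.
      apply RtoC_inj in E'. lra.
    + rewrite Hxp in Hreal by lra.
      assert (0 < Im (xp (s - T1))); [| lra].
      apply (im_psi_upper S); [apply inb_rs, Pband; lra |].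
      rewrite <- P2. rewrite <- P3 at 1. split; apply P5; lra.
  - intros T' y HT' Hy Hy0.
    assert (Hlow : forall s, 0 <= s <= Rmin T' T1 -> y s = xm s).
    { assert (Hm1 : Rmin T' T1 <= T') by apply Rmin_l. assert (Hm2 : Rmin T' T1 <= T1) by apply Rmin_r.
      apply (@lower_unique xm y (fun s => um (thm s)) thm (Rmin T' T1)).
      - apply Rmin_glb; lra.
      - intros s Hs. split; [reflexivity |]. split; [apply Mband; lra | apply M6; lra].
      - intros s Hs. rewrite <- M3. apply M5. lra.
      - intros s Hs. apply M7. lra.
      - apply (filippov_sub (s := 0) (t := T')); [lra | exact Hm1 | exact Hy].
      - rewrite Hy0. unfold xm. rewrite M2, polar_0. destruct Hum as [_ [E _]]. now rewrite E. }
    destruct (Rle_lt_dec T' T1) as [HT1' | HT1'].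
    + intros s Hs. rewrite Hxm by lra. apply Hlow. rewrite Rmin_left by lra. exact Hs.
    + rewrite Rmin_right in Hlow by lra. intros s Hs.
      destruct (Rle_lt_dec s T1) as [Hs1 | Hs1]; [rewrite Hxm by lra; apply Hlow; lra |].
      rewrite Hxp by lra. replace s with (s - T1 + T1) at 1 by ring.
      apply (@upper_unique xp (fun w => y (w + T1)) (fun s => up (thp s)) thp (T' - T1)); try lra.
      * intros w Hw. split; [reflexivity |]. split; [apply Pband; lra | apply P6; lra].
      * intros w Hw. rewrite <- P3. apply P5. lra.
      * intros w Hw. apply P7. lra.
      * apply filippov_shift. apply (filippov_sub (s := 0) (t := T')); [lra | lra | exact Hy].
      * rewrite Rplus_0_l, Hlow by lra. exact Hjoin.
Qed.

End Turn.

(** * The limit cycle *)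

Definition periodic_extension (T : R) (x : R -> C) (t : R) : C := x (t - T * IZR (Int_part (t / T))).

Section Periodic.

Variables (T : R) (x : R -> C).
Hypothesis HT : 0 < T.
Hypothesis Hper : x T = x 0.

Lemma cell_exists (t : R) : exists k : Z, T * IZR k <= t < T * IZR k + T.
Proof.
  exists (Int_part (t / T)). destruct (base_Int_part (t / T)) as [H1 H2].
  set (k := IZR (Int_part (t / T))) in *. assert (E : t = T * (t / T)) by (field; lra).
  split; [rewrite E; apply Rmult_le_compat_l; lra |].
  assert (T * (t / T) < T * (k + 1)); [apply Rmult_lt_compat_l; lra | lra].
Qed.

Lemma periodic_extension_cell (k : Z) (t : R) : T * IZR k <= t <= T * IZR k + T ->
  periodic_extension T x t = x (t - T * IZR k).
Proof.
  intros Ht. unfold periodic_extension.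
  destruct (Rle_lt_or_eq_dec t (T * IZR k + T) (proj2 Ht)) as [Hlt | ->].
  - replace (Int_part (t / T)) with k; [reflexivity |].
    apply Int_part_spec. assert (E : t = T * (t / T)) by (field; lra).
    split.
    + apply (Rmult_lt_reg_l T); [assumption |]. lra.
    + apply (Rmult_le_reg_l T); [assumption |]. lra.
  - replace (Int_part ((T * IZR k + T) / T)) with (k + 1)%Z.
    + rewrite plus_IZR. replace (T * IZR k + T - T * (IZR k + 1)) with 0 by ring.
      replace (T * IZR k + T - T * IZR k) with T by ring. now symmetry.
    + apply Int_part_spec. rewrite plus_IZR. replace ((T * IZR k + T) / T) with (IZR k + 1) by (field; lra). lra.
Qed.

Lemma periodic_extension_shift (k : Z) (t : R) :
  periodic_extension T x (t + T * IZR k) = periodic_extension T x t.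
Proof.
  destruct (cell_exists t) as [j Hj].
  rewrite (@periodic_extension_cell j t), (@periodic_extension_cell (j + k) (t + T * IZR k)).
  - f_equal. rewrite plus_IZR. ring.
  - rewrite plus_IZR. lra.
  - lra.
Qed.

Lemma periodic_extension_period (t : R) : periodic_extension T x (t + T) = periodic_extension T x t.
Proof. rewrite <- (periodic_extension_shift 1 t). f_equal. ring. Qed.

Lemma periodic_extension_lipschitz (L : R) :
  (forall a b, 0 <= a -> a <= b -> b <= T -> Cmod (x b - x a) <= L * (b - a)) ->
  forall a b, a <= b -> Cmod (periodic_extension T x b - periodic_extension T x a) <= L * (b - a).
Proof.
  intros HL.
  assert (H : forall n k, forall a b, T * IZR k <= a -> a <= b -> b <= T * IZR k + T * INR n ->
    Cmod (periodic_extension T x b - periodic_extension T x a) <= L * (b - a)).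
  { induction n as [| n IH]; intros k.
    - simpl. intros a b H1 H2 H3. replace b with a by lra. rewrite Cmod_minus_self. lra.
    - rewrite S_INR. apply (@lipschitz_join (periodic_extension T x) L (T * IZR k) (T * IZR k + T)).
      + intros s t H1 H2 H3. rewrite !(@periodic_extension_cell k) by lra.
        replace (t - s) with ((t - T * IZR k) - (s - T * IZR k)) by ring. apply HL; lra.
      + intros s t H1 H2 H3. apply (IH (k + 1)%Z); rewrite ?plus_IZR; lra. }
  intros a b Hab. destruct (cell_exists a) as [k Hk].
  destruct (INR_unbounded ((b - T * IZR k) / T)) as [n Hn].
  apply (H n k); try lra.
  apply (Rmult_gt_compat_l T) in Hn; [| assumption].
  replace (T * ((b - T * IZR k) / T)) with (b - T * IZR k) in Hn by (field; lra). lra.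
Qed.

Lemma periodic_extension_filippov (D : C -> Prop) (Xp Xm : C -> C) (T1 L : R) : 0 <= L ->
  (forall s, 0 <= s <= T -> D (x s)) ->
  (forall a b, 0 <= a -> a <= b -> b <= T -> Cmod (x b - x a) <= L * (b - a)) ->
  (forall s, 0 < s < T -> s <> T1 -> exists v, filippov_set Xp Xm (x s) v /\ vderiv x s v) ->
  forall s t, filippov_solution D Xp Xm s t (periodic_extension T x).
Proof.
  intros HL HD Hlip Hder s t. split; [| split].
  - intros u _. destruct (cell_exists u) as [k Hk]. rewrite (@periodic_extension_cell k u) by lra. apply HD. lra.
  - apply (lipschitz_absolutely_continuous (K := L)); [assumption |]. intros. now apply periodic_extension_lipschitz.
  - destruct (cell_exists s) as [k0 Hk0].
    (* The exceptional times are the multiples of the period and the translates of [T1]; cells from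
       the one containing [s] onwards are enumerated with even indices for the former and odd ones
       for the latter. *)
    apply (null_set_countable (c := fun n => T * (IZR k0 + INR (Nat.div2 n)) + if Nat.even n then 0 else T1)).
    intros u [Hu Hn]. destruct (cell_exists u) as [k Hk].
    assert (Hkk : (k0 <= k)%Z).
    { apply Znot_gt_le. intros Hgt. assert (Hle : (k + 1 <= k0)%Z) by lia. apply IZR_le in Hle. rewrite plus_IZR in Hle.
      assert (T * (IZR k + 1) <= T * IZR k0) by (apply Rmult_le_compat_l; lra). lra. }
    set (j := Z.to_nat (k - k0)).
    assert (Hj : IZR k0 + INR j = IZR k).
    { unfold j. rewrite INR_IZR_INZ, Z2Nat.id by lia. rewrite minus_IZR. ring. }
    destruct (Req_dec u (T * IZR k)) as [E1 | E1].
    { exists (2 * j)%nat. rewrite Nat.div2_double, Nat.even_even, Hj. lra. }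
    destruct (Req_dec (u - T * IZR k) T1) as [E2 | E2].
    { exists (S (2 * j))%nat. rewrite Nat.div2_succ_double, Nat.even_succ, Nat.odd_even, Hj. lra. }
    exfalso. apply Hn.
    destruct (Hder (u - T * IZR k) ltac:(lra) E2) as [v [Hv1 Hv2]].
    exists v. rewrite (@periodic_extension_cell k u) by lra. split; [exact Hv1 |].
    apply (vderiv_ext_loc (x := fun w => x (w + - (T * IZR k))) (d := Rmin (u - T * IZR k) (T * IZR k + T - u))).
    + apply Rmin_pos; lra.
    + intros w Hw. below_min Hw as H1 H2.
      apply Rabs_def2 in H1. apply Rabs_def2 in H2. rewrite (@periodic_extension_cell k w) by lra. reflexivity.
    + exact (proj1 (vderiv_time_shift x u (- (T * IZR k)) v) Hv2).
Qed.

End Periodic.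

Lemma polar_decomposition (w : C) : w <> 0%C -> exists t, - PI <= t <= PI /\ w = polar (Cmod w) t.
Proof.
  intros Hw. assert (Hm : 0 < Cmod w) by now apply Cmod_gt_0.
  set (r := Cmod w) in *.
  assert (Hr : r * r = Re w * Re w + Im w * Im w).
  { transitivity (r ^ 2); [ring |]. unfold r. rewrite Cmod2_alt. ring. }
  set (c := Re w / r). set (s := Im w / r).
  assert (Hcs : c * c + s * s = 1).
  { unfold c, s. replace (Re w / r * (Re w / r) + Im w / r * (Im w / r)) with ((Re w * Re w + Im w * Im w) / (r * r)) by (field; lra).
    rewrite <- Hr. field. lra. }
  assert (Hc : -1 <= c <= 1) by nra.
  assert (HcosA := cos_acos c Hc). assert (HsinA := sin_acos c Hc).
  assert (Hb := acos_bound c).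
  assert (Hsq : sqrt (1 - Rsqr c) = Rabs s).
  { rewrite <- sqrt_Rsqr_abs. f_equal. unfold Rsqr. lra. }
  rewrite Hsq in HsinA.
  assert (Hwc : Re w = r * c) by (unfold c; field; lra).
  assert (Hws : Im w = r * s) by (unfold s; field; lra).
  destruct (Rle_lt_dec 0 s) as [Hs | Hs].
  - exists (acos c). split; [lra |]. apply C_ext; simpl; [rewrite HcosA; exact Hwc |].
    rewrite HsinA, Rabs_pos_eq by assumption. exact Hws.
  - exists (- acos c). split; [lra |]. apply C_ext; simpl.
    + rewrite cos_neg, HcosA. exact Hwc.
    + rewrite sin_neg, HsinA, Rabs_left by assumption. rewrite Ropp_involutive. exact Hws.
Qed.

Section Cycle.

Variables (D U : C -> Prop) (f phi psi : C -> C) (p : C) (rs : R).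
Hypothesis S : linearized_center D U f phi psi p rs.
Variables (m : nat) (ap am : nat -> nat -> C) (A1p b1p A1m b1m : R -> R -> R) (r0 h K kap eps : R).
Hypothesis Bp : band_data (radial_rate psi m ap) A1p (angular_rate psi m ap) b1p r0 h K.
Hypothesis Bm : band_data (radial_rate psi m am) A1m (angular_rate psi m am) b1m r0 h K.
Hypothesis Hr1 : 0 < r0 - 2 * h.
Hypothesis Hr2 : r0 + 2 * h < rs.
Hypothesis Heps : 0 < eps < family_eps h K kap.
Hypothesis Hdrift : 32 * K * eps <= h / 2.

Notation Xp := (perturbed f (bipoly m ap) eps).
Notation Xm := (perturbed f (bipoly m am) eps).
Notation inb r := (r0 - 2 * h <= r <= r0 + 2 * h).

Hypothesis Htr : forall r, inb r ->
  (Im (Xp (psi (RtoC r))) < 0 /\ Im (Xm (psi (RtoC r))) < 0) /\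
  (0 < Im (Xp (psi (RtoC (- r)))) /\ 0 < Im (Xm (psi (RtoC (- r))))).

Variables (Phm Php : R -> R -> R).
Hypothesis HPhm : forall rho, Rabs (rho - r0) <= h ->
  is_flow (radial_rate psi m am) (angular_rate psi m am) r0 h K eps 0 rho (Phm rho).
Hypothesis HPhp : forall rho, Rabs (rho - r0) <= h ->
  is_flow (radial_rate psi m ap) (angular_rate psi m ap) r0 h K eps PI rho (Php rho).

Notation ret := (return_radius Phm Php).
Notation is_turn := (turn D f psi rs m ap am r0 h K eps Phm Php).

Variables (re lambda : R).
Hypothesis Hre : Rabs (re - r0) + 32 * K * eps < h / 2.
Hypothesis Hfix : ret re = re.
Hypothesis Hmono : forall r1 r2, Rabs (r1 - r0) <= h / 2 -> Rabs (r2 - r0) <= h / 2 -> r1 < r2 -> ret r1 < ret r2.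
Hypothesis Huniq : forall r, Rabs (r - r0) <= h / 2 -> ret r = r -> r = re.
Hypothesis Hder : is_derive ret re lambda.
Hypothesis Hlam : Rabs lambda <> 1.

Lemma turn_any (rho : R) : Rabs (rho - r0) <= h / 2 -> exists T1 T x, is_turn rho T1 T x.
Proof. exact (turn_exists S Bp Bm Hr1 Hr2 Heps Hdrift Htr HPhm HPhp (rho := rho)). Qed.

Lemma Keps_nonneg : 0 <= K * eps.
Proof. assert (HK := bd_K Bm). assert (He := proj1 Heps). apply Rmult_le_pos; lra. Qed.

Lemma re_near : Rabs (re - r0) < h / 2.
Proof. assert (H := Keps_nonneg). lra. Qed.

Lemma near_inb (r : R) : Rabs (r - r0) <= h -> inb r.
Proof. intros H. assert (Hh := bd_h Bm). apply Rabs_le_between in H. lra. Qed.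

Lemma ret_inb (rho : R) : Rabs (rho - r0) <= h / 2 -> inb (ret rho).
Proof.
  intros H. apply (flow_inb (HPhp (half_radius Bm Heps Hdrift HPhm H)) abs_0_4).
Qed.

Lemma turn_filippov (rho T1 T : R) (x : R -> C) : is_turn rho T1 T x -> filippov_solution D Xp Xm 0 T x.
Proof.
  intros Ht. destruct (tn_lip Ht) as [L [HL Hlip]]. split; [| split].
  - intros u Hu. destruct (tn_ann Ht Hu) as [r [t [E [Hin _]]]]. rewrite E.
    apply (U_D S), (psi_U S), pdisc_polar. lra.
  - now apply (lipschitz_absolutely_continuous (K := L)).
  - apply (null_set_countable (c := fun _ => T1)). intros u [Hu Hn]. exists 0%nat.
    apply NNPP. intros Hne. apply Hn. now apply (tn_der Ht).
Qed.

Lemma psi_R_inj (r r' : R) : 0 < r < rs -> 0 < r' < rs -> psi (RtoC r) = psi (RtoC r') -> r = r'.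
Proof.
  intros Hr Hr' E. apply (f_equal phi) in E. rewrite (phi_psi S (pdisc_R Hr)), (phi_psi S (pdisc_R Hr')) in E.
  now apply RtoC_inj.
Qed.

Definition cycle_section (s : R) : C := psi (RtoC (re + s)).
(** The largest size for which every radius of the section is within [h / 2] of [r0], where a full
    turn is available. *)
Definition section_size : R := h / 2 - Rabs (re - r0).
Definition section_return (s : R) : R := ret (re + s) - re.

Lemma section_size_pos : 0 < section_size.
Proof. assert (H := re_near). unfold section_size. lra. Qed.

Lemma section_near (s : R) : Rabs s < section_size -> Rabs (re + s - r0) <= h / 2.
Proof.
  intros Hs. replace (re + s - r0) with ((re - r0) + s) by ring.
  eapply Rle_trans; [apply Rabs_triang |]. unfold section_size in Hs. lra.
Qed.

Lemma section_rs (s : R) : Rabs s < section_size -> 0 < re + s < rs.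
Proof.
  intros Hs. assert (H := section_near Hs). assert (Hh := bd_h Bm).
  apply Rabs_le_between in H. lra.
Qed.

Lemma cycle_section_transversal : transversal_section D Xp Xm cycle_section section_size.
Proof.
  split; [exact section_size_pos |]. split.
  - intros s1 s2 H1 H2 E. assert (E' := psi_R_inj (section_rs H1) (section_rs H2) E). lra.
  - exists (fun s => C_derive psi (RtoC (re + s))). intros s Hs.
    assert (Hr := section_rs Hs). assert (Hw := pdisc_R Hr).
    assert (Hv : vderiv (fun s => RtoC (re + s)) s (RtoC 1)).
    { apply vderiv_re_im. simpl. split; [auto_derive; [trivial | ring] |].
      apply (is_derive_const (K := R_AbsRing) (V := R_NormedModule)). }
    split; [apply (U_D S), (psi_U S Hw) |]. split; [| split].
    + replace (C_derive psi (RtoC (re + s))) with (C_derive psi (RtoC (re + s)) * 1)%C by ring.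
      apply (vderiv_comp psi (fun s => RtoC (re + s))); [exact Hv | apply (psi_cderiv S Hw)].
    + apply (continuous_comp (fun s : R => RtoC (re + s) : C_UniformSpace) (C_derive psi)).
      * apply (ex_derive_continuous (K := R_AbsRing) (V := C_R_NormedModule)). eexists. exact Hv.
      * apply ccont_iff. apply (dpsi_ccont S Hw).
    + intros v Hv'. destruct (psi_real_pos S Hr) as [_ [Hd1 Hd2]].
      assert (Hin : inb (re + s)) by (apply near_inb; assert (T := section_near Hs); assert (Hh := bd_h Bm); lra).
      destruct (Htr Hin) as [[H1 H2] _].
      assert (Hvn : Im v < 0).
      { apply Rle_lt_trans with (Rmax (Im (Xp (psi (RtoC (re + s))))) (Im (Xm (psi (RtoC (re + s)))))).
        - apply (filippov_set_im_le (Xp := Xp) (Xm := Xm) (z := psi (RtoC (re + s)))); [apply Rmax_l | apply Rmax_r | exact Hv'].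
        - now apply Rmax_lub_lt. }
      rewrite Im_mult. change (Re (Cconj (C_derive psi (RtoC (re + s))))) with (Re (C_derive psi (RtoC (re + s)))).
      change (Im (Cconj (C_derive psi (RtoC (re + s))))) with (- Im (C_derive psi (RtoC (re + s)))).
      rewrite Hd1. nra.
Qed.

(** By uniqueness a returning solution follows the turn. Its return time cannot be earlier than [T],
    since the turn avoids the positive axis before, nor later, since at [T] it already meets the
    section. *)
Lemma first_return_iff (s s' : R) : Rabs s < section_size -> Rabs s' < section_size ->
  Rabs (section_return s) < section_size ->
  (first_return D Xp Xm cycle_section section_size s s' <-> s' = section_return s).
Proof.
  intros Hs Hs' HP. destruct (turn_any (section_near Hs)) as [T1 [T [x Ht]]].
  assert (HT1 := tn_T1 Ht).
  assert (Hend : x T = cycle_section (section_return s)).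
  { rewrite (tn_end Ht). unfold cycle_section, section_return. do 2 f_equal. ring. }
  split.
  - intros [T' [y [HT' [Hy [Hy0 [HyT Hoff]]]]]].
    assert (Hmin : T' = T).
    { destruct (Rtotal_order T' T) as [Hlt | [E | Hgt]]; [exfalso | exact E | exfalso].
      - assert (E := tn_uniq Ht (T' := T') (y := y) ltac:(lra) Hy Hy0 (s := T') ltac:(lra)).
        apply (tn_off Ht (s := T') (r := re + s')); [lra | now apply section_rs |]. rewrite <- E. exact HyT.
      - assert (E := tn_uniq Ht (T' := T) (y := y) ltac:(lra)
          (filippov_sub (s := 0) (t := T') (Rle_refl 0) (Rlt_le _ _ Hgt) Hy) Hy0 (s := T) ltac:(lra)).
        apply (Hoff T ltac:(lra) (section_return s) HP). rewrite E. exact Hend. }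
    subst T'.
    assert (E := tn_uniq Ht (T' := T) (y := y) ltac:(lra) Hy Hy0 (s := T) ltac:(lra)).
    rewrite HyT, Hend in E. apply psi_R_inj in E; [lra | now apply section_rs | now apply section_rs].
  - intros ->. exists T, x. split; [lra |]. split; [exact (turn_filippov Ht) |].
    split; [exact (tn_0 Ht) |]. split; [exact Hend |].
    intros t Htt u Hu. apply (tn_off Ht Htt). now apply section_rs.
Qed.

(** The region where an orbit can be followed: at each crossing of the positive axis its radius is
    within [h / 2] of [r0], so a full turn starts there. *)
Definition good (z : C) : Prop := U z /\ pdisc rs (phi z) /\ Rabs (Cmod (phi z) - r0) < h / 2.

Lemma good_nearby (r t : R) : 0 < r < rs -> Rabs (r - r0) < h / 2 ->
  exists d, 0 < d /\ forall z, Cmod (z - psi (polar r t)) < d -> good z.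
Proof.
  intros Hr Hn. assert (Hw := pdisc_polar t Hr). destruct (U_ball S (psi_U S Hw)) as [d1 [Hd1 HU]].
  destruct (pdisc_open Hw) as [d2 [Hd2 Hp]].
  assert (Hm : 0 < Rmin d2 (h / 2 - Rabs (r - r0))) by (apply Rmin_pos; lra).
  destruct (loclip_ccont (phi_loclip S Hw) Hm) as [d3 [Hd3 Hc]]. rewrite (phi_psi S Hw) in Hc.
  exists (Rmin d1 d3). split; [now apply Rmin_pos |]. intros z Hz.
  below_min Hz as Hz1 Hz2.
  specialize (Hc z Hz2).
  below_min Hc as Hc1 Hc2.
  split; [now apply HU |]. split; [now apply Hp |].
  assert (E1 := Cmod_triangle_rev (phi z) (polar r t)). assert (E2 := Cmod_triangle_rev (polar r t) (phi z)).
  rewrite (Cmod_minus_sym (polar r t)) in E2. rewrite Cmod_polar, Rabs_pos_eq in E1, E2 by lra.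
  apply Rabs_def2 in Hn. 
  assert (T := Rabs_triang (Cmod (phi z) - r) (r - r0)).
  replace (Cmod (phi z) - r + (r - r0)) with (Cmod (phi z) - r0) in T by ring.
  assert (Rabs (Cmod (phi z) - r) <= Cmod (phi z - polar r t)) by (apply Rabs_le; lra). lra.
Qed.

Lemma good_axis (r : R) : 0 < r < rs -> good (psi (RtoC r)) -> Rabs (r - r0) < h / 2.
Proof.
  intros Hr [_ [_ H]]. rewrite (phi_psi S (pdisc_R Hr)), Cmod_R, (Rabs_pos_eq r) in H by lra. exact H.
Qed.

(** Compactness of the turn, by real induction on the part already surrounded. The cycle stays
    strictly inside the [h / 2] band because [re] has room for the drift [32 * K * eps]. *)
Lemma turn_tube (T1 T : R) (x : R -> C) : is_turn re T1 T x ->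
  exists eta, 0 < eta /\ forall s z, 0 <= s <= T -> Cmod (z - x s) < eta -> good z.
Proof.
  intros Ht. assert (HT := tn_T1 Ht). destruct (tn_lip Ht) as [L [HL Hlip]].
  assert (HG : exists eta, 0 < eta /\ forall s z, 0 <= s <= T -> Cmod (z - x s) < eta -> good z); [| exact HG].
  apply (@real_induction (fun c => exists eta, 0 < eta /\ forall s z, 0 <= s <= c -> Cmod (z - x s) < eta -> good z) 0 T); [lra | |].
  - intros u Hu. destruct (tn_ann Ht Hu) as [r [t [E [Hin Hd]]]].
    assert (Hnear : Rabs (r - r0) < h / 2).
    { replace (r - r0) with ((r - re) + (re - r0)) by ring. eapply Rle_lt_trans; [apply Rabs_triang |]. lra. }
    destruct (good_nearby (r := r) t ltac:(lra) Hnear) as [d [Hd0 Hg]]. rewrite <- E in Hg.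
    exists (d / (2 * (L + 1))). split; [apply Rdiv_lt_0_compat; lra |].
    intros a b Ha Hb Hda Hdb [eta [Heta HGa]].
    exists (Rmin eta (d / 2)). split; [apply Rmin_pos; lra |]. intros s z Hs Hz.
    below_min Hz as Hz1 Hz2.
    destruct (Rle_lt_dec s a) as [Hsa | Hsa]; [apply (HGa s); lra |].
    apply Hg. eapply Rle_lt_trans; [apply (Cmod_minus_triangle _ (x s)) |].
    assert (Hsu : Cmod (x s - x u) <= L * Rabs (s - u)).
    { destruct (Rle_lt_dec u s) as [Hus | Hus].
      - rewrite Rabs_pos_eq by lra. apply Hlip; lra.
      - rewrite Rabs_left, Cmod_minus_sym by lra. replace (- (s - u)) with (u - s) by ring. apply Hlip; lra. }
    assert (Hab : Rabs (s - u) < d / (2 * (L + 1))) by (apply Rabs_def1; lra).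
    apply (Rmult_lt_compat_l (L + 1)) in Hab; [| lra].
    replace ((L + 1) * (d / (2 * (L + 1)))) with (d / 2) in Hab by (field; lra).
    assert (P := Rabs_pos (s - u)). lra.
  - destruct (tn_ann Ht (s := 0) ltac:(lra)) as [r [t [E [Hin Hd]]]].
    assert (Hnear : Rabs (r - r0) < h / 2).
    { replace (r - r0) with ((r - re) + (re - r0)) by ring. eapply Rle_lt_trans; [apply Rabs_triang |]. lra. }
    destruct (good_nearby (r := r) t ltac:(lra) Hnear) as [d [Hd0 Hg]]. rewrite <- E in Hg.
    exists d. split; [assumption |]. intros s z Hs. replace s with 0 by lra. apply Hg.
Qed.

Lemma visit_step (y : R -> C) (t rho : R) :
  (forall s t, s < t -> filippov_solution D Xp Xm s t y) ->
  Rabs (rho - r0) <= h / 2 -> y t = psi (RtoC rho) ->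
  exists T, PI <= T /\ y (t + T) = psi (RtoC (ret rho)) /\
    forall s r, 0 < s < T -> 0 < r < rs -> y (t + s) <> psi (RtoC r).
Proof.
  intros Hy Hrho Hyt. destruct (turn_any Hrho) as [T1 [T [x Ht]]]. assert (HT := tn_T1 Ht).
  assert (E : forall s, 0 <= s <= T -> y (t + s) = x s).
  { intros s Hs. rewrite (Rplus_comm t s).
    apply (tn_uniq Ht (T' := T) (y := fun s => y (s + t))); [lra | | | exact Hs].
    - apply filippov_shift. apply Hy. lra.
    - rewrite Rplus_0_l. exact Hyt. }
  exists T. split; [exact (tn_T Ht) |]. split; [rewrite E by lra; exact (tn_end Ht) |].
  intros s r Hs Hr. rewrite E by lra. now apply (tn_off Ht).
Qed.

(* The successive crossings of the positive real axis have radii [ret^n rho]; these are strictly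
   monotone unless [rho] is fixed, so a periodic orbit has [rho = re]. *)
Lemma recurrent_radius (y : R -> C) (rho t : R) :
  (forall s t, s < t -> filippov_solution D Xp Xm s t y) -> (forall t, good (y t)) ->
  0 < rho < rs -> y 0 = psi (RtoC rho) -> 0 < t -> y t = psi (RtoC rho) -> rho = re.
Proof.
  intros Hy Hg Hrs Hy0 Ht Hyt.
  set (rn := fun n => Nat.iter n ret rho).
  (* Either some iterate has returned to [rho], or the crossing of index [n] happens before [t] and
     not before [n * PI]; the second case fails for large [n]. The last clause keeps all iterates in
     the band in either case. *)
  assert (Hv : forall n, Rabs (rn n - r0) < h / 2 /\
    ((exists k, rn (Datatypes.S k) = rho) \/ exists tn, INR n * PI <= tn /\ tn < t /\ y tn = psi (RtoC (rn n)))
    /\ exists tn, y tn = psi (RtoC (rn n))).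
  { induction n as [| n [IH1 [IH2 IH3]]].
    - assert (Hn : Rabs (rho - r0) < h / 2) by (apply good_axis; [exact Hrs | rewrite <- Hy0; apply Hg]).
      split; [exact Hn |]. split; [right; exists 0; simpl; split; [lra | split; [exact Ht | exact Hy0]] |].
      now exists 0.
    - change (rn (Datatypes.S n)) with (ret (rn n)).
      assert (Hin := ret_inb (Rlt_le _ _ IH1)).
      destruct IH3 as [t3 E3]. destruct (visit_step Hy (Rlt_le _ _ IH1) E3) as [T3 [_ [E3' _]]].
      assert (Hnear : Rabs (ret (rn n) - r0) < h / 2).
      { apply good_axis; [lra |]. rewrite <- E3'. apply Hg. }
      split; [exact Hnear |]. split; [| now exists (t3 + T3)].
      destruct IH2 as [Hk | [tn [B1 [B2 B3]]]]; [now left |].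
      destruct (visit_step Hy (Rlt_le _ _ IH1) B3) as [T [HT1 [HT2 HT3]]].
      destruct (Rtotal_order (tn + T) t) as [Hlt | [Heq | Hgt]].
      + right. exists (tn + T). rewrite S_INR. split; [lra |]. now split.
      + left. exists n. change (rn (Datatypes.S n)) with (ret (rn n)).
        rewrite Heq, Hyt in HT2. symmetry. apply psi_R_inj; [exact Hrs | lra | exact HT2].
      + exfalso. apply (HT3 (t - tn) rho); [lra | exact Hrs |]. replace (tn + (t - tn)) with t by ring. exact Hyt. }
  assert (Hk : exists k, rn (Datatypes.S k) = rho).
  { destruct (INR_unbounded (t / PI)) as [n Hn]. assert (HP := PI_RGT_0).
    destruct (proj1 (proj2 (Hv n))) as [Hk | [tn [B1 [B2 _]]]]; [exact Hk | exfalso].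
    apply (Rmult_gt_compat_r PI) in Hn; [| lra]. replace (t / PI * PI) with t in Hn by (field; lra). lra. }
  destruct Hk as [k Hk].
  assert (Hnear : forall n, Rabs (rn n - r0) <= h / 2) by (intros n; apply Rlt_le, Hv).
  apply Huniq; [exact (Hnear 0%nat) |].
  destruct (Rtotal_order (ret rho) rho) as [Hlt | [E | Hgt]]; [exfalso | exact E | exfalso].
  - assert (Hdec : forall n, rn (Datatypes.S n) < rn n).
    { induction n as [| n IH]; [exact Hlt |]. apply (Hmono (Hnear _) (Hnear _) IH). }
    assert (Hlt' : forall n, rn (Datatypes.S n) < rho).
    { induction n as [| n IH]; [exact Hlt |]. assert (T := Hdec (Datatypes.S n)). lra. }
    specialize (Hlt' k). lra.
  - assert (Hinc : forall n, rn n < rn (Datatypes.S n)).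
    { induction n as [| n IH]; [exact Hgt |]. apply (Hmono (Hnear _) (Hnear _) IH). }
    assert (Hgt' : forall n, rho < rn (Datatypes.S n)).
    { induction n as [| n IH]; [exact Hgt |]. assert (T := Hinc (Datatypes.S n)). lra. }
    specialize (Hgt' k). lra.
Qed.

Lemma periodic_nat (y : R -> C) (T : R) : (forall t, y (t + T) = y t) -> forall n t, y (t + INR n * T) = y t.
Proof.
  intros H n. induction n as [| n IH]; intros t.
  - simpl. f_equal. ring.
  - rewrite S_INR. replace (t + (INR n + 1) * T) with ((t + INR n * T) + T) by ring. now rewrite H.
Qed.

Lemma reaches_axis (y : R -> C) : (forall s t, s < t -> filippov_solution D Xp Xm s t y) ->
  (forall t, good (y t)) -> exists tau r, inb r /\ y tau = psi (RtoC r).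
Proof.
  intros Hy Hg. destruct (Hg 0) as [HU [Hp Hn]]. assert (Hh := bd_h Bm).
  destruct (polar_decomposition (pdisc_neq_0 Hp)) as [t [Ht E]].
  assert (H0 : y 0 = psi (polar (Cmod (phi (y 0))) t)).
  { rewrite <- E. symmetry. apply (psi_phi S HU). apply Hp. }
  destruct (Rle_lt_dec 0 t) as [Ht0 | Ht0].
  - destruct (@reaches_axis_upper D U f phi psi p rs S m ap am A1p b1p r0 h K kap eps Bp Hr1 Hr2 Heps Htr
      t (Cmod (phi (y 0))) y ltac:(lra) ltac:(lra) Hy H0) as [tau [r [_ Hr]]]. now exists tau, r.
  - destruct (@reaches_axis_lower D U f phi psi p rs S m ap am A1p b1p A1m b1m r0 h K kap eps Bp Bm Hr1 Hr2 Heps Hdrift Htr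
      t (Cmod (phi (y 0))) y ltac:(lra) ltac:(lra) Hy H0) as [tau [r [_ Hr]]]. now exists tau, r.
Qed.

Lemma cycle_hyperbolic : exists x : R -> C,
  hyperbolic_limit_cycle D Xp Xm x /\
  (forall t, exists r a, x t = psi (polar r a) /\ inb r /\ Rabs (r - re) <= 32 * K * eps) /\
  (forall a, exists t r, x t = psi (polar r a) /\ inb r /\ Rabs (r - re) <= 32 * K * eps).
Proof.
  assert (Hh := bd_h Bm). assert (HP := PI_RGT_0).
  assert (Hrn := re_near).
  destruct (turn_any (Rlt_le _ _ Hrn)) as [T1 [T [x Ht]]].
  assert (HT := tn_T1 Ht).
  assert (Hrers : 0 < re < rs) by (apply Rabs_def2 in Hrn; lra).
  assert (Hper : x T = x 0) by (rewrite (tn_end Ht), (tn_0 Ht), Hfix; reflexivity).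
  assert (HT0 : 0 < T) by lra.
  set (xe := periodic_extension T x).
  assert (Hcell := periodic_extension_cell HT0 Hper). fold xe in Hcell.
  assert (Hx : forall s, 0 <= s <= T -> xe s = x s).
  { intros s Hs. rewrite (Hcell 0%Z) by lra. f_equal. ring. }
  assert (Hxe : forall t, exists s, 0 <= s <= T /\ xe t = x s).
  { intros t. destruct (cell_exists HT0 t) as [k Hk]. exists (t - T * IZR k). split; [lra |]. apply Hcell. lra. }
  destruct (tn_lip Ht) as [L [HL Hlip]].
  assert (Hfil : forall s t, filippov_solution D Xp Xm s t xe).
  { apply (periodic_extension_filippov HT0 Hper (T1 := T1) (L := L)); try assumption.
    - intros s Hs. apply (turn_filippov Ht). exact Hs.
    - exact (tn_der Ht). }
  exists xe. split; [| split].
  - split.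
    + split.
      * split; [intros; apply Hfil |]. split.
        -- exists T. split; [lra |]. apply (periodic_extension_period HT0 Hper).
        -- exists T1. rewrite !Hx by lra. rewrite (tn_0 Ht). apply (tn_off Ht); [lra | exact Hrers].
      * destruct (turn_tube Ht) as [eta [Heta Htube]]. exists eta. split; [assumption |].
        intros y [Hy [[Ty [HTy HTyp]] _]] Hclose.
        assert (Hg : forall t, good (y t)).
        { intros t. destruct (Hclose t) as [s Hs]. destruct (Hxe s) as [s' [Hs' E]]. rewrite E in Hs. exact (Htube s' _ Hs' Hs). }
        destruct (reaches_axis Hy Hg) as [tau [r [Hin Htau]]].
        set (y1 := fun s => y (s + tau)).
        assert (Hy1 : forall s t, s < t -> filippov_solution D Xp Xm s t y1).
        { intros s t Hst. apply filippov_shift, Hy. lra. }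
        assert (Hy10 : y1 0 = psi (RtoC r)) by (unfold y1; rewrite Rplus_0_l; exact Htau).
        assert (Hr : r = re).
        { apply (@recurrent_radius y1 r Ty Hy1); [intros t; apply Hg | lra | exact Hy10 | exact HTy |].
          unfold y1. rewrite Rplus_comm, HTyp. exact Htau. }
        subst r.
        assert (Hn : forall n s, 0 <= s <= T -> y1 (INR n * T + s) = x s).
        { assert (Hstep : forall t0, y1 t0 = psi (RtoC re) -> forall s, 0 <= s <= T -> y1 (t0 + s) = x s).
          { intros t0 E0 s Hs. rewrite (Rplus_comm t0 s).
            apply (tn_uniq Ht (T' := T) (y := fun s => y1 (s + t0))); [lra | | | exact Hs].
            - apply filippov_shift, Hy1. lra.
            - rewrite Rplus_0_l. exact E0. }
          induction n as [| n IH]; intros s Hs; apply Hstep; try exact Hs.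
          - simpl. rewrite Rmult_0_l. exact Hy10.
          - rewrite S_INR. replace ((INR n + 1) * T) with (INR n * T + T) by ring. rewrite IH by lra.
            rewrite Hper. exact (tn_0 Ht). }
        assert (Hpos : forall s, 0 <= s -> y1 s = xe s).
        { intros s Hs. destruct (cell_exists HT0 s) as [k Hk].
          assert (Hk0 : (0 <= k)%Z).
          { apply Znot_gt_le. intros Hgt. assert (Hle : (k + 1 <= 0)%Z) by lia. apply IZR_le in Hle. rewrite plus_IZR in Hle.
            assert (T * (IZR k + 1) <= T * 0) by (apply Rmult_le_compat_l; lra). lra. }
          rewrite (Hcell k) by lra. rewrite <- (Hn (Z.to_nat k)) by lra.
          rewrite INR_IZR_INZ, Z2Nat.id by exact Hk0. f_equal. ring. }
        intros z. split.
        (* Agreement with the cycle is known from time [tau] on; adding enough periods of [y] brings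
           any earlier time into that range. *)
        -- intros [t E]. destruct (INR_unbounded ((tau - t) / Ty)) as [n Hnn].
           exists (t + INR n * Ty - tau).
           rewrite <- Hpos.
           ++ unfold y1. replace (t + INR n * Ty - tau + tau) with (t + INR n * Ty) by ring.
              rewrite (periodic_nat HTyp). exact E.
           ++ apply (Rmult_gt_compat_r Ty) in Hnn; [| lra].
              replace ((tau - t) / Ty * Ty) with (tau - t) in Hnn by (field; lra). lra.
        -- intros [t E]. destruct (Hxe t) as [s [Hs E']]. exists (s + tau).
           rewrite <- E, E', <- (Hx s Hs). apply (Hpos s). lra.
    + assert (Hcont : continuous ret re) by exact (is_derive_continuous Hder).
      (* Continuity of the return map at [re] supplies the smaller parameter range whose returns
         land inside the section. *)
      destruct (proj1 (continuous_eps _ _) Hcont section_size section_size_pos) as [a0 [Ha0 Hret]].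
      exists cycle_section, (Rmin a0 section_size), section_size, section_return, lambda.
      split; [exact cycle_section_transversal |]. split.
      { exists 0. unfold cycle_section. rewrite Rplus_0_r, Hx by lra. exact (tn_0 Ht). }
      split. { split; [apply Rmin_pos; [exact Ha0 | exact section_size_pos] | apply Rmin_r]. }
      split.
      { intros s Hs. below_min Hs as Hs1 Hs2.
        assert (HPs : Rabs (section_return s) < section_size).
        { unfold section_return. rewrite <- Hfix at 2. apply Hret. replace (re + s - re) with s by ring. exact Hs1. }
        split; [exact HPs |]. intros s' Hs'. now apply first_return_iff. }
      split. { unfold section_return. rewrite Rplus_0_r, Hfix. ring. }
      split; [| exact Hlam].
      unfold section_return. replace lambda with (lambda - 0) by ring.
      apply (is_derive_minus (K := R_AbsRing) (V := R_NormedModule)).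
      * evar_last.
        -- apply (is_derive_comp ret (fun s => re + s) 0).
           ++ rewrite Rplus_0_r. exact Hder.
           ++ auto_derive; [trivial | reflexivity].
        -- unfold scal; simpl. unfold mult; simpl. ring.
      * apply (is_derive_const (K := R_AbsRing) (V := R_NormedModule)).
  - intros t. destruct (Hxe t) as [s [Hs E]]. destruct (tn_ann Ht Hs) as [r [a [E' Hr]]].
    exists r, a. rewrite E. now split.
  - intros a.
    assert (Hone : polar 1 a <> 0%C) by (apply Cmod_gt_0; rewrite Cmod_cis; lra).
    destruct (polar_decomposition Hone) as [a' [Ha' Ea]]. rewrite Cmod_cis in Ea.
    destruct (tn_onto Ht Ha') as [s [r [Hs [Hin [Hr E]]]]].
    exists s, r. split; [| now split]. rewrite Hx by exact Hs. rewrite E. f_equal.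
    rewrite (polar_cis r a), (polar_cis r a'), Ea. reflexivity.
Qed.

End Cycle.

(** * Transversality to the axis and fixed points of the return map *)

Lemma pos_lower_bound (g : R -> R) (a b : R) : a <= b ->
  (forall r, a <= r <= b -> continuous g r /\ 0 < g r) -> exists c, 0 < c /\ forall r, a <= r <= b -> c <= g r.
Proof.
  intros Hab H. destruct (continuity_ab_min g a b Hab) as [x [Hx1 Hx2]].
  - intros c Hc. apply continuity_pt_filterlim. now apply H.
  - exists (g x). split; [now apply H | exact Hx1].
Qed.

(** From [exp (- x) >= 1 - x] follows [exp x - 1 <= x / (1 - x)], and here [1 - x] is at most 2
    while [x] is not positive. *)
Lemma exp_small_contraction (x : R) : -1 <= x <= 0 -> exp x - 1 <= x / 2.
Proof.
  intros Hx. destruct (Req_dec x 0) as [-> | Hn]; [rewrite exp_0; lra |].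
  assert (H1 := exp_ineq1 (- x) ltac:(lra)).
  assert (E : exp x * exp (- x) = 1) by (rewrite <- exp_plus, Rplus_opp_r; apply exp_0).
  assert (P := exp_pos x). nra.
Qed.

Lemma exp_expansion (x : R) : x <= exp x - 1.
Proof.
  destruct (Req_dec x 0) as [-> | Hn]; [rewrite exp_0; lra |].
  assert (H := exp_ineq1 x Hn). lra.
Qed.

Section Transversality.

Variables (D U : C -> Prop) (f phi psi : C -> C) (p : C) (rs : R).
Hypothesis S : linearized_center D U f phi psi p rs.

(** The factor [s] is 1 or -1 in use, for the positive and the negative axis. *)
Lemma im_f_continuous (s r : R) : pdisc rs (RtoC (s * r)) -> continuous (fun r => Im (f (psi (RtoC (s * r))))) r.
Proof.
  intros Hw. apply continuous_eps. intros e He.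
  assert (Hc : ccont (fun w => f (psi w)) (RtoC (s * r))).
  { apply (ccont_comp psi f); [now apply (psi_ccont S) |].
    eapply cderiv_ccont. apply (f_cderiv S), (U_D S), (psi_U S Hw). }
  destruct (Hc e He) as [d [Hd H]]. exists (d / (Rabs s + 1)). assert (P := Rabs_pos s).
  split; [apply Rdiv_lt_0_compat; lra |]. intros u Hu. rewrite <- Im_minus.
  eapply Rle_lt_trans; [apply im_le_Cmod |]. apply H.
  rewrite <- RtoC_minus, Cmod_R, <- Rmult_minus_distr_l, Rabs_mult.
  apply (Rmult_lt_compat_l (Rabs s + 1)) in Hu; [| lra].
  replace ((Rabs s + 1) * (d / (Rabs s + 1))) with d in Hu by (field; lra).
  assert (P2 := Rabs_pos (u - r)). lra.
Qed.

Lemma perturbation_bounded_band (m : nat) (a : nat -> nat -> C) (r1 r2 : R) : 0 < r1 -> r2 < rs ->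
  exists K, 0 < K /\ forall r t, r1 <= r <= r2 -> Rabs t <= 4 ->
    Cmod (bipoly m a (psi (polar r t)) (Cconj (psi (polar r t)))) <= K.
Proof.
  intros H1 H2.
  (* The perturbation is the field at [eps = 1] minus the field at [eps = 0], so two field bounds
     suffice. *)
  destruct (@field_bounded D U f phi psi p rs S m a 1 r1 r2 H1 H2) as [K1 [P1 B1]].
  destruct (@field_bounded D U f phi psi p rs S m a 0 r1 r2 H1 H2) as [K2 [P2 B2]].
  exists (K1 + K2). split; [lra |]. intros r t Hr Ht.
  specialize (B1 r t Hr Ht). specialize (B2 r t Hr Ht). unfold perturbed in B1, B2.
  set (z := psi (polar r t)) in *. set (P := bipoly m a z (Cconj z)) in *.
  replace P with ((f z + 1 * P) - (f z + 0 * P))%C by ring.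
  eapply Rle_trans; [apply Cmod_triangle |]. rewrite Cmod_opp. lra.
Qed.

(** On a compact interval of radii the imaginary part of [f] stays away from 0 on each half axis;
    the range of [eps] lets the perturbation use up less than half of that margin. *)
Lemma transversality (m : nat) (a : nat -> nat -> C) (r1 r2 : R) : 0 < r1 -> r1 <= r2 -> r2 < rs ->
  exists e, 0 < e /\ forall eps r, 0 < eps < e -> r1 <= r <= r2 ->
    Im (perturbed f (bipoly m a) eps (psi (RtoC r))) < 0 /\
    0 < Im (perturbed f (bipoly m a) eps (psi (RtoC (- r)))).
Proof.
  intros H1 H12 H2.
  destruct (@pos_lower_bound (fun r => - Im (f (psi (RtoC (1 * r))))) r1 r2 H12) as [c1 [Hc1 B1]].
  { intros r Hr. assert (Hr' : 0 < r < rs) by lra. split.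
    - apply (continuous_opp (V := R_NormedModule)), im_f_continuous. rewrite Rmult_1_l. now apply pdisc_R.
    - rewrite Rmult_1_l. assert (T := im_f_pos_axis S Hr'). lra. }
  destruct (@pos_lower_bound (fun r => Im (f (psi (RtoC (-1 * r))))) r1 r2 H12) as [c2 [Hc2 B2]].
  { intros r Hr. assert (Hr' : 0 < r < rs) by lra. replace (-1 * r) with (- r) by ring. split.
    - apply im_f_continuous. replace (-1 * r) with (- r) by ring. now apply pdisc_R_neg.
    - now apply (im_f_neg_axis S). }
  destruct (@perturbation_bounded_band m a r1 r2 H1 H2) as [K [HK HB]].
  exists (Rmin (c1 / (2 * K)) (c2 / (2 * K))). split; [apply Rmin_pos; apply Rdiv_lt_0_compat; lra |].
  intros eps r [He0 He] Hr.
  below_min He as He1 He2.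
  apply (Rmult_lt_compat_r K) in He1; [| assumption]. apply (Rmult_lt_compat_r K) in He2; [| assumption].
  replace (c1 / (2 * K) * K) with (c1 / 2) in He1 by (field; lra).
  replace (c2 / (2 * K) * K) with (c2 / 2) in He2 by (field; lra).
  specialize (B1 r Hr). specialize (B2 r Hr). rewrite Rmult_1_l in B1. replace (-1 * r) with (- r) in B2 by ring.
  assert (E : forall x y : C, Im (x + RtoC eps * y) = Im x + eps * Im y) by (intros; simpl; unfold Im; ring).
  unfold perturbed. rewrite !E.
  assert (Q : forall y : C, Cmod y <= K -> Rabs (eps * Im y) <= eps * K).
  { intros y Hy. rewrite Rabs_mult, Rabs_pos_eq by lra. apply Rmult_le_compat_l; [lra |].
    eapply Rle_trans; [apply im_le_Cmod | exact Hy]. }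
  assert (Q1 := HB r 0 Hr abs_0_4). rewrite polar_0 in Q1.
  assert (Q2 := HB r PI Hr abs_PI_4). rewrite polar_PI in Q2.
  apply Q, Rabs_le_between in Q1. apply Q, Rabs_le_between in Q2. lra.
Qed.

End Transversality.

Section Return_map.

Variables (D U : C -> Prop) (f phi psi : C -> C) (p : C) (rs : R).
Hypothesis S : linearized_center D U f phi psi p rs.
Variables (m : nat) (ap am : nat -> nat -> C) (A1p b1p A1m b1m : R -> R -> R) (r0 h K kap eps : R).
Hypothesis Bp : band_data (radial_rate psi m ap) A1p (angular_rate psi m ap) b1p r0 h K.
Hypothesis Bm : band_data (radial_rate psi m am) A1m (angular_rate psi m am) b1m r0 h K.
Hypothesis Oscp : forall r t, r0 - 2 * h <= r <= r0 + 2 * h -> Rabs t <= 4 -> Rabs (A1p r t - A1p r0 t) <= kap.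
Hypothesis Oscm : forall r t, r0 - 2 * h <= r <= r0 + 2 * h -> Rabs t <= 4 -> Rabs (A1m r t - A1m r0 t) <= kap.
Hypothesis Heps : 0 < eps < family_eps h K kap.
Hypothesis Hdrift : 32 * K * eps <= h / 2.

Variables (Phm Php : R -> R -> R).
Hypothesis HPhm : forall rho, Rabs (rho - r0) <= h ->
  is_flow (radial_rate psi m am) (angular_rate psi m am) r0 h K eps 0 rho (Phm rho).
Hypothesis HPhp : forall rho, Rabs (rho - r0) <= h ->
  is_flow (radial_rate psi m ap) (angular_rate psi m ap) r0 h K eps PI rho (Php rho).

Notation ret := (return_radius Phm Php).

Variable d : R.
Hypothesis Hd : d <> 0.
Hypothesis Hkapd : 64 * kap <= Rabs d.
Hypothesis HI0 : RInt (fun t => radial_rate psi m ap r0 t) PI 0 + RInt (fun t => radial_rate psi m am r0 t) 0 (- PI) = 0.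
Hypothesis HI1 : RInt (fun t => A1p r0 t) PI 0 + RInt (fun t => A1m r0 t) 0 (- PI) = d.
Hypothesis Hepsd : 2 * Rabs d * eps <= 1.

(** The exponents of the two half turns add. Each is off by at most [16 * kap], and
    [64 * kap <= Rabs d] makes the total error at most half of [Rabs d], so the sign of the sum is
    that of [- d]. *)
Lemma log_slope_sum (La Lb : R) :
  Rabs (La + RInt (fun t => A1m r0 t) 0 (- PI)) <= 16 * kap ->
  Rabs (Lb + RInt (fun t => A1p r0 t) PI 0) <= 16 * kap ->
  Rabs (La + Lb + d) <= Rabs d / 2.
Proof.
  intros H1 H2. rewrite <- HI1.
  match goal with |- Rabs (_ + _ + (?x + ?y)) <= _ =>
    replace (La + Lb + (x + y)) with ((La + y) + (Lb + x)) by ring end.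
  rewrite HI1. eapply Rle_trans; [apply Rabs_triang |]. lra.
Qed.

Lemma return_slope (r1 r2 : R) : Rabs (r1 - r0) <= h / 2 -> Rabs (r2 - r0) <= h / 2 -> r1 <> r2 ->
  exists La, ret r2 - ret r1 = (r2 - r1) * exp (eps * La) /\ Rabs (La + d) <= Rabs d / 2.
Proof.
  intros H1 H2 Hne. assert (Hh := bd_h Bm).
  destruct (flow_slope Bm Oscm Heps abs_0_4 Hne (HPhm (rho := r1) ltac:(lra)) (HPhm (rho := r2) ltac:(lra)) abs_opp_PI_4) as [La [E1 F1]].
  assert (Q1 := half_radius Bm Heps Hdrift HPhm H1). assert (Q2 := half_radius Bm Heps Hdrift HPhm H2).
  assert (Hne' : Phm r1 (- PI) <> Phm r2 (- PI)).
  { intros E. assert (E' : (r2 - r1) * exp (eps * La) = 0) by lra.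
    apply Rmult_integral in E'. assert (P := exp_pos (eps * La)). destruct E'; lra. }
  destruct (flow_slope Bp Oscp Heps abs_PI_4 Hne' (HPhp Q1) (HPhp Q2) abs_0_4) as [Lb [E2 F2]].
  exists (La + Lb). split; [| now apply log_slope_sum].
  unfold return_radius. rewrite E2, E1, Rmult_plus_distr_l, exp_plus. ring.
Qed.

Lemma return_derive (rho : R) : Rabs (rho - r0) < h / 2 ->
  exists La, is_derive ret rho (exp (eps * La)) /\ Rabs (La + d) <= Rabs d / 2.
Proof.
  intros H1. assert (Hh := bd_h Bm). assert (HK := bd_K Bm). assert (He := proj1 Heps).
  destruct (flow_derive Bm Oscm Heps (Phi := Phm) abs_0_4 HPhm (rho := rho) ltac:(lra) abs_opp_PI_4) as [La [E1 F1]].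
  assert (Q1 : Rabs (Phm rho (- PI) - r0) < h).
  { destruct (flow_inb (HPhm (rho := rho) ltac:(lra)) abs_opp_PI_4) as [_ T].
    replace (Phm rho (- PI) - r0) with ((Phm rho (- PI) - rho) + (rho - r0)) by ring.
    eapply Rle_lt_trans; [apply Rabs_triang |].
    assert (0 <= K * eps) by (apply Rmult_le_pos; lra). lra. }
  destruct (flow_derive Bp Oscp Heps (Phi := Php) abs_PI_4 HPhp Q1 abs_0_4) as [Lb [E2 F2]].
  exists (La + Lb). split; [| now apply log_slope_sum].
  unfold return_radius. evar_last.
  - apply (is_derive_comp (fun x => Php x 0) (fun x => Phm x (- PI)) rho); [exact E2 | exact E1].
  - unfold scal; simpl. unfold mult; simpl. rewrite Rmult_plus_distr_l, exp_plus. reflexivity.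
Qed.

(** The first order terms cancel since [r0] is a zero of the Melnikov function. The remainders are
    [8 * 18 = 144] for the half turn starting at [r0] and [8 * 34 = 272] for the one starting within
    [16 * K * eps] of it. *)
Lemma return_center : Rabs (ret r0 - r0) <= 416 * K * K * eps * eps.
Proof.
  assert (Hh := bd_h Bm). assert (HK := bd_K Bm). assert (He := proj1 Heps).
  assert (H00 : Rabs (r0 - r0) = 0) by (rewrite Rminus_diag; apply Rabs_R0).
  assert (F1 := flow_average Bm Heps abs_0_4 (HPhm (rho := r0) ltac:(lra)) abs_opp_PI_4).
  rewrite H00 in F1.
  assert (Q : Rabs (Phm r0 (- PI) - r0) <= h) by (apply (half_radius Bm Heps Hdrift HPhm); lra).
  assert (F2 := flow_average Bp Heps abs_PI_4 (HPhp Q) abs_0_4).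
  assert (F3 : Rabs (Phm r0 (- PI) - r0) <= 16 * K * eps).
  { apply (flow_inb (HPhm (rho := r0) ltac:(lra)) abs_opp_PI_4). }
  change (ret r0) with (Php (Phm r0 (- PI)) 0).
  set (r' := Phm r0 (- PI)) in *.
  set (Ip := RInt (fun t => radial_rate psi m ap r0 t) PI 0) in *.
  set (Im := RInt (fun t => radial_rate psi m am r0 t) 0 (- PI)) in *.
  replace (Php r' 0 - r0) with ((r' - r0 + eps * Im) + (Php r' 0 - r' + eps * Ip)).
  2: { replace (r' - r0 + eps * Im + (Php r' 0 - r' + eps * Ip)) with (Php r' 0 - r0 + eps * (Ip + Im)) by ring.
       rewrite HI0. ring. }
  eapply Rle_trans; [apply Rabs_triang |].
  assert (K * Rabs (r' - r0) <= K * (16 * K * eps)) by (apply Rmult_le_compat_l; lra).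
  assert (8 * eps * (18 * K * K * eps + K * Rabs (r' - r0)) <= 8 * eps * (34 * K * K * eps)).
  { apply Rmult_le_compat_l; lra. }
  lra.
Qed.

(** Here [La] lies between [- 3 * d / 2] and [- d / 2], and [2 * Rabs d * eps <= 1] places
    [eps * La] in the range of [exp_small_contraction]. *)
Lemma slope_excess_neg (La : R) : 0 < d -> Rabs (La + d) <= Rabs d / 2 -> exp (eps * La) - 1 <= - (eps * d / 4).
Proof.
  intros Hpos H. rewrite (Rabs_pos_eq d) in * by lra. apply Rabs_le_between in H. assert (He := proj1 Heps).
  assert (B : -1 <= eps * La <= 0) by nra.
  assert (E := exp_small_contraction B). nra.
Qed.

Lemma slope_excess_pos (La : R) : d < 0 -> Rabs (La + d) <= Rabs d / 2 -> - (eps * d / 4) <= exp (eps * La) - 1.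
Proof.
  intros Hneg H. rewrite (Rabs_left d) in * by lra. apply Rabs_le_between in H. assert (He := proj1 Heps).
  assert (E := exp_expansion (eps * La)). nra.
Qed.

Lemma slope_neq_1 (La : R) : Rabs (La + d) <= Rabs d / 2 -> exp (eps * La) <> 1.
Proof.
  intros H E. assert (He := proj1 Heps). destruct (Rtotal_order d 0) as [Hn | [Hz | Hp]]; [| lra |].
  - assert (T := slope_excess_pos Hn H). assert (0 < eps * - d) by (apply Rmult_lt_0_compat; lra). lra.
  - assert (T := slope_excess_neg Hp H). assert (0 < eps * d) by (apply Rmult_lt_0_compat; lra). lra.
Qed.

Lemma return_increasing (r1 r2 : R) : Rabs (r1 - r0) <= h / 2 -> Rabs (r2 - r0) <= h / 2 -> r1 < r2 -> ret r1 < ret r2.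
Proof.
  intros H1 H2 Hlt. destruct (return_slope H1 H2 ltac:(lra)) as [La [E _]].
  assert (0 < (r2 - r1) * exp (eps * La)) by (apply Rmult_lt_0_compat; [lra | apply exp_pos]). lra.
Qed.

Lemma return_fixed_unique (r1 r2 : R) : Rabs (r1 - r0) <= h / 2 -> Rabs (r2 - r0) <= h / 2 ->
  ret r1 = r1 -> ret r2 = r2 -> r2 = r1.
Proof.
  intros H1 H2 F1 F2. apply NNPP. intros Hne.
  destruct (return_slope H1 H2 ltac:(lra)) as [La [E HL]]. rewrite F1, F2 in E.
  apply (slope_neq_1 HL). apply (Rmult_eq_reg_l (r2 - r1)); lra.
Qed.

(** Intermediate value theorem for the displacement [ret r - r] between [r0 - q] and [r0 + q]: the
    sign of [d] fixes opposite signs at the two ends as soon as the slope outweighs the displacement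
    at [r0]. *)
Lemma return_fixed_exists (q : R) : q = 3328 * K * K * eps / Rabs d -> q < h / 2 ->
  exists re, Rabs (re - r0) <= q /\ ret re = re.
Proof.
  intros Hq Hqh. assert (Hh := bd_h Bm). assert (HK := bd_K Bm). assert (He := proj1 Heps).
  assert (Hd0 : 0 < Rabs d) by now apply Rabs_pos_lt.
  assert (HKK : 0 < K * K * eps) by (repeat apply Rmult_lt_0_compat; lra).
  assert (Hq0 : 0 < q) by (rewrite Hq; apply Rdiv_lt_0_compat; lra).
  (* The constant 3328 is [8 * 416]: over the distance [q] the slope contributes at least twice the
     bound 416 of [return_center]. *)
  assert (Hqd : q * (eps * Rabs d / 4) = 832 * K * K * eps * eps) by (rewrite Hq; field; lra).
  set (cl := clamp (r0 - q) (r0 + q)).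
  assert (Hcl : forall r, r0 - q <= cl r <= r0 + q) by (intros; apply clamp_range; lra).
  set (g := fun r => ret (cl r) - cl r).
  assert (Hg : Ranalysis1.continuity g).
  { intros r. apply continuity_pt_filterlim. apply (continuous_minus (V := R_NormedModule) (fun r => ret (cl r)) cl).
    - apply continuous_eps. intros e Hepos.
      destruct (return_derive (rho := cl r)) as [La [Hder _]].
      { specialize (Hcl r). apply Rabs_def1; lra. }
      destruct (proj1 (continuous_eps _ _) (is_derive_continuous Hder) e Hepos) as [dl [Hdl Hc]].
      exists dl. split; [assumption |]. intros s Hs. apply Hc. eapply Rle_lt_trans; [apply clamp_lipschitz | exact Hs].
    - apply continuous_eps. intros e Hepos. exists e. split; [assumption |]. intros s Hs.
      eapply Rle_lt_trans; [apply clamp_lipschitz | exact Hs]. }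
  assert (Hc := return_center). apply Rabs_le_between in Hc.
  assert (Hnear0 : Rabs (r0 - r0) <= h / 2) by (rewrite Rminus_diag, Rabs_R0; lra).
  assert (Hnear1 : Rabs (r0 + q - r0) <= h / 2) by (apply Rabs_le; lra).
  assert (Hnear2 : Rabs (r0 - q - r0) <= h / 2) by (apply Rabs_le; lra).
  destruct (return_slope Hnear0 Hnear1 ltac:(lra)) as [La [E1 L1]].
  destruct (return_slope Hnear0 Hnear2 ltac:(lra)) as [Lb [E2 L2]].
  assert (G1 : g (r0 + q) = (ret r0 - r0) + q * (exp (eps * La) - 1)).
  { unfold g, cl. rewrite clamp_id by lra. lra. }
  assert (G2 : g (r0 - q) = (ret r0 - r0) - q * (exp (eps * Lb) - 1)).
  { unfold g, cl. rewrite clamp_id by lra. lra. }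
  assert (Hsgn : Rmin (g (r0 - q)) (g (r0 + q)) <= 0 <= Rmax (g (r0 - q)) (g (r0 + q))).
  { rewrite G1, G2. assert (HKe : 0 < K * K * eps * eps) by (apply Rmult_lt_0_compat; lra).
    destruct (Rtotal_order d 0) as [Hn | [Hz | Hp]]; [| lra |].
    - rewrite (Rabs_left d) in Hqd by lra.
      assert (T1 := slope_excess_pos Hn L1). assert (T2 := slope_excess_pos Hn L2).
      apply (Rmult_le_compat_l q) in T1; [| lra]. apply (Rmult_le_compat_l q) in T2; [| lra].
      split; [eapply Rle_trans; [apply Rmin_l |] | eapply Rle_trans; [| apply Rmax_r]]; lra.
    - rewrite (Rabs_pos_eq d) in Hqd by lra.
      assert (T1 := slope_excess_neg Hp L1). assert (T2 := slope_excess_neg Hp L2).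
      apply (Rmult_le_compat_l q) in T1; [| lra]. apply (Rmult_le_compat_l q) in T2; [| lra].
      split; [eapply Rle_trans; [apply Rmin_r |] | eapply Rle_trans; [| apply Rmax_l]]; lra. }
  destruct (IVT_gen g (r0 - q) (r0 + q) 0 Hg Hsgn) as [re [_ Hre]].
  exists (cl re). split; [specialize (Hcl re); apply Rabs_le; lra |]. unfold g in Hre. lra.
Qed.

Hypothesis Hr1 : 0 < r0 - 2 * h.
Hypothesis Hr2 : r0 + 2 * h < rs.
Notation Xp := (perturbed f (bipoly m ap) eps).
Notation Xm := (perturbed f (bipoly m am) eps).
Hypothesis Htr : forall r, r0 - 2 * h <= r <= r0 + 2 * h ->
  (Im (Xp (psi (RtoC r))) < 0 /\ Im (Xm (psi (RtoC r))) < 0) /\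
  (0 < Im (Xp (psi (RtoC (- r)))) /\ 0 < Im (Xm (psi (RtoC (- r))))).

Lemma cycle_near_simple_zero : 3328 * K * K * eps / Rabs d + 32 * K * eps < h / 2 ->
  exists x : R -> C, hyperbolic_limit_cycle D Xp Xm x /\
  (forall t, exists r a, x t = psi (polar r a) /\ r0 - 2 * h <= r <= r0 + 2 * h /\
     Rabs (r - r0) <= (3328 * K * K / Rabs d + 32 * K) * eps) /\
  (forall a, exists t r, x t = psi (polar r a) /\ r0 - 2 * h <= r <= r0 + 2 * h /\
     Rabs (r - r0) <= (3328 * K * K / Rabs d + 32 * K) * eps).
Proof.
  intros Hsmall. assert (Hh := bd_h Bm). assert (HK := bd_K Bm). assert (He := proj1 Heps).
  assert (HKe : 0 < K * eps) by (apply Rmult_lt_0_compat; lra).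
  destruct (return_fixed_exists eq_refl ltac:(lra)) as [re [Hre Hfix]].
  assert (Hnear : Rabs (re - r0) < h / 2) by lra.
  destruct (return_derive Hnear) as [La [Hder HLa]].
  destruct (@cycle_hyperbolic D U f phi psi p rs S m ap am A1p b1p A1m b1m r0 h K kap eps Bp Bm Hr1 Hr2 Heps Hdrift Htr
    Phm Php HPhm HPhp re (exp (eps * La))) as [x [Hx [X1 X2]]]; try assumption.
  - lra.
  - intros; now apply return_increasing.
  - intros r Hr Hrf. apply return_fixed_unique; try assumption; lra.
  - rewrite Rabs_pos_eq by (apply Rlt_le, exp_pos). now apply slope_neq_1.
  - assert (Htri : forall r, Rabs (r - re) <= 32 * K * eps -> Rabs (r - r0) <= (3328 * K * K / Rabs d + 32 * K) * eps).
    { intros r Hr. replace (r - r0) with ((r - re) + (re - r0)) by ring.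
      eapply Rle_trans; [apply Rabs_triang |].
      replace ((3328 * K * K / Rabs d + 32 * K) * eps) with (32 * K * eps + 3328 * K * K * eps / Rabs d)
        by (field; now apply Rabs_no_R0). lra. }
    exists x. split; [exact Hx |]. split.
    + intros t. destruct (X1 t) as [r [a [E1 [E2 E3]]]]. exists r, a. auto.
    + intros a. destruct (X2 a) as [t [r [E1 [E2 E3]]]]. exists t, r. auto.
Qed.

End Return_map.

(** * Choice of the constants and convergence of the cycles *)

Lemma is_derive_ext_open (g k : R -> R) (a b r l : R) : a < r < b ->
  (forall s, a < s < b -> g s = k s) -> is_derive g r l -> is_derive k r l.
Proof.
  intros Hr E. apply (is_derive_ext_loc g k).
  assert (Hd : 0 < Rmin (r - a) (b - r)) by (apply Rmin_pos; lra).
  exists (mkposreal _ Hd). intros s Hs. change (Rabs (s - r) < Rmin (r - a) (b - r)) in Hs.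
  below_min Hs as H1 H2.
  apply Rabs_def2 in H1. apply Rabs_def2 in H2. apply E. lra.
Qed.

Section Main.

Variables (D U : C -> Prop) (f phi psi : C -> C) (p : C) (rs : R).
Hypothesis S : linearized_center D U f phi psi p rs.
Variables (m : nat) (ap am : nat -> nat -> C).

Notation M1 := (fun r : R => melnikov_half phi psi (bipoly m ap) PI r - melnikov_half phi psi (bipoly m am) (- PI) r).

(** The sign in [melnikov_half] is absorbed by reversing the upper integral; both integrals then
    follow the clockwise sense in which orbits run. *)
Lemma melnikov_rates (r : R) : 0 < r < rs ->
  M1 r = RInt (fun t => radial_rate psi m ap r t) PI 0 + RInt (fun t => radial_rate psi m am r t) 0 (- PI).
Proof.
  intros Hr. cbv beta. rewrite !(melnikov_half_eq S) by assumption.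
  assert (E : RInt (fun t => radial_rate psi m ap r t) PI 0 = - RInt (fun t => radial_rate psi m ap r t) 0 PI).
  { symmetry. apply (opp_RInt_swap (V := R_CompleteNormedModule)). now apply (ex_RInt_perturbation S). }
  rewrite E. unfold radial_rate. ring.
Qed.

(** The constants depend on one another in the order [d], [kap], [h], [K], [eps0]; all but the last
    are independent of [eps]. *)
Lemma hyperbolic_cycles (r0 : R) : 0 < r0 < rs -> simple_zero M1 r0 ->
  exists (eps0 : R) (x : R -> R -> C), 0 < eps0 /\
    (forall eps, 0 < eps < eps0 ->
       hyperbolic_limit_cycle D (perturbed f (bipoly m ap) eps) (perturbed f (bipoly m am) eps) (x eps)) /\
    tends_to_circle psi r0 x.
Proof.
  intros Hr0 [Hz [d [Hder Hd]]].
  destruct (perturbation_band S m ap) as [A1p [b1p [Rp [Bp Op]]]].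
  destruct (perturbation_band S m am) as [A1m [b1m [Rm [Bm Om]]]].
  assert (Hd0 : 0 < Rabs d) by now apply Rabs_pos_lt.
  assert (HI0 : RInt (fun t => radial_rate psi m ap r0 t) PI 0 + RInt (fun t => radial_rate psi m am r0 t) 0 (- PI) = 0).
  { exact (eq_trans (eq_sym (melnikov_rates Hr0)) Hz). }
  assert (HI1 : RInt (fun t => A1p r0 t) PI 0 + RInt (fun t => A1m r0 t) 0 (- PI) = d).
  { assert (E1 := radial_integral_derive S PI 0 Rp Hr0).
    assert (E2 := radial_integral_derive S 0 (- PI) Rm Hr0).
    assert (E := is_derive_plus (K := R_AbsRing) (V := R_NormedModule) _ _ _ _ _ E1 E2).
    rewrite <- (is_derive_unique _ _ _ Hder). symmetry. apply is_derive_unique.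
    refine (is_derive_ext_open Hr0 _ E). intros s Hs. symmetry. now apply melnikov_rates. }
  set (kap := Rabs d / 64).
  assert (Hkap : 0 < kap) by (unfold kap; lra).
  destruct (Op r0 kap Hr0 Hkap) as [hp [Hp1 [Hp2 [Hp3 Oscp]]]].
  destruct (Om r0 kap Hr0 Hkap) as [hm [Hm1 [Hm2 [Hm3 Oscm]]]].
  set (h := Rmin hp hm).
  assert (Hh : 0 < h) by now apply Rmin_pos.
  assert (Hhp : h <= hp) by apply Rmin_l. assert (Hhm : h <= hm) by apply Rmin_r.
  assert (Hr1 : 0 < r0 - 2 * h) by lra. assert (Hr2 : r0 + 2 * h < rs) by lra.
  destruct (Bp r0 h Hh Hr1 Hr2) as [Kp [HKp Bp']]. destruct (Bm r0 h Hh Hr1 Hr2) as [Km [HKm Bm']].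
  (* A common constant for the two fields, above each of their thresholds. *)
  set (K := Kp + Km).
  assert (HK : 0 < K) by (unfold K; lra).
  specialize (Bp' K ltac:(unfold K; lra)). specialize (Bm' K ltac:(unfold K; lra)).
  destruct (transversality S m ap Hr1 (r2 := r0 + 2 * h) ltac:(lra) Hr2) as [ep [Hep Tp]].
  destruct (transversality S m am Hr1 (r2 := r0 + 2 * h) ltac:(lra) Hr2) as [em [Hem Tm]].
  set (c := 3328 * K * K / Rabs d + 32 * K).
  assert (Hc : 0 < 3328 * K * K / Rabs d) by (apply Rdiv_lt_0_compat; [repeat apply Rmult_lt_0_compat |]; lra).
  assert (Hfe : 0 < family_eps h K kap).
  { unfold family_eps, band_eps. apply Rmin_pos; [apply Rmin_pos |].
    - apply Rinv_0_lt_compat. lra.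
    - apply Rdiv_lt_0_compat; lra.
    - apply Rdiv_lt_0_compat; [lra |]. repeat apply Rmult_lt_0_compat; lra. }
  (* In order: the flow estimates; [c * eps < h / 2], which covers the drift and the displacement of
     the fixed point; transversality of the two fields; the range of the exponential estimate. *)
  set (eps0 := Rmin (Rmin (family_eps h K kap) (h / (2 * c))) (Rmin (Rmin ep em) (/ (2 * Rabs d)))).
  assert (Heps0 : 0 < eps0).
  { apply Rmin_pos; apply Rmin_pos; try assumption.
    - apply Rdiv_lt_0_compat; unfold c; lra.
    - now apply Rmin_pos.
    - apply Rinv_0_lt_compat. lra. }
  assert (Hex : forall eps, exists x : R -> C, 0 < eps < eps0 ->
    hyperbolic_limit_cycle D (perturbed f (bipoly m ap) eps) (perturbed f (bipoly m am) eps) x /\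
    (forall t, exists r a, x t = psi (polar r a) /\ r0 - 2 * h <= r <= r0 + 2 * h /\ Rabs (r - r0) <= c * eps) /\
    (forall a, exists t r, x t = psi (polar r a) /\ r0 - 2 * h <= r <= r0 + 2 * h /\ Rabs (r - r0) <= c * eps)).
  { intros eps. destruct (classic (0 < eps < eps0)) as [[He0 He] | Hn].
    (* A default outside the range of [eps], so that the choice of a cycle for each [eps] is a total
       function. *)
    2: { exists (fun _ => p). intros He. contradiction. }
    below_min He as Hea Heb.
    below_min Hea as He1 He2.
    below_min Heb as Hec He5.
    below_min Hec as He3 He4.
    assert (Hc0 : 0 < c) by (unfold c; lra).
    apply (Rmult_lt_compat_l c) in He2; [| exact Hc0].
    replace (c * (h / (2 * c))) with (h / 2) in He2 by (field; lra).
    assert (Hce : c * eps = 3328 * K * K * eps / Rabs d + 32 * K * eps) by (unfold c; field; lra).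
    assert (Hq : 0 < 3328 * K * K * eps / Rabs d).
    { replace (3328 * K * K * eps / Rabs d) with (3328 * K * K / Rabs d * eps) by (field; lra). apply Rmult_lt_0_compat; lra. }
    apply (Rmult_lt_compat_l (2 * Rabs d)) in He5; [| lra]. rewrite Rinv_r in He5 by lra.
    assert (Hfam : 0 < eps < family_eps h K kap) by (split; assumption).
    assert (Fm : exists Ph : R -> R -> R, forall rho, Rabs (rho - r0) <= h ->
      is_flow (radial_rate psi m am) (angular_rate psi m am) r0 h K eps 0 rho (Ph rho)).
    { apply (functional_choice (fun rho u => Rabs (rho - r0) <= h ->
        is_flow (radial_rate psi m am) (angular_rate psi m am) r0 h K eps 0 rho u)). intros rho.
      destruct (classic (Rabs (rho - r0) <= h)) as [H | H]; [| exists (fun _ => 0); tauto].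
      destruct (flow_exists Bm' (family_eps_band Hfam) abs_0_4 H) as [u Hu]. now exists u. }
    assert (Fp : exists Ph : R -> R -> R, forall rho, Rabs (rho - r0) <= h ->
      is_flow (radial_rate psi m ap) (angular_rate psi m ap) r0 h K eps PI rho (Ph rho)).
    { apply (functional_choice (fun rho u => Rabs (rho - r0) <= h ->
        is_flow (radial_rate psi m ap) (angular_rate psi m ap) r0 h K eps PI rho u)). intros rho.
      destruct (classic (Rabs (rho - r0) <= h)) as [H | H]; [| exists (fun _ => 0); tauto].
      destruct (flow_exists Bp' (family_eps_band Hfam) abs_PI_4 H) as [u Hu]. now exists u. }
    destruct Fm as [Phm HPhm]. destruct Fp as [Php HPhp].
    destruct (@cycle_near_simple_zero D U f phi psi p rs S m ap am A1p b1p A1m b1m r0 h K kap eps Bp' Bm')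
      with (Phm := Phm) (Php := Php) (d := d) as [x Hx]; try assumption.
    - intros r t Hr Ht. apply Oscp; [lra | exact Ht].
    - intros r t Hr Ht. apply Oscm; [lra | exact Ht].
    - lra.
    - unfold kap. lra.
    - lra.
    - intros r Hr. destruct (Tp eps r ltac:(lra) Hr). destruct (Tm eps r ltac:(lra) Hr). repeat split; assumption.
    - lra.
    - exists x. intros _. exact Hx. }
  apply functional_choice in Hex. destruct Hex as [x Hx].
  exists eps0, x. split; [exact Heps0 |]. split; [intros eps He; now apply Hx |].
  intros eta Heta.
  (* Uniform continuity of [psi] on the closed annulus turns the radial distance [c * eps] into a
     distance in the plane. *)
  destruct (@rect_uniform (fun r t => psi (polar r t)) (r0 - 2 * h) (r0 + 2 * h) (-4) 4) with (e := eta) as [dl [Hdl HU]]; [| exact Heta |].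
  { intros r t Hr _. apply (ccont_comp (fun y : C => polar (fst y) (snd y)) psi); [apply ccont_polar |].
    apply (psi_ccont S), pdisc_polar. simpl. lra. }
  assert (HP4 := PI_4). assert (Hc0 : 0 < c) by (unfold c; lra).
  assert (HU' : forall r a, r0 - 2 * h <= r <= r0 + 2 * h -> Rabs (r - r0) < dl ->
    Cmod (psi (polar r a) - psi (polar r0 a)) < eta).
  { intros r a Hr Hra.
    assert (Hone : polar 1 a <> 0%C) by (apply Cmod_gt_0; rewrite Cmod_cis; lra).
    destruct (polar_decomposition Hone) as [a' [Ha' Ea]]. rewrite Cmod_cis in Ea.
    rewrite (polar_cis r a), (polar_cis r0 a), Ea, <- (polar_cis r a'), <- (polar_cis r0 a').
    apply (HU r0 r a'); lra. }
  exists (Rmin eps0 (dl / (2 * c))). split; [apply Rmin_pos; [assumption | apply Rdiv_lt_0_compat; lra] |].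
  intros eps [He0 He].
  below_min He as He1 He2.
  apply (Rmult_lt_compat_l c) in He2; [| exact Hc0]. replace (c * (dl / (2 * c))) with (dl / 2) in He2 by (field; lra).
  destruct (Hx eps (conj He0 He1)) as [_ [X1 X2]]. split.
  - intros t. destruct (X1 t) as [r [a [E [Hin Hr]]]]. exists a. rewrite E. apply HU'; [exact Hin | lra].
  - intros a. destruct (X2 a) as [t [r [E [Hin Hr]]]]. exists t. rewrite E. apply HU'; [exact Hin | lra].
Qed.

End Main.

Unset Implicit Arguments.

Theorem theorem1 (D U : C -> Prop) (f phi psi : C -> C) (p : C)
    (m : nat) (ap am : nat -> nat -> C) (rs : R)
    (hD : open D) (hpD : D p) (hf : holomorphic_on D f)
    (hcenter : has_center D f p)
    (hphi : linearizing_change D f p U phi)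
    (hSigma : forall z, U z -> Im z = 0 -> Im (phi z) = 0)
    (hp : Im p = 0)
    (horient : 0 < Re (C_derive phi p))
    (hrs : 0 < rs)
    (hpsi : forall w, Cmod w < rs -> U (psi w) /\ phi (psi w) = w) :
  let Xp := perturbed f (bipoly m ap) in
  let Xm := perturbed f (bipoly m am) in
  let M1 := fun r : R =>
    melnikov_half phi psi (bipoly m ap) PI r
    - melnikov_half phi psi (bipoly m am) (- PI) r in
  (forall M : R -> R,
     is_first_order_melnikov Xp Xm phi psi rs M <->
     (forall r, 0 < r < rs -> M r = M1 r)) /\
  (forall r0, 0 < r0 < rs -> simple_zero M1 r0 ->
     exists (eps0 : R) (x : R -> R -> C),
       0 < eps0 /\
       (forall eps, 0 < eps < eps0 ->
          hyperbolic_limit_cycle D (Xp eps) (Xm eps) (x eps)) /\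
       tends_to_circle psi r0 x).
Proof.
  assert (S : linearized_center D U f phi psi p rs) by (constructor; assumption).
  intros Xp Xm M1. split.
  - intros M. exact (first_order_melnikov_iff S m ap am M).
  - intros r0 Hr0 Hz. exact (hyperbolic_cycles S Hr0 Hz).
Qed.
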